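(* Let $Y$ be a smooth plane quartic over $K$ in the normal form described in the context, with associated degree-$3$ covering $\phi\colon Y\to\mathbb{P}^1_K$. Let $x_0\in\mathbb{P}^1(\mathbb{K})\setminus\{\infty\}$, $t=x-x_0$, and let $$T^3+AT^2+BT+C,\qquad A=a_2t^2+a_1t+a_0,\quad B=b_3t^3+b_2t^2+b_1t+b_0,\quad C=c_4t^4+c_2t^2+c_1t$$ be the minimal polynomial over $\mathbb{K}(t)$ of the generator $z$ of $\mathbb{K}(Y)$ constructed in the context. Then for every point $\xi\in[x_0,\infty]\subset(\mathbb{P}^1_{\mathbb{K}})^{\mathrm{an}}$ one has $$\delta_\phi(\xi)=\max\Big\{0,\min\Big\{\tfrac{3}{2}v_K(3),\ \tfrac{3v_\xi(A)}{2}-\tfrac{v_\xi(C)}{2},\ \tfrac{3v_\xi(B)}{2}-v_\xi(C)\Big\}\Big\}.$$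
   Context: **Fields and quartic.** $K$ is a field complete with respect to a non-trivial discrete real-valued valuation $v_K$, with valuation ring $\mathcal{O}_K$ and perfect residue field $\kappa$ of characteristic $3$ (the characteristic of $K$ is arbitrary). $\mathbb{K}$ is the completion of an algebraic closure of $K$, with the extended valuation $v_K$. $Y\subset\mathbb{P}^2_K$ is a smooth, geometrically irreducible plane quartic over $K$ with affine chart $\operatorname{Spec}K[x,y]/(F)$, $F=y^3+A_2y^2+A_1y+A_0$, where $A_2,A_1,A_0\in K[x]$ have degrees at most $2,3,4$ respectively. $\phi\colon Y\to\mathbb{P}^1_K$ is the degree-$3$ covering (finite separable morphism) given by the function $x$; its base change $Y_{\mathbb{K}}\to\mathbb{P}^1_{\mathbb{K}}$ is also denoted $\phi$. **Analytification.** For a smooth projective curve $X$ over $\mathbb{K}$, $X^{\mathrm{an}}$ is its Berkovich analytification; its points are the closed points of $X$ and one point $\xi$ for each valuation $v_\xi\colon\mathbb{K}(X)\to\mathbb{R}\cup\{\infty\}$ extending $v_K$. For a closed point $P$ put $v_P(f)=v_K(f(P))$ if $f\in\mathcal{O}_{X,P}$ and $v_P(f)=-\infty$ otherwise. A point is of Type II if the residue field of $v_\xi$ has transcendence degree $1$ over $\kappa$. $\mathcal{H}(\xi)$ is the completion of $\mathbb{K}(X)$ with respect to $v_\xi$. The space $(\mathbb{P}^1_{\mathbb{K}})^{\mathrm{an}}$ is uniquely path-connected and $[x_0,\infty]$ denotes the path from $x_0$ to $\infty$. **Different function.** A one-dimensional analytic field over $\mathbb{K}$ is a complete valued extension field of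 $\mathbb{K}$ that is finite over the closure of a subfield $\mathbb{K}(f)$ with $f\notin\mathbb{K}$. For a finite separable extension $\mathcal{H}_2/\mathcal{H}_1$ of such fields with valuation rings $\mathcal{H}_i^\circ$ and $|a|=\exp(-v(a))$, the Cohen–Temkin–Trushin different is $\delta^{\mathrm{CTT}}(\mathcal{H}_2/\mathcal{H}_1)=\sup\{|a| : a\in\mathcal{H}_2^\circ,\ a\,\Omega_{\mathcal{H}_2^\circ/\mathcal{H}_1^\circ}=0\}$, and $\delta(\mathcal{H}_2/\mathcal{H}_1)=-\tfrac32\log\delta^{\mathrm{CTT}}(\mathcal{H}_2/\mathcal{H}_1)$. The different function $\delta_\phi\colon Y_{\mathbb{K}}^{\mathrm{an}}\to[0,\infty]$ is given at Type II points $\eta$ by $\delta_\phi(\eta)=\delta(\mathcal{H}(\eta)/\mathcal{H}(\phi(\eta)))$ and extended to all points by continuity along intervals. It is constant on fibers of $\phi$ (if a fiber has more than one point then $\delta_\phi=0$ on it), so it is regarded as a function on $(\mathbb{P}^1_{\mathbb{K}})^{\mathrm{an}}$. **The generator $z$.** Choose $p_0\in\phi^{-1}(x_0)$ and put $y_0=y(p_0)$. The element $y-y_0$ has minimal polynomial over $\mathbb{K}(t)$ of the form $$T^3+(a_2't^2+a_1't+a_0')T^2+(b_3't^3+b_2't^2+b_1't+b_0')T+c_4't^4+c_3't^3+c_2't^2+c_1't$$ with coefficients in $\mathbb{K}$. Let $v\in\mathbb{K}$ be a solution of $v^3+a_1'v^2+b_2'v+c_3'=0$ and put $z=y-y_0-vt$.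 Then the minimal polynomial of $z$ over $\mathbb{K}(t)$ has the form stated in the claim (in particular $C$ has no constant and no $t^3$ term). **Endpoints.** At the endpoints $x_0,\infty$ of the path, where the values involved may be infinite, the right-hand side is understood as its limit along the path. *)

(* Defs.v *)
From HB Require Import structures.
From mathcomp Require Import all_boot all_order all_algebra all_field.
From mathcomp Require mpoly.
(* The notations of mpoly clash with those of all_analysis. *)
Import -(notations) mpoly.
From mathcomp Require Import all_classical all_reals all_analysis.

Set Implicit Arguments.
Unset Strict Implicit.
Unset Printing Implicit Defensive.

Import Order.TTheory GRing.Theory Num.Theory.
Import numFieldNormedType.Exports.

Local Open Scope classical_set_scope.
Local Open Scope ring_scope.

(** * Valued fields *)

Record valuation (R : realType) (F : fieldType) := Valuation {
  vfun :> F -> \bar R;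
  val_neqNy : forall x, vfun x <> -oo%E;
  val_eqy : forall x, vfun x = +oo%E <-> x = 0;
  valM : forall x y, vfun (x * y) = (vfun x + vfun y)%E;
  valD : forall x y, (Order.min (vfun x) (vfun y) <= vfun (x + y))%E }.

Lemma val1 (R : realType) (F : fieldType) (v : valuation R F) : v 1 = 0%E.
Proof.
have := valM v 1 1; rewrite mulr1.
have /eqP : v 1 <> +oo%E by move/val_eqy/eqP; rewrite oner_eq0.
have /eqP := @val_neqNy _ _ v 1.
case: (v 1) => [r _ _| |] //=.
by rewrite -EFinD => -[] /eqP; rewrite -subr_eq0 opprD addNKr oppr_eq0 => /eqP ->.
Qed.

Lemma valN1 (R : realType) (F : fieldType) (v : valuation R F) : v (-1) = 0%E.
Proof.
have := valM v (-1) (-1); rewrite mulrNN mulr1 val1.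
have /eqP : v (-1) <> +oo%E.
  by move/val_eqy/eqP; rewrite oppr_eq0 oner_eq0.
have /eqP := @val_neqNy _ _ v (-1).
case: (v (-1)) => [r _ _| |] //=.
rewrite -EFinD => -[] /esym/eqP.
by rewrite -mulr2n mulrn_eq0 /= => /eqP ->.
Qed.

Definition valring_pred (R : realType) (F : fieldType) (v : valuation R F)
  : {pred F} := [pred x | (0 <= v x)%E].

Lemma valring_subring (R : realType) (F : fieldType) (v : valuation R F) :
  subring_closed (valring_pred v).
Proof.
split=> [|x y|x y]; rewrite !inE ?val1 // => vx vy.
- apply: le_trans (valD v _ _); rewrite le_min vx -mulN1r valM valN1 add0e.
  exact: vy.
- by rewrite valM adde_ge0.
Qed.

HB.instance Definition _ (R : realType) (F : fieldType) (v : valuation R F) :=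
  GRing.isSubringClosed.Build F (valring_pred v) (valring_subring v).

(** The valuation ring, as a commutative ring. *)
Record valring (R : realType) (F : fieldType) (v : valuation R F) :=
  Valring { valring_val :> F; _ : valring_val \in valring_pred v }.

HB.instance Definition _ (R : realType) (F : fieldType) (v : valuation R F) :=
  [isSub for @valring_val R F v].
HB.instance Definition _ (R : realType) (F : fieldType) (v : valuation R F) :=
  [Choice of valring v by <:].
HB.instance Definition _ (R : realType) (F : fieldType) (v : valuation R F) :=
  [SubChoice_isSubComNzRing of valring v by <:].

(** [k], with the reduction map [res], is the residue field of [v]. *)
Definition is_residue_field (R : realType) (F : fieldType) (v : valuation R F)
    (k : fieldType) (res : {rmorphism valring v -> k}) : Prop :=
  (forall a : k, exists x, res x = a) /\
  (forall x : valring v, res x = 0 <-> (0 < v (val x))%E).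

Definition nontrivial_discrete (R : realType) (F : fieldType)
    (v : valuation R F) : Prop :=
  exists2 r : R, 0 < r &
    (exists x, v x = r%:E) /\
    (forall x, x != 0 -> exists k : int, v x = (r *~ k)%:E).

Definition complete_valuation (R : realType) (F : fieldType)
    (v : valuation R F) : Prop :=
  forall u : nat -> F,
    (forall M : R, exists N, forall m n : nat, (N <= m)%N -> (N <= n)%N ->
        (M%:E < v (u m - u n)%R)%E) ->
    exists l : F, forall M : R, exists N, forall n : nat, (N <= n)%N ->
        (M%:E < v (u n - l)%R)%E.

(** [(H, w)], with the embedding [i], is the completion of [F] with respect to
    [v].  The valuation [v] is an unbundled function because the points of
    the analytifications below are functions. *)
Definition is_completion (R : realType) (F : fieldType) (v : F -> \bar R)
    (H : fieldType) (w : valuation R H) (i : {rmorphism F -> H}) : Prop :=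
  [/\ forall x, w (i x) = v x,
      complete_valuation w &
      forall (h : H) (M : R), exists x : F, (M%:E < w (h - i x)%R)%E].

Definition perfect_field (k : fieldType) : Prop :=
  forall p : {poly k}, irreducible_poly p -> separable_poly p.

(** [L / k] has transcendence degree 1: there is a transcendental [b], and every
    [c] is algebraically dependent on [b]. *)
Definition trdeg_eq1 (k L : fieldType) (f : {rmorphism k -> L}) : Prop :=
  exists b : L,
    ~ algebraicOver f b /\
    (forall c : L, exists2 P : {poly {poly k}}, P != 0 &
       (map_poly (fun q : {poly k} => (map_poly f q).[b]) P).[c] = 0).

(** [p] is the minimal polynomial of [e] over the subfield [F] of [E]. *)
Definition is_minimal_polynomial (F E : fieldType) (f : {rmorphism F -> E})
    (e : E) (p : {poly F}) : Prop :=
  [/\ p \is monic, irreducible_poly p & root (map_poly f p) e].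

(** * Kaehler differentials and the different *)

(** The generator [db] of the free [B]-module on the symbols [db], [b : B].
    Elements of this free module are the finitely supported functions
    [B -> B]. *)
Definition dgen (B : comNzRingType) (b : B) : B -> B := fun x => (x == b)%:R.

(** The submodule of relations: [Omega_(B/A)] is the quotient of the free module
    by it, [A] being the image in [B] of the base ring. *)
Inductive kaehler_relation (B : comNzRingType) (A : set B) : (B -> B) -> Prop :=
| kaehler_0 : kaehler_relation A (fun=> 0)
| kaehler_lin (c : B) (f g : B -> B) :
    kaehler_relation A f -> kaehler_relation A g ->
    kaehler_relation A (fun x => c * f x + g x)
| kaehler_add (b c : B) :
    kaehler_relation A (fun x => dgen (b + c) x - dgen b x - dgen c x)
| kaehler_leibniz (b c : B) :
    kaehler_relation A
      (fun x => dgen (b * c) x - b * dgen c x - c * dgen b x)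
| kaehler_const (a : B) : A a -> kaehler_relation A (dgen a).

(** [a * Omega_(B/A) = 0] *)
Definition annihilates_kaehler (B : comNzRingType) (A : set B) (a : B) : Prop :=
  forall g : B -> B, finite_set [set b | g b != 0] ->
    kaehler_relation A (fun b => a * g b).

Definition different_CTT (R : realType) (H1 H2 : fieldType)
    (w1 : valuation R H1) (w2 : valuation R H2) (h : {rmorphism H1 -> H2})
    : \bar R :=
  let A : set (valring w2) :=
    [set b | exists a : valring w1, val b = h (val a)] in
  ereal_sup [set expeR (- w2 (val a))%E |
             a in [set a : valring w2 | annihilates_kaehler A a]].

Definition log_different (R : realType) (H1 H2 : fieldType)
    (w1 : valuation R H1) (w2 : valuation R H2) (h : {rmorphism H1 -> H2})
    : \bar R :=
  (- ((3 / 2)%:E * lne (different_CTT w1 w2 h)))%E.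

(** * Analytifications *)

(** A projective curve [X] in [P^(m-1)] over [C] enters through
    - its function field [E], with the inclusion [c : C -> E],
    - the homogeneous coordinates [e : 'I_m -> E] of its generic point,
    - the set [pts] of homogeneous coordinate vectors of its closed points
      ([C] is algebraically closed in all uses). *)

(** [f] is regular at the closed point [P], with value [a]: it is a quotient of
    two forms of the same degree, the denominator not vanishing at [P]. *)
Definition value_at (C E : fieldType) (c : {rmorphism C -> E}) (m : nat)
    (e : 'I_m -> E) (P : 'I_m -> C) (f : E) (a : C) : Prop :=
  exists (n : nat) (g h : mpoly m C),
    [/\ g \is ishomog1 n mdeg, h \is ishomog1 n mdeg, meval P h != 0,
        f = mmap c e g / mmap c e h & a = meval P g / meval P h].

(** The function [v_P]; it is [-oo] where [f] is not regular. *)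
Definition closed_point_val (R : realType) (C E : fieldType)
    (v : valuation R C) (c : {rmorphism C -> E}) (m : nat) (e : 'I_m -> E)
    (P : 'I_m -> C) : E -> \bar R :=
  fun f => if `[< exists a, value_at c e P f a >]
           then v (xget 0 [set a | value_at c e P f a]) else -oo%E.

(** A point [xi] is represented by the function [v_xi].  For a closed point this
    function determines the local ring, hence the point, and it takes the value
    [-oo], which a valuation does not. *)
Definition analytification (R : realType) (C E : fieldType)
    (v : valuation R C) (c : {rmorphism C -> E}) (m : nat) (e : 'I_m -> E)
    (pts : set ('I_m -> C)) : set (E -> \bar R) :=
  [set xi : E -> \bar R |
            (exists w : valuation R E, xi = w /\ forall a, w (c a) = v a) \/
            (exists P, pts P /\ xi = closed_point_val v c e P)].

(** An interval in [X], parametrized by [[0, 1]]: a continuous injective path for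
    the Berkovich topology, the coarsest one for which all the functions
    [xi |-> v_xi(f)] are continuous. *)
Definition is_interval_in (R : realType) (E : fieldType)
    (X : set (E -> \bar R)) (gamma : R -> E -> \bar R) : Prop :=
  [/\ forall s, s \in `[0, 1] -> X (gamma s),
      set_inj `[0, 1] gamma &
      forall f : E, {within `[0, 1], continuous (fun s => gamma s f)}].

(** The residue field of [xi] has transcendence degree 1 over the residue field
    [kappa] of [K]; [s] is the inclusion of [K] in the function field. *)
Definition is_type_II (R : realType) (K kappa : fieldType)
    (vK : valuation R K) (resK : {rmorphism valring vK -> kappa})
    (E : fieldType) (s : {rmorphism K -> E}) (xi : E -> \bar R) : Prop :=
  exists (w : valuation R E) (k : fieldType)
         (res : {rmorphism valring w -> k}) (rho : {rmorphism kappa -> k}),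
    [/\ xi = w, is_residue_field res,
        forall (a : valring vK) (b : valring w),
          val b = s (val a) -> res b = rho (resK a) &
        trdeg_eq1 rho].

(** * The projective line *)

Definition ratfun (C : fieldType) : fieldType := {fraction {poly C}}.

Definition xfun (C : fieldType) : ratfun C := tofrac 'X.

Definition ratC (C : fieldType) : {rmorphism C -> ratfun C} :=
  (@tofrac {poly C} \o polyC).

Definition P1_coord (C : fieldType) : 'I_2 -> ratfun C :=
  fun i => [:: xfun C; 1]`_i.

Definition P1_val (R : realType) (C : fieldType) (v : valuation R C)
    (P : 'I_2 -> C) : ratfun C -> \bar R :=
  closed_point_val v (ratC C) (@P1_coord C) P.

Definition P1_point (C : fieldType) (a : C) : 'I_2 -> C := fun i => [:: a; 1]`_i.
Definition P1_infty (C : fieldType) : 'I_2 -> C := fun i => [:: 1; 0]`_i.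

Definition P1an (R : realType) (C : fieldType) (v : valuation R C)
    : set (ratfun C -> \bar R) :=
  analytification v (ratC C) (@P1_coord C) [set P | exists i, P i != 0].

(** * The quartic *)

(** [y^3 + A2 y^2 + A1 y + A0], as a polynomial in [y] *)
Definition affine_eq (K : fieldType) (A2 A1 A0 : {poly K}) : {poly {poly K}} :=
  'X^3 + A2%:P * 'X^2 + A1%:P * 'X + A0%:P.

(** Its homogenization of degree 4 in the coordinates [x, y, z]; it involves
    the coefficients of [A2], [A1], [A0] up to degrees 2, 3, 4. *)
Definition quartic_form (K : fieldType) (A2 A1 A0 : {poly K}) : mpoly 3 K :=
  let x := mpolyX K (mnm1 (inord 0 : 'I_3)) in
  let y := mpolyX K (mnm1 (inord 1 : 'I_3)) in
  let z := mpolyX K (mnm1 (inord 2 : 'I_3)) in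
  z * y ^+ 3
  + \sum_(i < 3) A2`_i *: (x ^+ i * z ^+ (2 - i)) * y ^+ 2
  + \sum_(i < 4) A1`_i *: (x ^+ i * z ^+ (3 - i)) * y
  + \sum_(i < 5) A0`_i *: (x ^+ i * z ^+ (4 - i)).

Definition irreducible_element (A : idomainType) (a : A) : Prop :=
  [/\ a != 0, a \isn't a GRing.unit &
      forall b c : A, a = b * c ->
        b \is a GRing.unit \/ c \is a GRing.unit].

(** Irreducibility over the algebraic closure [L] of [K]. *)
Definition geometrically_irreducible (K L : fieldType) (i : {rmorphism K -> L})
    (Q : mpoly 3 K) : Prop :=
  irreducible_element (map_mpoly i Q).

(** Jacobian criterion, over the algebraic closure [L] of [K]. *)
Definition smooth_curve (K L : fieldType) (i : {rmorphism K -> L})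
    (Q : mpoly 3 K) : Prop :=
  forall P : 'I_3 -> L, (exists k, P k != 0) ->
    meval P (map_mpoly i Q) = 0 ->
    exists k, meval P (mderiv k (map_mpoly i Q)) != 0.

(** Over [C], [E] is the function field of the curve, [iota] is the inclusion
    [phi^*] of the field of rational functions in [x] and [y] is the second
    coordinate function. *)
Definition is_function_field (K C E : fieldType) (h : {rmorphism K -> C})
    (iota : {rmorphism ratfun C -> E}) (y : E) (A2 A1 A0 : {poly K}) : Prop :=
  let F := map_poly (fun a : {poly K} => tofrac (map_poly h a) : ratfun C)
             (affine_eq A2 A1 A0) in
  root (map_poly iota F) y /\
  (forall f : E, exists p : {poly ratfun C}, f = (map_poly iota p).[y]).

Definition Y_cst (C E : fieldType) (iota : {rmorphism ratfun C -> E})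
    : {rmorphism C -> E} := iota \o ratC C.

Definition Y_coord (C E : fieldType) (iota : {rmorphism ratfun C -> E}) (y : E)
    : 'I_3 -> E :=
  fun i => [:: iota (xfun C); y; 1]`_i.

Definition Y_pts (K C : fieldType) (h : {rmorphism K -> C})
    (Q : mpoly 3 K) : set ('I_3 -> C) :=
  [set P | (exists i, P i != 0) /\ meval P (map_mpoly h Q) = 0].

Definition Y_val (R : realType) (C E : fieldType) (v : valuation R C)
    (iota : {rmorphism ratfun C -> E}) (y : E) (P : 'I_3 -> C) : E -> \bar R :=
  closed_point_val v (Y_cst iota) (Y_coord iota y) P.

Definition Yan (R : realType) (K C E : fieldType) (v : valuation R C)
    (h : {rmorphism K -> C}) (iota : {rmorphism ratfun C -> E}) (y : E)
    (Q : mpoly 3 K) : set (E -> \bar R) :=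
  analytification v (Y_cst iota) (Y_coord iota y) (Y_pts h Q).

(** The map [phi] on analytifications: [v_phi(eta)(f) = v_eta(phi^* f)]. *)
Definition phi_an (R : realType) (C E : fieldType)
    (iota : {rmorphism ratfun C -> E}) (eta : E -> \bar R)
    : ratfun C -> \bar R := fun f => eta (iota f).

(** [delta] is the different function of [phi] on the analytification of [Y].
    At a point [eta] of Type II, [H2] is the completed residue field of [eta],
    [H1] that of [phi eta], and [g] the inclusion; the completions are unique
    up to unique isomorphism. *)
Definition is_different_function (R : realType) (K kappa C E : fieldType)
    (vK : valuation R K) (resK : {rmorphism valring vK -> kappa})
    (v : valuation R C) (h : {rmorphism K -> C})
    (iota : {rmorphism ratfun C -> E}) (y : E) (Q : mpoly 3 K)
    (delta : (E -> \bar R) -> \bar R) : Prop :=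
  [/\ forall eta, Yan v h iota y Q eta -> (0 <= delta eta)%E,
      forall eta, Yan v h iota y Q eta -> is_type_II resK (Y_cst iota \o h) eta ->
        exists (H1 : fieldType) (w1 : valuation R H1)
               (i1 : {rmorphism ratfun C -> H1})
               (H2 : fieldType) (w2 : valuation R H2)
               (i2 : {rmorphism E -> H2}) (g : {rmorphism H1 -> H2}),
          [/\ is_completion (phi_an iota eta) w1 i1,
              is_completion eta w2 i2,
              forall f, g (i1 f) = i2 (iota f),
              forall a, w2 (g a) = w1 a &
              delta eta = log_different w1 w2 g] &
      forall gamma, is_interval_in (Yan v h iota y Q) gamma ->
        {within `[0, 1], continuous (fun s => delta (gamma s))}].

(** [max {0, min {3/2 v(3), 3/2 v_xi(A) - 1/2 v_xi(C), 3/2 v_xi(B) - v_xi(C)}}],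
    with [v3 = v(3)] *)
Definition different_formula (R : realType) (F : fieldType) (v3 : \bar R)
    (A B C : F) (xi : F -> \bar R) : \bar R :=
  Order.max 0%E
    (Order.min ((3 / 2)%:E * v3)%E
      (Order.min ((3 / 2)%:E * xi A - (1 / 2)%:E * xi C)%E
                 ((3 / 2)%:E * xi B - xi C)%E)).

(* Main.v *)
Require Import Defs.
From HB Require Import structures.
From mathcomp Require Import all_boot all_order all_algebra all_field.
From mathcomp Require mpoly.
Import -(notations) mpoly.
From mathcomp Require Import all_classical all_reals all_analysis.
From mathcomp Require Import generic_quotient ring_quotient.
From mathcomp Require Import ring lra zify.

Set Implicit Arguments.
Unset Strict Implicit.
Unset Printing Implicit Defensive.

Import Order.TTheory GRing.Theory Num.Theory.
Import numFieldNormedType.Exports.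

Local Open Scope classical_set_scope.
Local Open Scope ring_scope.

(** Points of [Y] over a point of the open path are valuations over a Gauss
    valuation [gauss v x0 rho]; the points over its ends are closed points.

    If [rho] is a value of a constant, the valuation is of Type II ([typeII_gauss])
    and [delta] is the different of an extension of complete fields.  Choose a
    constant [m] whose value [mu] is the minimum of v(A), v(B)/2, v(C)/3, so that
    [z / m] satisfies an integral cubic equation.  If v(A) = mu or v(B) = 2 mu, the
    reduction of this cubic is not a cube, the different is trivial
    ([different_noncube]) and the formula gives 0.  Otherwise v(C) = 3 mu.  As the
    exponents of [C] are 1, 2, 4, the derivative of [C] has the greatest possible
    absolute value ([normal_deriv]), so that [C] is as far as possible from a cube,
    and [1], [z], [z^2] form an orthogonal basis: the norm form
    x0^3 - C x1^3 + C^2 x2^3 has no cancellation, because differentiating it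
    twice isolates its terms ([cube_norm_poly], [cube_root_unique]).  Hence
    [z / m] generates the valuation ring and the different is the value of the
    derivative of its equation ([different_orth]), which is
    min (v(3), v(A) - mu, v(B) - 2 mu) up to the factor 3/2.

    At the other radii [delta] is known only by its continuity along intervals.
    A valuation over the Gauss valuation of such a radius is the origin of an
    interval lying over larger radii ([liftable_irrational]); as the values of
    constants are dense and both sides are continuous, the formula follows
    ([delta_interior]).  To lift the interval, either the norm form gives an
    explicit extension at each radius ([liftable_cube]), or the equation of [z]
    can be brought to the form b T^3 + a T^2 + T + 1 with small [a] and [b].  The
    roots of the latter are limits of rational expressions in [a], [b] and the
    square root of the discriminant, which is close to a monomial
    ([gauss_irr_dom]); each root gives a family of extensions ([lift_family]).

    For the ends, smoothness passes to the closed points over the completion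
    ([smooth_completion]), Newton's iteration parametrizes the branch through such
    a point by a local coordinate ([chart_branch]), and the Gauss valuations of
    that coordinate pull back to a family of valuations which tends to the point
    and lies over Gauss valuations whose radius is affine in the parameter
    ([closed_point_family], [local_limit], [reached_finite], [reached_infinite]).
    The continuity of [delta] along this interval gives the limit
    ([endpoint_limit]).  Finally the points of the open path are indeed the
    Gauss valuations with centre [x0] ([path_gauss]): a path that enters an open
    disc not containing [x0] has to leave it through the same boundary point. *)

(** * Calculus of valuations *)

Section Thresholds.
Variables (R : realType).

Lemma ereal_le_thr (a b : \bar R) :
  (forall M : R, (M%:E <= a)%E -> (M%:E <= b)%E) -> (a <= b)%E.
Proof.
case: a => [r| |] h; [exact: h | | exact: leNye].
case: b h => [s| |] h //.
- by have := h (s + 1) (leey _); rewrite lee_fin => ?; exfalso; lra.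
- by have := h 0%R (leey _); rewrite leeNy_eq.
Qed.

Lemma ereal_eq_thr (a b : \bar R) :
  (forall M : R, (M%:E <= a)%E <-> (M%:E <= b)%E) -> a = b.
Proof.
by move=> h; apply/le_anti/andP; split; apply: ereal_le_thr => M /h.
Qed.

Lemma ereal_gt_ex (M : R) (a : \bar R) :
  (M%:E < a)%E -> exists2 M' : R, M < M' & (M'%:E <= a)%E.
Proof.
case: a => [r| |] //; first by rewrite lte_fin => h; exists r.
by move=> _; exists (M + 1); rewrite ?leey //; lra.
Qed.

Variables (F : fieldType) (w : valuation R F).

(** Values are compared with real thresholds throughout; this spares the case
    distinctions for infinite values. *)
Definition vge (M : R) (x : F) := (M%:E <= w x)%E.

Lemma val0 : w 0 = +oo%E.
Proof. by apply/val_eqy. Qed.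

Lemma val_fin x : x != 0 -> exists r, w x = r%:E.
Proof.
move=> x0; have := @val_neqNy _ _ w x.
have : w x <> +oo%E by move/val_eqy/eqP; rewrite (negPf x0).
by case: (w x) => [r _ _| |] //; exists r.
Qed.

Lemma val_fin_neq0 x r : w x = r%:E -> x != 0.
Proof. by move=> h; apply/eqP => x0; move: h; rewrite x0 val0. Qed.

Lemma valN x : w (- x) = w x.
Proof. by rewrite -mulN1r Defs.valM Defs.valN1 add0e. Qed.

Lemma vge0 M : vge M 0.
Proof. by rewrite /vge val0 leey. Qed.

Lemma vge1 : vge 0 1.
Proof. by rewrite /vge Defs.val1. Qed.

Lemma vgeW M M' x : M <= M' -> vge M' x -> vge M x.
Proof. by move=> h; apply: le_trans; rewrite lee_fin. Qed.

Lemma vgeN M x : vge M (- x) = vge M x.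
Proof. by rewrite /vge valN. Qed.

Lemma vgeD M x y : vge M x -> vge M y -> vge M (x + y).
Proof. by move=> hx hy; apply: le_trans (Defs.valD _ _ _); rewrite le_min; apply/andP. Qed.

Lemma vgeB M x y : vge M x -> vge M y -> vge M (x - y).
Proof. by move=> hx hy; apply: vgeD; rewrite ?vgeN. Qed.

Lemma vgeBC M x y : vge M (x - y) = vge M (y - x).
Proof. by rewrite -vgeN opprB. Qed.

Lemma vge_trans M x y z : vge M (x - y) -> vge M (y - z) -> vge M (x - z).
Proof. by move=> h1 h2; rewrite -(subrKA y x) vgeD. Qed.

Lemma vge_near M x y : vge M (x - y) -> vge M y -> vge M x.
Proof. by move=> h1 h2; rewrite -(subrK y x); apply: vgeD. Qed.

Lemma vgeM M N x y : vge M x -> vge N y -> vge (M + N) (x * y).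
Proof. by move=> hx hy; rewrite /vge Defs.valM EFinD leeD. Qed.

Lemma vgeM' K M N x y : vge M x -> vge N y -> K <= M + N -> vge K (x * y).
Proof. by move=> hx hy hK; apply: vgeW hK _; apply: vgeM. Qed.

Lemma vgeM0 M x y : vge 0 x -> vge M y -> vge M (x * y).
Proof. by move=> hx hy; apply: vgeM' hx hy _; rewrite add0r. Qed.

Lemma vgeM0r M x y : vge M x -> vge 0 y -> vge M (x * y).
Proof. by move=> hx hy; rewrite mulrC; apply: vgeM0. Qed.

Lemma vgeX M x n : vge M x -> vge (n%:R * M) (x ^+ n).
Proof.
move=> hx; elim: n => [|n IH]; first by rewrite mul0r expr0 vge1.
by rewrite exprS -natr1 mulrDl mul1r addrC; apply: vgeM.
Qed.

Lemma vgeX0 x n : vge 0 x -> vge 0 (x ^+ n).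
Proof. by move=> /(@vgeX _ _ n); rewrite mulr0. Qed.

Lemma vge_nat n : vge 0 n%:R.
Proof. by elim: n => [|n IH]; rewrite ?vge0 // -natr1 vgeD ?vge1. Qed.

Lemma vgeMn M x n : vge M x -> vge M (x *+ n).
Proof. by move=> h; rewrite -mulr_natl; apply: vgeM0 => //; apply: vge_nat. Qed.

Lemma vge_sum M (I : Type) (s : seq I) (P : pred I) (f : I -> F) :
  (forall i, P i -> vge M (f i)) -> vge M (\sum_(i <- s | P i) f i).
Proof. by move=> h; elim/big_ind: _ => //; [apply: vge0 | apply: vgeD]. Qed.

Lemma vge_all0 x : (forall M, vge M x) -> x = 0.
Proof.
move=> h; apply/eqP/negPn/negP => /val_fin[r hr].
by have := h (r + 1); rewrite /vge hr lee_fin; lra.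
Qed.

Lemma vge_fin M r x : w x = r%:E -> vge M x = (M <= r).
Proof. by rewrite /vge => ->; rewrite lee_fin. Qed.

Lemma vge_self r x : w x = r%:E -> vge r x.
Proof. by move=> h; rewrite (vge_fin _ h). Qed.

Lemma val_thr x r : vge r x -> (forall M, r < M -> ~ vge M x) -> w x = r%:E.
Proof.
move=> h1 h2; have x0 : x != 0.
  by apply/eqP => x0; apply: (h2 (r + 1)); rewrite ?x0 ?vge0 //; lra.
have [s hs] := val_fin x0; rewrite hs; congr (_%:E).
move: h1 h2; rewrite (vge_fin _ hs) => h1 /(_ s) h2.
by apply/eqP; rewrite eq_le h1 andbT leNgt; apply/negP => /h2; apply; apply: vge_self.
Qed.

Lemma valM_fin x y r s : w x = r%:E -> w y = s%:E -> w (x * y) = (r + s)%:E.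
Proof. by move=> hx hy; rewrite Defs.valM hx hy. Qed.

Lemma valX_fin x r n : w x = r%:E -> w (x ^+ n) = (n%:R * r)%:E.
Proof.
move=> hx; elim: n => [|n IH]; first by rewrite mul0r expr0 Defs.val1.
by rewrite exprS (valM_fin hx IH) -natr1 mulrDl mul1r addrC.
Qed.

Lemma valV_fin x r : w x = r%:E -> w x^-1 = (- r)%:E.
Proof.
move=> hx; have x0 := val_fin_neq0 hx.
have /val_fin[s hs] : x^-1 != 0 by rewrite invr_eq0.
have := valM_fin hx hs; rewrite mulfV // Defs.val1 => -[] h.
by rewrite hs; congr (_%:E); lra.
Qed.

Lemma val_div_fin x y r s : w x = r%:E -> w y = s%:E -> w (x / y) = (r - s)%:E.
Proof. by move=> hx /valV_fin hy; exact: valM_fin. Qed.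

Lemma valD_fin x y r M : w x = r%:E -> r < M -> vge M y -> w (x + y) = r%:E.
Proof.
move=> hx hM hy; apply: val_thr => [|M' hM' h].
  by apply: vgeD; [exact: vge_self | apply: vgeW hy; apply: ltW].
have : vge (Num.min M M') x.
  rewrite -(addrK y x); apply: vgeB.
    by apply: vgeW h; rewrite ge_min lexx orbT.
  by apply: vgeW hy; rewrite ge_min lexx.
by rewrite (vge_fin _ hx) ge_min => /orP[]; lra.
Qed.

Lemma valB_fin x y r M : w x = r%:E -> r < M -> vge M (y - x) -> w y = r%:E.
Proof. by move=> hx hM /(valD_fin hx hM); rewrite subrKC. Qed.

Lemma vgeMl M r x y : w x = r%:E -> vge (M + r) (x * y) -> vge M y.
Proof.
move=> hx; have [->|/val_fin[s hs]] := eqVneq y 0; first by rewrite vge0.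
by rewrite (vge_fin _ hs) (vge_fin _ (valM_fin hx hs)); lra.
Qed.

Lemma vgeMr M r x y : w x = r%:E -> vge M (y / x) = vge (M + r) y.
Proof.
move=> hx; apply/idP/idP => h.
  rewrite -(divfK (val_fin_neq0 hx) y); apply: vgeM => //; exact: vge_self.
by apply: vgeM' h (vge_self (valV_fin hx)) _; lra.
Qed.

Lemma vgeXr M x n : (0 < n)%N -> vge (n%:R * M) (x ^+ n) -> vge M x.
Proof.
move=> n0; have [->|/val_fin[s hs]] := eqVneq x 0; first by rewrite vge0.
by rewrite (vge_fin _ hs) (vge_fin _ (valX_fin n hs)) ler_pM2l // ltr0n.
Qed.

Lemma vge_gt0 M x : (M%:E < w x)%E -> exists2 M' : R, M < M' & vge M' x.
Proof. exact: ereal_gt_ex. Qed.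

Lemma vge_gt M M' x : M < M' -> vge M' x -> (M%:E < w x)%E.
Proof. by move=> h; apply: lt_le_trans; rewrite lte_fin. Qed.

(** Ultrametric: the two smallest of [x], [y], [x + y] agree. *)
Lemma val_eq_near x y : (w x < w (y - x)%R)%E -> w y = w x.
Proof.
have [->|/val_fin[r hr]] := eqVneq x 0; first by rewrite val0 ltNge leey.
by rewrite hr => /vge_gt0[M rM hM]; exact: valB_fin hr rM hM.
Qed.

Lemma val_rootn_eq0 x n r : (0 < n)%N -> w (x ^+ n) = r%:E -> w x = (r / n%:R)%:E.
Proof.
move=> n0 h; have x0 : x != 0.
  by move: (val_fin_neq0 h); rewrite expf_eq0 n0.
have [s hs] := val_fin x0; move: h; rewrite (valX_fin n hs) => -[<-].
by rewrite hs mulrAC mulfV ?mul1r // pnatr_eq0 -lt0n.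
Qed.

Lemma val2 : (0 < w 3%R)%E -> w 2 = 0%E.
Proof.
move=> /vge_gt0[M M0 hM].
have hN : w (-1) = 0%E by rewrite valN Defs.val1.
by apply: (valB_fin hN M0); rewrite opprK -[2 + 1]/(2%:R + 1) natr1.
Qed.

End Thresholds.

Lemma rmorph_lift (R S : pzRingType) (f : R -> S) :
  zmod_morphism f -> monoid_morphism f -> exists g : {rmorphism R -> S}, g =1 f.
Proof.
move=> h1 h2.
pose a := GRing.isZmodMorphism.Build R S f h1.
pose b := GRing.isMonoidMorphism.Build R S f h2.
pose g : {rmorphism R -> S} := HB.pack f a b.
by exists g.
Qed.

(** [E] is the field of fractions of [S / ker ev]. *)
Lemma valuation_of_ring (R : realType) (S : comNzRingType) (E : fieldType)
    (ev : {rmorphism S -> E}) (l : S -> \bar R) :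
  (forall a, l a <> -oo%E) ->
  (forall a, l a = +oo%E <-> ev a = 0) ->
  (forall a b, l (a * b)%R = (l a + l b)%E) ->
  (forall a b, (Order.min (l a) (l b) <= l (a + b)%R)%E) ->
  (forall x, exists a b, ev b != 0 /\ x = ev a / ev b) ->
  exists w : valuation R E, forall a, w (ev a) = l a.
Proof.
move=> lN ly lM lD fr.
have lfin a : ev a != 0 -> exists r, l a = r%:E.
  move=> ea; have := @lN a; have : l a <> +oo%E by move/ly/eqP; rewrite (negPf ea).
  by case: (l a) => [r _ _| |] //; exists r.
have l1 : l 1 = 0%E.
  have [|r hr] := lfin 1; first by rewrite rmorph1 oner_eq0.
  by have := lM 1 1; rewrite mulr1 hr -EFinD => -[] h; congr (_%:E); lra.
have lN1 : l (-1) = 0%E.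
  have [|r hr] := lfin (-1); first by rewrite rmorphN1 oppr_eq0 oner_eq0.
  by have := lM (-1) (-1); rewrite mulrNN mulr1 l1 hr -EFinD => -[] h; congr (_%:E); lra.
have leq a b : ev a = ev b -> l a = l b.
  have key a' b' : ev a' = ev b' -> (l a' <= l b')%E.
    move=> e; have h : l (b' - a') = +oo%E by apply/ly; rewrite rmorphB e subrr.
    have := lD a' (b' - a'); rewrite h addrC subrK.
    by rewrite (min_idPl _) ?leey.
  by move=> e; apply/le_anti; rewrite !key.
pose frac x := cid (fr x).
pose num x := projT1 (frac x).
pose den x := projT1 (cid (projT2 (frac x))).
have denN x : ev (den x) != 0 by rewrite /den; case: (cid _) => b /= [].
have fracE x : x = ev (num x) / ev (den x).
  by rewrite {1}/num /den; case: (cid _) => b /= [].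
pose w x := (l (num x) - l (den x))%E.
have wE x a b : ev b != 0 -> x = ev a / ev b -> w x = (l a - l b)%E.
  move=> eb xE; have [rd hd] := lfin _ (denN x); have [rb hb] := lfin _ eb.
  have : l (num x * b) = l (a * den x).
    apply: leq; rewrite !rmorphM -[LHS]mulr1 -(mulVf (denN x)) mulrA.
    rewrite (mulrAC _ (ev b)) -fracE xE mulfVK // mulrC.
  rewrite !lM hb hd /w hd.
  case: (l (num x)) (@lN (num x)) => [rn| |] _; case: (l a) (@lN a) => [ra| |] _ //.
  by case=> h; apply: (congr1 EFin); lra.
have w0 : forall x, w x <> -oo%E.
  move=> x; rewrite /w; have [rd ->] := lfin _ (denN x).
  by case: (l (num x)) (@lN (num x)).
have wy x : w x = +oo%E <-> x = 0.
  rewrite /w; have [rd ->] := lfin _ (denN x); split=> [h|x0].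
    have /ly h0 : l (num x) = +oo%E by case: (l (num x)) h (@lN (num x)).
    by rewrite (fracE x) h0 mul0r.
  have : ev (num x) = 0.
    move/eqP: x0; rewrite {1}(fracE x) mulf_eq0 invr_eq0 (negPf (denN x)) orbF.
    by move/eqP.
  by move/ly=> ->.
have wM x y : w (x * y) = (w x + w y)%E.
  rewrite (@wE _ (num x * num y) (den x * den y)).
  - rewrite !lM /w; have [rd ->] := lfin _ (denN x); have [re ->] := lfin _ (denN y).
    case: (l (num x)) (@lN (num x)) => [rn| |] //= _;
    case: (l (num y)) (@lN (num y)) => [ra| |] //= _.
    by apply: (congr1 EFin); lra.
  - by rewrite rmorphM mulf_neq0.
  - by rewrite !rmorphM {1}(fracE x) {1}(fracE y) mulf_div.
have wD x y : (Order.min (w x) (w y) <= w (x + y)%R)%E.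
  rewrite (@wE x (num x * den y) (den x * den y)); first last.
  - by rewrite !rmorphM -mulf_div divff ?mulr1 // -fracE.
  - by rewrite rmorphM mulf_neq0.
  rewrite (@wE y (num y * den x) (den x * den y)); first last.
  - by rewrite !rmorphM [X in _ / X]mulrC -mulf_div divff ?mulr1 // -fracE.
  - by rewrite rmorphM mulf_neq0.
  rewrite (@wE (x + y) (num x * den y + num y * den x) (den x * den y)); first last.
  - by rewrite rmorphD !rmorphM {1}(fracE x) {1}(fracE y) addf_div.
  - by rewrite rmorphM mulf_neq0.
  have [|r hr] := lfin (den x * den y); first by rewrite rmorphM mulf_neq0.
  rewrite hr; have := lD (num x * den y) (num y * den x).
  set p := l (num x * _); set q := l (num y * _) => h.
  rewrite ge_min; move: h; rewrite ge_min => /orP[] h.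
    by apply/orP; left; apply: leeB.
  by apply/orP; right; apply: leeB.
exists (Valuation w0 wy wM wD) => a /=.
rewrite (@wE _ a 1) ?rmorph1 ?oner_eq0 ?divr1 // l1 sube0 //.
Qed.

(** * Gauss valuations *)

Section PolyGauss.
Variables (R : realType) (C : fieldType) (v : valuation R C).
Implicit Types (rho M : R) (p q : {poly C}).

(** The Gauss value of [p] at radius [rho] is at least [M]. *)
Definition pge rho M p := forall i, vge v (M - i%:R * rho) p`_i.

Definition gval rho p : \bar R :=
  \big[Order.min/+oo%E]_(i < size p) (v p`_i + (i%:R * rho)%:E)%E.

Lemma gval_geP rho M p : (M%:E <= gval rho p)%E <-> pge rho M p.
Proof.
split.
  move=> /bigmin_geP[_ h] i; have [ip|ip] := ltnP i (size p); last first.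
    by rewrite nth_default // vge0.
  by have := h (Ordinal ip) isT; rewrite /= /vge -leeBlDr.
move=> h; apply/bigmin_geP; split=> [|i _]; first exact: leey.
by have := h i; rewrite /vge -leeBlDr.
Qed.

Lemma pgeD rho M p q : pge rho M p -> pge rho M q -> pge rho M (p + q).
Proof. by move=> hp hq i; rewrite coefD; apply: vgeD. Qed.

Lemma pgeM rho M N p q : pge rho M p -> pge rho N q -> pge rho (M + N) (p * q).
Proof.
move=> hp hq k; rewrite coefM; apply: vge_sum => i _.
apply: vgeM' (hp i) (hq (k - i)%N) _.
have -> : (k%:R : R) = i%:R + (k - i)%:R by rewrite -natrD subnKC // -ltnS.
by rewrite le_eqVlt; apply/orP; left; apply/eqP; ring.
Qed.

(** The least index at which the minimum defining the Gauss value is attained;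
    it makes the Gauss value multiplicative. *)
Lemma pge_lead rho p : p != 0 -> exists (i : nat) (M : R),
  [/\ v p`_i = (M - i%:R * rho)%:E, pge rho M p &
      forall j, (j < i)%N -> exists2 M', M < M' & vge v (M' - j%:R * rho) p`_j].
Proof.
move=> p0.
have fin i : p`_i != 0 -> exists r, v p`_i = (r - i%:R * rho)%:E.
  by move=> /(val_fin v)[r hr]; exists (r + i%:R * rho); rewrite addrK.
have [M [hM [i [ri hi]]]] : exists M, pge rho M p /\
    exists i, p`_i != 0 /\ v p`_i = (M - i%:R * rho)%:E.
  have := gval_geP rho _ p.
  case E : (gval rho p) => [M| |] h.
  - exists M; have hM : pge rho M p by apply/h.
    split=> //; apply: contrapT => hn.
    have [d [d0 hd]] : exists d, M < d /\ pge rho d p.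
      suff [d d0 hd] : exists2 d, M < d & forall i, (i < size p)%N ->
          vge v (d - i%:R * rho) p`_i.
        exists d; split=> // i; have [|ip] := ltnP i (size p); first exact: hd.
        by rewrite nth_default // vge0.
      elim: (size p) => [|n [d d0 IH]]; first by exists (M + 1) => //; lra.
      have [pn|/eqP pn] := boolP (p`_n == 0).
        exists d => // i; rewrite ltnS leq_eqVlt => /orP[/eqP ->|]; last exact: IH.
        by rewrite (eqP pn) vge0.
      have [r hr] := fin n (introN eqP pn).
      have Mr : M < r.
        have := hM n; rewrite (vge_fin _ hr) => hle; rewrite lt_neqAle.
        apply/andP; split; last lra.
        apply/eqP => Mr; apply: hn; exists n; split; first exact/eqP.
        by rewrite Mr.
      exists (Num.min d r); first by rewrite lt_min d0.
      move=> i; rewrite ltnS leq_eqVlt => /orP[/eqP ->|/IH].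
        by rewrite (vge_fin _ hr) lerD2r ge_min lexx orbT.
      by apply: vgeW; rewrite lerD2r ge_min lexx.
    by have := (h d).2 hd; rewrite lee_fin; lra.
  - exfalso; have /eqP := p0; apply; apply/polyP => i; rewrite coef0.
    apply: (@vge_all0 _ _ v) => M; have := (h (M + i%:R * rho)).1 (leey _) i.
    by apply: vgeW; lra.
  - exfalso; have [M hM] : exists M, pge rho M p.
      suff [d hd] : exists d, forall i, (i < size p)%N -> vge v (d - i%:R * rho) p`_i.
        exists d => i; have [|ip] := ltnP i (size p); first exact: hd.
        by rewrite nth_default // vge0.
      elim: (size p) => [|n [d IH]]; first by exists 0.
      have [pn|/eqP pn] := boolP (p`_n == 0).
        exists d => // i; rewrite ltnS leq_eqVlt => /orP[/eqP ->|]; last exact: IH.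
        by rewrite (eqP pn) vge0.
      have [r hr] := fin n (introN eqP pn).
      exists (Num.min d r).
      move=> i; rewrite ltnS leq_eqVlt => /orP[/eqP ->|/IH].
        by rewrite (vge_fin _ hr) lerD2r ge_min lexx orbT.
      by apply: vgeW; rewrite lerD2r ge_min lexx.
    by have := (h M).2 hM; rewrite leeNy_eq.
pose P i := `[< p`_i != 0 /\ v p`_i = (M - i%:R * rho)%:E >].
have exP : exists i, P i by exists i; apply/asboolP.
case: (ex_minnP exP) => k /asboolP[rk hk] kmin.
exists k, M; split=> // j jlt.
have [pj|pj] := eqVneq p`_j 0.
  by exists (M + 1); rewrite ?pj ?vge0 //; lra.
have [r hr] := fin _ pj; exists r; last by rewrite (vge_fin _ hr).
have := hM j; rewrite (vge_fin _ hr) => hle; rewrite lt_neqAle.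
apply/andP; split; last lra.
apply/eqP => Mr; have /kmin : P j by apply/asboolP; rewrite Mr.
by rewrite leqNgt jlt.
Qed.

Lemma gval_fin rho p i M :
  v p`_i = (M - i%:R * rho)%:E -> pge rho M p -> gval rho p = M%:E.
Proof.
move=> hi hp; apply: ereal_eq_thr => N; split.
  by move=> /gval_geP/(_ i); rewrite (vge_fin _ hi) lee_fin; lra.
rewrite lee_fin => h; apply/gval_geP => j; apply: vgeW (hp j); lra.
Qed.

Lemma gvalE rho p : p != 0 -> exists i M,
  [/\ v p`_i = (M - i%:R * rho)%:E, pge rho M p & gval rho p = M%:E].
Proof.
move=> /(@pge_lead rho)[i [M [h1 h2 _]]]; exists i, M; split=> //.
exact: gval_fin h1 h2.
Qed.

Lemma gval0 rho : gval rho 0 = +oo%E.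
Proof. by rewrite /gval size_poly0 big_ord0. Qed.

Lemma gvalM rho p q : gval rho (p * q) = (gval rho p + gval rho q)%E.
Proof.
have notNy r : gval rho r <> -oo%E.
  by have [->|/(@gvalE rho)[? [? [_ _ ->]]]] := eqVneq r 0; rewrite ?gval0.
have [->|p0] := eqVneq p 0.
  by rewrite mul0r gval0 addye //; apply/eqP/notNy.
have [->|q0] := eqVneq q 0.
  by rewrite mulr0 gval0 addey //; apply/eqP/notNy.
have [i [M [hi hp ilt]]] := pge_lead rho p0.
have [j [N [hj hq jlt]]] := pge_lead rho q0.
rewrite (gval_fin hi hp) (gval_fin hj hq) -EFinD.
apply: (@gval_fin _ _ (i + j)%N); last exact: pgeM.
rewrite coefM.
have ilt' : (i < (i + j).+1)%N by rewrite ltnS leq_addr.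
rewrite (bigD1 (Ordinal ilt')) //= addKn.
have h0 : v (p`_i * q`_j) = (M + N - (i + j)%:R * rho)%:E.
  by rewrite (valM_fin hi hj) natrD; congr (_%:E); ring.
suff [K hK1 hK2] : exists2 K, M + N - (i + j)%:R * rho < K &
    vge v K (\sum_(k < (i + j).+1 | k != Ordinal ilt') p`_k * q`_(i + j - k)).
  exact: valD_fin h0 hK1 hK2.
have : forall k : 'I_(i + j).+1, k != Ordinal ilt' ->
    exists2 K, M + N - (i + j)%:R * rho < K & vge v K (p`_k * q`_(i + j - k)).
  move=> k ki; have e : ((i + j)%:R : R) = k%:R + (i + j - k)%:R.
    by rewrite -natrD subnKC // -ltnS.
  have ki' : (k : nat) != i by [].
  case: (ltngtP k i) ki' => // kic _.
    have [M' hM' h] := ilt _ kic.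
    exists (M' - k%:R * rho + (N - (i + j - k)%:R * rho)).
      by rewrite e; lra.
    exact: vgeM.
  have jk : (i + j - k < j)%N by rewrite ltn_subLR ?ltn_add2r // -ltnS.
  have [N' hN' h] := jlt _ jk.
  exists (M - k%:R * rho + (N' - (i + j - k)%:R * rho)); first by rewrite e; lra.
  exact: vgeM.
move=> hk; pose f k := xget 0 [set K | M + N - (i + j)%:R * rho < K /\
   vge v K (p`_k * q`_(i + j - k))].
elim/big_rec: _ => [|k x ki [K hK1 hK2]].
  by exists (M + N - (i + j)%:R * rho + 1); rewrite ?vge0 //; lra.
have [K' hK1' hK2'] := hk k ki; exists (Num.min K K'); first by rewrite lt_min hK1.
apply: vgeD; first by apply: vgeW hK2'; rewrite ge_min lexx orbT.
by apply: vgeW hK2; rewrite ge_min lexx.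
Qed.

Lemma pge_deriv rho M p : pge rho M p -> pge rho (M - rho) p^`().
Proof.
move=> h i; rewrite coef_deriv; apply: vgeMn; apply: vgeW (h i.+1).
by rewrite -natr1; lra.
Qed.

Lemma gval_lip rho rho' M p : pge rho M p ->
  pge rho' (M - (size p)%:R * `|rho - rho'|) p.
Proof.
move=> h i; have [ip|ip] := ltnP i (size p); last by rewrite nth_default // vge0.
apply: vgeW (h i).
have h1 : rho - rho' <= `|rho - rho'| by apply: ler_norm.
have h2 : 0 <= `|rho - rho'| by [].
have h3 : (i%:R : R) <= (size p)%:R by rewrite ler_nat ltnW.
have h4 : 0 <= (i%:R : R) by [].
have := ler_wpM2l h4 h1; have := ler_wpM2r h2 h3; lra.
Qed.

End PolyGauss.

Section Ratfun.
Variable (C : fieldType).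

Lemma ratfunP (f : ratfun C) : exists n d : {poly C},
  d != 0 /\ f = tofrac n / tofrac d.
Proof.
pose r := repr f.
exists (frac r).1, (frac r).2; have d0 := denom_ratioP r; split=> //.
have key : f * tofrac (frac r).2 = tofrac (frac r).1.
  rewrite -[f in LHS]reprK -/r; unlock FracField.tofrac.
  rewrite -[LHS]FracField.pi_mul; apply/eqmodP => /=.
  rewrite FracField.equivfE /FracField.mulf !numden_Ratio ?mulr1 ?oner_neq0 //.
  by rewrite mulrC.
by rewrite -key mulfK // tofrac_eq0.
Qed.

(** The local parameter of the projective line at [c]. *)
Definition tpar (c : C) : ratfun C := xfun C - ratC C c.

Definition polyT (c : C) (p : {poly C}) : ratfun C := (map_poly (ratC C) p).[tpar c].

Lemma polyTE c p : polyT c p = tofrac (p \Po ('X - c%:P)).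
Proof.
elim/poly_ind: p => [|p a IH]; first by rewrite /polyT rmorph0 horner0 comp_poly0 tofrac0.
rewrite /polyT rmorphD rmorphM /= map_polyX map_polyC hornerMXaddC.
rewrite -[_.[_]]/(polyT c p) IH comp_polyD comp_polyM comp_polyX comp_polyC.
by rewrite tofracD tofracM /tpar /xfun /ratC /= tofracB.
Qed.

Lemma tofracT c p : tofrac p = polyT c (p \Po ('X + c%:P)).
Proof.
by rewrite polyTE -comp_polyA comp_polyD comp_polyX comp_polyC subrK comp_polyXr.
Qed.

Lemma polyT_eq0 c p : (polyT c p == 0) = (p == 0).
Proof.
apply/idP/idP => [|/eqP ->]; last by rewrite polyTE comp_poly0 tofrac0.
rewrite polyTE tofrac_eq0 => /eqP h.
have -> : p = (p \Po ('X - c%:P)) \Po ('X + c%:P).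
  by rewrite -comp_polyA comp_polyB comp_polyX comp_polyC addrK comp_polyXr.
by rewrite h comp_poly0.
Qed.

Lemma polyTP c f : exists n d, d != 0 /\ f = polyT c n / polyT c d.
Proof.
have [n [d [d0 ->]]] := ratfunP f.
exists (n \Po ('X + c%:P)), (d \Po ('X + c%:P)); split; last by rewrite -!tofracT.
by rewrite -(polyT_eq0 c) -tofracT tofrac_eq0.
Qed.

Lemma polyTD c p q : polyT c (p + q) = polyT c p + polyT c q.
Proof. by rewrite /polyT rmorphD hornerD. Qed.
Lemma polyTB c p q : polyT c (p - q) = polyT c p - polyT c q.
Proof. by rewrite /polyT rmorphB hornerD hornerN. Qed.
Lemma polyTM c p q : polyT c (p * q) = polyT c p * polyT c q.
Proof. by rewrite /polyT rmorphM hornerM. Qed.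
Lemma polyTX c : polyT c 'X = tpar c.
Proof. by rewrite /polyT map_polyX hornerX. Qed.
Lemma polyTC c a : polyT c a%:P = ratC C a.
Proof. by rewrite /polyT map_polyC hornerC. Qed.
Lemma ratC_eq0 (a : C) : (ratC C a == 0) = (a == 0).
Proof. by rewrite -(polyTC 0) polyT_eq0 polyC_eq0. Qed.
Lemma ratC_div (a b : C) : ratC C (a / b) = ratC C a / ratC C b.
Proof. exact: fmorph_div. Qed.
Lemma polyTXn c p n : polyT c (p ^+ n) = polyT c p ^+ n.
Proof. by rewrite /polyT rmorphXn horner_exp. Qed.

Lemma tpar_neq0 c : tpar c != 0.
Proof. by rewrite -polyTX polyT_eq0 polyX_eq0. Qed.
End Ratfun.

Section Gauss.
Variables (R : realType) (C : fieldType) (v : valuation R C).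
Implicit Types (rho M : R) (c : C).

Lemma gauss_ex c rho : exists w : valuation R (ratfun C),
  forall p, w (polyT c p) = gval v rho p.
Proof.
have := @valuation_of_ring R {poly C} (ratfun C) (@tofrac {poly C})
  (fun p => gval v rho (p \Po ('X + c%:P))).
case.
- move=> p; set q := _ \Po _.
  by have [->|/(@gvalE _ _ v rho)[? [? [_ _ ->]]]] := eqVneq q 0; rewrite ?gval0.
- move=> p; have E : tofrac p = polyT c (p \Po ('X + c%:P)) := tofracT c p.
  set q := p \Po _ in E *; split => [|/eqP].
    have [q0 _|/(@gvalE _ _ v rho)[? [? [_ _ ->]]]] // := eqVneq q 0.
    by apply: etrans E _; rewrite q0 polyTE comp_poly0 tofrac0.
  have -> : (tofrac p == 0) = (polyT c q == 0) by rewrite -E.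
  by rewrite polyT_eq0 => /eqP ->; rewrite gval0.
- by move=> p q; rewrite comp_polyM gvalM.
- move=> p q; rewrite comp_polyD; apply: ereal_le_thr => M.
  by rewrite le_min => /andP[/gval_geP h1 /gval_geP h2]; apply/gval_geP/pgeD.
- move=> f; have [n [d [d0 ->]]] := ratfunP f; exists n, d; split=> //.
  by rewrite tofrac_eq0.
move=> w hw; exists w => p; rewrite polyTE hw; congr gval.
by rewrite -comp_polyA comp_polyB comp_polyX comp_polyC addrK comp_polyXr.
Qed.

Definition gauss c rho : valuation R (ratfun C) := projT1 (cid (gauss_ex c rho)).

Lemma gaussE c rho p : gauss c rho (polyT c p) = gval v rho p.
Proof. by rewrite /gauss; case: cid. Qed.

Lemma gauss_vge c rho M p : vge (gauss c rho) M (polyT c p) <-> pge v rho M p.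
Proof. by rewrite /vge gaussE; exact: gval_geP. Qed.

Lemma gauss_C c rho a : gauss c rho (ratC C a) = v a.
Proof.
rewrite -(polyTC c) gaussE; have [->|a0] := eqVneq a 0.
  by rewrite val0 gval0.
have [r hr] := val_fin v a0; rewrite hr; apply: (@gval_fin _ _ v rho a%:P 0).
  by rewrite coefC /= hr mul0r subr0.
move=> i; rewrite coefC; case: eqP => [->|_]; last exact: vge0.
by rewrite mul0r subr0; exact: vge_self.
Qed.

Lemma gauss_t c rho : gauss c rho (tpar c) = rho%:E.
Proof.
rewrite -polyTX gaussE; apply: (@gval_fin _ _ v rho 'X 1).
  by rewrite coefX /= Defs.val1 mul1r subrr.
move=> i; rewrite coefX; case: eqP => [->|_]; last exact: vge0.
by rewrite mul1r subrr; exact: vge1.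
Qed.

(** The Lipschitz constant for a polynomial is its size. *)
Lemma gauss_lip c f : f != 0 -> exists2 K, 0 <= K & forall rho rho' r r',
  gauss c rho f = r%:E -> gauss c rho' f = r'%:E -> `|r - r'| <= K * `|rho - rho'|.
Proof.
have [n [d [d0 ->]]] := polyTP c f; rewrite mulf_eq0 polyT_eq0 negb_or => /andP[n0 _].
have plip p : p != 0 -> forall rho rho' r r', gauss c rho (polyT c p) = r%:E ->
    gauss c rho' (polyT c p) = r'%:E -> r' - r <= (size p)%:R * `|rho - rho'|.
  move=> p0 rho rho' r r' h h'.
  have /gauss_vge/(@gval_lip _ _ v _ rho)/(gauss_vge c) := vge_self h'.
  by rewrite (vge_fin _ h) distrC; lra.
exists ((size n)%:R + (size d)%:R); first by rewrite addr_ge0.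
move=> rho rho' r r'.
have fin p rh : p != 0 -> exists r, gauss c rh (polyT c p) = r%:E.
  by move=> p0; apply: val_fin; rewrite polyT_eq0.
have [a ha] := fin n rho n0; have [b hb] := fin d rho d0.
have [a' ha'] := fin n rho' n0; have [b' hb'] := fin d rho' d0.
rewrite (val_div_fin ha hb) (val_div_fin ha' hb') => -[<-] [<-].
have := plip _ n0 _ _ _ _ ha ha'; have := plip _ n0 _ _ _ _ ha' ha.
have := plip _ d0 _ _ _ _ hb hb'; have := plip _ d0 _ _ _ _ hb' hb.
rewrite [`|rho' - rho|]distrC ler_norml.
by move=> h1 h2 h3 h4; apply/andP; split; lra.
Qed.

Section Irrational.
Variables (c : C) (rho : R).
Hypothesis irr : forall n a, (0 < n)%N -> v a <> (n%:R * rho)%:E.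

(** By induction on [p]: the highest terms are close to a monomial, whose value
    differs from that of the constant term by hypothesis. *)
Lemma irr_lead (w : valuation R (ratfun C)) (p : {poly C}) :
  (forall a, w (ratC C a) = v a) -> w (tpar c) = rho%:E -> p != 0 ->
  exists (i : nat) r, [/\ v p`_i = (r - i%:R * rho)%:E,
   w (polyT c p) = r%:E,  gauss c rho (polyT c p) = r%:E & exists2 r', r < r' &
   vge w r' (polyT c p - ratC C p`_i * tpar c ^+ i)].
Proof.
move=> wC wt.
elim/poly_ind: p => [|p a IH]; first by rewrite eqxx.
rewrite polyTD polyTM polyTX polyTC => pa.
have coefpa i : (p * 'X + a%:P)`_i.+1 = p`_i by rewrite coefD coefMX coefC addr0.
have coefpa0 : (p * 'X + a%:P)`_0 = a by rewrite coefD coefMX coefC add0r.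
have [p0|p0] := eqVneq p 0.
  have a0 : a != 0 by apply: contraNneq pa => a0; rewrite p0 a0 mul0r add0r polyC0.
  have [r hr] := val_fin v a0; exists 0%N, r.
  rewrite coefpa0 p0 !polyTE !comp_poly0 !tofrac0 !mul0r !add0r wC gauss_C hr.
  by split=> //; [by rewrite subr0 | by exists (r + 1); rewrite ?expr0 ?mulr1 ?subrr ?vge0 //; lra].
have [i [r [hi hw hg [r' rr' hr']]]] := IH p0.
have hwt := valM_fin hw wt; have hgt := valM_fin hg (gauss_t c rho).
have near : vge w (r' + rho) (polyT c p * tpar c - ratC C p`_i * tpar c ^+ i.+1).
  rewrite exprSr mulrA -mulrBl; apply: vgeM => //; exact: vge_self.
have [a0|a0] := eqVneq a 0.
  exists i.+1, (r + rho); rewrite coefpa a0 rmorph0 addr0; split=> //.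
    by rewrite hi -natr1; congr (_%:E); ring.
  by exists (r' + rho) => //; lra.
have [s hs] := val_fin v a0.
have wa : w (ratC C a) = s%:E by rewrite wC.
have ga : gauss c rho (ratC C a) = s%:E by rewrite gauss_C.
case: (ltgtP s (r + rho)) => hsr.
- exists 0%N, s; rewrite coefpa0 hs mul0r subr0 addrC.
  split=> //.
  + by apply: valD_fin wa hsr _; apply: vge_self.
  + by apply: valD_fin ga hsr _; apply: vge_self.
  + by exists (r + rho) => //; rewrite expr0 mulr1 addrC addrK; apply: vge_self.
- exists i.+1, (r + rho); rewrite coefpa; split.
  + by rewrite hi -natr1; congr (_%:E); ring.
  + by apply: valD_fin hwt hsr _; apply: vge_self.
  + by apply: valD_fin hgt hsr _; apply: vge_self.
  + exists (Num.min s (r' + rho)); first by rewrite lt_min hsr; lra.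
    rewrite addrAC; apply: vgeD.
      by apply: vgeW near; rewrite ge_min lexx orbT.
    by rewrite (vge_fin _ wa) ge_min lexx.
- exfalso; apply: (irr (n := i.+1) (a := a / p`_i)) => //.
  by rewrite (val_div_fin hs hi) hsr -natr1; congr (_%:E); ring.
Qed.

(** A valuation whose value at the parameter is not commensurable with a value
    of constants is a Gauss valuation: distinct monomials have distinct values. *)
Lemma gauss_irr (w : valuation R (ratfun C)) :
  (forall a, w (ratC C a) = v a) -> w (tpar c) = rho%:E ->
  forall f, w f = gauss c rho f.
Proof.
move=> wC wt f; have [n [d [d0 ->]]] := polyTP c f.
have [->|n0] := eqVneq n 0.
  by rewrite polyTE comp_poly0 tofrac0 mul0r !val0.
have [_ [r [_ h1 h2 _]]] := irr_lead wC wt n0.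
have [_ [s [_ h3 h4 _]]] := irr_lead wC wt d0.
by rewrite (val_div_fin h1 h3) (val_div_fin h2 h4).
Qed.

(** At such a radius every function is, up to a factor close to 1, a monomial. *)
Lemma gauss_irr_dom f : f != 0 -> exists (a : C) (n m : nat), a != 0 /\
    (0 < gauss c rho (f * tpar c ^+ m / (ratC C a * tpar c ^+ n) - 1)%R)%E.
Proof.
have [n [d [d0 ->]]] := polyTP c f; rewrite mulf_eq0 polyT_eq0 negb_or => /andP[n0 _].
pose w := gauss c rho.
have mono p : p != 0 -> exists (a : C) (i : nat), a != 0 /\
    exists2 e, 0 < e & vge w e (polyT c p / (ratC C a * tpar c ^+ i) - 1).
  move=> p0; have [i [r [hi hr _ [r' rr' hr']]]] :=
    irr_lead (gauss_C c rho) (gauss_t c rho) p0.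
  exists p`_i, i; split; first exact: val_fin_neq0 hi.
  have hm : w (ratC C p`_i * tpar c ^+ i) = r%:E.
    have ha : w (ratC C p`_i) = (r - i%:R * rho)%:E by rewrite gauss_C.
    by rewrite (valM_fin ha (valX_fin i (gauss_t c rho))) subrK.
  have m0 := val_fin_neq0 hm; exists (r' - r); first by lra.
  by rewrite -(mulfV m0) -mulrBl (vgeMr _ _ hm) subrK.
have [a [i [a0 [e e0 he]]]] := mono n n0; have [b [j [b0 [e' e0' he']]]] := mono d d0.
exists (a / b), i, j; split; first by rewrite mulf_neq0 ?invr_eq0.
have gen (K : fieldType) (N D Ti Tj A B : K) : D != 0 -> A != 0 -> B != 0 ->
    Ti != 0 -> Tj != 0 -> N / D * Tj / (A / B * Ti) = N / (A * Ti) / (D / (B * Tj)).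
  by move=> D0 A0 B0 Ti0 Tj0; field; rewrite D0 A0 B0 Ti0 Tj0.
have mono0 (h : C) k : h != 0 -> ratC C h * tpar c ^+ k != 0.
  move=> h1; apply: mulf_neq0; first by rewrite ratC_eq0.
  exact: expf_neq0 (tpar_neq0 c).
have A0 := mono0 a i a0; have B0 := mono0 b j b0.
move: he he'; set x := _ / (ratC C a * _); set y := _ / (ratC C b * _) => he he'.
have y0 : y != 0 by rewrite mulf_neq0 ?invr_eq0 ?polyT_eq0.
have -> : polyT c n / polyT c d * tpar c ^+ j / (ratC C (a / b) * tpar c ^+ i) = x / y.
  rewrite /x /y ratC_div.
  have dT0 : polyT c d != 0 by rewrite polyT_eq0.
  have a0' : ratC C a != 0 by rewrite ratC_eq0.
  have b0' : ratC C b != 0 by rewrite ratC_eq0.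
  have ti : tpar c ^+ i != 0 := expf_neq0 i (tpar_neq0 c).
  have tj : tpar c ^+ j != 0 := expf_neq0 j (tpar_neq0 c).
  exact (gen (ratfun C) _ _ _ _ _ _ dT0 a0' b0' ti tj).
have w1 : w 1 = 0%:E by rewrite Defs.val1.
have wy : w y = 0%:E.
  by apply: (valB_fin w1 e0').
have := @vgeMr _ _ w (Num.min e e') 0 y (x - y) wy.
rewrite addr0 mulrBl divff // => h.
have m0 : 0 < Num.min e e' by rewrite lt_min e0.
apply: (vge_gt m0); rewrite h.
apply: (@vge_trans _ _ _ _ _ 1); first by apply: vgeW he; rewrite ge_min lexx.
by rewrite vgeBC; apply: vgeW he'; rewrite ge_min lexx orbT.
Qed.
End Irrational.

End Gauss.

(** * Annihilators of Kaehler differentials *)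

Section Kaehler.
Variables (A B : comNzRingType) (h : {rmorphism A -> B}).

Definition imset : set B := [set b | exists a, b = h a].
Local Notation krel := (kaehler_relation imset).

Lemma krel_ext f g : f =1 g -> krel f -> krel g.
Proof. by move=> /funext ->. Qed.

Lemma krelD f g : krel f -> krel g -> krel (fun x => f x + g x).
Proof.
by move=> hf hg; apply: krel_ext (kaehler_lin 1 hf hg) => x; rewrite mul1r.
Qed.

Lemma krelZ c f : krel f -> krel (fun x => c * f x).
Proof.
move=> hf; apply: krel_ext (kaehler_lin c hf (kaehler_0 _)) => x.
by rewrite addr0.
Qed.

Lemma krelB f g : krel f -> krel g -> krel (fun x => f x - g x).
Proof.
move=> hf hg; apply: krel_ext (kaehler_lin (-1) hg hf) => x.
by rewrite mulN1r addrC.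
Qed.

Variable w : B.

(** [db = c dw] in the module of differentials. *)
Definition dmul (b c : B) := krel (fun x => dgen b x - c * dgen w x).

Lemma dmul_const a : dmul (h a) 0.
Proof.
apply: (@krel_ext (dgen (h a))) => [x|]; first by rewrite mul0r subr0.
by apply: kaehler_const; exists a.
Qed.

Lemma dmulD b c b' c' : dmul b c -> dmul b' c' -> dmul (b + b') (c + c').
Proof.
move=> hb hb'; apply: krel_ext (krelD (krelD (kaehler_add _ b b') hb) hb') => x.
by rewrite /=; ring.
Qed.

Lemma dmulM b c b' c' : dmul b c -> dmul b' c' -> dmul (b * b') (b * c' + b' * c).
Proof.
move=> hb hb'.
apply: krel_ext (krelD (krelD (kaehler_leibniz _ b b') (krelZ b hb')) (krelZ b' hb)) => x.
by rewrite /=; ring.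
Qed.

(** The chain rule for [d(q(w))]. *)
Lemma dmul_poly (q : {poly A}) : dmul (map_poly h q).[w] (map_poly h q^`()).[w].
Proof.
have hw : dmul w 1.
  by apply: (krel_ext _ (kaehler_0 _)) => x; rewrite mul1r subrr.
elim/poly_ind: q => [|q a IH].
  by rewrite deriv0 rmorph0 horner0 -(rmorph0 h); rewrite {2}rmorph0; apply: dmul_const.
rewrite derivMXaddC !rmorphD !rmorphM /= map_polyX map_polyC !hornerE.
have := dmulD (dmulM IH hw) (dmul_const a).
by rewrite mulr1 addr0 [w * _]mulrC.
Qed.

Variable f : {poly A}.
Hypothesis f_monic : f \is monic.
Hypothesis fw : (map_poly h f).[w] = 0.
Let delta := (map_poly h f^`()).[w].

Lemma dmul_annih : krel (fun x => delta * dgen w x).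
Proof.
have := dmul_poly f; rewrite fw => h1.
apply: krel_ext (krelB (dmul_const 0) h1) => x; rewrite rmorph0.
by rewrite /delta; ring.
Qed.

Lemma krel_sum (s : seq B) (F : B -> B -> B) :
  (forall b, krel (F b)) -> krel (fun x => \sum_(b <- s) F b x).
Proof.
move=> hF; elim: s => [|b s IH].
  by apply: krel_ext (kaehler_0 _) => x; rewrite big_nil.
by apply: krel_ext (krelD (hF b) IH) => x; rewrite big_cons.
Qed.

(** All differentials are multiples of [dw], and [0 = d(f(w)) = f'(w) dw]. *)
Lemma annihilates_deriv (a : B) :
  (forall b, exists q, b = (map_poly h q).[w]) ->
  annihilates_kaehler imset (delta * a).
Proof.
move=> gen g /finite_seqP[s hs].
have hb b : krel (fun x => delta * a * g b * dgen b x).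
  have [q ->] := gen b; set c := (map_poly h q).[w].
  have h1 := krelZ (delta * a * g c) (dmul_poly q).
  have h2 := krelZ (a * g c * (map_poly h q^`()).[w]) dmul_annih.
  by apply: krel_ext (krelD h1 h2) => x; rewrite -/c /=; ring.
apply: krel_ext (krel_sum (undup s) hb) => x.
have [xs|xs] := boolP (x \in s).
  rewrite (bigD1_seq x) ?mem_undup ?undup_uniq //= /dgen eqxx mulr1.
  rewrite big1 ?addr0 // => b bx; rewrite eq_sym (negPf bx) mulr0 //.
have g0 : g x = 0.
  by apply/eqP; apply: contraNT xs => gx; have : [set b | g b != 0] x := gx; rewrite hs.
rewrite g0 mulr0 big_seq big1 // => b; rewrite mem_undup => bs.
rewrite /dgen; case: eqP => [xb|_]; last by rewrite mulr0.
by move: xs; rewrite xb bs.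
Qed.

(** Conversely, the derivation [q(w) |-> q'(w)] with values in [B / I] kills
    every relation, so an annihilator [a] satisfies [a dw = 0] there. *)
Lemma annihilates_deriv_le (I : set B) (a : B) :
  I 0 -> (forall x y, I x -> I y -> I (x + y)) -> (forall c x, I x -> I (c * x)) ->
  I delta ->
  (forall b, exists q, b = (map_poly h q).[w]) ->
  (forall r : {poly A}, (size r < size f)%N -> (map_poly h r).[w] = 0 -> r = 0) ->
  annihilates_kaehler imset a -> I a.
Proof.
move=> I0 ID IM Idelta gen funiq ann.
pose Q b : {poly A} := projT1 (cid (gen b)).
have QE b : (map_poly h (Q b)).[w] = b by rewrite /Q; case: cid.
pose D b := (map_poly h (Q b)^`()).[w].
have IN x : I x -> I (- x) by move=> /(IM (-1)); rewrite mulN1r.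
have DE q : I (D (map_poly h q).[w] - (map_poly h q^`()).[w]).
  have key r : (map_poly h r).[w] = 0 -> I (map_poly h r^`()).[w].
    move=> r0; rewrite (Pdiv.RingMonic.rdivp_eq f_monic r).
    set u := Pdiv.CommonRing.rdivp _ _.
    suff -> : Pdiv.CommonRing.rmodp r f = 0.
      rewrite addr0 derivM !rmorphD !rmorphM /= !hornerE fw mulr0 add0r.
      exact: IM.
    apply: funiq; first by rewrite Pdiv.CommonRing.ltn_rmodp monic_neq0.
    have := r0; rewrite {1}(Pdiv.RingMonic.rdivp_eq f_monic r).
    by rewrite !rmorphD !rmorphM /= !hornerE fw mulr0 add0r.
  set b := (map_poly h q).[w].
  have := key (Q b - q); rewrite derivB !rmorphB /= !hornerE QE subrr.
  by apply.
pose P (g : B -> B) := exists s0 : seq B, forall s, uniq s -> {subset s0 <= s} ->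
  I (\sum_(b <- s) g b * D b).
have sdgen s b c : uniq s -> b \in s -> \sum_(x <- s) c * dgen b x * D x = c * D b.
  move=> us bs; rewrite (bigD1_seq b) //= /dgen eqxx mulr1.
  by rewrite big1 ?addr0 // => x xb; rewrite (negPf xb) mulr0 mul0r.
have sdgen1 s b : uniq s -> b \in s -> \sum_(x <- s) dgen b x * D x = D b.
  move=> us bs; rewrite -[RHS]mul1r -(sdgen s b 1) //.
  by apply: eq_bigr => x _; rewrite mul1r.
have Pk g : krel g -> P g.
  elim=> {g} [|c f1 g1 _ [s1 h1] _ [s2 h2]|b c|b c|b [a' ->]].
  - exists [::] => s _ _; rewrite big1 // => b _; rewrite mul0r //.
  - exists (s1 ++ s2) => s us ss.
    under eq_bigr do rewrite mulrDl -mulrA.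
    rewrite big_split /= -mulr_sumr; apply: (ID).
      by apply: (IM); apply: h1 => // x xs; apply: ss; rewrite mem_cat xs.
    by apply: h2 => // x xs; apply: ss; rewrite mem_cat xs orbT.
  - exists [:: b + c; b; c] => s us ss.
    under eq_bigr do rewrite !mulrBl.
    rewrite !big_split /= !sumrN !sdgen1 ?ss ?inE ?eqxx ?orbT //.
    have E : b + c = (map_poly h (Q b + Q c)).[w].
      by rewrite rmorphD hornerD !QE.
    have := DE (Q b + Q c); rewrite -E derivD rmorphD hornerD.
    by rewrite opprD addrA.
  - exists [:: b * c; b; c] => s us ss.
    under eq_bigr do rewrite !mulrBl.
    rewrite !big_split /= !sumrN sdgen1 ?sdgen ?ss ?inE ?eqxx ?orbT //.
    have E : b * c = (map_poly h (Q b * Q c)).[w].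
      by rewrite rmorphM hornerM !QE.
    have := DE (Q b * Q c); rewrite -E derivM rmorphD !rmorphM /= hornerD !hornerM !QE.
    rewrite -/(D b) -/(D c); congr I; ring.
  - exists [:: h a'] => s us ss; rewrite sdgen1 ?ss ?inE //.
    have := DE a'%:P; rewrite map_polyC hornerC derivC rmorph0 horner0 subr0.
    by [].
have fw1 : finite_set [set b | dgen w b != 0].
  apply: sub_finite_set (finite_set1 w) => b /=.
  rewrite /dgen; have [->|/negPf bw] := eqVneq b w; first by [].
  by rewrite mulr0n eqxx.
have [s0 hs] := Pk _ (ann (dgen w) fw1).
have := hs (undup (w :: s0)) (undup_uniq _).
rewrite sdgen ?undup_uniq ?mem_undup ?inE ?eqxx // => H.
have {}H : I (a * D w).
  by apply: H => x xs; rewrite mem_undup inE xs orbT.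
have := DE 'X; rewrite map_polyX hornerX derivX rmorph1 hornerC => /(IM a).
rewrite mulrBr mulr1 => /IN; rewrite opprB => /(ID _ _ H).
by rewrite addrC subrK.
Qed.

End Kaehler.

Section Different.
Variables (R : realType) (H1 H2 : fieldType).
Variables (w1 : valuation R H1) (w2 : valuation R H2) (h : {rmorphism H1 -> H2}).
Hypothesis hv : forall a, w2 (h a) = w1 a.

Lemma valring_ge (x : valring w2) : (0 <= w2 (val x))%E.
Proof. by case: x. Qed.

Lemma valring_map : exists g : {rmorphism valring w1 -> valring w2},
  forall a, val (g a) = h (val a).
Proof.
have P (a : valring w1) : h (val a) \in valring_pred w2.
  by rewrite inE hv; case: a.
pose g a : valring w2 := Valring (P a).
have gz : zmod_morphism g by move=> a b; apply: val_inj; rewrite /= rmorphB.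
have gm : monoid_morphism g.
  by split=> [|a b]; apply: val_inj; rewrite /= ?rmorph1 ?rmorphM.
have [g' hg'] := rmorph_lift gz gm; exists g' => a; by rewrite hg'.
Qed.

(** If the upper valuation ring is [A[w]] with [f] the minimal polynomial of
    [w], its differentials are [A[w] / f'(w)]. *)
Lemma log_different_monogenic (g : {rmorphism valring w1 -> valring w2})
    (w : valring w2) (f : {poly valring w1}) :
  (forall a, val (g a) = h (val a)) ->
  f \is monic -> (map_poly g f).[w] = 0 ->
  (forall b, exists q, b = (map_poly g q).[w]) ->
  (forall r : {poly valring w1}, (size r < size f)%N -> (map_poly g r).[w] = 0 -> r = 0) ->
  log_different w1 w2 h = ((3 / 2)%:E * w2 (val (map_poly g f^`()).[w]))%E.
Proof.
move=> gE f_monic fw gen uniq; set delta := (map_poly g f^`()).[w].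
have imE : [set b : valring w2 | exists a : valring w1, val b = h (val a)] = imset g.
  apply/seteqP; split=> b /= [a ba]; exists a; last by rewrite ba gE.
  by apply: val_inj; rewrite gE.
suff : different_CTT w1 w2 h = expeR (- w2 (val delta))%E.
  rewrite /log_different => ->; rewrite expeRK muleN oppeK //.
rewrite /different_CTT imE; apply/le_anti/andP; split.
  apply: ge_ereal_sup => _ [a /= ann <-]; rewrite lee_expeR leeN2.
  apply: (@annihilates_deriv_le _ _ g w f f_monic fw
     [set x | (w2 (val delta) <= w2 (val x))%E]) => //=.
  - by rewrite val0 leey.
  - by move=> x y hx hy; apply: le_trans (Defs.valD _ _ _); rewrite le_min hx.
  - by move=> c x hx; rewrite Defs.valM -[leLHS]add0e; apply: leeD => //; apply: valring_ge.
apply: ereal_sup_ubound; exists delta => //=.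
by rewrite -[delta]mulr1; apply: annihilates_deriv.
Qed.

End Different.

(** * Successive approximation *)

Section Approx.
Variables (R : realType) (M : fieldType).
Implicit Types (a b x : M) (w : valuation R M) (k : R).

Lemma archi_ex k : 0 < k -> forall K : R, exists n : nat, K < n.+1%:R * k.
Proof.
move=> k0 K; exists (Num.bound `|K / k|); rewrite -ltr_pdivrMr //.
apply: le_lt_trans (ler_norm _) _; apply: lt_trans (archi_boundP (normr_ge0 _)) _.
by rewrite ltr_nat.
Qed.

(** Iteration for the root of [b T^3 + a T^2 + T + 1] near -1, for small [a], [b]. *)
Fixpoint xi_seq a b (n : nat) : M :=
  if n is n'.+1 then - 1 - a * xi_seq a b n' ^+ 2 - b * xi_seq a b n' ^+ 3 else - 1.

Lemma xi_seqP w a b k : 0 < k -> vge w k a -> vge w k b ->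
  [/\ forall n, vge w 0 (xi_seq a b n), forall n, vge w k (xi_seq a b n + 1),
      forall n, vge w (n.+1%:R * k) (xi_seq a b n.+1 - xi_seq a b n) &
      forall n m, (n <= m)%N -> vge w (n.+1%:R * k) (xi_seq a b m - xi_seq a b n)].
Proof.
move=> k0 ha hb.
have h0 n : vge w 0 (xi_seq a b n).
  elim: n => [|n IH] /=; first by rewrite vgeN vge1.
  have h (c : M) i : vge w k c -> vge w 0 (c * xi_seq a b n ^+ i).
    by move=> hc; apply: vgeM0r; [apply: vgeW hc; lra | apply: vgeX0].
  by rewrite !vgeB ?h ?vgeN ?vge1.
have h1 n : vge w k (xi_seq a b n + 1).
  case: n => [|n] /=; first by rewrite addNr vge0.
  have -> (x y : M) : - 1 - x - y + 1 = - (x + y) by ring.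
  by rewrite vgeN; apply: vgeD; apply: vgeM0r => //; apply: vgeX0.
have h2 n : vge w (n.+1%:R * k) (xi_seq a b n.+1 - xi_seq a b n).
  elim: n => [|n IH].
    by rewrite mul1r /= -[_ - -1]/(xi_seq a b 1 - - 1) opprK; apply: h1.
  set x := xi_seq a b n.+1 in IH *; set y := xi_seq a b n in IH *.
  have -> : xi_seq a b n.+2 - x =
      (a * - (x + y) + b * - (x ^+ 2 + x * y + y ^+ 2)) * (x - y).
    transitivity ((- 1 - a * x ^+ 2 - b * x ^+ 3) - (- 1 - a * y ^+ 2 - b * y ^+ 3)) => //.
    by ring.
  have x0 : vge w 0 x := h0 n.+1. have y0 : vge w 0 y := h0 n.
  rewrite -natr1 mulrDl mul1r addrC; apply: vgeM => //.
  apply: vgeD; apply: vgeM0r => //; rewrite vgeN; first exact: vgeD.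
  by rewrite !vgeD // ?vgeX0 // vgeM0.
split=> // n m /subnKC <-; elim: (m - n)%N => [|d IH].
  by rewrite addn0 subrr vge0.
apply: vge_trans IH; rewrite addnS; apply: vgeW (h2 (n + d)%N).
by apply: ler_wpM2r; [apply: ltW | rewrite ler_nat ltnS leq_addr].
Qed.

Lemma xi_seq_root a b n : let x := xi_seq a b n in
  b * x ^+ 3 + a * x ^+ 2 + x + 1 = xi_seq a b n - xi_seq a b n.+1.
Proof. by rewrite /=; ring. Qed.

Lemma complete_limit w (u : nat -> M) k : complete_valuation w -> 0 < k ->
  (forall n m, (n <= m)%N -> vge w (n.+1%:R * k) (u m - u n)) ->
  exists l, forall n, vge w (n.+1%:R * k) (l - u n).
Proof.
move=> cw k0 hu.
have arch := archi_ex k0.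
have [|l hl] := cw u.
  move=> K; have [N hN] := arch K; exists N => m n Nm Nn.
  apply: vge_gt hN _; apply: (@vge_trans _ _ _ _ _ (u N)); first exact: hu.
  by rewrite vgeBC; apply: hu.
exists l => n; have [N hN] := hl (n.+1%:R * k).
apply: (@vge_trans _ _ _ _ _ (u (maxn N n))).
  by rewrite vgeBC; apply: ltW; apply: hN; apply: leq_maxl.
by apply: hu; apply: leq_maxr.
Qed.

Lemma xi_root w a b k : complete_valuation w -> 0 < k -> vge w k a -> vge w k b ->
  exists x, w x = 0%E /\ b * x ^+ 3 + a * x ^+ 2 + x + 1 = 0.
Proof.
move=> cw k0 ha hb; have [h0 h1 h2 h3] := xi_seqP k0 ha hb.
have [l hl] := complete_limit cw k0 h3; exists l.
have l1 : vge w k (l + 1).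
  by apply: vge_near (h1 0%N); have -> : l + 1 - (xi_seq a b 0 + 1) = l - xi_seq a b 0;
    [ring | have := hl 0%N; rewrite mul1r].
have wl : w l = 0%:E.
  by apply: (@valB_fin _ _ w (-1) _ _ k _ k0); rewrite ?valN ?Defs.val1 // opprK.
split=> //; apply: (@vge_all0 _ _ w) => K.
have [n hn] : exists n : nat, K <= n.+1%:R * k.
  by have [n /ltW hn] := archi_ex k0 K; exists n.
apply: vgeW hn _; set x := xi_seq a b n.
have xr := xi_seq_root a b n; rewrite /= -/x in xr.
apply: (@vge_near _ _ _ _ _ (b * x ^+ 3 + a * x ^+ 2 + x + 1)); last first.
  by rewrite xr vgeBC.
have -> : b * l ^+ 3 + a * l ^+ 2 + l + 1 - (b * x ^+ 3 + a * x ^+ 2 + x + 1) =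
   (b * (l ^+ 2 + l * x + x ^+ 2) + a * (l + x) + 1) * (l - x) by ring.
apply: vgeM0 (hl n).
have b0 : vge w 0 b by apply: vgeW hb; apply: ltW.
have a0 : vge w 0 a by apply: vgeW ha; apply: ltW.
have x0 : vge w 0 x := h0 n. have l0 := vge_self wl.
by rewrite !vgeD ?vge1 // vgeM0 // !vgeD ?vgeX0 // vgeM0.
Qed.

End Approx.

(** * Cubic extensions of complete fields *)

Section Hensel.
Variables (R : realType) (H : fieldType) (w : valuation R H).
Hypothesis cw : complete_valuation w.
Hypothesis w3 : (0 < w 3%R)%E.

Let pos_min (k k' : R) : 0 < k -> 0 < k' -> 0 < Num.min k k'.
Proof. by move=> h1 h2; rewrite lt_min h1. Qed.

(** Centre the cubic at the approximate root [h].  If the linear coefficient is a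
    unit, the root is simple and lifts.  Otherwise the quadratic coefficient is a
    unit and the third root is simple.  Both cases are rescaled to [xi_root]. *)
Lemma cubic_root a b c h : vge w 0 a -> vge w 0 b -> vge w 0 h ->
  ~ ((0 < w a)%E /\ (0 < w b)%E) ->
  (0 < w (h ^+ 3 + a * h ^+ 2 + b * h + c)%R)%E ->
  exists x, x ^+ 3 + a * x ^+ 2 + b * x + c = 0.
Proof.
move=> a0 b0 h0 ab; have [k3 k30 hk3] := vge_gt0 w3.
set a' := a + 3 * h; set b' := 3 * h ^+ 2 + 2 * a * h + b.
set c' := h ^+ 3 + _ + _ + c => /vge_gt0[kc kc0 hc].
suff [x hx] : exists x, x ^+ 3 + a' * x ^+ 2 + b' * x + c' = 0.
  by exists (x + h); rewrite -hx /a' /b' /c'; ring.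

have a'0 : vge w 0 a' by rewrite vgeD // vgeM0 // vge_nat.
have b'0 : vge w 0 b'.
  by rewrite !vgeD // vgeM0 ?vge_nat ?vgeX0 // vgeM0 // vge_nat.
have dich x : vge w 0 x -> w x = 0%:E \/ exists2 k, 0 < k & vge w k x.
  have [->|/(val_fin w)[r hr]] := eqVneq x 0; first by right; exists 1; rewrite ?vge0.
  rewrite (vge_fin _ hr) le_eqVlt => /orP[/eqP r0|r0]; first by left; rewrite hr -r0.
  by right; exists r => //; apply: vge_self.
have [hb'|[kb kb0 hb]] := dich _ b'0.
  have e1 : vge w kc (a' * c' / b' ^+ 2).
    rewrite (vgeMr _ _ (valX_fin 2 hb')) mulr0 addr0; exact: vgeM0.
  have e2 : vge w kc (c' ^+ 2 / b' ^+ 3).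
    rewrite (vgeMr _ _ (valX_fin 3 hb')) mulr0 addr0 expr2; apply: vgeM0 => //.
    by apply: vgeW hc; apply: ltW.
  have [x [_ hx]] := xi_root cw kc0 e1 e2; exists (x * c' / b').
  have b'n := val_fin_neq0 hb'.
  have -> : (x * c' / b') ^+ 3 + a' * (x * c' / b') ^+ 2 + b' * (x * c' / b') + c'
    = c' * (c' ^+ 2 / b' ^+ 3 * x ^+ 3 + a' * c' / b' ^+ 2 * x ^+ 2 + x + 1) by field.
  by rewrite hx mulr0.
have ha' : w a' = 0%:E.
  case: (dich _ a'0) => // -[ka ka0 ha]; exfalso; apply: ab.
  have ha2 : vge w (Num.min ka k3) a.
    have -> : a = a' - 3 * h by rewrite /a'; ring.
    apply: vgeB; first by apply: vgeW ha; rewrite ge_min lexx.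
    by apply: vgeM0r => //; apply: vgeW hk3; rewrite ge_min lexx orbT.
  have m0 := pos_min ka0 k30.
  split; first exact: vge_gt m0 ha2.
  apply: (@vge_gt _ _ w 0 (Num.min kb (Num.min ka k3))); first exact: pos_min.
  have -> : b = b' - 3 * h ^+ 2 - 2 * a * h by rewrite /b'; ring.
  apply: vgeB; first apply: vgeB.
  - by apply: vgeW hb; rewrite ge_min lexx.
  - by apply: vgeM0r; [apply: vgeW hk3; rewrite !ge_min lexx !orbT | apply: vgeX0].
  - apply: vgeM0r => //; apply: vgeM0; first exact: vge_nat.
    by apply: vgeW ha2; rewrite ge_min lexx orbT.
have e1 : vge w kb (b' / a' ^+ 2).
  by rewrite (vgeMr _ _ (valX_fin 2 ha')) mulr0 addr0.
have e2 : vge w kc (c' / a' ^+ 3).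
  by rewrite (vgeMr _ _ (valX_fin 3 ha')) mulr0 addr0.
have m0 := pos_min kb0 kc0.
have [||x [wx hx]] := @xi_root _ _ w (b' / a' ^+ 2) (c' / a' ^+ 3) _ cw m0.
- by apply: vgeW e1; rewrite ge_min lexx.
- by apply: vgeW e2; rewrite ge_min lexx orbT.
have xn := val_fin_neq0 wx; have a'n := val_fin_neq0 ha'.
exists (a' / x).
have -> : (a' / x) ^+ 3 + a' * (a' / x) ^+ 2 + b' * (a' / x) + c' =
  (a' / x) ^+ 3 * (c' / a' ^+ 3 * x ^+ 3 + b' / a' ^+ 2 * x ^+ 2 + x + 1).
  by field; rewrite xn a'n.
by rewrite hx mulr0.
Qed.

Lemma sqrt_root u k : w u = 0%E -> vge w 0 k -> (0 < w (u - k ^+ 2)%R)%E ->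
  exists x, x ^+ 2 = u.
Proof.
move=> wu k0 /vge_gt0[e e0 he].
have wk2 : w (k ^+ 2) = 0%:E.
  by apply: (valB_fin wu e0); rewrite vgeBC.
have k2n := val_fin_neq0 wk2.
have kn : k != 0 by apply: contraNneq k2n => ->; rewrite expr0n.
have w2 := val2 w3; have two0 := val_fin_neq0 w2.
have four0 : (4 : H) != 0 by have -> : (4 : H) = 2 ^+ 2 by [ring]; apply: expf_neq0.
pose d := (k ^+ 2 - u) / k ^+ 2.
have hd : vge w e (d / 2 ^+ 2).
  rewrite (vgeMr _ _ (valX_fin 2 w2)) mulr0 addr0 /d (vgeMr _ _ wk2) addr0.
  by rewrite vgeBC.
have [x [_ hx]] := xi_root cw e0 hd (vge0 w e).
exists (k * (1 + d / 2 * x)).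
have -> : (k * (1 + d / 2 * x)) ^+ 2 =
   k ^+ 2 * (1 + d * (d / 2 ^+ 2 * x ^+ 2 + x)).
  by clearbody d; field; rewrite two0 four0.
have -> : d / 2 ^+ 2 * x ^+ 2 + x = -1.
  by apply/eqP; rewrite -addr_eq0 -hx; apply/eqP; ring.
by rewrite /d; field; rewrite ?kn.
Qed.

End Hensel.

(** * The different of a cubic extension *)

Section Tower.
Variables (R : realType) (E H1 H2 : fieldType).
Variables (w1 : valuation R H1) (w2 : valuation R H2).
Variables (g : {rmorphism H1 -> H2}) (i2 : {rmorphism E -> H2}).
Hypothesis gv : forall a, w2 (g a) = w1 a.
Hypothesis cw : complete_valuation w1.
Hypothesis dens : forall (h : H2) (M : R), exists x : E, (M%:E < w2 (h - i2 x)%R)%E.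

(** The powers of [w] below the [d]-th are orthogonal over [H1]. *)
Definition orth (w : H2) (d : nat) := forall q : {poly H1}, (size q <= d)%N ->
  forall M, vge w2 M (map_poly g q).[w] -> forall i, vge w1 M q`_i.

Definition spans (w : H2) := forall x : E, exists q : {poly H1}, i2 x = (map_poly g q).[w].

Lemma gvge M a : vge w2 M (g a) = vge w1 M a.
Proof. by rewrite /vge gv. Qed.

Lemma vge_horner M (p : {poly H1}) w :
  (forall i, vge w1 M p`_i) -> vge w2 0 w -> vge w2 M (map_poly g p).[w].
Proof.
move=> hp hw; rewrite horner_coef; apply: vge_sum => i _.
by apply: vgeM0r; [rewrite coef_map gvge | apply: vgeX0].
Qed.

(** Coefficients of approximations from [E] converge, by orthogonality. *)
Lemma span_closed w d : vge w2 0 w -> orth w d ->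
  (forall x, exists2 q : {poly H1}, (size q <= d)%N & i2 x = (map_poly g q).[w]) ->
  forall b, exists2 q : {poly H1}, (size q <= d)%N & b = (map_poly g q).[w].
Proof.
move=> w0 ow sp b.
(* Approximations from [E], whose coefficients form Cauchy sequences. *)
have /choice[q hq] : forall n : nat, exists q : {poly H1}, (size q <= d)%N /\
    vge w2 (n.+1%:R * 1) (b - (map_poly g q).[w]).
  move=> n; have [x /ltW hx] := dens b (n.+1%:R * 1).
  by have [q sq qx] := sp x; exists q; rewrite -qx.
have hc i n m : (n <= m)%N -> vge w1 (n.+1%:R * 1) ((q m)`_i - (q n)`_i).
  move=> nm; rewrite -coefB; apply: ow.
    rewrite (leq_trans (size_polyD _ _)) // size_polyN geq_max.
    by rewrite (hq m).1 (hq n).1.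
  rewrite rmorphB hornerD hornerN; apply: (@vge_trans _ _ _ _ _ b); last exact: (hq n).2.
  rewrite vgeBC; apply: vgeW (hq m).2.
  by rewrite !mulr1 ler_nat.
have /choice[l hl] : forall i, exists l, forall n, vge w1 (n.+1%:R * 1) (l - (q n)`_i).
  by move=> i; apply: (complete_limit cw ltr01) => n m; apply: hc.
exists (\poly_(i < d) l i); first exact: size_poly.
apply/eqP; rewrite -subr_eq0; apply/eqP; apply: (@vge_all0 _ _ w2) => K.
have [n /ltW hn] := archi_ex (@ltr01 R) K; apply: vgeW hn _.
apply: vge_trans (hq n).2 _; rewrite -hornerN -hornerD -rmorphB.
apply: vge_horner => // i; rewrite coefB coef_poly; case: ifP => [_|/negbT].
  by rewrite vgeBC.
rewrite -leqNgt => di; rewrite nth_default ?subr0 ?vge0 //.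
exact: leq_trans (hq n).1 di.
Qed.

Lemma lift_valring (F : fieldType) (w : valuation R F) (p : {poly F}) :
  (forall i, vge w 0 p`_i) -> exists p' : {poly valring w}, map_poly val p' = p /\ size p' = size p.
Proof.
move=> hp; pose u i : valring w := Valring (hp i : p`_i \in valring_pred w).
have E1 : map_poly val (\poly_(i < size p) u i) = p.
  apply/polyP => i; rewrite coef_map coef_poly; case: ifP => //= /negbT.
  by rewrite -leqNgt => h; rewrite nth_default.
exists (\poly_(i < size p) u i); split=> //.
have h : size (map_poly (val : valring w -> F) (\poly_(i < size p) u i)) =
    size (\poly_(i < size p) u i).
  by apply: size_map_inj_poly; [exact: val_inj | exact: rmorph0].
by rewrite -h E1.
Qed.

(** By orthogonality an integral element has integral coordinates, so that the
    valuation ring is generated by [w]. *)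
Lemma different_monogenic (w : H2) (f : {poly H1}) :
  f \is monic -> (forall i, vge w1 0 f`_i) -> (map_poly g f).[w] = 0 ->
  vge w2 0 w -> orth w (size f).-1 -> spans w ->
  log_different w1 w2 g = ((3 / 2)%:E * w2 (map_poly g f^`()).[w])%E.
Proof.
move=> fm fi fw w0 ow sp.
have sfm (p : {poly H1}) : exists2 r : {poly H1}, (size r <= (size f).-1)%N &
    (map_poly g r).[w] = (map_poly g p).[w].
  exists (Pdiv.CommonRing.rmodp p f).
    rewrite -ltnS prednK ?Pdiv.CommonRing.ltn_rmodp ?monic_neq0 //.
    by rewrite size_poly_gt0 monic_neq0.
  rewrite [in RHS](Pdiv.RingMonic.rdivp_eq fm p) rmorphD rmorphM hornerD hornerM.
  by rewrite fw mulr0 add0r.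
have sp' b : exists2 q : {poly H1}, (size q <= (size f).-1)%N & b = (map_poly g q).[w].
  apply: span_closed => // x; have [q ->] := sp x.
  by have [r ? <-] := sfm q; exists r.
have [g' gE] := valring_map gv.
have [f' [ff' sf']] := lift_valring fi.
pose w' : valring w2 := Valring (w0 : w \in valring_pred w2).
have evE (q : {poly valring w1}) :
    val (map_poly g' q).[w'] = (map_poly g (map_poly val q)).[w].
  rewrite -horner_map -!map_poly_comp /=; congr (_.[_]).
  by apply: eq_map_poly => a; apply: gE.
have f'm : f' \is monic.
  rewrite monicE; apply/eqP/val_inj => /=.
  by move/monicP: fm; rewrite /lead_coef sf' -ff' coef_map /=.
rewrite (@log_different_monogenic _ _ _ w1 w2 g g' w' f') //.
- by rewrite evE -deriv_map ff'.
- by apply: val_inj; rewrite evE ff' fw.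
- move=> b; have [q sq qb] := sp' (val b).
  have b0 : vge w2 0 (val b) := valring_ge b.
  rewrite qb in b0; have [q' [qq' _]] := lift_valring (ow q sq 0 b0).
  by exists q'; apply: val_inj; rewrite evE qq'.
- move=> r sr rw; suff : map_poly val r = 0.
    move=> hr; apply/polyP => i; rewrite coef0; apply: val_inj.
    by have := congr1 (fun p : {poly H1} => p`_i) hr; rewrite coef_map coef0.
  have h : (map_poly g (map_poly val r)).[w] = 0 by rewrite -evE rw.
  apply/polyP => i; rewrite coef0; apply: (@vge_all0 _ _ w1) => M.
  apply: ow; last by rewrite h vge0.
  apply: leq_trans (size_poly _ _) _.
  by rewrite -ltnS prednK -?sf' // (leq_ltn_trans _ sr).
Qed.

(** The upper valuation ring is generated by 0 over the lower one. *)
Lemma different_trivial w h : spans w -> w = g h -> log_different w1 w2 g = 0%E.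
Proof.
move=> sp wh.
have sp1 : spans 0.
  by move=> x; have [q ->] := sp x; exists (q.[h])%:P; rewrite map_polyC hornerC wh horner_map.
rewrite (@different_monogenic 0 'X) ?monicX //.
- by rewrite derivX rmorph1 hornerC Defs.val1 mule0.
- by move=> i; rewrite coefX; case: eqP => _; rewrite ?vge0 ?vge1.
- by rewrite map_polyX hornerX.
- exact: vge0.
- rewrite size_polyX => q sq M; rewrite (size1_polyC sq) map_polyC hornerC gvge.
  by move=> hM i; rewrite coefC; case: eqP; rewrite ?vge0.
Qed.

Hypothesis w3 : (0 < w1 3%R)%E.
Hypothesis half : forall a, a != 0 -> exists c r, w1 c = r%:E /\ w1 a = (r + r)%:E.

Let w3' : (0 < w2 3%R)%E. Proof. by have := gv 3; rewrite rmorph_nat => ->. Qed.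
Let v2 : w1 2 = 0%:E. Proof. exact: val2. Qed.
Let two0 : (2 : H1) != 0. Proof. exact: val_fin_neq0 v2. Qed.

Lemma dich x : vge w1 0 x -> w1 x = 0%:E \/ exists2 k, 0 < k & vge w1 k x.
Proof.
have [->|/(val_fin w1)[r hr]] := eqVneq x 0; first by right; exists 1; rewrite ?vge0.
rewrite (vge_fin _ hr) le_eqVlt => /orP[/eqP r0|r0]; first by left; rewrite hr -r0.
by right; exists r => //; apply: vge_self.
Qed.

(** Degree at most 2 is tame, as the residue characteristic is 3. *)
Lemma different_quadratic w p q : spans w ->
  w ^+ 2 + g p * w + g q = 0 -> log_different w1 w2 g = 0%E.
Proof.
move=> sp wpq; pose s := w + g (p / 2); pose D := (p / 2) ^+ 2 - q.
have g2 : (2 : H2) != 0 by rewrite -(rmorph_nat g) fmorph_eq0.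
have sD : s ^+ 2 = g D.
  have -> : s ^+ 2 = (w ^+ 2 + g p * w + g q) + g D.
    rewrite /s /D !(rmorphB, rmorphXn, fmorph_div, rmorph_nat) /=.
    by field.
  by rewrite wpq add0r.
have ws : w = s - g (p / 2) by rewrite addrK.
have [D0|Dn] := eqVneq D 0.
  apply: (different_trivial sp (h := - (p / 2))); rewrite ws rmorphN.
  by move/eqP: sD; rewrite D0 rmorph0 sqrf_eq0 => /eqP ->; rewrite add0r.
have [c [r [hc hD]]] := half Dn.
have cn := val_fin_neq0 hc; pose u := D / c ^+ 2; pose w' := s / g c.
have gcn : g c != 0 by rewrite fmorph_eq0.
have wu : w1 u = 0%:E.
  by rewrite (val_div_fin hD (valX_fin 2 hc)); congr (_%:E); ring.
have w'u : w' ^+ 2 = g u by rewrite expr_div_n sD fmorph_div rmorphXn.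
have ww' : w = g c * w' - g (p / 2) by rewrite /w' mulrC divfK // ws.
have sp' : spans w'.
  move=> x; have [l ->] := sp x; exists (l \Po (c%:P * 'X - (p / 2)%:P)).
  rewrite map_comp_poly horner_comp; congr (_.[_]).
  rewrite rmorphB rmorphM /= !map_polyC map_polyX hornerD hornerN hornerM.
  by rewrite !hornerC hornerX.
have [[k [k0 hk]]|nok] := pselect (exists k, vge w1 0 k /\ (0 < w1 (u - k ^+ 2)%R)%E).
  have [x xu] := sqrt_root cw w3 wu k0 hk.
  have : (w' - g x) * (w' + g x) == 0 by rewrite -subr_sqr w'u -xu rmorphXn subrr.
  rewrite mulf_eq0 subr_eq0 addr_eq0 => /orP[/eqP h|/eqP h].
    exact: different_trivial sp' h.
  by apply: (different_trivial sp' (h := - x)); rewrite rmorphN.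
have w'0 : w2 w' = 0%:E.
  have h : w2 (w' ^+ 2) = 0%:E by rewrite w'u gv.
  by rewrite (val_rootn_eq0 (n := 2) _ h) // mul0r.
have sf : size ('X^2 - u%:P) = 3 by rewrite size_XnsubC.
have dn : 'X^2 - u%:P \is monic by apply: monicXnsubC.
rewrite (@different_monogenic w' ('X^2 - u%:P)) //.
- rewrite derivB derivXn derivC subr0 expr1 rmorphMn /= map_polyX hornerMn hornerX.
  have -> : w' *+ 2 = 2 * w' by ring.
  rewrite Defs.valM w'0 adde0.
  by have := gv 2; rewrite rmorph_nat v2 => ->; rewrite mule0.
- move=> i; rewrite coefB coefXn coefC.
  apply: vgeB; first by case: eqP => _; rewrite ?vge0 ?vge1.
  by case: eqP => _; rewrite ?vge0 // vge_self.
- rewrite rmorphB rmorphXn /= map_polyX map_polyC.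
  by rewrite hornerD hornerN horner_exp hornerX hornerC w'u subrr.
- exact: vge_self.
rewrite sf /= => l sl M.
have -> : l = (l`_0)%:P + (l`_1)%:P * 'X.
  apply/polyP => i; rewrite coefD coefC coefCM coefX; case: i => [|[|i]] /=.
  - by rewrite mulr0 addr0.
  - by rewrite mulr1 add0r.
  - by rewrite mulr0 addr0 nth_default // (leq_trans sl).
set l0 := l`_0; set l1 := l`_1.
rewrite rmorphD rmorphM /= !map_polyC map_polyX.
rewrite !(hornerD, hornerM, hornerX, hornerC) => hM0.
have {hM0}hM : vge w2 M (g l0 + g l1 * w') := hM0.
suff [h0 h1] : vge w1 M l0 /\ vge w1 M l1.
  move=> i; rewrite coefD coefC coefCM coefX; case: i => [|[|i]] /=;
  by rewrite ?mulr0 ?mulr1 ?addr0 ?add0r ?vge0.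
have [l10|l1n] := eqVneq l1 0.
  have gl10 : g l1 = 0 by apply/eqP; rewrite fmorph_eq0; apply/eqP.
  move: hM; rewrite gl10 mul0r addr0 gvge => hM; split=> //.
  by have := vge0 w1 M; rewrite -l10.
have [r1 hr1] := val_fin w1 l1n.
have hr1' : w2 (g l1 * w') = (r1 + 0)%:E by apply: valM_fin; rewrite ?gv.
rewrite addr0 in hr1'.
have [Mr|rM] := leP M r1.
  have h1 : vge w1 M l1 by rewrite (vge_fin _ hr1).
  split=> //; rewrite -gvge.
  have -> : g l0 = (g l0 + g l1 * w') - g l1 * w' by rewrite addrK.
  by apply: vgeB => //; rewrite (vge_fin _ hr1').
exfalso; apply: nok; exists (- (l0 / l1)).
have hl : w1 l0 = r1%:E.
  rewrite -gv; apply: (@valB_fin _ _ w2 (- (g l1 * w')) _ _ M); rewrite ?valN //.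
  by rewrite opprK.
have hk0 : w1 (- (l0 / l1)) = 0%:E by rewrite valN (val_div_fin hl hr1) subrr.
split; first exact: vge_self.
apply: (@vge_gt _ _ _ 0 (M - r1)); first by lra.
have E1 : g (u - (- (l0 / l1)) ^+ 2) = (w' - g l0 / g l1) * (w' + g l0 / g l1).
  by rewrite -subr_sqr w'u -fmorph_div rmorphB rmorphXn rmorphN sqrrN.
rewrite -gvge E1; have gl1 : g l1 != 0 by rewrite fmorph_eq0.
have -> : (w' - g l0 / g l1) * (w' + g l0 / g l1) =
  (w' - g l0 / g l1) * ((g l0 + g l1 * w') / g l1) by field.
apply: vgeM0; last by rewrite (@vgeMr _ _ w2 _ r1) ?gv // subrK.
apply: vgeB; first exact: vge_self.
by rewrite -fmorph_div gvge -vgeN vge_self.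
Qed.

(** The terms of [f'(w) = 3 w^2 + 2 a w + b] do not cancel, by orthogonality. *)
Lemma different_orth w a b c : spans w -> vge w2 0 w ->
  vge w1 0 a -> vge w1 0 b -> vge w1 0 c ->
  w ^+ 3 + g a * w ^+ 2 + g b * w + g c = 0 -> orth w 3 ->
  log_different w1 w2 g =
    ((3 / 2)%:E * Order.min (w1 3%R) (Order.min (w1 a) (w1 b)))%E.
Proof.
move=> sp w0 a0 b0 c0 weq ow.
pose f : {poly H1} := 'X^3 + (a%:P * 'X^2 + b%:P * 'X + c%:P).
have sr : (size (a%:P * 'X^2 + b%:P * 'X + c%:P)%R < 4)%N.
  rewrite ltnS; apply/leq_sizeP => j hj.
  rewrite !coefD !coefCM coefXn coefX coefC.
  by case: j hj => [|[|[|j]]] //= _; rewrite !mulr0 !addr0.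
have sf : size f = 4 by rewrite /f size_polyDl size_polyXn.
have fm : f \is monic.
  by rewrite monicE /f lead_coefDl ?lead_coefXn // size_polyXn.
have coeff i : f`_i = (i == 3)%:R + (a * (i == 2)%:R + b * (i == 1)%:R + c * (i == 0)%:R).
  rewrite !coefD !coefCM !coefXn coefX coefC; congr (_ + (_ + _)).
  by case: eqP; rewrite ?mulr1 ?mulr0.
rewrite (@different_monogenic w f) ?sf //.
- congr (_ * _)%E.
  pose q : {poly H1} := 3 *: 'X^2 + (2 * a) *: 'X + b%:P.
  have -> : f^`() = q.
    apply/polyP => i; rewrite coef_deriv coeff !coefD !coefZ coefXn coefX coefC.
    by case: i => [|[|[|i]]] /=; rewrite ?(mulr0, addr0, mul0rn, mulr1) //; ring.
  have q0 : q`_0 = b by rewrite !coefD !coefZ coefXn coefX coefC /= !mulr0 !add0r.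
  have q1 : q`_1 = 2 * a by rewrite !coefD !coefZ coefXn coefX coefC /= mulr0 mulr1 add0r addr0.
  have q2 : q`_2 = 3 by rewrite !coefD !coefZ coefXn coefX coefC /= mulr0 mulr1 !addr0.
  have sq : (size q <= 3)%N.
    apply/leq_sizeP => j hj; rewrite !coefD !coefZ coefXn coefX coefC.
    by case: j hj => [|[|[|j]]] //= _; rewrite !mulr0 !addr0.
  apply: ereal_eq_thr => M; rewrite !le_min; split.
    move=> hM; have h := ow q sq M hM.
    have := h 0%N; have := h 1%N; have := h 2%N; rewrite q0 q1 q2 /vge => -> h1 ->.
    rewrite andbT /=; apply: (@vgeMl _ _ w1 M 0 2) => //.
    by rewrite addr0.
  move=> /and3P[h3 ha hb]; apply: vge_horner => // i.
  case: i => [|[|[|i]]]; rewrite ?q0 ?q1 ?q2 //; first by apply: vgeM0 => //; apply: vge_nat.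
  by rewrite nth_default ?vge0 // (leq_trans sq).
- have vb x (t : bool) : vge w1 0 x -> vge w1 0 (x * t%:R).
    by move=> hx; apply: vgeM0r hx (vge_nat _ _).
  by move=> i; rewrite coeff !vgeD ?vb // vge_nat.
rewrite -[RHS]weq /f !(rmorphD, rmorphM, rmorphXn) /= !map_polyC ?map_polyX.
by rewrite !(hornerD, hornerM, horner_exp, hornerX, hornerC) !addrA.
Qed.

(** When the reduction of the cubic is not a cube, either it has a root, which
    lifts, or it is irreducible and separable. *)
Lemma different_noncube w a b c : spans w -> vge w2 0 w ->
  vge w1 0 a -> vge w1 0 b -> vge w1 0 c ->
  w ^+ 3 + g a * w ^+ 2 + g b * w + g c = 0 ->
  ~ ((0 < w1 a)%E /\ (0 < w1 b)%E) -> log_different w1 w2 g = 0%E.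
Proof.
move=> sp w0 a0 b0 c0 weq nc.
pose f h := h ^+ 3 + a * h ^+ 2 + b * h + c.
have [[h [h0 fh]]|nor] := pselect (exists h, vge w1 0 h /\ (0 < w1 (f h))%E).
  have [x hx] := cubic_root cw w3 a0 b0 h0 nc fh.
  have : (w - g x) * (w ^+ 2 + g (a + x) * w + g (b + a * x + x ^+ 2)) == 0.
    have gx : g x ^+ 3 + g a * g x ^+ 2 + g b * g x + g c = 0.
      by rewrite -!rmorphXn -!rmorphM -!rmorphD hx rmorph0.
    rewrite !(rmorphD, rmorphM, rmorphXn) /=; apply/eqP.
    transitivity ((w ^+ 3 + g a * w ^+ 2 + g b * w + g c)
       - (g x ^+ 3 + g a * g x ^+ 2 + g b * g x + g c)); first by ring.
    by rewrite weq gx subr0.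
  rewrite mulf_eq0 subr_eq0 => /orP[/eqP wx|/eqP].
    exact: different_trivial sp wx.
  exact: different_quadratic.
have froot h k : vge w1 0 h -> 0 < k -> vge w1 k (f h) -> False.
  by move=> h0 k0 hk; apply: nor; exists h; split=> //; apply: vge_gt k0 hk.
(* an approximate linear relation yields an approximate root *)
have lin p q k : w1 p = 0%:E -> vge w1 0 q -> 0 < k ->
    ~ vge w2 k (g p * w + g q).
  move=> wp q0 k0 hk; have pn := val_fin_neq0 wp.
  have gp : g p != 0 by rewrite fmorph_eq0.
  have hw : vge w2 k (w - g (- (q / p))).
    have -> : w - g (- (q / p)) = (g p * w + g q) / g p.
      by rewrite rmorphN fmorph_div; field.
    by rewrite (@vgeMr _ _ w2 _ 0) ?gv // addr0.
  have h0 : vge w1 0 (- (q / p)) by rewrite vgeN (vgeMr _ _ wp) addr0.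
  apply: (froot _ _ h0 k0); rewrite -gvge /f.
  move: h0 hw; set h := - (q / p) => h0 hw.
  have -> : g (h ^+ 3 + a * h ^+ 2 + b * h + c) =
     - ((w ^+ 2 + w * g h + g h ^+ 2) + g a * (w + g h) + g b) * (w - g h).
    rewrite -[LHS]subr0 -weq !(rmorphD, rmorphM, rmorphXn) /=; ring.
  have gh0 : vge w2 0 (g h) by rewrite gvge.
  apply: vgeM0 hw; rewrite vgeN !vgeD ?vgeX0 ?gvge //.
    exact: vgeM0.
  by apply: vgeM0; rewrite ?gvge // vgeD.
have lin0 p q k : vge w1 0 p -> vge w1 0 q -> 0 < k -> vge w2 k (g p * w + g q) ->
    exists2 k', 0 < k' & vge w1 k' p /\ vge w1 k' q.
  move=> p0 q0 k0 hk; case: (dich p0) => [wp|[kp kp0 hp]].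
    by case: (lin _ _ _ wp q0 k0 hk).
  have m0 : 0 < Num.min k kp by rewrite lt_min k0.
  exists (Num.min k kp) => //; split; first by apply: vgeW hp; rewrite ge_min lexx orbT.
  have E1 : g q = (g p * w + g q) - g p * w by ring.
  rewrite -gvge E1; apply: vgeB; first by apply: vgeW hk; rewrite ge_min lexx.
  by apply: vgeM0r => //; rewrite gvge; apply: vgeW hp; rewrite ge_min lexx orbT.
have key q0 q1 q2 k : vge w1 0 q0 -> vge w1 0 q1 -> vge w1 0 q2 -> 0 < k ->
    vge w2 k (g q2 * w ^+ 2 + g q1 * w + g q0) ->
    exists2 k', 0 < k' & [/\ vge w1 k' q0, vge w1 k' q1 & vge w1 k' q2].
  move=> h0 h1 h2 k0 hk; case: (dich h2) => [wq|[k2 k20 hq2]].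
    exfalso; have qn := val_fin_neq0 wq; have gq : g q2 != 0 by rewrite fmorph_eq0.
    pose p1 := q1 / q2; pose p0 := q0 / q2.
    have hp1 : vge w1 0 p1 by rewrite (vgeMr _ _ wq) addr0.
    have hp0 : vge w1 0 p0 by rewrite (vgeMr _ _ wq) addr0.
    have hp : vge w2 k (w ^+ 2 + g p1 * w + g p0).
      have -> : w ^+ 2 + g p1 * w + g p0 = (g q2 * w ^+ 2 + g q1 * w + g q0) / g q2.
        by rewrite /p1 /p0 !fmorph_div; field.
      by rewrite (@vgeMr _ _ w2 _ 0) ?gv // addr0.
    pose e := a - p1; pose al := b - p0 - e * p1; pose be := c - e * p0.
    have e0 : vge w1 0 e by rewrite vgeB.
    have al0 : vge w1 0 al by rewrite !vgeB // vgeM0.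
    have be0 : vge w1 0 be by rewrite vgeB // vgeM0.
    have hab : vge w2 k (g al * w + g be).
      have -> : g al * w + g be = - (w + g e) * (w ^+ 2 + g p1 * w + g p0).
        rewrite -[LHS]subr0 -weq /al /be /e !(rmorphB, rmorphM) /=; ring.
      by apply: vgeM0 => //; rewrite vgeN vgeD // gvge.
    have [k' k'0 [hal hbe]] := lin0 _ _ _ al0 be0 k0 hab.
    have me0 : vge w1 0 (- e) by rewrite vgeN.
    apply: (froot _ k' me0 k'0).
    have -> : f (- e) = be - e * al by rewrite /f /al /be /e; ring.
    by apply: vgeB => //; apply: vgeM0.
  have m0 : 0 < Num.min k k2 by rewrite lt_min k0.
  have hl : vge w2 (Num.min k k2) (g q1 * w + g q0).
    have -> : g q1 * w + g q0 =
      (g q2 * w ^+ 2 + g q1 * w + g q0) - g q2 * w ^+ 2 by ring.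
    apply: vgeB; first by apply: vgeW hk; rewrite ge_min lexx.
    by apply: vgeM0r; rewrite ?vgeX0 // gvge; apply: vgeW hq2; rewrite ge_min lexx orbT.
  have [k' k'0 [hh1 hh0]] := lin0 _ _ _ h1 h0 m0 hl.
  have m1 : 0 < Num.min k' k2 by rewrite lt_min k'0.
  exists (Num.min k' k2) => //; split.
  - by apply: vgeW hh0; rewrite ge_min lexx.
  - by apply: vgeW hh1; rewrite ge_min lexx.
  - by apply: vgeW hq2; rewrite ge_min lexx orbT.
have ow : orth w 3.
  move=> q sq M.
  have qE : (map_poly g q).[w] = g q`_2 * w ^+ 2 + g q`_1 * w + g q`_0.
    have -> : q = (q`_0)%:P + (q`_1)%:P * 'X + (q`_2)%:P * 'X^2.
      apply/polyP => i; rewrite !coefD !coefCM coefC coefX coefXn.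
      case: i => [|[|[|i]]] /=; rewrite ?mulr0 ?mulr1 ?addr0 ?add0r //.
      by rewrite nth_default // (leq_trans sq).
    rewrite !coefD !coefCM !coefC !coefX !coefXn /= !(mulr0, mulr1, addr0, add0r).
    rewrite !(rmorphD, rmorphM, rmorphXn) /= !map_polyC ?map_polyX.
    by rewrite !(hornerD, hornerM, horner_exp, hornerX, hornerC); ring.
  rewrite qE => hM.
  have [q0|qn] := eqVneq q 0; first by move=> i; rewrite q0 coef0 vge0.
  have [i0 [N [hi0 hN _]]] := pge_lead w1 0 qn.
  have hN' i : vge w1 N q`_i by have := hN i; rewrite mulr0 subr0.
  rewrite mulr0 subr0 in hi0.
  have [MN|NM] := leP M N; first by move=> i; apply: vgeW (hN' i).
  exfalso; pose d := q`_i0; have dn := val_fin_neq0 hi0.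
  have gd : g d != 0 by rewrite fmorph_eq0.
  have hd i : vge w1 0 (q`_i / d) by rewrite (vgeMr _ _ hi0) add0r.
  have k0 : 0 < M - N by lra.
  have hk : vge w2 (M - N) (g (q`_2 / d) * w ^+ 2 + g (q`_1 / d) * w + g (q`_0 / d)).
    have -> : g (q`_2 / d) * w ^+ 2 + g (q`_1 / d) * w + g (q`_0 / d) =
       (g q`_2 * w ^+ 2 + g q`_1 * w + g q`_0) / g d.
      by rewrite !fmorph_div; field.
    by rewrite (@vgeMr _ _ w2 _ N) ?gv // subrK.
  have [k' k'0 [hq0 hq1 hq2]] := key _ _ _ _ (hd 0%N) (hd 1%N) (hd 2%N) k0 hk.
  have : vge w1 k' (q`_i0 / d).
    have : (i0 < 3)%N.
      by rewrite ltnNge; apply/negP => i03; move: dn; rewrite nth_default ?eqxx // (leq_trans sq).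
    have hq j : (j < 3)%N -> vge w1 k' (q`_j / d) by case: j => [|[|[|]]].
    exact: hq.
  rewrite -/d divff // /vge Defs.val1 lee_fin; lra.
rewrite (different_orth sp w0 a0 b0 c0 weq ow).
have -> : Order.min (w1 3%R) (Order.min (w1 a) (w1 b)) = 0%E; last by rewrite mule0.
have m0 : (0 <= Order.min (w1 a) (w1 b))%E by rewrite le_min; apply/andP; split.
have m1 : (Order.min (w1 a) (w1 b) <= 0)%E.
  rewrite leNgt; apply/negP; rewrite lt_min => /andP h; exact: nc.
apply/le_anti; rewrite le_min m0 (ltW w3) /= andbT.
by rewrite (le_trans _ m1) // ge_min lexx orbT.
Qed.

End Tower.

(** * Inseparable residue extensions *)

Section CubeFree.
Variables (R : realType) (C : fieldType) (v : valuation R C) (c : C) (rho : R).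
Let w := gauss v c rho.
Local Notation pg := (pge v rho).

Lemma pgW M M' p : M <= M' -> pg M' p -> pg M p.
Proof. by move=> h hp i; apply: vgeW (hp i); lra. Qed.

Lemma pgN M p : pg M p -> pg M (- p).
Proof. by move=> hp i; rewrite coefN vgeN. Qed.

Lemma pgB M p q : pg M p -> pg M q -> pg M (p - q).
Proof. by move=> hp hq; apply: pgeD => //; apply: pgN. Qed.

Lemma pgM K M N p q : pg M p -> pg N q -> K <= M + N -> pg K (p * q).
Proof. by move=> hp hq h; apply: pgW h _; apply: pgeM. Qed.

Lemma pgX M p n : pg M p -> pg (n%:R * M) (p ^+ n).
Proof. by move=> /(gauss_vge _ c)/(@vgeX _ _ _ _ _ n) h; apply/(gauss_vge _ c); rewrite polyTXn. Qed.

Lemma pgMl M r p q : gval v rho p = r%:E -> pg (M + r) (p * q) -> pg M q.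
Proof.
move=> hp /(gauss_vge _ c); rewrite polyTM => h; apply/(gauss_vge _ c).
by apply: vgeMl h; rewrite gaussE.
Qed.

Lemma pgXr M p n : (0 < n)%N -> pg (n%:R * M) (p ^+ n) -> pg M p.
Proof.
move=> n0 /(gauss_vge _ c); rewrite polyTXn => h; apply/(gauss_vge _ c).
exact: vgeXr n0 h.
Qed.

Lemma pgC M a : vge v M a -> pg M a%:P.
Proof.
by move=> ha; apply/(gauss_vge _ c); rewrite polyTC /vge gauss_C.
Qed.

(** The norm of [x0 + x1 z + x2 z^2] when [z^3 = - A], up to multiples of 3. *)
Definition cube_norm (F : comNzRingType) (A x0 x1 x2 : F) :=
  x0 ^+ 3 - A * x1 ^+ 3 + A ^+ 2 * x2 ^+ 3.

Variables (Cp : {poly C}) (lam kap : R).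
Hypothesis C_val : gval v rho Cp = (3 * lam)%:E.
Hypothesis C'_val : gval v rho Cp^`() = (3 * lam - rho)%:E.
Hypothesis kap0 : 0 < kap.
Hypothesis v3 : vge v kap 3.

(** Differentiating twice separates the three summands of the norm, because
    cubes have small derivatives. *)
Lemma cube_norm_step M e n0 n1 n2 : 0 < e -> e <= kap ->
  pg M n0 -> pg (M - lam) n1 -> pg (M - 2 * lam) n2 ->
  pg (3 * M + e) (cube_norm Cp n0 n1 n2) ->
  [/\ pg (M + e / 3) n0, pg (M + e / 3 - lam) n1 & pg (M + e / 3 - 2 * lam) n2].
Proof.
move=> e0 ek h0 h1 h2 hX; set X := cube_norm _ _ _ _ in hX.
have two : v 2 = 0%:E by apply: val2; apply: vge_gt kap0 v3.
have hC : pg (3 * lam) Cp by apply/gval_geP; rewrite C_val.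
have p3 : pg kap 3 by rewrite -polyC_natr; apply: pgC.
have d0 := pge_deriv h0; have d1 := pge_deriv h1; have d2 := pge_deriv h2.
have sq M' p : pg M' p -> pg (2 * M') (p ^+ 2) by move=> /(pgX 2).
have cu M' p : pg M' p -> pg (3 * M') (p ^+ 3) by move=> /(pgX 3).
pose Y := 2 * Cp * n2 ^+ 3 - n1 ^+ 3.
have g2p r p : gval v rho p = r%:E -> gval v rho (2 * p) = r%:E.
  by move=> hp; rewrite -polyC_natr gvalM hp -(gaussE v c) polyTC gauss_C two add0e.
have hY : pg (3 * M + e - 3 * lam) Y.
  apply: (pgMl (p := Cp^`()) C'_val).
  have -> : Cp^`() * Y = X^`() - 3 * (n0 ^+ 2 * n0^`() - Cp * (n1 ^+ 2 * n1^`())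
      + Cp ^+ 2 * (n2 ^+ 2 * n2^`())).
    rewrite /X /cube_norm /Y !(derivD, derivB, derivN, derivM, derivXn, deriv_exp) /=.
    by ring.
  apply: pgB; first by apply: pgW (pge_deriv hX); lra.
  apply: (pgM (M := kap) (N := 3 * M - rho)) => //; last by lra.
  apply: pgeD; first apply: pgB.
  - by apply: pgM (sq _ _ h0) d0 _; lra.
  - by apply: pgM hC (pgM (sq _ _ h1) d1 (lexx _)) _; lra.
  - by apply: pgM (sq _ _ hC) (pgM (sq _ _ h2) d2 (lexx _)) _; lra.
have h2' : pg (M + e / 3 - 2 * lam) n2.
  apply: (pgXr (n := 3)) => //; apply: (pgMl (p := 2 * Cp^`()) (g2p _ _ C'_val)).
  have -> : 2 * Cp^`() * n2 ^+ 3 = Y^`() - 3 * (2 * Cp * (n2 ^+ 2 * n2^`()) - n1 ^+ 2 * n1^`()).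
    rewrite /Y !(derivD, derivB, derivN, derivM, derivXn, deriv_exp) /=.
    have -> : (1 : {poly C})^`() = 0 by rewrite -[1]/(1%:P) derivC.
    by ring.
  apply: pgB; first by apply: pgW (pge_deriv hY); lra.
  apply: (pgM (M := kap) (N := 3 * M - 3 * lam - rho)) => //; last by lra.
  have h2C : pg (3 * lam) (2 * Cp) by apply/gval_geP; rewrite (g2p _ _ C_val).
  apply: pgB.
  - by apply: pgM h2C (pgM (sq _ _ h2) d2 (lexx _)) _; lra.
  - by apply: pgM (sq _ _ h1) d1 _; lra.
have h1' : pg (M + e / 3 - lam) n1.
  apply: (pgXr (n := 3)) => //.
  have -> : n1 ^+ 3 = 2 * Cp * n2 ^+ 3 - Y by rewrite /Y; ring.
  have h2C : pg (3 * lam) (2 * Cp) by apply/gval_geP; rewrite (g2p _ _ C_val).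
  apply: pgB; last by apply: pgW hY; lra.
  by apply: pgM h2C (cu _ _ h2') _; lra.
split=> //; apply: (pgXr (n := 3)) => //.
have -> : n0 ^+ 3 = X + Cp * n1 ^+ 3 - Cp ^+ 2 * n2 ^+ 3 by rewrite /X /cube_norm; ring.
apply: pgB; first apply: pgeD.
- by apply: pgW hX; lra.
- by apply: pgM hC (cu _ _ h1') _; lra.
- by apply: pgM (sq _ _ hC) (cu _ _ h2') _; lra.
Qed.

(** Every step gains a fixed amount, from any bound to start with. *)
Lemma cube_norm_poly M n0 n1 n2 : pg (3 * M) (cube_norm Cp n0 n1 n2) ->
  [/\ pg M n0, pg (M - lam) n1 & pg (M - 2 * lam) n2].
Proof.
move=> hX.
have ex p : exists N, pg N p.
  have [->|/(@pge_lead _ _ v rho)[i [N [_ hN _]]]] := eqVneq p 0; last by exists N.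
  by exists 0 => i; rewrite coef0 vge0.
have [N0 hN0] := ex n0; have [N1 hN1] := ex n1; have [N2 hN2] := ex n2.
pose N := Num.min N0 (Num.min (N1 + lam) (N2 + 2 * lam)).
have NN0 : N <= N0 by rewrite ge_min lexx.
have NN1 : N - lam <= N1 by rewrite lerBlDr ge_min ge_min lexx orbT.
have NN2 : N - 2 * lam <= N2 by rewrite lerBlDr ge_min ge_min lexx !orbT.
pose P M' := [/\ pg M' n0, pg (M' - lam) n1 & pg (M' - 2 * lam) n2].
have PW M' M'' : M' <= M'' -> P M'' -> P M'.
  by move=> h [h0 h1 h2]; split; [apply: pgW h0 | apply: pgW h1 | apply: pgW h2]; lra.
have PN : P N by split; [apply: pgW hN0 | apply: pgW hN1 | apply: pgW hN2].
have step n : P (Num.min M (N + n%:R * (kap / 3))).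
  elim: n => [|n IH]; first by apply: PW PN; rewrite mul0r addr0 ge_min lexx orbT.
  set M' := Num.min M (N + n%:R * (kap / 3)) in IH.
  have [MM|MM] := leP M (N + n%:R * (kap / 3)).
    apply: PW IH; rewrite /M' (min_idPl MM) ge_min lexx //.
  have M'E : M' = N + n%:R * (kap / 3) by apply/min_idPr/ltW.
  pose e := Num.min kap (3 * (M - M')).
  have e0 : 0 < e by rewrite lt_min kap0 /=; lra.
  have ek : e <= kap by rewrite ge_min lexx.
  have eM : e <= 3 * (M - M') by rewrite ge_min lexx orbT.
  have [h0 h1 h2] := IH.
  have hX' : pg (3 * M' + e) (cube_norm Cp n0 n1 n2) by apply: pgW hX; lra.
  apply: PW (cube_norm_step e0 ek h0 h1 h2 hX').
  have [he|he] := leP kap (3 * (M - M')).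
    rewrite /e (min_idPl he) M'E -natr1 ge_min; apply/orP; right; lra.
  rewrite /e (min_idPr (ltW he)) ge_min; apply/orP; left; lra.
have k3 : 0 < kap / 3 by rewrite divr_gt0.
have [n hn] := archi_ex k3 (M - N).
have := step n.+1; rewrite (min_idPl _) //; lra.
Qed.

(** A common denominator reduces this to polynomials. *)
Lemma cube_norm_gauss M x0 x1 x2 :
  vge w (3 * M) (cube_norm (polyT c Cp) x0 x1 x2) ->
  [/\ vge w M x0, vge w (M - lam) x1 & vge w (M - 2 * lam) x2].
Proof.
have [p0 [d0 [d0n ->]]] := polyTP c x0; have [p1 [d1 [d1n ->]]] := polyTP c x1.
have [p2 [d2 [d2n ->]]] := polyTP c x2.
pose d := d0 * d1 * d2.
have dn : d != 0 by rewrite !mulf_neq0.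
have [r hr] : exists r, w (polyT c d) = r%:E by apply: val_fin; rewrite polyT_eq0.
have e0 : polyT c p0 / polyT c d0 = polyT c (p0 * d1 * d2) / polyT c d.
  have -> : d = d0 * (d1 * d2) by rewrite mulrA.
  rewrite -mulrA (polyTM c p0) (polyTM c d0) -mulf_div divff ?mulr1 //.
  by rewrite polyT_eq0 mulf_neq0.
have e1 : polyT c p1 / polyT c d1 = polyT c (p1 * (d0 * d2)) / polyT c d.
  have -> : d = d1 * (d0 * d2) by rewrite /d; ring.
  rewrite (polyTM c p1) (polyTM c d1) -mulf_div divff ?mulr1 //.
  by rewrite polyT_eq0 mulf_neq0.
have e2 : polyT c p2 / polyT c d2 = polyT c (p2 * (d0 * d1)) / polyT c d.
  have -> : d = d2 * (d0 * d1) by rewrite /d; ring.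
  rewrite (polyTM c p2) (polyTM c d2) -mulf_div divff ?mulr1 //.
  by rewrite polyT_eq0 mulf_neq0.
rewrite e0 e1 e2; move: (p0 * d1 * d2) (p1 * _) (p2 * _) => n0 n1 n2.
have gen (F : fieldType) (a x y z D : F) :
    cube_norm a (x / D) (y / D) (z / D) = cube_norm a x y z / D ^+ 3.
  by rewrite /cube_norm !expr_div_n !mulrDl !mulNr !mulrA.
rewrite gen (vgeMr _ _ (valX_fin 3 hr)) => h.
have [] := @cube_norm_poly (M + r) n0 n1 n2.
  apply/(gauss_vge _ c); rewrite /cube_norm polyTD polyTB (polyTM c Cp) (polyTM c (Cp ^+ 2)) !polyTXn.
  by apply: vgeW h; lra.
move=> /(gauss_vge _ c) h0 /(gauss_vge _ c) h1 /(gauss_vge _ c) h2.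
rewrite !(vgeMr _ _ hr); split => //; [apply: vgeW h1 | apply: vgeW h2]; lra.
Qed.

End CubeFree.

Section CubeRoot.
Variables (R : realType) (F E : fieldType) (w0 : valuation R F).
Variables (iota : {rmorphism F -> E}) (z : E) (A B C : F) (lam kap : R).
Hypothesis z_eq : z ^+ 3 + iota A * z ^+ 2 + iota B * z + iota C = 0.
Hypothesis gen : forall x, exists x0 x1 x2, x = iota x0 + iota x1 * z + iota x2 * z ^+ 2.
Hypothesis free : forall x0 x1 x2, iota x0 + iota x1 * z + iota x2 * z ^+ 2 = 0 ->
  [/\ x0 = 0, x1 = 0 & x2 = 0].
Hypothesis kap0 : 0 < kap.
Hypothesis hA : vge w0 (lam + kap) A.
Hypothesis hB : vge w0 (2 * lam + kap) B.
Hypothesis hC : w0 C = (3 * lam)%:E.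
Hypothesis h3 : vge w0 kap 3.
Hypothesis cf : forall M x0 x1 x2, vge w0 (3 * M) (cube_norm C x0 x1 x2) ->
  [/\ vge w0 M x0, vge w0 (M - lam) x1 & vge w0 (M - 2 * lam) x2].

(** The value of [x] is at least [M] for the maximum norm in which [1], [z], [z^2]
    are orthogonal with values 0, [lam], [2 lam].  This norm turns out to be the
    only extension of [w0]. *)
Definition wge M (x : E) := exists x0 x1 x2,
  [/\ x = iota x0 + iota x1 * z + iota x2 * z ^+ 2,
      vge w0 M x0, vge w0 (M - lam) x1 & vge w0 (M - 2 * lam) x2].

Let z3 : z ^+ 3 = - (iota A * z ^+ 2 + iota B * z + iota C).
Proof. by apply/eqP; rewrite -addr_eq0 !addrA z_eq. Qed.

Lemma wgeW M M' x : M <= M' -> wge M' x -> wge M x.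
Proof.
move=> h [x0 [x1 [x2 [-> h0 h1 h2]]]]; exists x0, x1, x2; split=> //.
- exact: vgeW h0.
- by apply: vgeW h1; lra.
- by apply: vgeW h2; lra.
Qed.

Lemma wgeD M x y : wge M x -> wge M y -> wge M (x + y).
Proof.
move=> [x0 [x1 [x2 [-> h0 h1 h2]]]] [y0 [y1 [y2 [-> k0 k1 k2]]]].
exists (x0 + y0), (x1 + y1), (x2 + y2); split; try exact: vgeD.
by rewrite !rmorphD; ring.
Qed.

Lemma wgeZ M N a x : vge w0 N a -> wge M x -> wge (N + M) (iota a * x).
Proof.
move=> ha [x0 [x1 [x2 [-> h0 h1 h2]]]].
exists (a * x0), (a * x1), (a * x2); split.
- by rewrite !rmorphM; ring.
- exact: vgeM.
- by apply: vgeM' ha h1 _; lra.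
- by apply: vgeM' ha h2 _; lra.
Qed.

Lemma wgeN M x : wge M x -> wge M (- x).
Proof.
move=> h; have : vge w0 0 (-1) by rewrite vgeN vge1.
by move=> /wgeZ/(_ h); rewrite rmorphN1 mulN1r add0r.
Qed.

Lemma wgeB M x y : wge M x -> wge M y -> wge M (x - y).
Proof. by move=> hx hy; apply: wgeD => //; apply: wgeN. Qed.

Lemma wge_iota M a : vge w0 M a -> wge M (iota a).
Proof.
by move=> ha; exists a, 0, 0; split; rewrite ?vge0 // rmorph0 !mul0r !addr0.
Qed.

Lemma wgez M x : wge M x -> wge (M + lam) (x * z).
Proof.
move=> [x0 [x1 [x2 [-> h0 h1 h2]]]].
have k0 := kap0; exists (- (x2 * C)), (x0 - x2 * B), (x1 - x2 * A); split.
- rewrite !(rmorphB, rmorphN, rmorphM) /=.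
  transitivity (iota x0 * z + iota x1 * z ^+ 2 + iota x2 * z ^+ 3); first by ring.
  by rewrite z3; ring.
- by rewrite vgeN; apply: vgeM' h2 (vge_self hC) _; lra.
- apply: vgeB; first by apply: vgeW h0; lra.
  by apply: vgeM' h2 hB _; lra.
- apply: vgeB; first by apply: vgeW h1; lra.
  by apply: vgeM' h2 hA _; lra.
Qed.

Lemma wgeM M N x y : wge M x -> wge N y -> wge (M + N) (x * y).
Proof.
move=> [x0 [x1 [x2 [-> h0 h1 h2]]]] hy.
have -> : (iota x0 + iota x1 * z + iota x2 * z ^+ 2) * y =
  iota x0 * y + iota x1 * (y * z) + iota x2 * (y * z * z) by ring.
apply: wgeD; first apply: wgeD.
- exact: wgeZ.
- by apply: (wgeW _ (wgeZ h1 (wgez hy))); lra.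
- by apply: (wgeW _ (wgeZ h2 (wgez (wgez hy)))); lra.
Qed.

Lemma wgeM' K M N x y : wge M x -> wge N y -> K <= M + N -> wge K (x * y).
Proof. by move=> hx hy hK; apply: wgeW hK _; apply: wgeM. Qed.

Lemma wge_z : wge lam z.
Proof. by have := wgez (wge_iota (vge1 w0)); rewrite rmorph1 mul1r add0r. Qed.

Lemma wge_sq M x : wge M x -> wge (2 * M) (x ^+ 2).
Proof. by move=> h; have -> : 2 * M = M + M by [ring]; rewrite expr2; apply: wgeM. Qed.

Lemma wge_cub M x : wge M x -> wge (3 * M) (x ^+ 3).
Proof. by move=> h; rewrite exprS; apply: wgeM' h (wge_sq h) _; lra. Qed.

Lemma wge_iotaP M a : wge M (iota a) -> vge w0 M a.
Proof.
move=> [x0 [x1 [x2 [e h0 h1 h2]]]].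
have [] := @free (x0 - a) x1 x2.
  transitivity ((iota x0 + iota x1 * z + iota x2 * z ^+ 2) - iota a).
    by rewrite rmorphB; ring.
  by rewrite -e subrr.
by move=> /eqP; rewrite subr_eq0 => /eqP <-.
Qed.

Let coords x : {p : F * F * F | x = iota p.1.1 + iota p.1.2 * z + iota p.2 * z ^+ 2}.
Proof.
apply: cid; have [x0 [x1 [x2 xE]]] := gen x.
by exists (x0, x1, x2).
Qed.

(** By [wge_nrm] the value of [x] is a third of the value of [nrm x]. *)
Definition nrm x := let p := projT1 (coords x) in cube_norm C p.1.1 p.1.2 p.2.

Lemma nrmE x0 x1 x2 : nrm (iota x0 + iota x1 * z + iota x2 * z ^+ 2) = cube_norm C x0 x1 x2.
Proof.
rewrite /nrm; case: (coords _) => -[[y0 y1] y2] /= e.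
have [] := @free (x0 - y0) (x1 - y1) (x2 - y2).
  rewrite !rmorphB.
  transitivity ((iota x0 + iota x1 * z + iota x2 * z ^+ 2) -
    (iota y0 + iota y1 * z + iota y2 * z ^+ 2)); first by ring.
  by rewrite e subrr.
by move=> /subr0_eq -> /subr0_eq -> /subr0_eq ->.
Qed.

Lemma wge_nrm M x : wge M x <-> vge w0 (3 * M) (nrm x).
Proof.
split=> [[x0 [x1 [x2 [-> h0 h1 h2]]]]|].
  have cu M' y : vge w0 M' y -> vge w0 (3 * M') (y ^+ 3) by move=> /(@vgeX _ _ _ _ _ 3).
  rewrite nrmE /cube_norm; apply: vgeD; first apply: vgeB.
  - exact: cu.
  - by apply: vgeM' (vge_self hC) (cu _ _ h1) _; lra.
  - by apply: vgeM' (vge_self (valX_fin 2 hC)) (cu _ _ h2) _; lra.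
have [x0 [x1 [x2 ->]]] := gen x; rewrite nrmE => /cf[h0 h1 h2].
by exists x0, x1, x2.
Qed.

(** Modulo 3 cubing is additive, and [z^3] is close to [- C]. *)
Lemma nrm_cube M x : wge M x -> wge (3 * M + kap) (x ^+ 3 - iota (nrm x)).
Proof.
move=> [x0 [x1 [x2 [-> h0 h1 h2]]]]; rewrite nrmE.
have X0 := wge_iota h0.
have X1 : wge M (iota x1 * z) by apply: wgeM' (wge_iota h1) wge_z _; lra.
have X2 : wge M (iota x2 * z ^+ 2).
  by apply: wgeM' (wge_iota h2) (wge_sq wge_z) _; lra.
have zC : wge (3 * lam + kap) (z ^+ 3 + iota C).
  have -> : z ^+ 3 + iota C = - (iota A * z ^+ 2 + iota B * z) by rewrite z3; ring.
  apply/wgeN/wgeD.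
  - by apply: wgeM' (wge_iota hA) (wge_sq wge_z) _; lra.
  - by apply: wgeM' (wge_iota hB) wge_z _; lra.
have hC' := wge_iota (vge_self hC).
set a := iota x0 in X0 *; set b := iota x1 * z in X1 *; set d := iota x2 * _ in X2 *.
have -> : (a + b + d) ^+ 3 - iota (cube_norm C x0 x1 x2) =
   iota 3 * (a ^+ 2 * b + a * b ^+ 2 + a ^+ 2 * d + a * d ^+ 2 + b ^+ 2 * d
     + b * d ^+ 2 + iota 2 * (a * b * d))
   + (iota x1 ^+ 3 * (z ^+ 3 + iota C)
      + iota x2 ^+ 3 * ((z ^+ 3 + iota C) * (z ^+ 3 + iota C - iota 2 * iota C))).
  by rewrite /cube_norm !(rmorphD, rmorphB, rmorphM, rmorphXn, rmorph_nat) /= /a /b /d; ring.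
have i2 : wge 0 (iota 2) by apply/wge_iota/vge_nat.
apply: wgeD.
  apply: wgeM' (wge_iota h3) (_ : wge (3 * M) _) _; last by lra.
  have m21 s t : wge M s -> wge M t -> wge (3 * M) (s ^+ 2 * t).
    by move=> hs ht; apply: wgeM' (wge_sq hs) ht _; lra.
  have m12 s t : wge M s -> wge M t -> wge (3 * M) (s * t ^+ 2).
    by move=> hs ht; rewrite (mulrC s); apply: m21.
  apply: wgeD; last by apply: wgeM' i2 (wgeM (wgeM X0 X1) X2) _; lra.
  by repeat (apply: wgeD); auto.
apply: wgeD; first by apply: wgeM' (wge_cub (wge_iota h1)) zC _; lra.
apply: wgeM' (wge_cub (wge_iota h2)) (wgeM zC (_ : wge (3 * lam) _)) _; last by lra.
apply: wgeB; first by apply: wgeW zC; rewrite lerDl ltW.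
by apply: wgeM' i2 hC' _; lra.
Qed.

Lemma nrm_eq0 x : nrm x = 0 -> x = 0.
Proof.
move=> n0; have [x0 [x1 [x2 xE]]] := gen x.
have H M : vge w0 M x0 /\ vge w0 M x1 /\ vge w0 M x2.
  have h M' : [/\ vge w0 M' x0, vge w0 (M' - lam) x1 & vge w0 (M' - 2 * lam) x2].
    by apply: cf; rewrite -nrmE -xE n0 vge0.
  have [a _ _] := h M; have [_ b _] := h (M + lam); have [_ _ d] := h (M + 2 * lam).
  by rewrite addrK in b; rewrite addrK in d.
rewrite xE (vge_all0 (fun M => (H M).1)) (vge_all0 (fun M => (H M).2.1)).
by rewrite (vge_all0 (fun M => (H M).2.2)) !rmorph0 !mul0r !addr0.
Qed.

Lemma nrm_fin x : x != 0 -> exists r, w0 (nrm x) = (3 * r)%:E.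
Proof.
move=> x0; have /(val_fin w0)[r hr] : nrm x != 0 by apply: contraNneq x0 => /nrm_eq0 ->.
by exists (r / 3); rewrite hr; congr (_%:E); field.
Qed.

Lemma nrm0 : nrm 0 = 0.
Proof. by have := nrmE 0 0 0; rewrite /cube_norm !rmorph0 !expr0n /= !mul0r !mulr0 !addr0 subr0. Qed.

Lemma nrmM x y r s : w0 (nrm x) = (3 * r)%:E -> w0 (nrm y) = (3 * s)%:E ->
  w0 (nrm (x * y)) = (3 * (r + s))%:E.
Proof.
move=> hx hy; have gx : wge r x by apply/wge_nrm; exact: vge_self.
have gy : wge s y by apply/wge_nrm; exact: vge_self.
have gxy := wgeM gx gy.
have hp : w0 (nrm x * nrm y) = (3 * (r + s))%:E.
  by rewrite (valM_fin hx hy); congr (_%:E); ring.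
apply: (valB_fin hp (M := 3 * (r + s) + kap)); first by rewrite ltrDl.
apply: wge_iotaP; rewrite rmorphB rmorphM.
have nx := nrm_cube gx; have ny := nrm_cube gy; have nxy := nrm_cube gxy.
have -> : iota (nrm (x * y)) - iota (nrm x) * iota (nrm y) =
  (x ^+ 3 - iota (nrm x)) * y ^+ 3 + iota (nrm x) * (y ^+ 3 - iota (nrm y))
  - ((x * y) ^+ 3 - iota (nrm (x * y))) by ring.
apply: wgeB nxy; apply: wgeD.
  by apply: wgeM' nx (wge_cub gy) _; lra.
by apply: wgeM' (wge_iota (vge_self hx)) ny _; lra.
Qed.

Lemma cube_root_valuation : exists W : valuation R E,
  [/\ forall x M, vge W M x <-> wge M x,
      forall x r, w0 (nrm x) = (3 * r)%:E -> W x = r%:E &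
      forall a, W (iota a) = w0 a].
Proof.
pose W x := ((1 / 3)%:E * w0 (nrm x))%E.
have Wr x r : w0 (nrm x) = (3 * r)%:E -> W x = r%:E.
  by rewrite /W => ->; rewrite -EFinM; congr (_%:E); field.
have W0 : W 0 = +oo%E by rewrite /W nrm0 val0 gt0_muley // lte_fin; lra.
have WN x : W x <> -oo%E.
  by have [->|/nrm_fin[r /Wr ->]] := eqVneq x 0; rewrite ?W0.
have Wy x : W x = +oo%E <-> x = 0.
  by split=> [|->] //; have [->|/nrm_fin[r /Wr ->]] := eqVneq x 0.
have WM x y : W (x * y) = (W x + W y)%E.
  have [->|xn] := eqVneq x 0; first by rewrite mul0r W0 addye //; apply/eqP.
  have [->|yn] := eqVneq y 0; first by rewrite mulr0 W0 addey //; apply/eqP.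
  have [r hr] := nrm_fin xn; have [s hs] := nrm_fin yn.
  by rewrite (Wr _ _ hr) (Wr _ _ hs) (Wr _ _ (nrmM hr hs)).
have WG x M : (M%:E <= W x)%E <-> wge M x.
  have [->|xn] := eqVneq x 0.
    by rewrite W0 leey; split=> // _; rewrite -(rmorph0 iota); apply/wge_iota/vge0.
  have [r hr] := nrm_fin xn; rewrite (Wr _ _ hr) lee_fin; split=> h.
    by apply/wge_nrm; rewrite (vge_fin _ hr); lra.
  by move/wge_nrm: h; rewrite (vge_fin _ hr); lra.
have WD x y : (Order.min (W x) (W y) <= W (x + y)%R)%E.
  apply: ereal_le_thr => M; rewrite le_min => /andP[/WG hx /WG hy].
  exact/WG/wgeD.
exists (Valuation WN Wy WM WD); split=> // a /=.
apply: ereal_eq_thr => M; split=> [/WG/wge_iotaP //|h].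
exact/WG/wge_iota.
Qed.

(** Here [x^3] is close to [nrm x], so the value of [x] is determined. *)
Lemma cube_root_unique (eta : valuation R E) : (forall a, eta (iota a) = w0 a) ->
  forall x M, vge eta M x <-> wge M x.
Proof.
move=> ext; have k0 := kap0.
have ei M a : vge eta M (iota a) = vge w0 M a by rewrite /vge ext.
have hz : vge eta lam z.
  have [->|/(val_fin eta)[r hr]] := eqVneq z 0; first exact: vge0.
  rewrite (vge_fin _ hr) leNgt; apply/negP => rl.
  have hz3 := valX_fin 3 hr.
  have : eta (z ^+ 3 + (iota A * z ^+ 2 + (iota B * z + iota C))) = (3%:R * r)%:E.
    apply: (valD_fin hz3 (M := Num.min (3 * r + kap) (3 * lam))).
      by rewrite lt_min; apply/andP; split; lra.
    have zr := vge_self hr.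
    apply: vgeD; last apply: vgeD.
    - apply: (vgeM' (M := lam + kap) (N := 2%:R * r)); rewrite ?ei //.
        exact: vge_self (valX_fin 2 hr).
      by rewrite ge_min; apply/orP; left; lra.
    - apply: (vgeM' (M := 2 * lam + kap) (N := r)); rewrite ?ei //.
      by rewrite ge_min; apply/orP; left; lra.
    - by rewrite ei (vge_fin _ hC) ge_min lexx orbT.
  by rewrite !addrA z_eq val0.
have wv M x : wge M x -> vge eta M x.
  move=> [x0 [x1 [x2 [-> h0 h1 h2]]]]; apply: vgeD; first apply: vgeD.
  - by rewrite ei.
  - by apply: (vgeM' (M := M - lam) (N := lam)); rewrite ?ei //; lra.
  - apply: (vgeM' (M := M - 2 * lam) (N := 2%:R * lam)); rewrite ?ei //; last by lra.
    exact: vgeX.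
move=> x M; split; last exact: wv.
have [->|xn] := eqVneq x 0.
  by rewrite -(rmorph0 iota) => _; apply/wge_iota/vge0.
have [r hr] := nrm_fin xn.
have gx : wge r x by apply/wge_nrm; exact: vge_self.
have hn : eta (iota (nrm x)) = (3%:R * r)%:E by rewrite ext.
have hx3 : eta (x ^+ 3) = (3%:R * r)%:E.
  apply: (valB_fin hn (M := 3 * r + kap)); first by rewrite ltrDl.
  exact/wv/nrm_cube.
have hx := val_rootn_eq0 (n := 3) isT hx3.
have {}hx : eta x = r%:E by rewrite hx; congr (_%:E); field.
by rewrite (vge_fin _ hx) => h; apply: wgeW gx.
Qed.

End CubeRoot.

(** * Valuations obtained as limits *)

Section Good.
Variables (R : realType) (M : fieldType) (V : R -> valuation R M) (J : set R).
Implicit Types (u : nat -> M).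

Definition bddb u := exists K : R, forall n s, J s -> vge (V s) K (u n).
Definition unif_cauchy u := forall B : R, exists N : nat, forall n m s,
  (N <= n)%N -> (N <= m)%N -> J s -> vge (V s) B (u n - u m).
(** The sequences which will be compared are Cauchy for all the valuations [V s],
    [s] in [J], uniformly; so a limit has a value at every [s]. *)
Definition good u := bddb u /\ unif_cauchy u.
Definition null u := forall B : R, exists N : nat, forall n s,
  (N <= n)%N -> J s -> vge (V s) B (u n).
(** Eventually bounded away from 0. *)
Definition away u := exists (N : nat) (K : R), forall n s,
  (N <= n)%N -> J s -> ~ vge (V s) K (u n).

Lemma good_cst a : (exists K : R, forall s, J s -> vge (V s) K a) -> good (fun=> a).
Proof.
move=> [K hK]; split; first by exists K => _; apply: hK.
by move=> B; exists 0%N => n m s _ _ _; rewrite subrr vge0.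
Qed.

Lemma goodD u u' : good u -> good u' -> good (fun n => u n + u' n).
Proof.
move=> [[K hK] hu] [[K' hK'] hu']; split.
  exists (Num.min K K') => n s Js; apply: vgeD.
    by apply: vgeW (hK n s Js); rewrite ge_min lexx.
  by apply: vgeW (hK' n s Js); rewrite ge_min lexx orbT.
move=> B; have [N hN] := hu B; have [N' hN'] := hu' B.
exists (maxn N N') => n m s; rewrite !geq_max => /andP[n1 n2] /andP[m1 m2] Js.
have -> : u n + u' n - (u m + u' m) = (u n - u m) + (u' n - u' m) by ring.
by apply: vgeD; [apply: hN | apply: hN'].
Qed.

Lemma goodM u u' : good u -> good u' -> good (fun n => u n * u' n).
Proof.
move=> [[K hK] hu] [[K' hK'] hu']; split.
  by exists (K + K') => n s Js; apply: vgeM; [apply: hK | apply: hK'].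
move=> B; have [N hN] := hu (B - K'); have [N' hN'] := hu' (B - K).
exists (maxn N N') => n m s; rewrite !geq_max => /andP[n1 n2] /andP[m1 m2] Js.
have -> : u n * u' n - u m * u' m = (u n - u m) * u' n + u m * (u' n - u' m) by ring.
apply: vgeD.
  by apply: vgeM' (hN _ _ _ n1 m1 Js) (hK' n s Js) _; lra.
by apply: vgeM' (hK m s Js) (hN' _ _ _ n2 m2 Js) _; lra.
Qed.

Lemma goodN u : good u -> good (fun n => - u n).
Proof.
move=> [[K hK] hu]; split; first by exists K => n s Js; rewrite vgeN; apply: hK.
move=> B; have [N hN] := hu B; exists N => n m s n1 m1 Js.
by rewrite -opprD vgeN; apply: hN.
Qed.

Lemma goodB u u' : good u -> good u' -> good (fun n => u n - u' n).
Proof. by move=> h h'; apply: goodD => //; apply: goodN. Qed.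

Lemma goodV u : good u -> (forall n, u n != 0) ->
  bddb (fun n => (u n)^-1) -> good (fun n => (u n)^-1).
Proof.
move=> [[K hK] hu] un [K' hK']; split; first by exists K'.
move=> B; have [N hN] := hu (B - K' - K'); exists N => n m s n1 m1 Js.
have -> : (u n)^-1 - (u m)^-1 = (u n)^-1 * (u m)^-1 * (u m - u n).
  by field; rewrite !un.
apply: (vgeM' (M := K' + K')) (hN _ _ _ m1 n1 Js) _; last by lra.
by apply: vgeM; apply: hK'.
Qed.

Lemma nullD u u' : null u -> null u' -> null (fun n => u n + u' n).
Proof.
move=> h h' B; have [N hN] := h B; have [N' hN'] := h' B; exists (maxn N N') => n s.
by rewrite geq_max => /andP[n1 n2] Js; apply: vgeD; [apply: hN | apply: hN'].
Qed.

Lemma nullMg u u' : bddb u -> null u' -> null (fun n => u n * u' n).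
Proof.
move=> [K hK] h' B; have [N hN] := h' (B - K); exists N => n s n1 Js.
by apply: vgeM' (hK n s Js) (hN n s n1 Js) _; lra.
Qed.

Lemma null_ext u u' : u =1 u' -> null u -> null u'.
Proof. by move=> /funext ->. Qed.

Lemma good_ext u u' : u =1 u' -> good u -> good u'.
Proof. by move=> /funext ->. Qed.

Lemma null_div u u' : away u -> null (fun n => u n * u' n) -> null u'.
Proof.
move=> [N [K hK]] h B; have [N' hN'] := h (B + K); exists (maxn N N') => n s.
rewrite geq_max => /andP[n1 n2] Js; have := hK n s n1 Js; have := hN' n s n2 Js.
have [->|/(val_fin (V s))[r hr]] := eqVneq (u n) 0; first by rewrite vge0.
rewrite (vge_fin _ hr) => h1 /negP; rewrite -ltNge => rK.
by apply: (vgeMl (r := r) (x := u n)) => //; apply: vgeW h1; lra.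
Qed.


(** Late terms differ by less than their distance from 0. *)
Lemma away_const u : unif_cauchy u -> away u -> exists N : nat, forall n s,
  (N <= n)%N -> J s -> V s (u n) = V s (u N) /\ u n != 0.
Proof.
move=> hu [N [K hK]]; have [N' hN'] := hu K; exists (maxn N N') => n s.
rewrite geq_max => /andP[n1 n2] Js.
have m1 := leq_maxl N N'; have m2 := leq_maxr N N'.
have un m : (N <= m)%N -> u m != 0.
  by move=> hm; apply/eqP => um; apply: (hK m s hm Js); rewrite um vge0.
split; last exact: un.
have [r hr] := val_fin (V s) (un _ m1); rewrite hr.
have := hK _ s m1 Js; rewrite (vge_fin _ hr) => /negP; rewrite -ltNge => rK.
exact: valB_fin hr rK (hN' _ _ _ n2 m2 Js).
Qed.

Lemma away_factor u u' b : bddb u' -> away (fun n => u' n * u n + b n) -> null b -> away u.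
Proof.
move=> [K' hK'] [N [K hK]] hb; have [N' hN'] := hb K.
exists (maxn N N'), (K - K') => n s; rewrite geq_max => /andP[n1 n2] Js h.
apply: (hK n s n1 Js); apply: vgeD; last exact: hN'.
by apply: vgeM' (hK' n s Js) h _; lra.
Qed.

End Good.

Section LimitValuation.
Variables (R : realType) (M E : fieldType) (A : idomainType).
Variables (V : R -> valuation R M) (J : nat -> set R) (s0 : R).
Variables (io : {rmorphism A -> E}) (th : E) (p : {poly A}).
Variables (al : nat -> {rmorphism A -> M}) (u : nat -> M).
Hypothesis io_inj : forall a, io a = 0 -> a = 0.
Hypothesis Js0 : J 0%N s0.
Hypothesis al_good : forall k a, good V (J k) (fun n => al n a).
Hypothesis al_away : forall k a, a != 0 -> away V (J k) (fun n => al n a).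
Hypothesis u_good : forall k, good V (J k) u.
Hypothesis p_null : forall k, null V (J k) (fun n => (map_poly (al n) p).[u n]).
Hypothesis div : forall G : {poly A}, (map_poly io G).[th] = 0 ->
  exists2 h, h != 0 & exists W, h%:P * G = W * p.
Hypothesis bezout : forall G : {poly A}, (map_poly io G).[th] != 0 ->
  exists2 h, h != 0 & exists U W, U * G + W * p = h%:P.
Hypothesis frac : forall x, exists G a, a != 0 /\ x = (map_poly io G).[th] / io a.

Definition evn n (G : {poly A}) := (map_poly (al n) G).[u n].

Let evD n G H : evn n (G + H) = evn n G + evn n H.
Proof. by rewrite /evn rmorphD hornerD. Qed.
Let evM n G H : evn n (G * H) = evn n G * evn n H.
Proof. by rewrite /evn rmorphM hornerM. Qed.
Let evC n a : evn n a%:P = al n a.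
Proof. by rewrite /evn map_polyC hornerC. Qed.

Lemma evn_good k G : good V (J k) (fun n => evn n G).
Proof.
elim/poly_ind: G => [|G a IH].
  by apply: good_ext (al_good k 0) => n; rewrite /evn !rmorph0 horner0.
apply: (good_ext _ (goodD (goodM IH (u_good k)) (al_good k a))) => n.
by rewrite evD evM evC /evn map_polyX hornerX.
Qed.

Lemma evn_null k G : (map_poly io G).[th] = 0 -> null V (J k) (fun n => evn n G).
Proof.
move=> /div[h h0 [W hW]]; apply: (null_div (al_away k h0)).
apply: (null_ext _ (nullMg (evn_good k W).1 (p_null k))) => n.
by rewrite -/(evn n p) -evM -hW evM evC.
Qed.

Lemma evn_away k G : (map_poly io G).[th] != 0 -> away V (J k) (fun n => evn n G).
Proof.
move=> /bezout[h h0 [U [W hUW]]].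
apply: (@away_factor _ _ _ _ _ (fun n => evn n U) (fun n => evn n W * evn n p)).
- exact: (evn_good k U).1.
- have [N [K hK]] := al_away k h0; exists N, K => n s n1 Js.
  by rewrite -!evM -evD hUW evC; apply: hK.
- exact: nullMg (evn_good k W).1 (p_null k).
Qed.

(** An element [G(th)] of [E] is approximated by [G(u n)] in [M].  Its values are
    eventually constant: [G(u n)] stays away from 0, as [G] is coprime to [p]. *)
Lemma limit_valuation : exists W : R -> valuation R E,
  forall k G, (map_poly io G).[th] != 0 -> exists N : nat, forall n s,
    (N <= n)%N -> J k s -> W s (map_poly io G).[th] = V s (evn n G).
Proof.
pose ev : {rmorphism {poly A} -> E} := horner_morph (fun a => mulrC th (io a)).
have evE G : ev G = (map_poly io G).[th] by [].
have one s : (exists k, J k s) -> exists W : valuation R E, forall G,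
    (map_poly io G).[th] != 0 -> exists N : nat, forall n, (N <= n)%N ->
    W (map_poly io G).[th] = V s (evn n G).
  move=> [k Js].
  have ex G : exists l, (ev G = 0 /\ l = +oo%E) \/
      (ev G <> 0 /\ l <> +oo%E /\ exists N : nat, forall n, (N <= n)%N -> V s (evn n G) = l).
    have [g0|/eqP g0] := eqVneq (ev G) 0; first by exists +oo%E; left.
    have [N hN] := away_const (evn_good k G).2 (evn_away k (introN eqP g0)).
    exists (V s (evn N G)); right; split=> //; split.
      by move/val_eqy/eqP; rewrite (negPf (hN N s (leqnn _) Js).2).
    by exists N => n n1; rewrite (hN n s n1 Js).1.
  pose l G := projT1 (cid (ex G)).
  have lP G : (ev G = 0 /\ l G = +oo%E) \/
      (ev G <> 0 /\ l G <> +oo%E /\ exists N : nat, forall n, (N <= n)%N -> V s (evn n G) = l G).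
    by rewrite /l; case: cid.
  have lge G (B : R) : (B%:E <= l G)%E <->
      exists N : nat, forall n, (N <= n)%N -> vge (V s) B (evn n G).
    case: (lP G) => [[g0 ->]|[g0 [_ [N hN]]]]; split.
    - by move=> _; have [N hN] := evn_null k g0 B; exists N => n n1; apply: hN.
    - by rewrite leey.
    - by move=> h; exists N => n n1; rewrite /vge hN.
    - by move=> [N' hN']; rewrite -(hN (maxn N N')) ?leq_maxl //; apply/hN'/leq_maxr.
  have [] := @valuation_of_ring R {poly A} E ev l.
  - move=> G; case: (lP G) => [[_ ->] //|[_ [_ [N hN]]]].
    by rewrite -(hN N (leqnn _)); apply: val_neqNy.
  - move=> G; case: (lP G) => [[g0 g1]|[g0 [g1 _]]]; first by split.
    by split.
  - move=> G H; case: (lP (G * H)) => [[gh0 ->]|[gh0 [_ [N hN]]]].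
      move/eqP: gh0; rewrite rmorphM mulf_eq0 => /orP[/eqP g0|/eqP h0].
        case: (lP G) => [[_ ->]|[] //].
        rewrite addye //; apply/eqP.
        case: (lP H) => [[_ ->] //|[_ [_ [N hN]]]].
        by rewrite -(hN N (leqnn _)); apply: val_neqNy.
      case: (lP H) => [[_ ->]|[] //].
      rewrite addey //; apply/eqP.
      case: (lP G) => [[_ ->] //|[_ [_ [N hN]]]].
      by rewrite -(hN N (leqnn _)); apply: val_neqNy.
    have gn : ev G <> 0 by move=> g0; apply: gh0; rewrite rmorphM g0 mul0r.
    have hn : ev H <> 0 by move=> h0; apply: gh0; rewrite rmorphM h0 mulr0.
    case: (lP G) => [[] //|[_ [_ [N1 hN1]]]]; case: (lP H) => [[] //|[_ [_ [N2 hN2]]]].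
    pose n := maxn N (maxn N1 N2).
    rewrite -(hN n) ?leq_maxl // -(hN1 n) ?leq_max ?leqnn ?orbT //.
    by rewrite -(hN2 n) ?leq_max ?leqnn ?orbT // evM Defs.valM.
  - move=> G H; apply: ereal_le_thr => B; rewrite le_min => /andP[/lge[N hN] /lge[N' hN']].
    apply/lge; exists (maxn N N') => n; rewrite geq_max => /andP[n1 n2].
    by rewrite evD; apply: vgeD; [apply: hN | apply: hN'].
  - move=> x; have [G [a [a0 ->]]] := frac x; exists G, a%:P.
    rewrite !evE map_polyC hornerC; split=> //.
    by apply/eqP => /io_inj/eqP; rewrite (negPf a0).
  move=> W hW; exists W => G gn; have := hW G; rewrite evE => ->.
  case: (lP G) => [[g0 _]|[_ [_ [N hN]]]]; first by rewrite -evE g0 eqxx in gn.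
  by exists N => n n1; rewrite hN.
have [W0 _] := one s0 (ex_intro _ _ Js0).
have /choice[W hW] : forall s, exists W : valuation R E, (exists k, J k s) -> forall G,
    (map_poly io G).[th] != 0 -> exists N : nat, forall n, (N <= n)%N ->
    W (map_poly io G).[th] = V s (evn n G).
  move=> s; have [hs|hs] := pselect (exists k, J k s); last by exists W0.
  by have [W hW] := one s hs; exists W.
exists W => k G gn; have [N hN] := away_const (evn_good k G).2 (evn_away k gn).
exists N => n s n1 Js; have [N' hN'] := hW s (ex_intro _ k Js) G gn.
rewrite (hN' (maxn N N')) ?leq_maxr // (hN _ _ _ Js).1 ?leq_maxl //.
by rewrite (hN n s n1 Js).1.
Qed.

End LimitValuation.

Section LimitField.
Variables (R : realType) (M E F : fieldType).
Variables (iota : {rmorphism F -> E}) (th : E) (p : {poly F}).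
Hypothesis p_irr : irreducible_poly p.
Hypothesis p_th : (map_poly iota p).[th] = 0.

Lemma irr_div G : (map_poly iota G).[th] = 0 -> exists W, G = W * p.
Proof.
move=> g0; have [/dvdpP[W ->]|] := boolP (p %| G); first by exists W.
rewrite -irreducible_poly_coprime // => /Bezout_eq1_coprimepP[[U W] /= h].
have := congr1 (fun q : {poly F} => (map_poly iota q).[th]) h.
rewrite rmorphD !rmorphM rmorph1 hornerD !hornerM hornerC p_th g0 !mulr0 addr0.
by move/esym/eqP; rewrite oner_eq0.
Qed.

Lemma irr_bezout G : (map_poly iota G).[th] != 0 -> exists U W, U * G + W * p = 1.
Proof.
move=> g0; have : coprimep p G.
  rewrite irreducible_poly_coprime //; apply: contraNN g0 => /dvdpP[W ->].
  by rewrite rmorphM hornerM p_th mulr0.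
by move=> /Bezout_eq1_coprimepP[[W U] /= h]; exists U, W; rewrite addrC.
Qed.

(** The case in which the base ring is a field, embedded in [M] by [psi]. *)
Lemma limit_valuation_field (V : R -> valuation R M) (J : set R) (s0 : R)
    (psi : {rmorphism F -> M}) (u : nat -> M) :
  J s0 -> (forall m, exists K : R, forall s, J s -> vge (V s) K m) ->
  (forall x, exists G, x = (map_poly iota G).[th]) ->
  good V J u -> null V J (fun n => (map_poly psi p).[u n]) ->
  exists W : R -> valuation R E, forall G, (map_poly iota G).[th] != 0 ->
    exists N : nat, forall n s, (N <= n)%N -> J s ->
    W s (map_poly iota G).[th] = V s (map_poly psi G).[u n].
Proof.
move=> Js bd gen gu pn.
have := @limit_valuation R M E F V (fun=> J) s0 iota th p (fun=> psi) u.
case=> //.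
- by move=> a /eqP; rewrite fmorph_eq0 => /eqP.
- by move=> _ a; apply: good_cst; apply: bd.
- move=> _ a a0; have [K hK] := bd (psi a)^-1; exists 0%N, (1 - K) => n s _ Js' h.
  have pa : psi a != 0 by rewrite fmorph_eq0.
  have := vgeM h (hK s Js'); rewrite mulfV // /vge Defs.val1 lee_fin; lra.
- by move=> G /irr_div[W ->]; exists 1; rewrite ?oner_eq0 //; exists W; rewrite mul1r.
- by move=> G /irr_bezout[U [W h]]; exists 1; rewrite ?oner_eq0 //; exists U, W.
- move=> x; have [G ->] := gen x; exists G, 1; rewrite oner_eq0 rmorph1 divr1 //.
by move=> W hW; exists W => G /(hW 0%N).
Qed.

End LimitField.

(** * Square roots *)

Section SquareRoot.
Variables (R : realType).

(** Newton approximations of the square root of [u] from [k]. *)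
Definition sqrt_seq (M : fieldType) (k u : M) (n : nat) : M :=
  let d := (k ^+ 2 - u) / k ^+ 2 in k * (1 + d / 2 * xi_seq (d / 2 ^+ 2) 0 n).

Lemma sqrt_seqP (M : fieldType) (w : valuation R M) (k u : M) (e : R) :
  0 < e -> w 2 = 0%E -> k != 0 -> vge w e (1 - u / k ^+ 2) ->
  forall r, w k = r%:E ->
  [/\ forall n, vge w r (sqrt_seq k u n),
      forall n m, (n <= m)%N ->
        vge w (n.+1%:R * e + r) (sqrt_seq k u m - sqrt_seq k u n) &
      forall n, vge w (n.+1%:R * e + 2 * r) (sqrt_seq k u n ^+ 2 - u)].
Proof.
move=> e0 w2 k0 he r hr; have two0 := val_fin_neq0 w2.
have four0 : (4 : M) != 0 by have -> : (4 : M) = 2 ^+ 2 by [ring]; apply: expf_neq0.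
set d := (k ^+ 2 - u) / k ^+ 2.
have hd : vge w e d by rewrite /d mulrBl divff ?expf_neq0.
have hd2 : vge w e (d / 2) by rewrite (vgeMr _ _ w2) addr0.
have hd4 : vge w e (d / 2 ^+ 2) by rewrite (vgeMr _ _ (valX_fin 2 w2)) mulr0 addr0.
have [h0 h1 h2 h3] := xi_seqP e0 hd4 (vge0 w e).
have d0 : vge w 0 (d / 2) by apply: vgeW hd2; apply: ltW.
split.
- move=> n; rewrite /sqrt_seq -/d -[r]addr0; apply: vgeM; first exact: vge_self.
  by apply: vgeD; [exact: vge1 | exact: vgeM0].
- move=> n m nm; rewrite /sqrt_seq -/d.
  set x := xi_seq _ _ m; set y := xi_seq _ _ n.
  have -> : k * (1 + d / 2 * x) - k * (1 + d / 2 * y) = k * (d / 2 * (x - y)) by ring.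
  rewrite addrC; apply: vgeM; first exact: vge_self.
  by apply: vgeM0 => //; apply: h3.
move=> n; rewrite /sqrt_seq -/d; set x := xi_seq _ _ n.
have xr : d / 2 ^+ 2 * x ^+ 2 + x + 1 = x - xi_seq (d / 2 ^+ 2) 0 n.+1.
  by rewrite /= -/x; ring.
have -> : (k * (1 + d / 2 * x)) ^+ 2 - u =
    k ^+ 2 * (d * (d / 2 ^+ 2 * x ^+ 2 + x + 1)).
  by rewrite /d; field; rewrite k0 two0 four0.
rewrite addrC; apply: vgeM; first exact: vge_self (valX_fin 2 hr).
apply: vgeM0; first by apply: vgeW hd; apply: ltW.
by rewrite xr vgeBC; apply: h2.
Qed.

(** If [t] is close to a square its root is found as a limit; otherwise the terms
    of [x + y r] do not cancel. *)
Lemma sqrt_extension (E : fieldType) (w : valuation R E) (t : E) :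
  w 2 = 0%E -> t != 0 -> exists (L : fieldType) (e : {rmorphism E -> L})
    (w' : valuation R L) (r : L), r ^+ 2 = e t /\ forall x, w' (e x) = w x.
Proof.
move=> w2 t0; have two0 := val_fin_neq0 w2.
have [[x xt]|nsq] := pselect (exists x, x ^+ 2 = t).
  by exists E, idfun, w, x.
have [rho hrho] := val_fin w t0.
have psize : size ('X^2 - t%:P) = 3 by rewrite size_XnsubC.
have irr : irreducible_poly ('X^2 - t%:P).
  apply: cubic_irreducible; first by rewrite psize.
  move=> x; apply/negP; rewrite /root !(hornerD, hornerN, horner_exp, hornerX, hornerC) subr_eq0.
  move=> /eqP xt.
  by apply: nsq; exists x.
have [L _ [r rr rgen]] := irredp_FAdjoin irr.
pose e : {rmorphism E -> L} := in_alg L.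
have r2 : r ^+ 2 = e t.
  move: rr; rewrite /root rmorphB rmorphXn /= map_polyX map_polyC.
  by rewrite hornerD hornerN horner_exp hornerX hornerC subr_eq0 => /eqP.
have gen x : exists G, x = (map_poly e G).[r].
  have /Fadjoin_poly_eq <- : x \in <<1; r>>%VS by rewrite rgen memvf.
  by have /polyOver1P[q ->] := Fadjoin_polyOver 1%AS r x; exists q.
have rroot : (map_poly e ('X^2 - t%:P)).[r] = 0 by apply/eqP.
clear rr; clearbody e.
have [[x0 hx0]|nap] := pselect (exists x0, (w t < w (t - x0 ^+ 2)%R)%E).
  (* [t] has approximate square roots: take a limit *)
  rewrite hrho in hx0; have [K rK hK] := vge_gt0 hx0.
  have wx2 : w (x0 ^+ 2) = rho%:E by apply: (valB_fin hrho rK); rewrite vgeBC.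
  have x00 : x0 != 0 by apply: contraTneq (val_fin_neq0 wx2) => ->; rewrite expr0n eqxx.
  have wx : w x0 = (rho / 2%:R)%:E := val_rootn_eq0 (n := 2) isT wx2.
  have k0 : 0 < K - rho by lra.
  have hk : vge w (K - rho) (1 - t / x0 ^+ 2).
    rewrite -{1}(divff (val_fin_neq0 wx2)) -mulrBl (vgeMr _ _ wx2) subrK.
    by rewrite vgeBC.
  have [h1 h2 h3] := sqrt_seqP k0 w2 x00 hk wx.
  have big B : exists N : nat, forall n, (N <= n)%N -> B <= n.+1%:R * (K - rho).
    have [N /ltW hN] := archi_ex k0 B; exists N => n n1; apply: le_trans hN _.
    by apply: ler_wpM2r; [apply: ltW | rewrite ler_nat ltnS].
  have [|||W hW] := @limit_valuation_field R E L E e r _ irr rroot (fun=> w)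
      setT 0 idfun (sqrt_seq x0 t) I _ gen.
  - by move=> m; have [->|/(val_fin w)[s hs]] := eqVneq m 0; [exists 0 => s _; rewrite vge0 |
      exists s => s' _; apply: vge_self].
  - split; first by exists (rho / 2%:R) => n _ _; apply: h1.
    move=> B; have [N hN] := big (B - rho / 2%:R); exists N => n m _ n1 m1 _.
    wlog nm : n m n1 m1 / (n <= m)%N => [hw|].
      by have [nm|/ltnW nm] := leqP n m; [|rewrite vgeBC]; apply: hw.
    by rewrite vgeBC; apply: vgeW (h2 _ _ nm); have := hN n n1; lra.
  - move=> B; have [N hN] := big (B - rho); exists N => n _ n1 _.
    rewrite rmorphB rmorphXn /= map_polyX map_polyC.
    rewrite hornerD hornerN horner_exp hornerX hornerC.
    apply: vgeW (h3 n); have := hN n n1.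
    have -> : 2 * (rho / 2%:R) = rho by field.
    by lra.
  exists L, e, (W 0), r; split=> // x.
  have [->|x0'] := eqVneq x 0; first by rewrite rmorph0 !val0.
  have := hW x%:P; rewrite map_polyC hornerC fmorph_eq0 => /(_ x0')[N hN].
  by rewrite (hN N 0) // map_polyC hornerC.
(* otherwise [x + y r] has the minimum of the values of its terms *)
have gen2 l : exists x y, l = e x + e y * r.
  have [G ->] := gen l; elim/poly_ind: G => [|G a [x [y IH]]].
    by exists 0, 0; rewrite !rmorph0 horner0 mul0r addr0.
  exists (y * t + a), x; rewrite rmorphD rmorphM /= map_polyX map_polyC.
  rewrite hornerD hornerM hornerX hornerC IH rmorphD rmorphM -r2; ring.
have free x y : e x + e y * r = 0 -> x = 0 /\ y = 0.
  move=> h; have [y0|yn] := eqVneq y 0.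
    move: h; rewrite y0 rmorph0 mul0r addr0 => /eqP; rewrite fmorph_eq0 => /eqP.
    by [].
  exfalso; apply: nsq; exists (x / y); apply: (fmorph_inj e).
  have ey : e y != 0 by rewrite fmorph_eq0.
  have rE : r = - (e x / e y).
    apply: (mulfI ey); rewrite mulrN mulrCA divff // mulr1.
    by apply/eqP; rewrite -addr_eq0 addrC h.
  by rewrite rmorphXn fmorph_div -r2 rE sqrrN.
have /choice[co coP] : forall l, exists p : E * E, l = e p.1 + e p.2 * r.
  by move=> l; have [x [y ->]] := gen2 l; exists (x, y).
have coE x y : co (e x + e y * r) = (x, y).
  set l := e x + _; have := coP l; case: (co l) => x' y' /= h.
  have [] := free (x - x') (y - y').
    by rewrite !rmorphB; transitivity ((e x + e y * r) - (e x' + e y' * r));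
      [ring | rewrite -h subrr].
  by move=> /subr0_eq -> /subr0_eq ->.
pose N l := (co l).1 ^+ 2 - t * (co l).2 ^+ 2.
have NM l l' : N (l * l') = N l * N l'.
  rewrite /N {1 2}(coP l) {1 2}(coP l'); move: (co l) (co l') => [x y] [x' y'] /=.
  have -> : (e x + e y * r) * (e x' + e y' * r) =
      e (x * x' + y * y' * t) + e (x * y' + y * x') * r.
    by rewrite !(rmorphD, rmorphM) -r2; ring.
  by rewrite coE /=; ring.
pose thr (K : R) x y := vge w K x /\ vge w (K - rho / 2) y.
have sq2 (K : R) x : vge w (2 * K) (x ^+ 2) <-> vge w K x.
  by split=> [/(@vgeXr _ _ _ _ _ 2 isT)|/(@vgeX _ _ _ _ _ 2)].
have Nthr (K : R) x y : vge w (2 * K) (x ^+ 2 - t * y ^+ 2) <-> thr K x y.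
  have ty (K' : R) : vge w (2 * K') (t * y ^+ 2) <-> vge w (K' - rho / 2) y.
    split=> [h|/sq2 h]; last by apply: vgeM' (vge_self hrho) h _; lra.
    by apply/sq2; apply: (vgeMl hrho); apply: vgeW h; lra.
  split=> [h|[h1 h2]]; last by apply: vgeB; [apply/sq2 | apply/ty].
  suff h2 : vge w (2 * K) (t * y ^+ 2).
    split; last exact/ty; apply/sq2.
    by rewrite -(subrK (t * y ^+ 2) (x ^+ 2)) vgeD.
  have [->|yn] := eqVneq y 0; first by rewrite expr0n mulr0 vge0.
  have [s hs] := val_fin w yn; have y2 := valX_fin 2 hs.
  have hty : w (t * y ^+ 2) = (rho + 2%:R * s)%:E := valM_fin hrho y2.
  rewrite (vge_fin _ hty) leNgt; apply/negP => lt2.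
  apply: nap; exists (x / y).
  have -> : t - (x / y) ^+ 2 = - (x ^+ 2 - t * y ^+ 2) / y ^+ 2 by field.
  rewrite hrho; apply: (@vge_gt _ _ _ _ (2 * K - 2%:R * s)); first by lra.
  by rewrite (vgeMr _ _ y2) vgeN subrK.
have Neq0 l : N l = 0 <-> l = 0.
  split=> [n0|->]; last first.
    have -> : (0 : L) = e 0 + e 0 * r by rewrite !rmorph0 mul0r addr0.
    by rewrite /N coE /= expr0n mulr0 subr0.
  have h K : thr K (co l).1 (co l).2 by apply/Nthr; rewrite -/(N l) n0 vge0.
  rewrite (coP l) (vge_all0 (fun K => (h K).1)).
  have -> : (co l).2 = 0.
    by apply: (@vge_all0 _ _ w) => K; have := (h (K + rho / 2)).2; rewrite addrK.
  by rewrite !rmorph0 mul0r addr0.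
pose W l := ((1 / 2)%:E * w (N l))%E.
have Wr l s : w (N l) = (2 * s)%:E -> W l = s%:E.
  by rewrite /W => ->; rewrite -EFinM; congr (_%:E); field.
have W0 : W 0 = +oo%E by rewrite /W (Neq0 0).2 // val0 gt0_muley // lte_fin; lra.
have Wfin l : l != 0 -> exists s, w (N l) = (2 * s)%:E.
  move=> l0; have /(val_fin w)[s hs] : N l != 0.
    by apply: contraNneq l0 => /Neq0 ->.
  by exists (s / 2); rewrite hs; congr (_%:E); field.
have WN l : W l <> -oo%E.
  by have [->|/Wfin[s /Wr ->]] := eqVneq l 0; rewrite ?W0.
have Wy l : W l = +oo%E <-> l = 0.
  by split=> [|->] //; have [->|/Wfin[s /Wr ->]] := eqVneq l 0.
have WM l l' : W (l * l') = (W l + W l')%E.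
  have [->|ln] := eqVneq l 0; first by rewrite mul0r W0 addye //; apply/eqP.
  have [->|ln'] := eqVneq l' 0; first by rewrite mulr0 W0 addey //; apply/eqP.
  have [s hs] := Wfin l ln; have [s' hs'] := Wfin l' ln'.
  rewrite (Wr _ _ hs) (Wr _ _ hs') (Wr _ (s + s')) // NM (valM_fin hs hs').
  by congr (_%:E); ring.
have WG l K : (K%:E <= W l)%E <-> thr K (co l).1 (co l).2.
  rewrite -Nthr -/(N l); have [->|ln] := eqVneq l 0.
    by rewrite W0 leey (Neq0 0).2 // vge0.
  have [s hs] := Wfin l ln; rewrite (Wr _ _ hs) lee_fin (vge_fin _ hs).
  by split; lra.
have WD l l' : (Order.min (W l) (W l') <= W (l + l')%R)%E.
  apply: ereal_le_thr => K; rewrite le_min => /andP[/WG[h1 h2] /WG[h1' h2']].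
  apply/WG; have -> : co (l + l') = ((co l).1 + (co l').1, (co l).2 + (co l').2).
    by rewrite -coE; congr co; rewrite {1}(coP l) {1}(coP l') !rmorphD; ring.
  by split; apply: vgeD.
exists L, e, (Valuation WN Wy WM WD), r; split=> // x /=.
have E1 : e x = e x + e 0 * r by rewrite rmorph0 mul0r addr0.
apply: ereal_eq_thr => K; split.
  by move=> /WG[+ _]; rewrite E1 coE.
by move=> h; apply/WG; rewrite E1 coE /=; split=> //; apply: vge0.
Qed.

End SquareRoot.

(** * The three branches of a cubic with a dominant linear part *)

Section Branches.
Variables (R : realType) (F E M : fieldType) (iota : {rmorphism F -> E}).
Variables (xi : E) (a b : F).
Let g : {poly F} := b%:P * 'X^3 + a%:P * 'X^2 + 'X + 1.
Hypothesis g_irr : irreducible_poly g.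
Hypothesis g_xi : iota b * xi ^+ 3 + iota a * xi ^+ 2 + xi + 1 = 0.
Hypothesis b0 : b != 0.
Hypothesis gen : forall x, exists G, x = (map_poly iota G).[xi].

Variables (V : R -> valuation R M) (J : set R) (s0 : R) (psi : {rmorphism F -> M}).
Hypothesis Js0 : J s0.
Hypothesis bd : forall m, exists K : R, forall s, J s -> vge (V s) K m.
Variable (kap : R).
Hypothesis kap0 : 0 < kap.
Hypothesis a_kap : forall s, J s -> vge (V s) kap (psi a).
Hypothesis b_kap : forall s, J s -> vge (V s) kap (psi b).
Hypothesis V2 : forall s, J s -> V s 2 = 0%E.

Let a' := psi a.
Let b' := psi b.
Let b'0 : b' != 0. Proof. by rewrite fmorph_eq0. Qed.
Let two0 : (2 : M) != 0. Proof. exact: val_fin_neq0 (V2 Js0). Qed.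
Let four0 : (4 : M) != 0.
Proof. by have -> : (4 : M) = 2 ^+ 2 by [ring]; apply: expf_neq0 two0. Qed.

(** The discriminant of [b T^3 + a T^2 + T + 1]. *)
Definition disc (K : comNzRingType) (a b : K) : K :=
  a ^+ 2 - 4 * b + 18 * a * b - 27 * b ^+ 2 - 4 * a ^+ 3.

Lemma map_g (K : fieldType) (f : {rmorphism F -> K}) x :
  (map_poly f g).[x] = f b * x ^+ 3 + f a * x ^+ 2 + x + 1.
Proof.
rewrite /g !(rmorphD, rmorphM, rmorphXn, rmorph1) /= !map_polyC ?map_polyX.
by rewrite !(hornerD, hornerM, horner_exp, hornerX, hornerC).
Qed.

Variables (sq : M) (e : R).
Hypothesis sq0 : sq != 0.
Hypothesis e0 : 0 < e.
Hypothesis sq_near : forall s, J s -> vge (V s) e (1 - psi (disc a b) / sq ^+ 2).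

Let x1 := xi_seq a' b'.
Let S := sqrt_seq sq (psi (disc a b)).
Let g' x := 3 * b' * x ^+ 2 + 2 * a' * x + 1.
(** The other two roots: [x1] splits off a quadratic factor, whose discriminant is
    the one of the cubic divided by the square of [g' x1]. *)
Let x2 (eps : M) n := (- (a' + b' * x1 n) + eps * (S n / g' (x1 n))) / (2 * b').

Let growth (k : R) (B : R) : 0 < k -> exists N : nat, forall n, (N <= n)%N -> B <= n.+1%:R * k.
Proof.
move=> k0; have [N /ltW hN] := archi_ex k0 B; exists N => n n1; apply: le_trans hN _.
by apply: ler_wpM2r; [apply: ltW | rewrite ler_nat ltnS].
Qed.

Let cauchy_of (k c : R) (u : nat -> M) : 0 < k ->
  (forall s, J s -> forall n m, (n <= m)%N -> vge (V s) (n.+1%:R * k + c) (u m - u n)) ->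
  unif_cauchy V J u.
Proof.
move=> k0 h B; have [N hN] := growth (B - c) k0; exists N => n m s n1 m1 Js.
wlog nm : n m n1 m1 / (n <= m)%N => [hw|].
  by have [nm|/ltnW nm] := leqP n m; [|rewrite vgeBC]; apply: hw.
by rewrite vgeBC; apply: vgeW (h s Js _ _ nm); have := hN n n1; lra.
Qed.

Let x1_good : good V J x1.
Proof.
split; first by exists 0 => n s Js; have [h _ _ _] := xi_seqP kap0 (a_kap Js) (b_kap Js).
apply: (@cauchy_of kap 0) => // s Js n m nm; rewrite addr0.
by have [_ _ _ h] := xi_seqP kap0 (a_kap Js) (b_kap Js); apply: h.
Qed.

Let gx1_null : null V J (fun n => b' * x1 n ^+ 3 + a' * x1 n ^+ 2 + x1 n + 1).
Proof.
move=> B; have [N hN] := growth B kap0; exists N => n s n1 Js.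
have -> := xi_seq_root a' b' n; rewrite vgeBC; apply: vgeW (hN n n1) _.
by have [_ _ h _] := xi_seqP kap0 (a_kap Js) (b_kap Js); apply: h.
Qed.

Let g'1 n s : J s -> V s (g' (x1 n)) = 0%:E.
Proof.
move=> Js; have k0 := kap0; have [h _ _ _] := xi_seqP kap0 (a_kap Js) (b_kap Js).
have w1 : V s 1 = 0%:E by rewrite Defs.val1.
rewrite /g' addrC; apply: (valD_fin w1 k0); apply: vgeD.
  apply: vgeM0r; last by apply: vgeX0; apply: h.
  by apply: vgeM0; [exact: vge_nat | exact: b_kap].
apply: vgeM0r; last exact: h.
by apply: vgeM0; [exact: vge_nat | exact: a_kap].
Qed.

Let g'0 n : g' (x1 n) != 0.
Proof. exact: val_fin_neq0 (g'1 n Js0). Qed.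

Let cst m : good V J (fun=> m). Proof. exact: good_cst (bd m). Qed.

Let g'_good : good V J (fun n => g' (x1 n)).
Proof.
have h : good V J (fun n => 3 * b' * (x1 n * x1 n) + 2 * a' * x1 n + 1).
  by apply: goodD => //; apply: goodD; apply: goodM => //; apply: goodM.
by apply: good_ext h => n; rewrite /g' expr2.
Qed.

Let g'V_good : good V J (fun n => (g' (x1 n))^-1).
Proof.
apply: goodV => //; exists 0 => n s Js.
by rewrite (vge_fin _ (valV_fin (g'1 n Js))) oppr0.
Qed.

Let S_bound : exists r0 : R, forall s, J s -> forall n,
  vge (V s) r0 (S n) /\ (forall m, (n <= m)%N -> vge (V s) (n.+1%:R * e + r0) (S m - S n)) /\
  vge (V s) (n.+1%:R * e + 2 * r0) (S n ^+ 2 - psi (disc a b)).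
Proof.
have [K hK] := bd sq; exists K => s Js n.
have [r hr] := val_fin (V s) sq0.
have Kr : K <= r by have := hK s Js; rewrite (vge_fin _ hr).
have [h1 h2 h3] := sqrt_seqP e0 (V2 Js) sq0 (sq_near Js) hr.
split; first by apply: vgeW (h1 n).
split; first by move=> m nm; apply: vgeW (h2 _ _ nm); lra.
by apply: vgeW (h3 n); lra.
Qed.

Let S_good : good V J S.
Proof.
have [r0 h] := S_bound; split; first by exists r0 => n s Js; have [] := h s Js n.
apply: (@cauchy_of e r0) => // s Js n m nm.
by have [_ []] := h s Js n => + _; apply.
Qed.

Let S2_null : null V J (fun n => S n ^+ 2 - psi (disc a b)).
Proof.
move=> B; have [r0 h] := S_bound; have [N hN] := growth (B - 2 * r0) e0.
exists N => n s n1 Js; have [_ [_]] := h s Js n; apply: vgeW.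
by have := hN n n1; lra.
Qed.

Let x2_good eps : good V J (x2 eps).
Proof.
rewrite /x2; apply: goodM => //; apply: goodD.
  by apply: goodN; apply: goodD => //; apply: goodM.
exact: goodM (cst eps) (goodM S_good g'V_good).
Qed.

(** The error of [x2] in the discriminant of the quadratic factor. *)
Let cofactor n := (x2 1 n - x2 (-1) n) ^+ 2 * b' ^+ 2
  - ((a' + b' * x1 n) ^+ 2 - 4 * b' * (1 + a' * x1 n + b' * x1 n ^+ 2)).

Let psi_disc : psi (disc a b) = disc a' b'.
Proof. by rewrite /disc /a' /b'; ring. Qed.

Let cofactorE n : let x := x1 n in cofactor n =
  (S n ^+ 2 - psi (disc a b)) * ((g' x)^-1) ^+ 2
  - (b' * x ^+ 3 + a' * x ^+ 2 + x + 1) *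
    ((- 27 * b' ^+ 3 * x ^+ 3 - 27 * a' * b' ^+ 2 * x ^+ 2 - 27 * b' ^+ 2 * x
     + 4 * a' ^+ 3 - 18 * a' * b' + 27 * b' ^+ 2) * ((g' x)^-1) ^+ 2).
Proof.
move=> x; have := g'0 n; rewrite /cofactor /x2 -/x => hg; rewrite psi_disc /disc.
have -> : (- (a' + b' * x) + 1 * (S n / g' x)) / (2 * b')
   - (- (a' + b' * x) + -1 * (S n / g' x)) / (2 * b') = S n / g' x / b'.
  by field; rewrite hg two0 b'0.
rewrite /g' in hg *; clearbody x; move: (S n) => s.
by field; rewrite hg b'0.
Qed.

Let cofactor_null : null V J cofactor.
Proof.
have gg : bddb V J (fun n => ((g' (x1 n))^-1) ^+ 2).
  by have [] := goodM g'V_good g'V_good.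
have x2g := goodM x1_good x1_good; have x3g := goodM x2g x1_good.
pose P n := - 27 * b' ^+ 3 * x1 n ^+ 3 - 27 * a' * b' ^+ 2 * x1 n ^+ 2 - 27 * b' ^+ 2 * x1 n
     + 4 * a' ^+ 3 - 18 * a' * b' + 27 * b' ^+ 2.
have Pg : good V J P.
  have h : good V J (fun n => - 27 * b' ^+ 3 * (x1 n * x1 n * x1 n)
    - 27 * a' * b' ^+ 2 * (x1 n * x1 n) - 27 * b' ^+ 2 * x1 n
     + 4 * a' ^+ 3 - 18 * a' * b' + 27 * b' ^+ 2).
    apply: goodD => //; apply: goodB => //; apply: goodD => //.
    by apply: goodB; [apply: goodB|]; apply: goodM.
  by apply: good_ext h => n; rewrite /P; ring.
have Qg : bddb V J (fun n => - (P n * ((g' (x1 n))^-1) ^+ 2)).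
  by have [] := goodN (goodM Pg (goodM g'V_good g'V_good)).
apply: (null_ext _ (nullD (nullMg gg S2_null) (nullMg Qg gx1_null))) => n.
by rewrite cofactorE /P /=; ring.
Qed.

Let x2_eq (eps : M) n : eps ^+ 2 = 1 ->
  b' * x2 eps n ^+ 3 + a' * x2 eps n ^+ 2 + x2 eps n + 1 =
  (x2 eps n - x1 n) * (4 * b')^-1 * cofactor n +
  (b' * x1 n ^+ 3 + a' * x1 n ^+ 2 + x1 n + 1).
Proof.
move=> heps.
have E1 (A B X Y T : M) : B != 0 -> T = (- (A + B * X) + eps * Y) / (2 * B) ->
  B * T ^+ 3 + A * T ^+ 2 + T + 1 = (T - X) * (4 * B)^-1 *
   (((- (A + B * X) + 1 * Y) / (2 * B) - (- (A + B * X) + -1 * Y) / (2 * B)) ^+ 2 * B ^+ 2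
    - ((A + B * X) ^+ 2 - 4 * B * (1 + A * X + B * X ^+ 2))) +
   (B * X ^+ 3 + A * X ^+ 2 + X + 1).
  move=> B0 TE.
  have -> : ((- (A + B * X) + 1 * Y) / (2 * B) - (- (A + B * X) + -1 * Y) / (2 * B)) ^+ 2
     * B ^+ 2 = eps ^+ 2 * Y ^+ 2.
    by rewrite heps; field; rewrite two0 B0.
  have -> : eps ^+ 2 * Y ^+ 2 = (2 * B * T + A + B * X) ^+ 2.
    by rewrite TE; field; rewrite two0 B0.
  by field; rewrite four0 B0.
exact: E1.
Qed.

Let x2_null eps : eps ^+ 2 = 1 ->
  null V J (fun n => b' * x2 eps n ^+ 3 + a' * x2 eps n ^+ 2 + x2 eps n + 1).
Proof.
move=> heps.
have h : bddb V J (fun n => (x2 eps n - x1 n) * (4 * b')^-1).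
  by have [] := goodM (goodB (x2_good eps) x1_good) (cst (4 * b')^-1).
by apply: (null_ext _ (nullD (nullMg h cofactor_null) gx1_null)) => n; rewrite x2_eq.
Qed.

Let branch_valuation u : good V J u ->
  null V J (fun n => b' * u n ^+ 3 + a' * u n ^+ 2 + u n + 1) ->
  exists W : R -> valuation R E, forall G, (map_poly iota G).[xi] != 0 ->
    exists N : nat, forall n s, (N <= n)%N -> J s ->
    W s (map_poly iota G).[xi] = V s (map_poly psi G).[u n].
Proof.
move=> gu nu; apply: (@limit_valuation_field _ _ _ _ iota xi g g_irr _ V J s0 psi u) => //.
  by rewrite map_g.
by apply: null_ext nu => n; rewrite map_g.
Qed.

Variables (L : fieldType) (eL : {rmorphism E -> L}) (fL : {rmorphism M -> L}).
Variables (eta : valuation R E) (w : valuation R L).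
Hypothesis compat : forall h, fL (psi h) = eL (iota h).
Hypothesis w_eta : forall x, w (eL x) = eta x.
Hypothesis w_V : forall m, w (fL m) = V s0 m.

Let P0 : set R := [set 0].
Let W0 (_ : R) := w.

Let good_fL u : good V J u -> good W0 P0 (fun n => fL (u n)).
Proof.
have E1 (B : R) m : vge w B (fL m) = vge (V s0) B m by rewrite /vge w_V.
move=> [[K hK] hu]; split; first by exists K => n s _; rewrite /W0 E1; apply: hK.
move=> B; have [N hN] := hu B; exists N => n m s n1 m1 _.
by rewrite /W0 -rmorphB E1; apply: hN.
Qed.

Let null_fL u : null V J u -> null W0 P0 (fun n => fL (u n)).
Proof.
have E1 (B : R) m : vge w B (fL m) = vge (V s0) B m by rewrite /vge w_V.
move=> hu B; have [N hN] := hu B; exists N => n s n1 _.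
by rewrite /W0 E1; apply: hN.
Qed.

(** Here there is only one valuation, so a Cauchy sequence which does not tend to
    0 is bounded away from it. *)
Let null_or_away u : good W0 P0 u -> null W0 P0 u \/ away W0 P0 u.
Proof.
move=> [_ hu]; have [h|h] := pselect (null W0 P0 u); [by left | right].
have [B hB] : exists B : R, ~ exists N : nat, forall n s, (N <= n)%N -> P0 s ->
    vge (W0 s) B (u n).
  by apply: contrapT => h'; apply: h => B; apply: contrapT => h''; apply: h'; exists B.
have [N hN] := hu B; exists N, B => n s n1 _ h1; apply: hB; exists N => m s' m1 Ps.
by apply: vge_near (hN m n s' m1 n1 Ps) h1.
Qed.

Let cstL l : good W0 P0 (fun=> l).
Proof.
apply: good_cst; have [->|/(val_fin w)[r hr]] := eqVneq l 0.
  by exists 0 => s _; rewrite vge0.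
by exists r => s _; apply: vge_self.
Qed.

Let away_mul u u' : away W0 P0 u -> away W0 P0 u' -> away W0 P0 (fun n => u n * u' n).
Proof.
move=> [N [K hK]] [N' [K' hK']]; exists (maxn N N'), (K + K') => n s.
rewrite geq_max => /andP[n1 n2] Ps; have := hK n s n1 Ps; have := hK' n s n2 Ps.
have [->|/(val_fin w)[r hr]] := eqVneq (u n) 0; first by rewrite vge0.
have [->|/(val_fin w)[r' hr']] := eqVneq (u' n) 0; first by rewrite vge0.
rewrite /W0 (vge_fin _ hr) (vge_fin _ hr') (vge_fin _ (valM_fin hr hr')).
move=> /negP; rewrite -ltNge => h1 /negP; rewrite -ltNge => h2 h3.
by have := ltrD h2 h1; rewrite ltNge h3.
Qed.

Let away_null u : away W0 P0 u -> null W0 P0 u -> False.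
Proof.
move=> [N [K hK]] /(_ K)[N' hN']; apply: (hK (maxn N N') 0) => //.
  exact: leq_maxl.
by apply: hN' => //; apply: leq_maxr.
Qed.

(** In [L] the product of the differences of [xi] with the three approximate roots
    tends to 0, so one of the factors does. *)
Let near_some : exists u, [/\ good V J u,
  null V J (fun n => b' * u n ^+ 3 + a' * u n ^+ 2 + u n + 1) &
  null W0 P0 (fun n => eL xi - fL (u n))].
Proof.
pose d (u : nat -> M) n := eL xi - fL (u n).
have dg u : good V J u -> good W0 P0 (d u).
  by move=> hu; apply: goodB => //; apply: good_fL.
have one2 : (1 : M) ^+ 2 = 1 by rewrite expr1n.
have mone2 : (-1 : M) ^+ 2 = 1 by rewrite sqrrN expr1n.
have [h1|h1] := null_or_away (dg _ x1_good); first by exists x1.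
have [h2|h2] := null_or_away (dg _ (x2_good 1)).
  by exists (x2 1); split=> //; apply: x2_null.
have [h3|h3] := null_or_away (dg _ (x2_good (-1))).
  by exists (x2 (-1)); split=> //; apply: x2_null.
exfalso; apply: (away_null (away_mul (away_mul h1 h2) h3)).
have fb : fL b' != 0 by rewrite fmorph_eq0.
have fb4 : fL (4 * b' ^+ 2) != 0 by rewrite fmorph_eq0 mulf_neq0 // expf_neq0.
have gL : fL b' * eL xi ^+ 3 + fL a' * eL xi ^+ 2 + eL xi + 1 = 0.
  by rewrite !compat -!rmorphXn -!rmorphM -!rmorphD -(rmorph1 eL) -rmorphD g_xi rmorph0.
pose gx n := fL (b' * x1 n ^+ 3 + a' * x1 n ^+ 2 + x1 n + 1).
have n1 : null W0 P0 (fun n => - fL (b'^-1) * gx n).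
  exact: nullMg (cstL _).1 (null_fL gx1_null).
have n2 : null W0 P0 (fun n => fL ((4 * b' ^+ 2)^-1) * d x1 n * - fL (cofactor n)).
  apply: nullMg; first by have [] := goodM (cstL (fL (4 * b' ^+ 2)^-1)) (dg _ x1_good).
  move=> B; have [N hN] := null_fL cofactor_null B; exists N => n s m1 Ps.
  by rewrite /W0 vgeN; apply: hN.
apply: (null_ext _ (nullD n1 n2)) => n; rewrite /gx /d.
have hg := g'0 n.
have E2 : forall (K : fieldType) (A B X1 Y c : K), B != 0 -> (4 : K) != 0 -> (2 : K) != 0 ->
    forall T, B * T ^+ 3 + A * T ^+ 2 + T + 1 = 0 ->
    (T - X1) * (T - (- (A + B * X1) + Y) / (2 * B)) * (T - (- (A + B * X1) - Y) / (2 * B)) =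
    - B^-1 * (B * X1 ^+ 3 + A * X1 ^+ 2 + X1 + 1) +
    (4 * B ^+ 2)^-1 * (T - X1) * - (Y ^+ 2 - ((A + B * X1) ^+ 2 - 4 * B * (1 + A * X1 + B * X1 ^+ 2))).
  move=> K A B X1 Y c B0 f0 t0 T hT.
  apply/eqP; rewrite -subr_eq0; apply/eqP.
  transitivity (B^-1 * (B * T ^+ 3 + A * T ^+ 2 + T + 1)); last by rewrite hT mulr0.
  by field; rewrite B0 f0 t0.
have L2 : (2 : L) != 0 by rewrite -(rmorph_nat fL) fmorph_eq0.
have L4 : (4 : L) != 0 by rewrite -(rmorph_nat fL) fmorph_eq0.
have cE : cofactor n = (S n / g' (x1 n)) ^+ 2
  - ((a' + b' * x1 n) ^+ 2 - 4 * b' * (1 + a' * x1 n + b' * x1 n ^+ 2)).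
  have E1 (A B X Y : M) : B != 0 ->
     ((- (A + B * X) + 1 * Y) / (2 * B) - (- (A + B * X) + -1 * Y) / (2 * B)) ^+ 2 * B ^+ 2 = Y ^+ 2.
    by move=> B0; field; rewrite two0 B0.
  by rewrite -(E1 a' b' (x1 n) _ b'0).
rewrite cE; have := E2 L (fL a') (fL b') (fL (x1 n)) (fL (S n / g' (x1 n))) 0 fb L4 L2 _ gL.
have fx2 eps : fL (x2 eps n) = (- (fL a' + fL b' * fL (x1 n)) +
    fL eps * fL (S n / g' (x1 n))) / (2 * fL b').
  rewrite /x2; move: (x1 n) (S n / g' (x1 n)) => X Y.
  by rewrite fmorph_div rmorphD rmorphN rmorphD !rmorphM rmorph_nat.
rewrite !fx2 rmorph1 rmorphN1 mul1r mulN1r => ->.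
have e4 : fL (4 * b' ^+ 2)^-1 = (4 * fL b' ^+ 2)^-1 by rewrite fmorphV; congr (_^-1); ring.
rewrite e4 fmorphV; move: (S n / _) (fL b')^-1 (4 * fL b' ^+ 2)^-1 => Y i1 i4.
by ring.
Qed.

(** The family defined by the branch to which [xi] is close in [L] passes through
    the given extension [eta]. *)
Lemma lift_family : exists W : R -> valuation R E,
  [/\ forall x, W s0 x = eta x,
      forall x, x != 0 -> exists m, forall s, J s -> W s x = V s m &
      forall h s, J s -> W s (iota h) = V s (psi h)].
Proof.
have [u [gu nu nL]] := near_some.
have [W hW] := branch_valuation gu nu; exists W.
have fGg G : good W0 P0 (fun n => fL (map_poly psi G).[u n]).
  elim/poly_ind: G => [|G c IH].
    by apply: good_ext (cstL 0) => n; rewrite rmorph0 horner0 rmorph0.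
  apply: (good_ext _ (goodD (goodM IH (good_fL gu)) (cstL (fL (psi c))))) => n.
  rewrite rmorphD rmorphM /= map_polyX map_polyC hornerD hornerM hornerX hornerC.
  by rewrite rmorphD rmorphM.
have near G : null W0 P0 (fun n => fL (map_poly psi G).[u n] - eL (map_poly iota G).[xi]).
  elim/poly_ind: G => [|G c IH].
    move=> B; exists 0%N => n s _ _.
    by rewrite !rmorph0 !horner0 !rmorph0 subrr vge0.
  have h1 := nullMg (cstL (eL xi)).1 IH.
  have h2 : null W0 P0 (fun n => - fL (map_poly psi G).[u n] * (eL xi - fL (u n))).
    by apply: nullMg nL; have [] := goodN (fGg G).
  apply: (null_ext _ (nullD h1 h2)) => n.
  rewrite !rmorphD !rmorphM /= !map_polyX !map_polyC !hornerD !hornerM !hornerX !hornerC.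
  by rewrite !rmorphD !rmorphM /= compat; ring.
split.
- move=> x; have [->|x0] := eqVneq x 0; first by rewrite !val0.
  have [G xG] := gen x; have G0 : (map_poly iota G).[xi] != 0 by rewrite -xG.
  have [N hN] := hW G G0; have [r hr] := val_fin eta x0.
  have hrL : w (eL x) = r%:E by rewrite w_eta.
  have [N' hN'] := near G (r + 1); pose n := maxn N N'.
  have h : w (fL (map_poly psi G).[u n]) = r%:E.
    apply: (valB_fin hrL (M := r + 1)); first by lra.
    by rewrite xG; apply: (hN' n 0) => //; apply: leq_maxr.
  by rewrite hr {1}xG (hN n s0) ?leq_maxl // -w_V.
- move=> x x0; have [G xG] := gen x.
  have G0 : (map_poly iota G).[xi] != 0 by rewrite -xG.
  have [N hN] := hW G G0; exists (map_poly psi G).[u N] => s Js.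
  by rewrite xG (hN N s).
move=> h s Js; have [->|h0] := eqVneq h 0; first by rewrite !rmorph0 !val0.
have [|N hN] := hW h%:P; first by rewrite map_polyC hornerC fmorph_eq0.
by have := hN N s (leqnn _) Js; rewrite !map_polyC !hornerC.
Qed.

End Branches.

(** * Approximation by algebraic constants *)

Section AlgClosure.
Variables (R : realType) (Kbar CK : fieldType) (vbar : valuation R Kbar).
Variables (v : valuation R CK) (j : {rmorphism Kbar -> CK}).
Hypothesis compl : is_completion vbar v j.

Lemma approx_alg (c : CK) (M : R) : exists b, vge v M (c - j b).
Proof. by have [_ _ /(_ c M)[b hb]] := compl; exists b; apply: ltW. Qed.

Lemma approx_alg_rel (c : CK) (M : R) : c != 0 ->
  exists b, [/\ b != 0, v (j b) = v c & vge v M (1 - j b / c)].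
Proof.
move=> c0; have [r hr] := val_fin v c0.
have [b hb] := approx_alg c (r + `|M| + 1).
have E : v (j b) = r%:E.
  apply: (valB_fin hr (M := r + `|M| + 1)); last by rewrite vgeBC.
  by have := normr_ge0 M; lra.
exists b; rewrite hr E; split=> //.
  by have := val_fin_neq0 E; rewrite fmorph_eq0.
have -> : 1 - j b / c = (c - j b) / c by field.
by rewrite (vgeMr _ _ hr); apply: vgeW hb; have := ler_norm M; lra.
Qed.

Lemma approx_alg_poly (p : {poly CK}) (M : R) :
  exists q : {poly Kbar}, forall k, vge v M (p - map_poly j q)`_k.
Proof.
have [f hf] := choice (fun k => approx_alg p`_k M).
exists (\poly_(k < size p) f k) => k; rewrite coefB coef_map coef_poly.
case: ltnP => h; first exact: hf.
have -> : p`_k - j 0 = 0 by rewrite nth_default // sub0r (rmorph0 j) oppr0.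
exact: vge0.
Qed.

End AlgClosure.

Section ValueGroup.
Variables (R : realType) (Kbar : closedFieldType) (CK : fieldType) (vbar : valuation R Kbar).
Variables (v : valuation R CK) (j : {rmorphism Kbar -> CK}).
Hypothesis compl : is_completion vbar v j.

Lemma closed_root n (b : Kbar) : (0 < n)%N -> exists d : Kbar, d ^+ n = b.
Proof.
move=> n0; have := @solve_monicpoly Kbar n (fun k => if k == 0%N then b else 0) n0.
case=> d hd; exists d; rewrite hd; case: n n0 {hd} => // n _.
by rewrite big_ord_recl /= expr0 mulr1 big1 ?addr0 // => k _; rewrite mul0r.
Qed.

(** [Kbar] is algebraically closed and has the same values. *)
Lemma value_group_div n (c : CK) : (0 < n)%N -> c != 0 ->
  exists (d : CK) (r : R), v d = r%:E /\ v c = (n%:R * r)%:E.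
Proof.
move=> n0 /(approx_alg_rel compl 0)[b [b0 hb _]].
have [d hd] := closed_root b n0.
have d0 : j d != 0.
  by rewrite fmorph_eq0; apply: contraNneq b0 => d0; rewrite -hd d0 expr0n gtn_eqF.
have [r hr] := val_fin v d0; exists (j d), r; split=> //.
by rewrite -hb -hd rmorphXn (valX_fin _ hr).
Qed.

Lemma value_group_root n (c : CK) : (0 < n)%N -> c != 0 ->
  exists d : CK, (0 < v (1 - d ^+ n / c)%R)%E.
Proof.
move=> n0 /(approx_alg_rel compl 1)[b [b0 hb h1]].
have [d hd] := closed_root b n0; exists (j d).
by rewrite -rmorphXn hd; apply: vge_gt h1.
Qed.

(** The value group is divisible and not zero. *)
Lemma value_group_dense (c0 : CK) (r0 : R) : v c0 = r0%:E -> r0 != 0 ->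
  forall r r' : R, r < r' -> exists (c : CK) (q : R), v c = q%:E /\ r < q < r'.
Proof.
move=> h0 r00 r r' rr'.
wlog r0p : c0 r0 h0 r00 / 0 < r0.
  move=> wl; case: (ltrgtP 0 r0) => h; first exact: (wl c0 r0).
    by apply: (wl c0^-1 (- r0)); rewrite ?oppr_eq0 ?oppr_gt0 // (valV_fin h0).
  by rewrite -h eqxx in r00.
have e0 : 0 < r' - r by lra.
have [n hn] := archi_ex e0 r0.
have [d [q [hd hq]]] := value_group_div (isT : (0 < n.+1)%N) (val_fin_neq0 h0).
have nR : 0 < n.+1%:R :> R by rewrite ltr0n.
have {}hq : r0 = n.+1%:R * q by move: hq; rewrite h0 => -[].
have q0 : 0 < q by rewrite hq pmulr_rgt0 in r0p.
have qr : q < r' - r by rewrite hq ltr_pM2l in hn.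
pose m := Num.floor (r / q) + 1.
have m1 : r / q < m%:~R by rewrite /m floorD1_gt.
have m2 : m%:~R <= r / q + 1 by rewrite /m intrD lerD2r floor_le.
exists (d ^ m), (m%:~R * q); split.
  case: (m) => k.
    by rewrite (valX_fin _ hd).
  by rewrite /exprz (valV_fin (valX_fin k.+1 hd)) NegzE rmorphN mulNr.
rewrite -ltr_pdivrMr // m1 /=.
apply: (@le_lt_trans _ _ (r + q)); last lra.
have -> : r + q = (r / q + 1) * q by field; rewrite gt_eqF.
by rewrite ler_pM2r.
Qed.

End ValueGroup.

Section DetectGauss.
Variables (R : realType) (Kbar : closedFieldType) (CK : fieldType) (vbar : valuation R Kbar).
Variables (v : valuation R CK) (j : {rmorphism Kbar -> CK}).
Hypothesis compl : is_completion vbar v j.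
Variables (L : fieldType) (w : valuation R L) (f : {rmorphism CK -> L}) (T : L) (rho : R).
Hypothesis w_cst : forall a, w (f a) = v a.

Lemma vge_horner_pge M p : (rho%:E <= w T)%E -> pge v rho M p -> vge w M (map_poly f p).[T].
Proof.
move=> ht hp; rewrite horner_coef; apply: vge_sum => k _.
rewrite coef_map; apply: vgeM' (_ : vge w (M - k%:R * rho) _) (vgeX k ht) _.
  by rewrite /vge w_cst; apply: hp.
lra.
Qed.

(** Over an algebraically closed field a valuation which is the Gauss valuation
    on linear polynomials is so on all polynomials, by factorization; the
    coefficients are first approximated by algebraic ones. *)
Lemma gval_detect :
  (forall a, w (T - f a)%R = Order.min rho%:E (v a)) ->
  forall p, w (map_poly f p).[T] = gval v rho p.
Proof.
move=> hw; pose e (p : {poly CK}) := (map_poly f p).[T].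
have eM p q : e (p * q) = e p * e q by rewrite /e rmorphM hornerM.
have eB p q : e (p - q) = e p - e q by rewrite /e rmorphB hornerD hornerN.
have eC a : e a%:P = f a by rewrite /e map_polyC hornerC.
have ht : w T = rho%:E.
  by rewrite -[T]subr0 -(rmorph0 f) hw val0 minEle leey.
have hlin a : w (e ('X - a%:P)) = gval v rho ('X - a%:P).
  rewrite eB eC {1}/e map_polyX hornerX hw; apply/esym/ereal_eq_thr => M.
  rewrite gval_geP le_min; split.
    move=> h; have := h 0; have := h 1.
    rewrite !coefB !coefX !coefC /= sub0r mul1r mul0r subr0 subr0 vgeN /vge => h1 ->.
    by move: h1; rewrite -/(vge _ _ _) (vge_fin _ (Defs.val1 v)) andbT lee_fin subr_le0.
  rewrite lee_fin => /andP[h1 h2] [|[|k]]; rewrite !coefB !coefX !coefC /= ?subrr ?vge0 //.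
    by rewrite sub0r mul0r subr0 vgeN.
  by rewrite mul1r subr0 (vge_fin _ (Defs.val1 v)) subr_le0.
have hcst a : w (e a%:P) = gval v rho a%:P.
  rewrite eC w_cst; apply/esym/ereal_eq_thr => M; rewrite gval_geP; split.
    by move=> /(_ 0); rewrite coefC /= mul0r subr0.
  by move=> h [|k]; rewrite coefC /= ?vge0 // mul0r subr0.
have halg (q : {poly Kbar}) : w (e (map_poly j q)) = gval v rho (map_poly j q).
  have [r ->] := closed_field_poly_normal q.
  rewrite map_polyZ rmorph_prod -mul_polyC eM gvalM Defs.valM hcst; congr (_ + _)%E.
  elim/big_rec: _ => [|a p _ IH]; first by rewrite -[1]/(1%:P) hcst.
  by rewrite eM gvalM Defs.valM IH rmorphB /= map_polyX map_polyC hlin.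
move=> p; rewrite -/(e p).
have [->|p0] := eqVneq p 0; first by rewrite -[0]/(0%:P) hcst.
have [_ [r [_ hpr hr]]] := gvalE v rho p0.
pose N := `|r| + 1 + (size p)%:R * `|rho|.
have [q' hq] := approx_alg_poly compl p N.
pose q := take_poly (size p) q'.
have hq' k : vge v N (p - map_poly j q)`_k.
  have := hq k; rewrite !coefB !coef_map coef_take_poly; case: ltnP => // h _.
  have -> : p`_k - j 0 = 0 by rewrite nth_default // sub0r (rmorph0 j) oppr0.
  by rewrite vge0.
have hp : pge v rho (r + 1) (p - map_poly j q).
  move=> k; have [h|h] := ltnP k (size p); last first.
    rewrite nth_default ?vge0 //; apply: leq_trans (size_polyD _ _) _.
    rewrite size_polyN geq_max h (leq_trans (size_poly _ _)) //.
    exact: leq_trans (size_take_poly _ _) h.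
  apply: vgeW (hq' k); rewrite /N.
  have h1 : k%:R * (- rho) <= (size p)%:R * `|rho|.
    apply: (@le_trans _ _ (k%:R * `|rho|)).
      by rewrite ler_wpM2l // -normrN ler_norm.
    by rewrite ler_wpM2r // ler_nat ltnW.
  by have := ler_norm r; lra.
have hN : pge v rho (r + 1) (map_poly j q - p) by move=> k; rewrite coefB vgeBC -coefB.
have e1 : gval v rho (map_poly j q) = r%:E.
  apply/ereal_eq_thr => M; rewrite gval_geP lee_fin; split=> [h|h].
    rewrite leNgt; apply/negP => rM.
    pose M' := Num.min M (r + 1).
    have : pge v rho M' p.
      rewrite -[p](subrK (map_poly j q)); apply: pgeD.
        by move=> k; apply: vgeW (hp k); rewrite lerD2r ge_min lexx orbT.
      by move=> k; apply: vgeW (h k); rewrite lerD2r ge_min lexx.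
    by rewrite -gval_geP hr lee_fin leNgt lt_min rM ltrDl ltr01.
  rewrite -[map_poly j q](subrK p); apply: pgeD.
    by move=> k; apply: vgeW (hN k); lra.
  by move=> k; apply: vgeW (hpr k); lra.
have e2 := halg q; rewrite e1 in e2.
rewrite hr; apply: (valB_fin e2 (M := r + 1)); first lra.
by rewrite -eB; apply: vge_horner_pge; rewrite ?ht.
Qed.

End DetectGauss.

Lemma gauss_detect (R : realType) (Kbar : closedFieldType) (CK : fieldType)
    (vbar : valuation R Kbar) (v : valuation R CK) (j : {rmorphism Kbar -> CK})
    (compl : is_completion vbar v j) (c : CK) (rho : R) (w : valuation R (ratfun CK)) :
  (forall a, w (ratC CK a) = v a) ->
  (forall a, w (tpar c - ratC CK a)%R = Order.min rho%:E (v a)) ->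
  forall f, w f = gauss v c rho f.
Proof.
move=> w_cst hw f; pose G := gauss v c rho.
have hpoly p : w (polyT c p) = G (polyT c p).
  by rewrite /G gaussE; apply: (gval_detect compl w_cst hw).
have [n [d [d0 ->]]] := polyTP c f.
have := Defs.valM w (polyT c n / polyT c d) (polyT c d).
have := Defs.valM G (polyT c n / polyT c d) (polyT c d).
rewrite divfK ?polyT_eq0 // !hpoly => ->.
have [r ->] : exists r, G (polyT c d) = r%:E by apply: val_fin; rewrite polyT_eq0.
have := @val_neqNy _ _ w (polyT c n / polyT c d).
have := @val_neqNy _ _ G (polyT c n / polyT c d).
rewrite -/G.
case: (w _) => [x||] //; case: (G _) => [x'||] // _ _ [].
by move=> /addIr ->.
Qed.

(** * The different in terms of a generator *)

Section CubicBasis.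
Variables (F E : fieldType) (iota : {rmorphism F -> E}) (z : E) (A B C : F).
Let p : {poly F} := 'X^3 + A%:P * 'X^2 + B%:P * 'X + C%:P.

Lemma size_cubic : size p = 4%N.
Proof.
rewrite /p -!addrA size_polyDl size_polyXn //.
rewrite addrA (leq_ltn_trans (size_polyD _ _)) // gtn_max (leq_ltn_trans (size_polyD _ _)) ?gtn_max.
  by rewrite (leq_ltn_trans (size_polyC_leq1 _)).
rewrite mul_polyC (leq_ltn_trans (size_scale_leq _ _)) ?size_polyXn //.
by rewrite mul_polyC (leq_ltn_trans (size_scale_leq _ _)) ?size_polyX.
Qed.

Lemma cubic_monic : p \is monic.
Proof.
rewrite monicE lead_coefE size_cubic /p !coefD !coefXn coefMX !mul_polyC coefZ coefXn !coefC /=.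
by rewrite mulr0 !addr0.
Qed.

Hypothesis pz : z ^+ 3 + iota A * z ^+ 2 + iota B * z + iota C = 0.

Lemma cubic_eval : (map_poly iota p).[z] = 0.
Proof.
rewrite /p !(rmorphD, rmorphM, rmorphXn) /= !map_polyX !map_polyC.
by rewrite !(hornerD, hornerM, horner_exp, hornerX, hornerC) -pz /=; ring.
Qed.

Lemma small_poly (q : {poly F}) : (size q <= 3)%N ->
  (map_poly iota q).[z] = iota q`_0 + iota q`_1 * z + iota q`_2 * z ^+ 2.
Proof.
move=> sq; rewrite (@horner_coef_wide _ 3) ?(leq_trans (size_poly _ _)) //.
by rewrite !big_ord_recr big_ord0 /= !coef_map add0r expr0 mulr1 expr1.
Qed.

Lemma cubic_gen : (forall x, exists q : {poly F}, x = (map_poly iota q).[z]) ->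
  forall x, exists x0 x1 x2, x = iota x0 + iota x1 * z + iota x2 * z ^+ 2.
Proof.
move=> gen x; have [q ->] := gen x.
have := divp_eq q p => ->; set r := q %% p.
have sr : (size r <= 3)%N by rewrite -ltnS -size_cubic ltn_modp -size_poly_eq0 size_cubic.
rewrite rmorphD rmorphM hornerD hornerM cubic_eval mulr0 add0r small_poly //.
by exists r`_0, r`_1, r`_2.
Qed.

Lemma cubic_free : irreducible_poly p ->
  forall x0 x1 x2, iota x0 + iota x1 * z + iota x2 * z ^+ 2 = 0 -> [/\ x0 = 0, x1 = 0 & x2 = 0].
Proof.
move=> irr x0 x1 x2 h; pose q := Poly [:: x0; x1; x2].
have sq : (size q <= 3)%N by apply: leq_trans (size_Poly _) _.
have hq : (map_poly iota q).[z] = 0 by rewrite small_poly // !coef_Poly.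
have q0 : q = 0.
  apply/eqP/negPn/negP => q0; have : coprimep p q.
    rewrite irreducible_poly_coprime //; apply/negP => /(dvdp_leq q0).
    by rewrite size_cubic => /leq_trans/(_ sq).
  move=> /Bezout_eq1_coprimepP[[U W] /= /(congr1 (fun r => (map_poly iota r).[z]))].
  rewrite rmorphD !rmorphM rmorph1 hornerD !hornerM cubic_eval hq !mulr0 addr0 hornerC.
  by move/eqP; rewrite eq_sym oner_eq0.
have := congr1 (fun r : {poly F} => (r`_0, r`_1, r`_2)) q0.
by rewrite !coef_Poly !coef0 /= => -[-> -> ->].
Qed.

End CubicBasis.

Section CubicDifferent.
Variables (R : realType) (F E H1 H2 : fieldType) (iota : {rmorphism F -> E}).
Variables (eta : valuation R E) (w1 : valuation R H1) (w2 : valuation R H2).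
Variables (i1 : {rmorphism F -> H1}) (i2 : {rmorphism E -> H2}) (g : {rmorphism H1 -> H2}).
Hypothesis compl1 : is_completion (fun f => eta (iota f)) w1 i1.
Hypothesis compl2 : is_completion eta w2 i2.
Hypothesis gi : forall f, g (i1 f) = i2 (iota f).
Hypothesis gv : forall a, w2 (g a) = w1 a.
Variables (z : E) (A B C m : F) (mu : R).
Hypothesis pz : z ^+ 3 + iota A * z ^+ 2 + iota B * z + iota C = 0.
Hypothesis gen : forall x, exists q : {poly F}, x = (map_poly iota q).[z].
Hypothesis m_val : eta (iota m) = mu%:E.
Hypothesis A_val : vge eta mu (iota A).
Hypothesis B_val : vge eta (2 * mu) (iota B).
Hypothesis C_val : vge eta (3 * mu) (iota C).
Hypothesis v3 : (0 < eta 3%R)%E.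

Let w := i2 (z / iota m).
Let a := i1 (A / m).
Let b := i1 (B / m ^+ 2).
Let c := i1 (C / m ^+ 3).

Let w1i f : w1 (i1 f) = eta (iota f).
Proof. by have [h _ _] := compl1; apply: h. Qed.

Let w2i x : w2 (i2 x) = eta x.
Proof. by have [h _ _] := compl2; apply: h. Qed.

Let m0 : m != 0.
Proof. by have := val_fin_neq0 m_val; rewrite fmorph_eq0. Qed.

Let mX n : eta (iota m ^+ n) = (n%:R * mu)%:E.
Proof. exact: valX_fin. Qed.

Let w1m M n f : vge w1 M (i1 (f / m ^+ n)) = vge eta (M + n%:R * mu) (iota f).
Proof. by rewrite /vge w1i fmorph_div rmorphXn -/(vge _ _ _) (vgeMr _ _ (mX n)). Qed.

Let a0 : vge w1 0 a.
Proof. by rewrite /a -[m in A / m]expr1 w1m add0r mul1r. Qed.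

Let b0 : vge w1 0 b.
Proof. by rewrite /b w1m add0r. Qed.

Let c0 : vge w1 0 c.
Proof. by rewrite /c w1m add0r. Qed.

Let pw : w ^+ 3 + g a * w ^+ 2 + g b * w + g c = 0.
Proof.
rewrite /a /b /c !gi /w -!rmorphXn -!rmorphM -!rmorphD.
have := fmorph_eq0 iota m; rewrite (negbTE m0) => /negbT im0.
have -> : (z / iota m) ^+ 3 + iota (A / m) * (z / iota m) ^+ 2 +
    iota (B / m ^+ 2) * (z / iota m) + iota (C / m ^+ 3) =
    (z ^+ 3 + iota A * z ^+ 2 + iota B * z + iota C) / iota m ^+ 3.
  by rewrite !fmorph_div !rmorphXn /=; field.
by rewrite pz mul0r rmorph0.
Qed.

Let w_int : vge w2 0 w.
Proof.
have [->|w0] := eqVneq w 0; first exact: vge0.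
have [r hr] := val_fin w2 w0; rewrite (vge_fin _ hr) leNgt; apply/negP => r0.
have h3 : w2 (w ^+ 3) = (3 * r)%:E by rewrite (valX_fin 3 hr).
have : vge w2 (2 * r) (w ^+ 3).
  have -> : w ^+ 3 = - (g a * w ^+ 2 + g b * w + g c).
    by apply/eqP; rewrite -addr_eq0 !addrA pw.
  rewrite vgeN; apply: vgeD; first apply: vgeD.
  - by apply: vgeM0; [rewrite /vge gv | apply: vgeX (vge_self hr)].
  - apply: vgeM0; [by rewrite /vge gv | apply: vgeW (vge_self hr); lra].
  - apply: vgeW (_ : vge w2 0 _); [lra | by rewrite /vge gv].
by rewrite (vge_fin _ h3); lra.
Qed.

Let w_spans : spans g i2 w.
Proof.
move=> x; have [q ->] := gen x; exists (map_poly i1 (q \Po (m *: 'X))).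
rewrite -map_poly_comp (eq_map_poly (gi : g \o i1 =1 i2 \o iota)) map_poly_comp.
rewrite -[w]/(i2 _) horner_map; congr (i2 _).
rewrite map_comp_poly horner_comp map_polyZ map_polyX hornerZ hornerX.
by rewrite mulrC divfK // fmorph_eq0.
Qed.

Let cw1 : complete_valuation w1.
Proof. by have [] := compl1. Qed.

Let dens2 : forall (h : H2) (M : R), exists x : E, (M%:E < w2 (h - i2 x)%R)%E.
Proof. by have [] := compl2. Qed.

Let w3 : (0 < w1 3%R)%E.
Proof. by have := v3; rewrite -(rmorph_nat iota 3) -w1i rmorph_nat. Qed.

Let w1a : w1 a = (eta (iota A) - mu%:E)%E.
Proof. by rewrite /a w1i fmorph_div Defs.valM (valV_fin m_val). Qed.

Let w1b : w1 b = (eta (iota B) - (2 * mu)%:E)%E.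
Proof. by rewrite /b w1i fmorph_div rmorphXn Defs.valM (valV_fin (mX 2)). Qed.

Lemma different_noncube_case :
  (forall f, f != 0 -> exists (c : F) (r : R),
     eta (iota c) = r%:E /\ eta (iota f) = (2 * r)%:E) ->
  ~ ((mu%:E < eta (iota A))%E /\ ((2 * mu)%:E < eta (iota B))%E) ->
  log_different w1 w2 g = 0%E.
Proof.
move=> half hn; apply: (different_noncube gv cw1 dens2 w3 _ w_spans w_int a0 b0 c0 pw).
  move=> h h0; have [r hr] := val_fin w1 h0.
  have [_ _ /(_ h r)[f hf]] := compl1; have [r' hf' rr'] : exists2 r', vge w1 r' (h - i1 f) & r < r'.
    by have [r' ? ?] := vge_gt0 hf; exists r'.
  have hif : w1 (i1 f) = r%:E by apply: (valB_fin hr rr'); rewrite vgeBC.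
  have f0 : f != 0 by have := val_fin_neq0 hif; rewrite fmorph_eq0.
  have [d [s [hd hfs]]] := half f f0; exists (i1 d), s; rewrite w1i hd hr; split=> //.
  by rewrite -hif w1i hfs mulrDl mul1r.
by rewrite w1a w1b !sube_gt0.
Qed.

Lemma different_cube_case :
  (mu%:E < eta (iota A))%E -> ((2 * mu)%:E < eta (iota B))%E ->
  (forall x0 x1 x2 M, vge eta M (iota x0 + iota x1 * z + iota x2 * z ^+ 2) ->
     [/\ vge eta M (iota x0), vge eta (M - mu) (iota x1) & vge eta (M - 2 * mu) (iota x2)]) ->
  log_different w1 w2 g = ((3 / 2)%:E * mine (eta 3%R)
    (mine (eta (iota A) - mu%:E) (eta (iota B) - (2 * mu)%:E)))%E.
Proof.
move=> hA hB hor.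
have -> : eta 3%R = w1 3%R by rewrite -(rmorph_nat iota 3) -w1i rmorph_nat.
rewrite -w1a -w1b; apply: (different_orth gv cw1 dens2 w3 w_spans w_int a0 b0 c0 pw).
move=> q sq M hM.
have [f hf] := choice (fun k => let: And3 _ _ h := compl1 in h q`_k M).
have hf' k : vge w1 M (q`_k - i1 (f k)) by exact: ltW (hf k).
have h : vge eta M (iota (f 0%N) + iota (f 1%N / m) * z + iota (f 2%N / m ^+ 2) * z ^+ 2).
  rewrite /vge -w2i -/(vge _ _ _).
  apply: vge_near hM.
  rewrite (@horner_coef_wide _ 3) ?(leq_trans (size_poly _ _)) //.
  rewrite !big_ord_recr big_ord0 /= !coef_map add0r expr0 mulr1 expr1.
  have := fmorph_eq0 iota m; rewrite (negbTE m0) => /negbT im0.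
  have -> : iota (f 0%N) + iota (f 1%N / m) * z + iota (f 2%N / m ^+ 2) * z ^+ 2 =
    iota (f 0%N) + iota (f 1%N) * (z / iota m) + iota (f 2%N) * (z / iota m) ^+ 2.
    by rewrite !fmorph_div !rmorphXn /=; field.
  rewrite !(rmorphXn, rmorphD, rmorphM) /= -!gi -[i2 z * _]rmorphM -/w.
  set k0 := i1 (f 0%N); set k1 := i1 (f 1%N); set k2 := i1 (f 2%N).
  have -> : g k0 + g k1 * w + g k2 * w ^+ 2 - (g q`_0 + g q`_1 * w + g q`_2 * w ^+ 2) =
    g (k0 - q`_0) + g (k1 - q`_1) * w + g (k2 - q`_2) * w ^+ 2 by ring.
  have gk k : vge w2 M (g (i1 (f k) - q`_k)) by rewrite /vge gv -/(vge _ _ _) vgeBC.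
  apply: vgeD; first apply: vgeD; first exact: gk.
    by apply: vgeM0r => //; apply: gk.
  by apply: vgeM0r; rewrite ?vgeX0 // gk.
have [h0 h1 h2] := hor _ _ _ _ h.
have q_near k : vge w1 M (i1 (f k)) -> vge w1 M q`_k by apply: vge_near.
case=> [|[|[|k]]]; last by rewrite nth_default ?vge0 ?(leq_trans sq).
- by apply: q_near; rewrite /vge w1i.
- apply: q_near; rewrite /vge w1i; move: h1; rewrite fmorph_div (vgeMr _ _ m_val).
  by apply: vgeW; lra.
- apply: q_near; rewrite /vge w1i; move: h2; rewrite fmorph_div rmorphXn (vgeMr _ _ (mX 2)).
  by apply: vgeW; lra.
Qed.

End CubicDifferent.

Lemma cubic_const_neq0 (F : fieldType) (A B C : F) :
  irreducible_poly ('X^3 + A%:P * 'X^2 + B%:P * 'X + C%:P) -> C != 0.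
Proof.
move=> irr; apply/negP => /eqP C0; subst C.
have /irr.2 : 'X %| ('X^3 + A%:P * 'X^2 + B%:P * 'X + 0%:P : {poly F}).
  by apply/dvdpP; exists ('X^2 + A%:P * 'X + B%:P); rewrite polyC0; ring.
rewrite size_polyX => /(_ isT) /eqp_size.
by rewrite size_polyX size_cubic.
Qed.

(** * The formula at a Gauss valuation *)

Section Normal.
Variables (R : realType) (CK : fieldType) (v : valuation R CK) (x0 : CK).
Hypothesis v3 : (0 < v 3%R)%E.
Let w0 rho := gauss v x0 rho.

Lemma gauss_value rho (d : CK) f : v d = rho%:E -> f != 0 ->
  exists2 e : CK, e != 0 & w0 rho f = v e.
Proof.
move=> hd f0; have [n [m [m0 E]]] := polyTP x0 f.
have d0 := val_fin_neq0 hd.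
have gp (p : {poly CK}) : p != 0 -> exists2 e : CK, e != 0 & w0 rho (polyT x0 p) = v e.
  move=> p0; have [k [M [hk _ hM]]] := gvalE v rho p0.
  exists (p`_k * d ^+ k).
    by rewrite mulf_neq0 ?expf_neq0 //; apply: val_fin_neq0 hk.
  rewrite /w0 gaussE hM (valM_fin hk (valX_fin k hd)); congr _%:E; ring.
have n0 : n != 0.
  by apply: contraNneq f0 => n0; rewrite E n0 -[0]/(0%:P) polyTC rmorph0 mul0r.
have [e1 h1 E1] := gp n n0; have [e2 h2 E2] := gp m m0.
exists (e1 / e2); first by rewrite mulf_neq0 ?invr_eq0.
have [r1 hr1] := val_fin v h1; have [r2 hr2] := val_fin v h2.
rewrite (val_div_fin hr1 hr2) E; apply: val_div_fin; first by rewrite E1.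
by rewrite E2.
Qed.

Variables (c4 c2 c1 : CK).
Let Cp : {poly CK} := c4%:P * 'X^4 + c2%:P * 'X^2 + c1%:P * 'X.

Lemma normal_C : polyT x0 Cp =
  ratC CK c4 * tpar x0 ^+ 4 + ratC CK c2 * tpar x0 ^+ 2 + ratC CK c1 * tpar x0.
Proof. by rewrite /Cp !polyTD !(polyTXn, polyTM) !polyTX !polyTC. Qed.

Lemma normal_coef k : Cp`_k = if k == 4%N then c4 else if k == 2%N then c2 else
  if k == 1%N then c1 else 0.
Proof.
rewrite /Cp !coefD !mul_polyC !coefZ !coefXn coefX.
by case: k => [|[|[|[|[|k]]]]] /=; rewrite !(mulr0, mulr1, addr0, add0r).
Qed.

(** The exponents of [C] are prime to the residue characteristic 3. *)
Lemma normal_deriv rho lam : gval v rho Cp = lam%:E -> gval v rho Cp^`() = (lam - rho)%:E.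
Proof.
have v2 := val2 v3.
have v4 : v 4 = 0%E by rewrite -[4]/(2 * 2)%:R natrM Defs.valM v2 adde0.
move=> hC; have C0 : Cp != 0 by apply: contra_eq_neq hC => ->; rewrite gval0.
have [k [M [hk hM E]]] := gvalE v rho C0; move: E; rewrite hC => -[E]; subst M.
apply: (@gval_fin _ _ _ _ _ k.-1); last exact: pge_deriv.
have {hk} hk : v Cp`_k = (lam - k%:R * rho)%:E by [].
have ck0 := val_fin_neq0 hk.
move: ck0; rewrite normal_coef {hM} => ck0; move: ck0 hk.
case: k => [|[|[|[|[|k]]]]]; rewrite ?eqxx // => _ hk;
  rewrite coef_deriv -[Cp`__ *+ _]mulr_natr Defs.valM hk.
- by rewrite Defs.val1 adde0; congr _%:E; rewrite /=; ring.
- by rewrite v2 adde0; congr _%:E; rewrite /=; ring.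
- by rewrite v4 adde0; congr _%:E; rewrite /=; ring.
Qed.

Lemma normal_norm rho lam kap : 0 < kap -> vge v kap 3 ->
  w0 rho (polyT x0 Cp) = (3 * lam)%:E ->
  forall M y0 y1 y2, vge (w0 rho) (3 * M) (cube_norm (polyT x0 Cp) y0 y1 y2) ->
  [/\ vge (w0 rho) M y0, vge (w0 rho) (M - lam) y1 & vge (w0 rho) (M - 2 * lam) y2].
Proof.
rewrite /w0 gaussE => k0 k3 hC; apply: (cube_norm_gauss hC _ k0 k3).
exact: normal_deriv hC.
Qed.

Variables (A B : ratfun CK).
Let C := polyT x0 Cp.
Variables (E : fieldType) (iota : {rmorphism ratfun CK -> E}) (z : E).
Hypothesis irr : irreducible_poly ('X^3 + A%:P * 'X^2 + B%:P * 'X + C%:P).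
Hypothesis pz : z ^+ 3 + iota A * z ^+ 2 + iota B * z + iota C = 0.
Hypothesis gen : forall x, exists q : {poly ratfun CK}, x = (map_poly iota q).[z].

(** At radius [rho] the reduction of the scaled cubic is [T^3 + c] with [c]
    non-zero. *)
Definition cube_at rho lam := [/\ (lam%:E < w0 rho A)%E, ((2 * lam)%:E < w0 rho B)%E
  & w0 rho C = (3 * lam)%:E].

Lemma cube_kap rho lam : cube_at rho lam -> exists2 kap, 0 < kap &
  [/\ vge (w0 rho) (lam + kap) A, vge (w0 rho) (2 * lam + kap) B & vge v kap 3].
Proof.
move=> [/vge_gt0[a h1 ha] /vge_gt0[b h2 hb] _]; have [k3 h3 hk] := vge_gt0 v3.
exists (Num.min (a - lam) (Num.min (b - 2 * lam) k3)).
  by rewrite !lt_min !subr_gt0 h1 h2.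
have e1 : Num.min (a - lam) (Num.min (b - 2 * lam) k3) <= a - lam by rewrite ge_min lexx.
have e2 : Num.min (a - lam) (Num.min (b - 2 * lam) k3) <= b - 2 * lam.
  by rewrite !ge_min lexx orbT.
have e3 : Num.min (a - lam) (Num.min (b - 2 * lam) k3) <= k3 by rewrite !ge_min lexx !orbT.
by split; [apply: vgeW ha; lra | apply: vgeW hb; lra | apply: vgeW hk].
Qed.

Lemma cube_coords rho lam (eta : valuation R E) : cube_at rho lam ->
  (forall f, eta (iota f) = w0 rho f) ->
  forall y0 y1 y2 M, vge eta M (iota y0 + iota y1 * z + iota y2 * z ^+ 2) ->
     [/\ vge eta M (iota y0), vge eta (M - lam) (iota y1) & vge eta (M - 2 * lam) (iota y2)].
Proof.
move=> hc he y0 y1 y2 M; have [kap k0 [hA hB h3]] := cube_kap hc.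
have [_ _ hC] := hc.
have free := cubic_free pz irr.
have h3' : vge (w0 rho) kap 3.
  by rewrite /vge -(rmorph_nat (ratC CK) 3) gauss_C.
move=> /(cube_root_unique pz (cubic_gen pz gen) free k0 hA hB hC h3' (normal_norm k0 h3 hC) he).
move=> [z0 [z1 [z2 [/eqP]]]]; rewrite -subr_eq0.
have -> : iota y0 + iota y1 * z + iota y2 * z ^+ 2 -
   (iota z0 + iota z1 * z + iota z2 * z ^+ 2) =
   iota (y0 - z0) + iota (y1 - z1) * z + iota (y2 - z2) * z ^+ 2.
  by rewrite !rmorphB /=; ring.
move=> /eqP /free [/eqP h0 /eqP h1 /eqP h2].
move: h0 h1 h2; rewrite !subr_eq0 => /eqP -> /eqP -> /eqP ->.
by rewrite /vge !he.
Qed.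

Variables (rho : R) (eta : valuation R E).
Hypothesis eta_iota : forall f, eta (iota f) = w0 rho f.
Variables (H1 H2 : fieldType) (w1 : valuation R H1) (w2 : valuation R H2).
Variables (i1 : {rmorphism ratfun CK -> H1}) (i2 : {rmorphism E -> H2}).
Variables (g : {rmorphism H1 -> H2}).
Hypothesis compl1 : is_completion (phi_an iota eta) w1 i1.
Hypothesis compl2 : is_completion eta w2 i2.
Hypothesis gi : forall f, g (i1 f) = i2 (iota f).
Hypothesis gv : forall a, w2 (g a) = w1 a.
Hypothesis divisible : forall n (c : CK), (0 < n)%N -> c != 0 ->
  exists (d : CK) (r : R), v d = r%:E /\ v c = (n%:R * r)%:E.
Variable (d : CK).
Hypothesis rho_val : v d = rho%:E.

Let half f : f != 0 -> exists (c : ratfun CK) (r : R),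
  eta (iota c) = r%:E /\ eta (iota f) = (2 * r)%:E.
Proof.
move=> f0; have [e e0 he] := gauss_value rho_val f0.
have [d' [r [h1 h2]]] := divisible (isT : (0 < 2)%N) e0.
by exists (ratC CK d'), r; rewrite !eta_iota he /w0 gauss_C.
Qed.

(** The minimum [mu] of v(A), v(B)/2, v(C)/3 is the value of a constant because
    the value group is divisible. *)
Let has_min : exists (m : CK) (mu : R), [/\ v m = mu%:E, vge (w0 rho) mu A,
   vge (w0 rho) (2 * mu) B, vge (w0 rho) (3 * mu) C &
   [\/ w0 rho A = mu%:E, w0 rho B = (2 * mu)%:E | w0 rho C = (3 * mu)%:E]].
Proof.
have C0 : C != 0 := cubic_const_neq0 irr.
have val_n n f : (0 < n)%N -> f != 0 -> exists (m : CK) (mu : R), v m = mu%:E /\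
    w0 rho f = (n%:R * mu)%:E.
  move=> n0 f0; have [e e0 he] := gauss_value rho_val f0.
  by have [m [mu [h1 h2]]] := divisible n0 e0; exists m, mu; rewrite he.
have [m3 [l3 [h3 hC]]] := val_n 3%N C isT C0.
have [m2 [l2 [h2 hB hB']]] : exists (m : CK) (mu : R), [/\ v m = mu%:E,
    vge (w0 rho) (2 * mu) B & mu < l3 -> w0 rho B = (2 * mu)%:E].
  have [->|B0] := eqVneq B 0; first by exists m3, l3; rewrite vge0 ltxx.
  have [m [mu [h1 h2]]] := val_n 2%N B isT B0.
  by exists m, mu; split=> //; rewrite (vge_fin _ h2).
have [m1 [l1 [h1 hA hA']]] : exists (m : CK) (mu : R), [/\ v m = mu%:E,
    vge (w0 rho) mu A & mu < l3 -> w0 rho A = mu%:E].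
  have [->|A0] := eqVneq A 0; first by exists m3, l3; rewrite vge0 ltxx.
  have [m [mu [h1' h2']]] := val_n 1%N A isT A0; rewrite mul1r in h2'.
  by exists m, mu; split=> //; rewrite (vge_fin _ h2').
have hC' mu : mu <= l3 -> vge (w0 rho) (3 * mu) C.
  by move=> h; rewrite (vge_fin _ hC) ler_pM2l.
have [a1|a1] := ltP l1 l3; have [a2|a2] := ltP l1 l2.
- exists m1, l1; split; rewrite ?hC' ?(ltW a1) ?hA' //; last by constructor 1.
  by apply: vgeW hB; lra.
- have a3 := le_lt_trans a2 a1.
  exists m2, l2; split; rewrite ?hC' ?hB' ?(ltW a3) //; last by constructor 2.
  by apply: vgeW hA.
- have a3 : l3 <= l2 := le_trans a1 (ltW a2).
  exists m3, l3; split; rewrite ?hC' //; last by constructor 3.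
    exact: vgeW hA.
  by apply: vgeW hB; lra.
have [a3|a3] := ltP l2 l3.
  exists m2, l2; split; rewrite ?hC' ?hB' ?(ltW a3) //; last by constructor 2.
  by apply: vgeW hA; lra.
exists m3, l3; split; rewrite ?hC' //; last by constructor 3.
  exact: vgeW hA.
by apply: vgeW hB; lra.
Qed.

(** If the scaled cubic does not reduce to a cube, one of the terms with [A] and
    [B] in the formula is at most 0. *)
Lemma different_at_gauss :
  log_different w1 w2 g = different_formula (v 3) A B C (w0 rho).
Proof.
have [m [mu [hm hA hB hC hmin]]] := has_min.
have C0 : C != 0 := cubic_const_neq0 irr.
have [r hr] := val_fin (w0 rho) C0.
have r3 : 3 * mu <= r by rewrite -(vge_fin _ hr).
have eC : vge eta (3 * mu) (iota C) by rewrite /vge eta_iota.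
have eA : vge eta mu (iota A) by rewrite /vge eta_iota.
have eB : vge eta (2 * mu) (iota B) by rewrite /vge eta_iota.
have em : eta (iota (ratC CK m)) = mu%:E by rewrite eta_iota /w0 gauss_C.
have e3 : eta 3 = v 3 by rewrite -(rmorph_nat (iota \o ratC CK) 3) /= eta_iota /w0 gauss_C.
have e3' : (0 < eta 3%R)%E by rewrite e3.
rewrite /different_formula hr.
have [[a1 a2]|hn] := pselect ((mu%:E < eta (iota A))%E /\ ((2 * mu)%:E < eta (iota B))%E); last first.
  rewrite (different_noncube_case compl1 compl2 gi gv pz gen em eA eB eC e3' half hn).
  apply/esym/max_idPl; rewrite !ge_min; apply/orP; right.
  have [h|h] := pselect (mu%:E < eta (iota A))%E; last first.
    have -> : w0 rho A = mu%:E by apply/eqP; rewrite eq_le (hA : (_ <= _)%E) andbT -eta_iota leNgt; apply/negP.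
    by rewrite -!EFinM -EFinB lee_fin; apply/orP; left; lra.
  have -> : w0 rho B = (2 * mu)%:E.
    apply/eqP; rewrite eq_le (hB : (_ <= _)%E) andbT -eta_iota leNgt; apply/negP => h'; exact: hn.
  by rewrite -!EFinM -EFinB lee_fin; apply/orP; right; lra.
have hCr : r = 3 * mu.
  case: hmin => h; last by move: h; rewrite hr => -[].
    by rewrite eta_iota h ltxx in a1.
  by rewrite eta_iota h ltxx in a2.
have hcube : cube_at rho mu by split; rewrite -?eta_iota // eta_iota hr hCr.
rewrite (different_cube_case compl1 compl2 gi gv pz gen em eA eB eC e3' a1 a2); last first.
  exact: cube_coords hcube eta_iota.
rewrite !eta_iota e3 hCr.
have a1' : (mu%:E < w0 rho A)%E by rewrite -eta_iota.
have a2' : ((2 * mu)%:E < w0 rho B)%E by rewrite -eta_iota.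
have k0 : (0 : R) < 3 / 2 by lra.
have k0' : (0 <= (3 / 2)%:E :> \bar R)%E by rewrite lee_fin ltW.
rewrite !mine_pMr //.
have -> : ((3 / 2)%:E * w0 rho A - (1 / 2)%:E * (3 * mu)%:E = (3 / 2)%:E * (w0 rho A - mu%:E))%E.
  move: a1'; case: (w0 rho A) => [s||] // _.
    by rewrite -!(EFinM, EFinB); congr _%:E; ring.
  by rewrite gt0_muley ?lte_fin.
have -> : ((3 / 2)%:E * w0 rho B - (3 * mu)%:E = (3 / 2)%:E * (w0 rho B - (2 * mu)%:E))%E.
  move: a2'; case: (w0 rho B) => [s||] // _.
    by rewrite -!(EFinM, EFinB); congr _%:E; field.
  by rewrite gt0_muley ?lte_fin.
apply/esym/max_idPr; rewrite !le_min; apply/and3P; split; apply: mule_ge0 => //.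
- exact: ltW.
- by rewrite sube_ge0 // ltW.
- by rewrite sube_ge0 // ltW.
Qed.

End Normal.


(** * Rational functions and residue fields *)

Section FractionLift.
Variables (C M : fieldType) (h : {rmorphism {poly C} -> M}).
Hypothesis h_inj : forall p, p != 0 -> h p != 0.

Lemma ratfun_lift : exists f : {rmorphism ratfun C -> M}, forall p, f (tofrac p) = h p.
Proof.
have ex (x : ratfun C) : exists y : M, forall n d : {poly C}, d != 0 ->
    x = tofrac n / tofrac d -> y = h n / h d.
  have [n [d [d0 ->]]] := ratfunP x; exists (h n / h d) => n' d' d0' /eqP.
  rewrite eqr_div ?tofrac_eq0 // -!rmorphM tofrac_eq => /eqP e.
  by apply/eqP; rewrite eqr_div ?h_inj // -!rmorphM e.
have [f hf] := choice ex.
have fE n d : d != 0 -> f (tofrac n / tofrac d) = h n / h d by move=> d0; apply: hf.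
have f0 p : f (tofrac p) = h p.
  by have := @fE p 1 (oner_neq0 _); rewrite !rmorph1 !divr1.
have fB : GRing.Theory.zmod_morphism f.
  move=> x y; have [n [d [d0 ->]]] := ratfunP x; have [m [e [e0 ->]]] := ratfunP y.
  have -> : (tofrac n / tofrac d - tofrac m / tofrac e : ratfun C) =
      tofrac (n * e + (- m) * d) / tofrac (d * e).
    by rewrite -mulNr addf_div ?tofrac_eq0 // !rmorphD !rmorphM rmorphN.
  rewrite !fE ?mulf_neq0 // rmorphD !rmorphM rmorphN.
  by field; rewrite !h_inj.
have fM : GRing.Theory.monoid_morphism f.
  split=> [|x y]; first by have := f0 1; rewrite !rmorph1.
  have [n [d [d0 ->]]] := ratfunP x; have [m [e [e0 ->]]] := ratfunP y.
  by rewrite mulf_div -!rmorphM !fE ?mulf_neq0 // mulf_div !rmorphM.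
have [g hg] := rmorph_lift fB fM.
by exists g => p; rewrite hg f0.
Qed.

End FractionLift.

Lemma clear_denom_step (K : comNzRingType) (D E E' p X N : K) : E * E' = 1 ->
  D * E * (p * X + N * E') = E * (D * p) * X + D * N.
Proof. by move=> h; rewrite -[D * N]mulr1 -h; ring. Qed.

Lemma clear_denom (C : fieldType) (p : {poly ratfun C}) : exists (d : {poly C}) (P : {poly {poly C}}),
  d != 0 /\ (tofrac d)%:P * p = map_poly (@tofrac {poly C}) P.
Proof.
elim/poly_ind: p => [|p c [d [P [d0 hP]]]].
  by exists 1, 0; rewrite oner_neq0 mulr0 rmorph0.
have [n [e [e0 ->]]] := ratfunP c.
exists (d * e), (e%:P * P * 'X + (d * n)%:P); split; first by rewrite mulf_neq0.
rewrite !(rmorphD, rmorphM) /= map_polyX !map_polyC /= -hP.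
apply: clear_denom_step.
by rewrite -(polyCM (tofrac e)) mulfV ?tofrac_eq0.
Qed.

Local Open Scope quotient_scope.

Section ResidueField.
Variables (R : realType) (F : fieldType) (w : valuation R F).

Definition maxideal : {pred valring w} := [pred x | (0 < w (val x))%E].

Lemma maxideal_closed : idealr_closed maxideal.
Proof.
split; first by rewrite inE /= val0 lt0y.
  by rewrite inE /= Defs.val1 ltxx.
move=> a x y; rewrite !inE /= => hx hy.
have [m m0 hm] := vge_gt0 hx; have [n n0 hn] := vge_gt0 hy.
pose k := Num.min m n.
have k0 : 0 < k by rewrite lt_min m0 n0.
apply: (vge_gt k0); apply: vgeD.
  apply: vgeM0; first exact: valring_ge.
  by apply: vgeW hm; rewrite ge_min lexx.
by apply: vgeW hn; rewrite ge_min lexx orbT.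
Qed.

HB.instance Definition _ := isIdealr.Build (valring w) maxideal maxideal_closed.

Definition resfield := {ideal_quot maxideal}.
HB.instance Definition _ := GRing.ComNzRing.on resfield.

Definition resinv (x : resfield) : resfield := xget 0 [set y | y * x = 1].

Definition resproj : {rmorphism valring w -> resfield} := \pi_(resfield).

Lemma resproj_eq0 x : resproj x = 0 <-> (0 < w (val x))%E.
Proof.
rewrite -(rmorph0 resproj); split=> [/eqmodP|h].
  by rewrite /= Quotient.equivE subr0.
by apply/eqmodP; rewrite /= Quotient.equivE subr0.
Qed.

Lemma resproj_surj a : exists x, resproj x = a.
Proof. by exists (repr a); rewrite /resproj /= reprK. Qed.

Lemma resinvP x : x != 0 -> resinv x * x = 1.
Proof.
have [a <-] := resproj_surj x => /eqP/resproj_eq0 h.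
have ha : w (val a) = 0%E.
  by apply/eqP; rewrite eq_le valring_ge andbT leNgt; apply/negP.
have a0 : val a != 0 := val_fin_neq0 ha.
have hi : (val a)^-1 \in valring_pred w by rewrite inE (valV_fin ha) oppr0.
apply: (@xgetPex _ 0 [set y | y * resproj a = 1]).
exists (resproj (Valring hi)); rewrite /= -rmorphM -[RHS](rmorph1 resproj).
by congr (resproj _); apply: val_inj; rewrite /= mulVf.
Qed.

Lemma resinv0 : resinv 0 = 0.
Proof.
rewrite /resinv; case: xgetP => // y _ /=.
by rewrite mulr0 => /esym/eqP; rewrite oner_eq0.
Qed.

HB.instance Definition _ := GRing.ComNzRing_isField.Build resfield resinvP resinv0.

End ResidueField.

Lemma residue_field_exists (R : realType) (F : fieldType) (w : valuation R F) :
  exists (k : fieldType) (res : {rmorphism valring w -> k}), is_residue_field res.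
Proof.
exists (resfield w), (resproj w); split; [exact: resproj_surj | exact: resproj_eq0].
Qed.

Lemma integralOver_0 (F L : fieldType) (f : {rmorphism F -> L}) : integralOver f 0.
Proof. by have := integral_id f 0; rewrite rmorph0. Qed.

Section ResidueMap.
Variables (R : realType) (L k : fieldType) (w : valuation R L).
Variable (res : {rmorphism valring w -> k}).
Hypothesis hres : is_residue_field res.

(** The reduction map, extended by zero to a function on the whole field. *)
Definition red (x : L) : k := if insub x is Some y then res y else 0.

Lemma redE (x : valring w) : red (val x) = res x.
Proof. by rewrite /red valK. Qed.

Lemma red_in x : vge w 0 x -> exists2 y : valring w, x = val y & red x = res y.
Proof.
move=> hx; have hx' : x \in valring_pred w by [].
by exists (Valring hx') => //; rewrite -redE.
Qed.

Lemma red_eq0 x : vge w 0 x -> red x = 0 <-> (0 < w x)%E.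
Proof. by move=> /red_in[y -> ->]; apply: hres.2. Qed.

Lemma redD x y : vge w 0 x -> vge w 0 y -> red (x + y) = red x + red y.
Proof. by move=> /red_in[a -> ->] /red_in[b -> ->]; rewrite -(rmorphD res) -redE. Qed.

Lemma redB x y : vge w 0 x -> vge w 0 y -> red (x - y) = red x - red y.
Proof. by move=> /red_in[a -> ->] /red_in[b -> ->]; rewrite -(rmorphB res) -redE. Qed.

Lemma redM x y : vge w 0 x -> vge w 0 y -> red (x * y) = red x * red y.
Proof. by move=> /red_in[a -> ->] /red_in[b -> ->]; rewrite -rmorphM -redE. Qed.

Lemma red1 : red 1 = 1.
Proof. by rewrite -(rmorph1 res) -redE. Qed.

Lemma red0 : red 0 = 0.
Proof. by rewrite -(rmorph0 res) -redE. Qed.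

Lemma redX x n : vge w 0 x -> red (x ^+ n) = red x ^+ n.
Proof.
move=> hx; elim: n => [|n IH]; first by rewrite !expr0 red1.
by rewrite !exprS redM ?IH // vgeX0.
Qed.

Lemma red_near x y : vge w 0 y -> (0 < w (x - y)%R)%E -> red x = red y.
Proof.
move=> hy /[dup] h /red_eq0; have hxy : vge w 0 (x - y) by apply: ltW.
move=> /(_ hxy) e; apply/eqP; rewrite -subr_eq0 -redB ?e //.
exact: vge_near hxy hy.
Qed.

Lemma red_div x y : vge w 0 x -> w y = 0%E -> red (x / y) = red x / red y.
Proof.
move=> hx hy; have y0 := val_fin_neq0 hy.
have hq : vge w 0 (x / y) by rewrite (vgeMr _ _ hy) addr0.
have iy : vge w 0 y by rewrite (vge_fin _ hy).
have ry : red y != 0 by apply/eqP => /(red_eq0 iy); rewrite hy ltxx.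
have -> : red x = red (x / y) * red y by rewrite -redM ?divfK.
by rewrite mulfK.
Qed.

Lemma red_horner (p : {poly L}) (x : L) : (forall n, vge w 0 p`_n) -> vge w 0 x ->
  vge w 0 p.[x] /\ red p.[x] = (\poly_(n < size p) red p`_n).[red x].
Proof.
move=> hp hx.
have -> : (\poly_(n < size p) red p`_n).[red x] = \sum_(n < size p) red p`_n * red x ^+ n.
  by rewrite (horner_coef_wide _ (size_poly _ _)); apply: eq_bigr => n _; rewrite coef_poly ltn_ord.
rewrite horner_coef; elim: (size p) => [|m [h1 h2]].
  by rewrite !big_ord0 red0 vge0.
have hm : vge w 0 (p`_m * x ^+ m) by apply: vgeM0 => //; apply: vgeX0.
rewrite !big_ord_recr /=; split; first exact: vgeD.
by rewrite redD // h2 redM ?redX // vgeX0.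
Qed.

(** Scale an equation of [x] so that its coefficients are integral and one of
    them is a unit, and reduce it. *)
Lemma red_integral (F G : fieldType) (s : {rmorphism F -> L}) (f : {rmorphism G -> k}) (x : L) :
  algebraicOver s x -> vge w 0 x ->
  (forall h, vge w 0 (s h) -> integralOver f (red (s h))) -> integralOver f (red x).
Proof.
move=> [p p0 px] hx hf; pose p' := map_poly s p.
have p'0 : p' != 0 by rewrite map_poly_eq0.
have [n [M [hn hM _]]] := gvalE w 0 p'0.
rewrite mulr0 subr0 in hn; have c0 := val_fin_neq0 hn.
pose q := (p'`_n)^-1 *: p'.
have qE m : q`_m = s (p`_m / p`_n) by rewrite coefZ !coef_map fmorph_div mulrC.
have hq m : vge w 0 q`_m.
  rewrite coefZ mulrC (vgeMr _ _ hn) add0r.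
  by have := hM m; rewrite mulr0 subr0.
have [_ hr] := red_horner hq hx.
apply: (integral_root (p := \poly_(m < size q) red q`_m)).
- apply/eqP => /(congr1 (fun r : {poly k} => r`_n)); rewrite coef_poly coef0.
  rewrite coefZ mulVf // red1; case: ifP => [_ /eqP|/negbT]; first by rewrite oner_eq0.
  rewrite -leqNgt => /(nth_default 0) /eqP; rewrite coefZ mulVf ?oner_eq0 //.
- by apply/rootP; rewrite -hr hornerZ (rootP px) mulr0 red0.
apply/integral_poly => m; rewrite coef_poly; case: ifP => _; last exact: integralOver_0.
by rewrite qE; apply: hf; rewrite -qE.
Qed.

End ResidueMap.

(** An equation over the rational functions in [b], with denominators cleared. *)
Lemma trdeg_intro (kappa k : fieldType) (rho : {rmorphism kappa -> k}) (b : k) :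
  ~ algebraicOver rho b ->
  (forall f : {rmorphism ratfun kappa -> k}, (forall a, f (ratC kappa a) = rho a) ->
     f (xfun kappa) = b -> forall c, integralOver f c) ->
  trdeg_eq1 rho.
Proof.
move=> nb hf; exists b; split=> //.
pose h : {rmorphism {poly kappa} -> k} := horner_eval b \o map_poly rho.
have h_inj p : p != 0 -> h p != 0.
  by move=> p0; apply/eqP => hp; apply: nb; exists p => //; apply/rootP.
have [f fE] := ratfun_lift h_inj.
move=> c; have /integral_algebraic[p p0 /rootP pc] : integralOver f c.
  apply: hf => [a|]; first by rewrite /ratC /= fE /h /= /horner_eval map_polyC hornerC.
  by rewrite /xfun fE /h /= /horner_eval map_polyX hornerX.
have [d [P [d0 hP]]] := clear_denom p; exists P.
  apply: contraNneq d0 => P0; move/eqP: hP; rewrite P0 rmorph0 mulf_eq0 (negPf p0) orbF.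
  by rewrite polyC_eq0 tofrac_eq0.
have -> : map_poly (fun q => (map_poly rho q).[b]) P = map_poly f (map_poly (@tofrac _) P).
  by rewrite -map_poly_comp; apply: eq_map_poly => q /=; rewrite fE.
by rewrite -hP rmorphM hornerM pc mulr0.
Qed.

Lemma div_scale (F : fieldType) (e n m : F) : m != 0 -> e != 0 -> n / m = e * n / (e * m).
Proof. by move=> m0 e0; field; rewrite e0 m0. Qed.

(** * Points of Type II *)

Section TypeII.
Variables (R : realType) (K kappa : fieldType) (vK : valuation R K).
Variables (resK : {rmorphism valring vK -> kappa}).
Hypothesis hresK : is_residue_field resK.
Variables (Kbar : fieldType) (vbar : valuation R Kbar) (i : {rmorphism K -> Kbar}).
Hypothesis alg : forall a : Kbar, algebraicOver i a.
Hypothesis ext : forall a : K, vbar (i a) = vK a.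
Variables (CK : fieldType) (v : valuation R CK) (j : {rmorphism Kbar -> CK}).
Hypothesis compl : is_completion vbar v j.
Variables (E : fieldType) (iota : {rmorphism ratfun CK -> E}) (eta : valuation R E).
Variables (x0 d : CK) (rho : R).
Hypothesis d_val : v d = rho%:E.
Hypothesis eta_iota : forall f, eta (iota f) = gauss v x0 rho f.
Hypothesis E_alg : forall x : E, algebraicOver iota x.

Let s : {rmorphism K -> E} := Y_cst iota \o (j \o i).

Let eta_C a : eta (iota (ratC CK a)) = v a.
Proof. by rewrite eta_iota gauss_C. Qed.

Let eta_s a : eta (s a) = vK a.
Proof. by rewrite /s /= /Y_cst eta_C; have [h _ _] := compl; rewrite /= h ext. Qed.

Let T := iota (tpar x0 / ratC CK d).

Let d0 : d != 0. Proof. exact: val_fin_neq0 d_val. Qed.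

Let T_val : eta T = 0%E.
Proof. by rewrite /T eta_iota (val_div_fin (gauss_t _ _ _) (etrans (gauss_C _ _ _ _) d_val)) subrr. Qed.

Let sT a n : s a * T ^+ n = iota (ratC CK (j (i a) / d ^+ n)) * iota (tpar x0) ^+ n.
Proof.
rewrite /T ratC_div !fmorph_div !rmorphXn expr_div_n -[s _]/(iota (ratC CK (j (i _)))).
have : iota (ratC CK d) != 0 by rewrite fmorph_eq0 ratC_eq0.
move: (iota (ratC CK d)) (iota (ratC CK _)) (iota (tpar x0)) => D b t D0.
by field; rewrite expf_neq0.
Qed.

Let CT a n : iota (ratC CK a) * iota (tpar x0) ^+ n = iota (ratC CK (a * d ^+ n)) * T ^+ n.
Proof.
rewrite /T fmorph_div [ratC CK (_ * _)]rmorphM !rmorphXn rmorphM expr_div_n rmorphXn.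
have : iota (ratC CK d) != 0 by rewrite fmorph_eq0 ratC_eq0.
move: (iota (ratC CK d)) (iota (ratC CK _)) (iota (tpar x0)) => D b t D0.
by field; rewrite expf_neq0.
Qed.

(** The reduction of [t / d] is transcendental.  Constants are close to algebraic
    ones, hence the residue field is algebraic over the functions of it. *)
Lemma typeII_gauss : is_type_II resK s eta.
Proof.
have [k [res hres]] := residue_field_exists eta.
have T0 : vge eta 0 T by rewrite (vge_fin _ T_val).
have [rho_ rhoE] : exists f : {rmorphism kappa -> k}, forall a : valring vK,
    f (resK a) = red res (s (val a)).
  have [f hf] : exists f : kappa -> k, forall a : valring vK, f (resK a) = red res (s (val a)).
    have hs (a : valring vK) : vge eta 0 (s (val a)) by rewrite /vge eta_s; apply: valring_ge.
    have [c hc] := choice hresK.1.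
    exists (fun x => red res (s (val (c x)))) => a.
    apply: (red_near hres) => //; rewrite -rmorphB eta_s.
    have : resK (c (resK a) - a) = 0 by rewrite rmorphB hc subrr.
    by move/hresK.2.
  have hs (a : valring vK) : vge eta 0 (s (val a)) by rewrite /vge eta_s; apply: valring_ge.
  have fB : GRing.Theory.zmod_morphism f.
    move=> x y; have [a <-] := hresK.1 x; have [b <-] := hresK.1 y.
    by rewrite -rmorphB !hf -redB // -rmorphB.
  have fM : GRing.Theory.monoid_morphism f.
    split=> [|x y]; first by rewrite -(rmorph1 resK) hf rmorph1 red1.
    have [a <-] := hresK.1 x; have [b <-] := hresK.1 y.
    by rewrite -rmorphM !hf -redM // -rmorphM.
  by have [g hg] := rmorph_lift fB fM; exists g => a; rewrite hg.
exists eta, k, res, rho_; split=> //.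
  by move=> a b e; rewrite rhoE -e redE.
apply: (@trdeg_intro _ _ _ (red res T)).
  move=> [p p0 /rootP pT].
  have [c hc] := choice hresK.1.
  pose P : {poly K} := \poly_(n < size p) val (c p`_n).
  have Pn n : P`_n = if (n < size p)%N then val (c p`_n) else 0 by rewrite coef_poly.
  have hP n : vge eta 0 (map_poly s P)`_n.
    rewrite coef_map /vge eta_s Pn; case: ifP => _; last by rewrite val0 leey.
    exact: valring_ge.
  have [h1 h2] := red_horner res hP T0.
  have hred : \poly_(n < size (map_poly s P)) red res (map_poly s P)`_n = map_poly rho_ p.
    apply/polyP => n; rewrite coef_poly coef_map; case: ifP => hn.
      rewrite coef_map Pn; case: ltnP => h; first by rewrite -rhoE hc.
      transitivity (red res 0); first by congr (red res _); exact: (rmorph0 s).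
      by rewrite red0 (nth_default 0 h); apply/esym/(rmorph0 rho_).
    move: hn; rewrite size_map_poly => /negbT; rewrite -leqNgt => hn.
    have {hn} := nth_default 0 hn; rewrite Pn; case: ltnP => h e; last first.
      by rewrite coef_map (nth_default 0 h); apply/esym/(rmorph0 rho_).
    have hr := rhoE (c p`_n); rewrite hc e in hr; rewrite coef_map; apply/esym/(etrans hr).
    by rewrite -[RHS](red0 res); congr (red res _); apply: (rmorph0 s).
  rewrite hred pT in h2; move/(red_eq0 hres h1): h2.
  pose Q : {poly CK} := \poly_(n < size P) (j (i P`_n) / d ^+ n).
  have Qn n : Q`_n = if (n < size P)%N then j (i P`_n) / d ^+ n else 0 by rewrite coef_poly.
  have -> : (map_poly s P).[T] = iota (polyT x0 Q).
    rewrite /polyT -horner_map -map_poly_comp horner_coef (@horner_coef_wide _ (size P)); last first.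
      exact: leq_trans (size_poly _ _) (size_poly _ _).
    rewrite size_map_poly; apply: eq_bigr => n _; rewrite !coef_map Qn ltn_ord; apply: sT.
  rewrite eta_iota => /vge_gt0[M M0 /gauss_vge hM].
  move/eqP: p0; apply; apply/polyP => n; rewrite coef0.
  have [h|h] := ltnP n (size p); last by rewrite nth_default.
  rewrite -[p`_n]hc; apply/hresK.2.
  have := hM n; rewrite Qn; case: ifP => hn.
    rewrite (vgeMr _ _ (valX_fin n d_val)) subrK.
    have [hj _ _] := compl; rewrite /vge hj ext Pn h; apply: lt_le_trans.
    by rewrite lte_fin.
  have : P`_n = 0 by rewrite nth_default // leqNgt hn.
  by rewrite Pn h => -> _; rewrite val0 lt0y.
move=> f f_cst fX c.
have red_K a : vge eta 0 (s a) -> integralOver f (red res (s a)).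
  move=> ha; have ha' : a \in valring_pred vK by rewrite inE -eta_s.
  by rewrite -[a]/(val (Valring ha')) -rhoE -f_cst; apply: integral_id.
have red_Kbar (a : Kbar) : vge eta 0 (iota (ratC CK (j a))) ->
    integralOver f (red res (iota (ratC CK (j a)))).
  move=> ha; apply: (red_integral (s := s)) => //.
  have [p p0 pa] := alg a; exists p => //.
  have -> : map_poly s p = map_poly (iota \o (ratC CK \o j)) (map_poly i p).
    by rewrite -map_poly_comp; apply: eq_map_poly.
  by rewrite -[iota _]/((iota \o (ratC CK \o j)) a) fmorph_root.
have red_CK (a : CK) : vge v 0 a -> integralOver f (red res (iota (ratC CK a))).
  move=> ha; have [b hb] := approx_alg compl a 1.
  have hb0 : vge v 0 (j b).
    by apply: vge_near ha; rewrite vgeBC; apply: vgeW hb; lra.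
  rewrite (@red_near _ _ _ _ _ hres _ (iota (ratC CK (j b)))).
  - by apply: red_Kbar; rewrite /vge eta_C.
  - by rewrite /vge eta_C.
  - by rewrite -!rmorphB eta_C; apply: vge_gt hb.
have T_int : integralOver f (red res T) by rewrite -fX; apply: integral_id.
have red_poly (Q : {poly CK}) : pge v rho 0 Q ->
    integralOver f (red res (iota (polyT x0 Q))).
  move=> hQ; pose Q' : {poly E} := \poly_(n < size Q) iota (ratC CK (Q`_n * d ^+ n)).
  have hv n : vge v 0 (Q`_n * d ^+ n).
    have := hQ n; rewrite sub0r => h; apply: (vgeM' h (vge_self (valX_fin n d_val))).
    by rewrite addNr.
  have -> : iota (polyT x0 Q) = Q'.[T].
    rewrite /polyT -horner_map -map_poly_comp horner_coef (@horner_coef_wide _ (size Q) Q'); last first.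
      exact: size_poly.
    rewrite size_map_poly; apply: eq_bigr => n _; rewrite coef_map coef_poly ltn_ord; apply: CT.
  have hQ' n : vge eta 0 Q'`_n.
    by rewrite coef_poly; case: ifP => _; [rewrite /vge eta_C; apply: hv | rewrite vge0].
  have [_ ->] := red_horner res hQ' T0; apply: integral_horner => //.
  apply/integral_poly => n; rewrite coef_poly coef_poly; case: ifP => _; last exact: integralOver_0.
  by case: ifP => _; [apply: red_CK | rewrite red0; apply: integralOver_0].
have red_F (h : ratfun CK) : vge eta 0 (iota h) -> integralOver f (red res (iota h)).
  rewrite /vge eta_iota -/(vge _ _ _).
  have [n [m [m0 ->]]] := polyTP x0 h.
  have m0' : polyT x0 m != 0 by rewrite polyT_eq0.
  have [e e0 he] := gauss_value x0 d_val m0'.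
  have [r hr] := val_fin v e0.
  have mE : gauss v x0 rho (polyT x0 (e^-1 *: m)) = 0%E.
    rewrite -mul_polyC polyTM polyTC Defs.valM he gauss_C (valV_fin hr) hr.
    by rewrite -EFinD addNr.
  have -> : polyT x0 n / polyT x0 m = polyT x0 (e^-1 *: n) / polyT x0 (e^-1 *: m).
    rewrite -!mul_polyC !polyTM !polyTC.
    have : ratC CK e^-1 != 0 by rewrite ratC_eq0 invr_eq0.
    move: (ratC CK _) (polyT x0 n) (polyT x0 m) m0'.
    by apply: div_scale.
  move=> hv; have hn : vge (gauss v x0 rho) 0 (polyT x0 (e^-1 *: n)).
    by move: hv; rewrite (vgeMr _ _ mE) addr0.
  have hm : vge (gauss v x0 rho) 0 (polyT x0 (e^-1 *: m)) by rewrite (vge_fin _ mE).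
  rewrite fmorph_div red_div //; last by rewrite eta_iota.
  - by apply: integral_div; apply: red_poly; apply/(gauss_vge v x0).
  - by rewrite /vge eta_iota.
have [x <-] := hres.1 c; rewrite -redE.
by apply: (red_integral (s := iota)) => //; exact: valring_ge.
Qed.

End TypeII.

(** * Lipschitz families of valuations *)

Section ValuationTools.
Variables (R : realType).

Lemma val_pullback (F L : fieldType) (f : {rmorphism F -> L}) (w : valuation R L) :
  exists w' : valuation R F, forall x, w' x = w (f x).
Proof.
have ax2 x : w (f x) = +oo%E <-> x = 0.
  by rewrite val_eqy; split=> [/eqP|->]; rewrite ?rmorph0 // fmorph_eq0 => /eqP.
have axM x y : w (f (x * y)) = (w (f x) + w (f y))%E by rewrite rmorphM Defs.valM.
have axD x y : (Order.min (w (f x)) (w (f y)) <= w (f (x + y)%R))%E.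
  by rewrite rmorphD Defs.valD.
by exists (@Valuation R F (w \o f) (fun x => @val_neqNy _ _ w (f x)) ax2 axM axD).
Qed.

Lemma ratfun_morph_eq (C L : fieldType) (c : C) (f g : {rmorphism ratfun C -> L}) :
  (forall a, f (ratC C a) = g (ratC C a)) -> f (tpar c) = g (tpar c) -> f =1 g.
Proof.
move=> hC ht x; have [n [d [d0 ->]]] := polyTP c x.
suff h p : f (polyT c p) = g (polyT c p) by rewrite !fmorph_div !h.
rewrite /polyT -!horner_map -!map_poly_comp ht; congr (_.[_]).
by apply: eq_map_poly => a; apply: hC.
Qed.

(** Real-valued and Lipschitz on [J]; every function met here is of this kind
    away from zero, and this is how continuity along intervals is obtained. *)
Definition lipschitz_val (J : set R) (f : R -> \bar R) := exists2 K : R, 0 <= K &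
  forall s s', J s -> J s' -> exists r r', [/\ f s = r%:E, f s' = r'%:E &
    `|r - r'| <= K * `|s - s'|].

Lemma lipschitz_gauss (C : fieldType) (v : valuation R C) c f J : f != 0 ->
  lipschitz_val J (fun s => gauss v c s f).
Proof.
move=> f0; have [K K0 hK] := gauss_lip v c f0; exists K => // s s' _ _.
have [r hr] := val_fin (gauss v c s) f0; have [r' hr'] := val_fin (gauss v c s') f0.
by exists r, r'; split=> //; apply: hK.
Qed.

Lemma lipschitz_gt J (f : R -> \bar R) s0 (M : R) : J s0 -> (M%:E < f s0)%E ->
  (f = (fun=> +oo%E) \/ lipschitz_val J f) ->
  exists e : R, [/\ 0 < e & exists2 M', M < M' & forall s, J s -> `|s - s0| <= e -> (M'%:E <= f s)%E].
Proof.
move=> Js0 hM [->|[K K0 hK]].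
  by exists 1; split=> //; exists (M + 1); rewrite ?ltrDl // => s _ _; rewrite leey.
have [r0 [_ [h0 _ _]]] := hK s0 s0 Js0 Js0; rewrite h0 lte_fin in hM.
pose k := K + 1; have k0 : 0 < k by rewrite /k; lra.
exists ((r0 - M) / (2 * k)); split; first by rewrite divr_gt0 //; lra.
exists ((r0 + M) / 2); first by lra.
move=> s Js hs; have [r [r' [h1 h2 h3]]] := hK s s0 Js Js0.
rewrite h1 lee_fin; move: h2; rewrite h0 => -[e]; subst r'.
have h4 : K * `|s - s0| <= (r0 - M) / 2.
  apply: (@le_trans _ _ (k * `|s - s0|)).
    by rewrite ler_wpM2r // /k; lra.
  have -> : (r0 - M) / 2 = k * ((r0 - M) / (2 * k)) by field; rewrite gt_eqF.
  by rewrite ler_wpM2l // ltW.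
have := ler_norm (r0 - r); rewrite distrC; lra.
Qed.

End ValuationTools.

(** Passage to a square root of the parameter: the Gauss valuation of radius [s]
    is the restriction of the one of radius [s/2] in the variable [sqrt t]. *)
Section DoubleCover.
Variables (R : realType) (C : fieldType) (v : valuation R C) (x0 : C).

Lemma double_cover : exists psi : {rmorphism ratfun C -> ratfun C},
  [/\ forall a, psi (ratC C a) = ratC C a, psi (tpar x0) = xfun C ^+ 2 &
      forall s f, gauss v 0 (s / 2) (psi f) = gauss v x0 s f].
Proof.
have tp0 : tpar (0 : C) = xfun C by rewrite /tpar rmorph0 subr0.
pose h : {rmorphism {poly C} -> ratfun C} :=
  (@tofrac {poly C} \o (fun p => p \Po ('X^2 + x0%:P))).
have sz : size ('X^2 + x0%:P : {poly C}) = 3%N.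
  by rewrite size_polyDl size_polyXn // (leq_ltn_trans (size_polyC_leq1 _)).
have h_inj p : p != 0 -> h p != 0.
  move=> p0; rewrite /h /= tofrac_eq0 comp_poly_eq0 ?sz //.
have [psi hpsi] := ratfun_lift h_inj.
have psiC a : psi (ratC C a) = ratC C a.
  by rewrite -[ratC C a]/(tofrac a%:P) hpsi /h /= comp_polyC.
have psit : psi (tpar x0) = xfun C ^+ 2.
  rewrite /tpar rmorphB psiC /xfun hpsi /h /= comp_polyX.
  by rewrite rmorphD rmorphXn addrK.
exists psi; split=> // s f.
have [n [d [d0 ->]]] := polyTP x0 f.
have E p : gauss v 0 (s / 2) (psi (polyT x0 p)) = gauss v x0 s (polyT x0 p).
  have -> : psi (polyT x0 p) = polyT 0 (p \Po 'X^2).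
    rewrite /polyT -horner_map psit tp0 -map_poly_comp.
    rewrite map_comp_poly horner_comp rmorphXn /= map_polyX horner_exp hornerX.
    by congr (_.[_]); apply: eq_map_poly => a; apply: psiC.
  apply/ereal_eq_thr => M; rewrite -!/(vge _ _ _) !gauss_vge.
  have cE m : (p \Po 'X^2)`_m = if (2 %| m)%N then p`_(m %/ 2) else 0.
    by rewrite coef_comp_poly_Xn.
  split=> hp m; last first.
    have := hp (m %/ 2)%N; rewrite cE; case: ifP => [dv|_ _]; last exact: vge0.
    apply: vgeW; have -> : m%:R * (s / 2) = (m %/ 2)%:R * s; last by [].
    by rewrite -[in LHS](divnK dv) natrM; field.
  have := hp (m * 2)%N; rewrite cE dvdn_mull // mulnK //; apply: vgeW.
  by rewrite natrM; lra.
have d0' : polyT x0 d != 0 by rewrite polyT_eq0.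
have [r hr] := val_fin (gauss v x0 s) d0'.
by rewrite fmorph_div !Defs.valM E (valV_fin hr) (valV_fin (etrans (E d) hr)).
Qed.

End DoubleCover.

(** * Lifting segments of Gauss valuations *)

Section DiscNeq0.
Variables (F E : fieldType) (iota : {rmorphism F -> E}) (xi : E) (a b : F).
Hypothesis xi_root : iota b * xi ^+ 3 + iota a * xi ^+ 2 + xi + 1 = 0.
Hypothesis free : forall y0 y1 y2 : F, iota y0 + iota y1 * xi + iota y2 * xi ^+ 2 = 0 ->
  [/\ y0 = 0, y1 = 0 & y2 = 0].
Hypothesis b0 : b != 0.
Hypothesis two0 : (2 : F) != 0.

(** The discriminant is the product of the square of [g'(xi)] and a polynomial of
    degree 2 in [xi]. *)
Lemma disc_neq0 : disc a b != 0.
Proof.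
apply/eqP => D0.
have key : forall A B : E, B * xi ^+ 3 + A * xi ^+ 2 + xi + 1 = 0 -> disc A B = 0 ->
   (A ^+ 2 - 4 * B - 2 * A * B * xi - 3 * B ^+ 2 * xi ^+ 2) *
   (1 + 2 * A * xi + 3 * B * xi ^+ 2) ^+ 2 = 0.
  move=> A B g0 d0; transitivity (disc A B + (B * xi ^+ 3 + A * xi ^+ 2 + xi + 1) *
    (- 27 * B ^+ 3 * xi ^+ 3 - 27 * A * B ^+ 2 * xi ^+ 2 - 27 * B ^+ 2 * xi +
      (4 * A ^+ 3 - 18 * A * B + 27 * B ^+ 2))); last by rewrite g0 d0 mul0r addr0.
  by rewrite /disc; ring.
have := key _ _ xi_root; have -> : disc (iota a) (iota b) = iota (disc a b).
  by rewrite /disc; ring.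
rewrite D0 rmorph0 => /(_ erefl) /eqP; rewrite mulf_eq0 expf_eq0 /= => /orP[|] /eqP h.
  have [|h0 h1 h2] := free (y0 := a ^+ 2 - 4 * b) (y1 := - (2 * a * b)) (y2 := - (3 * b ^+ 2)).
    by rewrite -[RHS]h; ring.
  have ab : a = 0.
    move/eqP: h1; rewrite oppr_eq0 !mulf_eq0 (negPf two0) (negPf b0) orbF => /= /eqP //.
  move/eqP: h0; rewrite ab expr0n /= sub0r oppr_eq0 mulf_eq0 (negPf b0) orbF.
  by rewrite (_ : 4 = 2 * 2 :> F) ?mulf_eq0 ?(negPf two0) //; ring.
have [|h0 _ _] := free (y0 := 1) (y1 := 2 * a) (y2 := 3 * b).
  by rewrite -[RHS]h; ring.
by move/eqP: h0; rewrite oner_eq0.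
Qed.

End DiscNeq0.

Definition segment (R : realType) (r e : R) : set R := [set s | r <= s <= r + e].

Section Lifting.
Variables (R : realType) (CK : fieldType) (v : valuation R CK) (x0 : CK).
Hypothesis v3 : (0 < v 3%R)%E.
Variables (E : fieldType) (iota : {rmorphism ratfun CK -> E}).
Variables (rho0 : R) (eta : valuation R E).
Hypothesis eta_iota : forall f, eta (iota f) = gauss v x0 rho0 f.

(** [eta] is the origin of an interval lying over the Gauss valuations of
    radius in [[rho0, rho0 + e]]. *)
Definition liftable := exists (e : R) (W : R -> valuation R E), [/\ 0 < e,
  forall x, W rho0 x = eta x,
  forall s f, segment rho0 e s -> W s (iota f) = gauss v x0 s f &
  forall x, x != 0 -> lipschitz_val (segment rho0 e) (fun s => W s x)].

Lemma near_gt (M : fieldType) (V : R -> valuation R M) :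
  (forall m, m != 0 -> lipschitz_val setT (fun s => V s m)) ->
  forall (m : M) (B : R), (B%:E < V rho0 m)%E ->
  exists2 e : R, 0 < e & exists2 B', B < B' & forall s, segment rho0 e s -> vge (V s) B' m.
Proof.
move=> Vlip m B hB.
have [||e [e0 [B' BB' h]]] := @lipschitz_gt R setT (fun s => V s m) rho0 B _ hB _ => //.
  have [->|m0] := eqVneq m 0; last by right; apply: Vlip.
  by left; apply/funext => s; rewrite val0.
exists e => //; exists B' => // s /andP[s1 s2]; apply: h => //.
by rewrite ger0_norm ?subr_ge0 //; lra.
Qed.

Section Branch.
Variables (xi : E) (a b : ratfun CK).
Hypothesis b0 : b != 0.
Hypothesis irr : irreducible_poly (b%:P * 'X^3 + a%:P * 'X^2 + 'X + 1).
Hypothesis g_xi : iota b * xi ^+ 3 + iota a * xi ^+ 2 + xi + 1 = 0.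
Hypothesis gen : forall x, exists G : {poly ratfun CK}, x = (map_poly iota G).[xi].
Hypothesis a_pos : (0 < gauss v x0 rho0 a)%E.
Hypothesis b_pos : (0 < gauss v x0 rho0 b)%E.

(** A square root of the discriminant known up to a factor close to 1 at [rho0] is
    so at nearby radii, hence the three branches exist there. *)
Lemma liftable_branch (M : fieldType) (V : R -> valuation R M)
    (psi : {rmorphism ratfun CK -> M}) (sq : M)
    (L : fieldType) (eL : {rmorphism E -> L}) (fL : {rmorphism M -> L}) (w : valuation R L) :
  (forall m, m != 0 -> lipschitz_val setT (fun s => V s m)) ->
  (forall s f, V s (psi f) = gauss v x0 s f) ->
  sq != 0 -> (0 < V rho0 (1 - psi (disc a b) / sq ^+ 2)%R)%E ->
  (forall h, fL (psi h) = eL (iota h)) -> (forall x, w (eL x) = eta x) ->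
  (forall m, w (fL m) = V rho0 m) -> liftable.
Proof.
move=> Vlip Vpsi sq0 hsq compat weL wfL.
have a_pos' : (0 < V rho0 (psi a))%E by rewrite Vpsi.
have b_pos' : (0 < V rho0 (psi b))%E by rewrite Vpsi.
have [e1 e10 [k1 k10 h1]] := near_gt Vlip a_pos'.
have [e2 e20 [k2 k20 h2]] := near_gt Vlip b_pos'.
have [e3 e30 [k3 k30 h3]] := near_gt Vlip hsq.
pose e := Num.min e1 (Num.min e2 e3); pose k := Num.min k1 k2.
have e0 : 0 < e by rewrite !lt_min e10 e20 e30.
have k0 : 0 < k by rewrite !lt_min k10 k20.
have Js s e' : e <= e' -> segment rho0 e s -> segment rho0 e' s.
  by move=> h /andP[s1 s2]; apply/andP; split=> //; lra.
have ee1 : e <= e1 by rewrite ge_min lexx.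
have ee2 : e <= e2 by rewrite !ge_min lexx orbT.
have ee3 : e <= e3 by rewrite !ge_min lexx !orbT.
have J0 : segment rho0 e rho0 by apply/andP; split=> //; lra.
have V2 s : V s 2 = 0%E.
  by apply: val2; rewrite -(rmorph_nat psi 3) Vpsi -(rmorph_nat (ratC CK) 3) gauss_C.
have bd m : exists K : R, forall s, segment rho0 e s -> vge (V s) K m.
  have [->|m0] := eqVneq m 0; first by exists 0 => s _; rewrite vge0.
  have [K K0 hK] := Vlip m m0.
  have [r [_ [hr _ _]]] := hK rho0 rho0 I I.
  exists (r - K * e) => s /andP[s1 s2].
  have [r1 [r2 [h h' h'']]] := hK s rho0 I I; rewrite (vge_fin _ h).
  move: h'; rewrite hr => -[er]; subst r2.
  have := ler_norm (r - r1); rewrite distrC => h5.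
  have h6 : K * `|s - rho0| <= K * e by rewrite ler_wpM2l // ger0_norm ?subr_ge0 //; lra.
  lra.
have ha s : segment rho0 e s -> vge (V s) k (psi a).
  by move=> js; apply: vgeW (h1 s (Js _ _ ee1 js)); rewrite ge_min lexx.
have hb s : segment rho0 e s -> vge (V s) k (psi b).
  by move=> js; apply: vgeW (h2 s (Js _ _ ee2 js)); rewrite ge_min lexx orbT.
have h3' s : segment rho0 e s -> vge (V s) k3 (1 - psi (disc a b) / sq ^+ 2).
  by move=> js; apply: h3 (Js _ _ ee3 js).
have [W [W0 Wm Wi]] := lift_family irr g_xi b0 gen J0 bd k0 ha hb (fun s _ => V2 s) sq0 k30 h3'
  compat weL wfL.
exists e, W; split=> //.
  by move=> s f js; rewrite Wi // Vpsi.
move=> x nx; have [m hm] := Wm x nx.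
have m0 : m != 0.
  have [r hr] := val_fin (W rho0) nx.
  by rewrite hm // in hr; apply: val_fin_neq0 hr.
have [K K0 hK] := Vlip m m0; exists K => // s s' js js'.
by have [r [r' [e1' e2' e3']]] := hK s s' I I; exists r, r'; rewrite !hm.
Qed.

Hypothesis irr0 : forall n (c : CK), (0 < n)%N -> v c <> (n%:R * rho0)%:E.
Hypothesis root2 : forall c : CK, c != 0 -> exists d : CK, (0 < v (1 - d ^+ 2 / c)%R)%E.
Hypothesis free : forall y0 y1 y2 : ratfun CK,
  iota y0 + iota y1 * xi + iota y2 * xi ^+ 2 = 0 -> [/\ y0 = 0, y1 = 0 & y2 = 0].

Lemma sq_near_step (F : fieldType) (w : valuation R F) (D c d t : F) n m l :
  c != 0 -> d != 0 -> t != 0 -> (n + m = l.*2)%N ->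
  (0 < w (D * t ^+ m / (c * t ^+ n) - 1)%R)%E -> (0 < w (1 - d ^+ 2 / c)%R)%E ->
  (0 < w (1 - D / (d * t ^+ l / t ^+ m) ^+ 2)%R)%E.
Proof.
move=> c0 d0 t0 nm; pose X := D * t ^+ m / (c * t ^+ n); pose Y := d ^+ 2 / c.
have tX k : t ^+ k != 0 by rewrite expf_neq0.
have Y0 : Y != 0 by rewrite mulf_neq0 ?invr_eq0 ?expf_neq0.
have -> : D / (d * t ^+ l / t ^+ m) ^+ 2 = X / Y.
  have e : t ^+ l ^+ 2 = t ^+ n * t ^+ m by rewrite -exprM muln2 -nm exprD.
  rewrite /X /Y !expr_div_n exprMn e; field; do ?[apply/andP; split]; by [].
rewrite -/X -/Y => hX hY.
have Y1 : w Y = 0%E.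
  rewrite -(Defs.val1 w); apply: val_eq_near; rewrite Defs.val1.
  by rewrite -valN opprB.
have -> : 1 - X / Y = (Y - X) / Y by field.
rewrite Defs.valM (valV_fin Y1) oppr0 adde0.
have [k1 k10 h1] := vge_gt0 hX; have [k2 k20 h2] := vge_gt0 hY.
apply: (@vge_gt _ _ _ 0 (Num.min k1 k2)); first by rewrite lt_min k10.
have -> : Y - X = - (1 - Y) - (X - 1) by ring.
apply: vgeB; first by rewrite vgeN; apply: vgeW h2; rewrite ge_min lexx orbT.
by apply: vgeW h1; rewrite ge_min lexx.
Qed.

Lemma sq_neq0 (F : fieldType) (d t : F) l m : d != 0 -> t != 0 -> d * t ^+ l / t ^+ m != 0.
Proof. by move=> d0 t0; rewrite !mulf_neq0 ?invr_eq0 ?expf_neq0. Qed.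

Lemma disc_branch_neq0 : disc a b != 0.
Proof.
apply: (disc_neq0 g_xi free b0).
have g3 : (0 < gauss v x0 rho0 3%R)%E by rewrite -(rmorph_nat (ratC CK) 3) gauss_C.
exact: val_fin_neq0 (val2 g3).
Qed.

(** The discriminant is close to a monomial.  If the exponent of [t] is odd, the
    root is taken after adjoining the square root of [t] to [E]. *)
Lemma liftable_branches : liftable.
Proof.
have [c [n [m [c0 hD]]]] := gauss_irr_dom x0 irr0 disc_branch_neq0.
have [d hd] := root2 c0.
have d0 : d != 0.
  by apply: contraTneq hd => ->; rewrite expr0n mul0r subr0 Defs.val1 ltxx.
pose D := disc a b.
have rc0 : ratC CK c != 0 by rewrite ratC_eq0.
have rd0 : ratC CK d != 0 by rewrite ratC_eq0.
have hd' : ratC CK (1 - d ^+ 2 / c) = 1 - ratC CK d ^+ 2 / ratC CK c.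
  by rewrite rmorphB rmorph1 ratC_div rmorphXn.
case: (boolP (odd (n + m))) => onm; last first.
  have nm : (n + m = (n + m)./2.*2)%N by rewrite -[LHS]odd_double_half (negPf onm).
  pose sq := ratC CK d * tpar x0 ^+ (n + m)./2 / tpar x0 ^+ m.
  apply: (@liftable_branch _ (gauss v x0) idfun sq E idfun iota eta).
  - by move=> f f0; apply: lipschitz_gauss.
  - by move=> s f; exact: erefl.
  - exact (sq_neq0 _ _ rd0 (tpar_neq0 x0)).
  - apply: (sq_near_step rc0 rd0 (tpar_neq0 x0) nm hD).
    by rewrite -hd' gauss_C.
  - by move=> f; exact: erefl.
  - by move=> x; exact: erefl.
  - exact: eta_iota.
(* The exponent is odd: work over the double cover. *)
have [psi [psiC psit psiv]] := double_cover v x0.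
have w2 : eta 2 = 0%E.
  by apply: val2; rewrite -(rmorph_nat (iota \o ratC CK) 3) /= eta_iota gauss_C.
have t0 : iota (tpar x0) != 0 by rewrite fmorph_eq0 tpar_neq0.
have [L [eL [w [r [r2 hw]]]]] := sqrt_extension w2 t0.
pose cL : {rmorphism CK -> L} := eL \o (iota \o ratC CK).
pose h : {rmorphism {poly CK} -> L} := horner_eval r \o map_poly cL.
have h_inj p : p != 0 -> h p != 0.
  move=> p0; apply/eqP => hp.
  have ar : algebraicOver cL r by exists p => //; apply/rootP.
  have [q q0 /rootP hq] := algebraic_mul ar ar.
  have E1 : eL (iota (polyT x0 q)) = (map_poly cL q).[r * r].
    by rewrite -expr2 r2 /polyT -!horner_map -!map_poly_comp.
  move/eqP: E1; rewrite hq !fmorph_eq0 polyT_eq0; exact/negP.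
have [fL hfL] := ratfun_lift h_inj.
have fLC c' : fL (ratC CK c') = cL c'.
  by rewrite -[ratC CK c']/(tofrac c'%:P) hfL /h /= /horner_eval map_polyC hornerC.
have fLX : fL (xfun CK) = r.
  by rewrite /xfun hfL /h /= /horner_eval map_polyX hornerX.
have tp0 : tpar (0 : CK) = xfun CK by rewrite /tpar rmorph0 subr0.
have nm : (n.*2 + m.*2 = (n + m).*2)%N by rewrite doubleD.
pose sq := ratC CK d * xfun CK ^+ (n + m) / xfun CK ^+ m.*2.
have X0 : xfun CK != 0 by rewrite -tp0 tpar_neq0.
apply: (@liftable_branch _ (fun s => gauss v 0 (s / 2)) psi sq L eL fL w).
- move=> f f0; have [K K0 hK] := gauss_lip v 0 f0.
  exists K => // s s' _ _.
  have [q hq] := val_fin (gauss v 0 (s / 2)) f0; have [q' hq'] := val_fin (gauss v 0 (s' / 2)) f0.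
  exists q, q'; split=> //; apply: le_trans (hK _ _ _ _ hq hq') _.
  rewrite ler_wpM2l // -mulrBl normrM [`|2^-1|]ger0_norm ?invr_ge0 //.
  by have := normr_ge0 (s - s'); lra.
- by move=> s f; exact: psiv.
- exact (sq_neq0 _ _ rd0 X0).
- apply: (sq_near_step rc0 rd0 X0 nm); last first.
    by rewrite -hd' gauss_C.
  have e : psi (D * tpar x0 ^+ m / (ratC CK c * tpar x0 ^+ n) - 1) =
     psi D * xfun CK ^+ m.*2 / (ratC CK c * xfun CK ^+ n.*2) - 1.
    rewrite rmorphB rmorph1 fmorph_div !rmorphM !rmorphXn psiC psit.
    by rewrite -!exprM !mul2n.
  by rewrite -e psiv.
- move=> f; apply: (@ratfun_morph_eq _ _ x0 (fL \o psi) (eL \o iota)) => [c'|] /=.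
    by rewrite psiC fLC.
  by rewrite psit rmorphXn fLX r2.
- exact: hw.
move=> f; have [w' hw'] := val_pullback fL w; rewrite -hw'.
apply: gauss_irr => [k c' k0 hk|c'|].
- apply: (irr0 (n := k) (c := c' ^+ 2) k0); rewrite (valX_fin 2 hk); congr _%:E.
  by field.
- by rewrite hw' fLC /cL /= hw eta_iota gauss_C.
rewrite hw' tp0 fLX.
have : w (r ^+ 2) = rho0%:E by rewrite r2 hw eta_iota gauss_t.
exact: val_rootn_eq0.
Qed.

End Branch.
End Lifting.

Section Reversed.
Variables (F E : fieldType) (iota : {rmorphism F -> E}) (z : E) (A B C : F).
Hypothesis irr : irreducible_poly ('X^3 + A%:P * 'X^2 + B%:P * 'X + C%:P).
Hypothesis pz : z ^+ 3 + iota A * z ^+ 2 + iota B * z + iota C = 0.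
Hypothesis gen : forall x, exists q : {poly F}, x = (map_poly iota q).[z].

Lemma cubic_noroot r : r ^+ 3 + A * r ^+ 2 + B * r + C != 0.
Proof.
apply/eqP => h; have /irr.2 : 'X - r%:P %| 'X^3 + A%:P * 'X^2 + B%:P * 'X + C%:P.
  rewrite -root_factor_theorem; apply/rootP.
  by rewrite !(hornerD, hornerM, hornerXn, hornerX, hornerC).
by rewrite size_XsubC => /(_ isT) /eqp_size; rewrite size_XsubC size_cubic.
Qed.

(** [xi] generates [E] and has the irreducible equation [b T^3 + a T^2 + T + 1]. *)
Definition reversed_data (xi : E) (a b : F) := [/\ b != 0,
  irreducible_poly (b%:P * 'X^3 + a%:P * 'X^2 + 'X + 1),
  iota b * xi ^+ 3 + iota a * xi ^+ 2 + xi + 1 = 0,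
  forall x, exists G : {poly F}, x = (map_poly iota G).[xi] &
  forall y0 y1 y2 : F, iota y0 + iota y1 * xi + iota y2 * xi ^+ 2 = 0 ->
    [/\ y0 = 0, y1 = 0 & y2 = 0]].

Lemma reversed_intro (xi : E) (a b : F) (Z : {poly F}) : b != 0 ->
  iota b * xi ^+ 3 + iota a * xi ^+ 2 + xi + 1 = 0 ->
  z = (map_poly iota Z).[xi] ->
  (forall r, b * r ^+ 3 + a * r ^+ 2 + r + 1 != 0) -> reversed_data xi a b.
Proof.
move=> b0 hxi hz nr.
have ge : b%:P * 'X^3 + a%:P * 'X^2 + 'X + 1 =
    b *: ('X^3 + (a / b)%:P * 'X^2 + (b^-1)%:P * 'X + (b^-1)%:P).
  by rewrite !scalerDr -!mul_polyC !mulrA -!polyCM mulrCA mulfV // mulr1 mul1r.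
have irr' : irreducible_poly ('X^3 + (a / b)%:P * 'X^2 + (b^-1)%:P * 'X + (b^-1)%:P).
  apply: cubic_irreducible; first by rewrite size_cubic.
  move=> r; apply: contra (nr r) => /rootP.
  rewrite !(hornerD, hornerM, hornerXn, hornerX, hornerC) => h.
  apply/eqP; transitivity (b * (r ^+ 3 + a / b * r ^+ 2 + b^-1 * r + b^-1)); last by rewrite h mulr0.
  by field.
split=> //.
- apply: cubic_irreducible; first by rewrite ge size_scale // size_cubic.
  move=> r; apply: contra (nr r) => /rootP.
  by rewrite !(hornerD, hornerM, hornerXn, hornerX, hornerC) => ->.
- move=> x; have [q ->] := gen x; exists (q \Po Z).
  by rewrite map_comp_poly horner_comp -hz.
apply: (@cubic_free _ _ iota xi (a / b) b^-1 b^-1) => //.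
have b0' : iota b != 0 by rewrite fmorph_eq0.
transitivity ((iota b * xi ^+ 3 + iota a * xi ^+ 2 + xi + 1) / iota b); last by rewrite hxi mul0r.
by rewrite fmorph_div fmorphV; field.
Qed.

Let C0 : C != 0. Proof. exact: cubic_const_neq0 irr. Qed.
Let z0 : z != 0.
Proof.
apply: contraNneq C0 => h; move: pz; rewrite h !expr0n /= !mulr0 !add0r => /eqP.
by rewrite fmorph_eq0.
Qed.

(** For dominant [A T^2]: the equation of [1 / z], scaled. *)
Lemma reversed1 : A != 0 -> reversed_data (iota A / z) (B / A ^+ 2) (C / A ^+ 3).
Proof.
move=> A0; have A0' : iota A != 0 by rewrite fmorph_eq0.
have hxi : iota (C / A ^+ 3) * (iota A / z) ^+ 3 + iota (B / A ^+ 2) * (iota A / z) ^+ 2 +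
    iota A / z + 1 = 0.
  transitivity ((z ^+ 3 + iota A * z ^+ 2 + iota B * z + iota C) / z ^+ 3); last by rewrite pz mul0r.
  by rewrite !fmorph_div !rmorphXn /=; field; rewrite z0 A0'.
apply: (@reversed_intro _ _ _ ((- A)%:P * (1 + (B / A ^+ 2)%:P * 'X + (C / A ^+ 3)%:P * 'X^2))) => //.
- by rewrite mulf_neq0 ?invr_eq0 ?expf_neq0.
- rewrite !(rmorphM (map_poly iota), rmorphD (map_poly iota), rmorphXn (map_poly iota), rmorph1 (map_poly iota)).
  rewrite /= !map_polyX !map_polyC !(hornerD, hornerM, horner_exp, hornerX, hornerC).
  apply: (@etrans _ _ (- iota A * (1 + iota (B / A ^+ 2) * (iota A / z) + iota (C / A ^+ 3) * (iota A / z) ^+ 2))); last first.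
    by congr (_ * _); apply/esym/(rmorphN iota).
  set a := iota (B / _) in hxi *; set b := iota (C / _) in hxi *; set xi := iota A / z in hxi *.
  have xi0 : xi != 0 by rewrite mulf_neq0 ?invr_eq0.
  have -> : z = iota A / xi by rewrite /xi; field; rewrite A0' z0.
  apply: (mulIf xi0); rewrite divfK //.
  transitivity (iota A * (1 - (b * xi ^+ 3 + a * xi ^+ 2 + xi + 1))); first by rewrite hxi subr0 mulr1.
  by ring.
move=> r; have [->|r0] := eqVneq r 0; first by rewrite !expr0n /= !mulr0 !add0r oner_eq0.
apply: contra_neq (cubic_noroot (A / r)) => h.
transitivity ((A / r) ^+ 3 * (C / A ^+ 3 * r ^+ 3 + B / A ^+ 2 * r ^+ 2 + r + 1)).
  by field; rewrite r0 A0.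
by rewrite h mulr0.
Qed.

(** For dominant [B T]: the equation of [z], scaled. *)
Lemma reversed2 : B != 0 -> reversed_data (z * iota B / iota C) (A * C / B ^+ 2) (C ^+ 2 / B ^+ 3).
Proof.
move=> B0; have B0' : iota B != 0 by rewrite fmorph_eq0.
have C0' : iota C != 0 by rewrite fmorph_eq0.
apply: (@reversed_intro _ _ _ ((C / B)%:P * 'X)) => //.
- by rewrite mulf_neq0 ?invr_eq0 ?expf_neq0.
- transitivity ((z ^+ 3 + iota A * z ^+ 2 + iota B * z + iota C) / iota C); last by rewrite pz mul0r.
  by rewrite !fmorph_div !(rmorphXn, rmorphM) /=; field; rewrite C0' B0'.
- rewrite (rmorphM (map_poly iota)) /= map_polyX map_polyC !(hornerM, hornerX, hornerC).
  apply: (@etrans _ _ (iota C / iota B * (z * iota B / iota C))); first by field; rewrite C0' B0'.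
  by congr (_ * _); apply/esym/(fmorph_div iota).
move=> r; apply: contra_neq (cubic_noroot (C * r / B)) => h.
transitivity (C * (C ^+ 2 / B ^+ 3 * r ^+ 3 + A * C / B ^+ 2 * r ^+ 2 + r + 1)).
  by field.
by rewrite h mulr0.
Qed.

End Reversed.

Section Irrational.
Variables (R : realType) (CK : fieldType) (v : valuation R CK) (x0 : CK).
Hypothesis v3 : (0 < v 3%R)%E.
Variables (c4 c2 c1 : CK) (Ap Bp : {poly CK}).
Let Cp : {poly CK} := c4%:P * 'X^4 + c2%:P * 'X^2 + c1%:P * 'X.
Let A := polyT x0 Ap.
Let B := polyT x0 Bp.
Let C := polyT x0 Cp.
Variables (E : fieldType) (iota : {rmorphism ratfun CK -> E}) (z : E).
Hypothesis irr : irreducible_poly ('X^3 + A%:P * 'X^2 + B%:P * 'X + C%:P).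
Hypothesis pz : z ^+ 3 + iota A * z ^+ 2 + iota B * z + iota C = 0.
Hypothesis gen : forall x, exists q : {poly ratfun CK}, x = (map_poly iota q).[z].
Variables (rho0 : R) (eta : valuation R E).
Hypothesis eta_iota : forall f, eta (iota f) = gauss v x0 rho0 f.

Let C0 : C != 0. Proof. exact: cubic_const_neq0 irr. Qed.
Let w := gauss v x0.

Let wlip m : m != 0 -> lipschitz_val setT (fun s => w s m).
Proof. exact: lipschitz_gauss. Qed.

Lemma gt_third (F : fieldType) (u : valuation R F) (a c : F) (r : R) k l : (0 < k)%N ->
  u c = r%:E -> (0 < u (a ^+ k / c ^+ l)%R)%E <-> ((l%:R * r / k%:R)%:E < u a)%E.
Proof.
move=> k0 hc; have kR : 0 < k%:R :> R by rewrite ltr0n.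
have [->|a0] := eqVneq a 0; first by rewrite expr0n gtn_eqF // mul0r val0 lt0y ltry.
have [q hq] := val_fin u a0.
rewrite (val_div_fin (valX_fin k hq) (valX_fin l hc)) hq !lte_fin ltr_pdivrMr //.
by rewrite subr_gt0 [q * _]mulrC.
Qed.

(** The condition on the reduction is open in the radius, and [cube_root_valuation]
    gives the extension at every radius. *)
Lemma liftable_cube lam : cube_at v x0 c4 c2 c1 A B rho0 lam -> liftable v x0 iota rho0 eta.
Proof.
move=> [hA hB hC].
have hA' : (0 < w rho0 (A ^+ 3 / C ^+ 1)%R)%E.
  by apply/(gt_third _ _ _ hC) => //; rewrite mul1r mulrC mulKf.
have hB' : (0 < w rho0 (B ^+ 3 / C ^+ 2)%R)%E.
  by apply/(gt_third _ _ _ hC) => //; rewrite (_ : 2 * (3 * lam) / 3 = 2 * lam) //; field.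
have [e1 e10 [k1 k10 h1]] := near_gt wlip hA'.
have [e2 e20 [k2 k20 h2]] := near_gt wlip hB'.
pose e := Num.min e1 e2.
have e0 : 0 < e by rewrite lt_min e10 e20.
have cube s : segment rho0 e s -> exists l, cube_at v x0 c4 c2 c1 A B s l.
  move=> /andP[s1 s2]; have [r hr] := val_fin (w s) C0; exists (r / 3).
  split; last by rewrite [LHS]hr; congr _%:E; field.
  - have /(gt_third A 1 (isT : (0 < 3)%N) hr) : (0 < w s (A ^+ 3 / C ^+ 1)%R)%E.
      apply: vge_gt k10 (h1 s _); apply/andP; split=> //; apply: le_trans s2 _.
      by rewrite lerD2l ge_min lexx.
    by rewrite mul1r.
  - have /(gt_third B 2 (isT : (0 < 3)%N) hr) : (0 < w s (B ^+ 3 / C ^+ 2)%R)%E.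
      apply: vge_gt k20 (h2 s _); apply/andP; split=> //; apply: le_trans s2 _.
      by rewrite lerD2l ge_min lexx orbT.
    by rewrite mulrA.
have free := cubic_free pz irr; pose gen3 := cubic_gen pz gen.
have hW s : exists W : valuation R E, segment rho0 e s ->
   [/\ forall x M, vge W M x <-> exists2 l, w s C = (3 * l)%:E & wge (w s) iota z l M x,
     forall x r, w s (nrm C gen3 x) = (3 * r)%:E -> W x = r%:E &
     forall a, W (iota a) = w s a].
  have [js|njs] := pselect (segment rho0 e s); last by exists eta.
  have [l hl] := cube s js; have [kap k0 [a1 a2 a3]] := cube_kap v3 hl.
  have [_ _ hC'] := hl.
  have h3' : vge (w s) kap 3 by rewrite /vge -(rmorph_nat (ratC CK) 3) gauss_C.
  have [W [W1 W2 W3]] := cube_root_valuation pz gen3 free k0 a1 a2 hC' h3' (normal_norm v3 k0 a3 hC').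
  exists W => _; split=> // x M; rewrite W1; split=> [?|[l' ]]; first by exists l.
  rewrite hC' => -[e']; have -> : l' = l by lra.
  by [].
have [W hW'] := choice hW.
exists e, W; split=> //.
- move=> x; have j0 : segment rho0 e rho0 by apply/andP; split=> //; lra.
  have [W1 _ _] := hW' rho0 j0; apply: ereal_eq_thr => M; rewrite -!/(vge _ _ _).
  have [kap k0 [a1 a2 a3]] := cube_kap v3 (And3 hA hB hC).
  have h3' : vge (w rho0) kap 3 by rewrite /vge -(rmorph_nat (ratC CK) 3) gauss_C.
  rewrite (cube_root_unique pz gen3 free k0 a1 a2 hC h3' (normal_norm v3 k0 a3 hC) eta_iota).
  rewrite W1; split=> [[l']|h]; last by exists lam.
  by rewrite hC => -[e']; have -> : l' = lam by lra.
- by move=> s f js; have [_ _ h] := hW' s js; apply: h.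
move=> x nx; have n0 : nrm C gen3 x != 0.
  apply: contra_neq nx => n0; have j0 : segment rho0 e rho0 by apply/andP; split=> //; lra.
  have [W1 _ _] := hW' rho0 j0; apply: (@vge_all0 _ _ (W rho0)) => M; apply/W1; exists lam => //.
  have [kap k0 [a1 a2 a3]] := cube_kap v3 (And3 hA hB hC).
  by apply/(wge_nrm gen3 free hC (normal_norm v3 k0 a3 hC)); rewrite n0 vge0.
have [K K0 hK] := gauss_lip v x0 n0; exists K => // s s' js js'.
have [r hr] := val_fin (w s) n0; have [r' hr'] := val_fin (w s') n0.
have [_ h _] := hW' s js; have [_ h' _] := hW' s' js'.
exists (r / 3), (r' / 3); split.
- by apply: h; rewrite hr; congr _%:E; field.
- by apply: h'; rewrite hr'; congr _%:E; field.
apply: le_trans (hK _ _ _ _ hr hr'); rewrite -mulrBl normrM [`|3^-1|]ger0_norm ?invr_ge0 //.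
by have := normr_ge0 (r - r'); lra.
Qed.

Hypothesis irr0 : forall n (c : CK), (0 < n)%N -> v c <> (n%:R * rho0)%:E.
Hypothesis root2 : forall c : CK, c != 0 -> exists d : CK, (0 < v (1 - d ^+ 2 / c)%R)%E.

Lemma irr_diff (e : CK) n m : v e = ((n%:R - m%:R) * rho0)%:E -> n = m.
Proof.
move=> he; case: (ltngtP n m) => // h; exfalso.
  apply: (irr0 (n := m - n) (c := e^-1)); first by rewrite subn_gt0.
  by rewrite (valV_fin he) natrB 1?ltnW //; congr _%:E; ring.
apply: (irr0 (n := n - m) (c := e)); first by rewrite subn_gt0.
by rewrite he natrB // ltnW.
Qed.

Let mono (p : {poly CK}) : polyT x0 p != 0 -> exists k r,
  [/\ p`_k != 0, v p`_k = (r - k%:R * rho0)%:E & w rho0 (polyT x0 p) = r%:E].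
Proof.
rewrite polyT_eq0 => p0; have [k [M [h1 _ h2]]] := gvalE v rho0 p0.
by exists k, M; split=> //; [apply: val_fin_neq0 h1 | rewrite /w gaussE].
Qed.

(** The exponents 1, 2, 4 of the monomials of the constant term are not divisible
    by 3; this excludes the ties. *)
Let C_exp (p : {poly CK}) n : polyT x0 p != 0 -> (0 < n < 3)%N -> forall r r',
  w rho0 (polyT x0 p) = r%:E -> w rho0 C = r'%:E -> 3 * r <> n%:R * r'.
Proof.
move=> p0 n3 r r' hr hr' e.
have [k [q [h1 h2]]] := mono p0; rewrite hr => -[e1]; subst q.
have [i [q [h1' h2']]] := mono C0; rewrite hr' => -[e1]; subst q.
have : v (p`_k ^+ 3 / Cp`_i ^+ n) = (((n * i)%:R - (3 * k)%:R) * rho0)%:E.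
  rewrite (val_div_fin (valX_fin 3 h2) (valX_fin n h2')) !natrM; congr _%:E.
  by rewrite !mulrBr e; ring.
move=> /irr_diff; move: h1'; rewrite normal_coef.
by case: i {h2'} => [|[|[|[|[|i]]]]]; rewrite ?eqxx // => _; case: n n3 e => [|[|[|n]]] // _ _; lia.
Qed.

(** Outside the cube case the coefficients in [reversed1] or [reversed2] are small;
    ties with the constant term are excluded by [C_exp]. *)
Lemma liftable_irrational : liftable v x0 iota rho0 eta.
Proof.
have [r hr] := val_fin (w rho0) C0.
have [[hA hB]|hn] := pselect (((r / 3)%:E < w rho0 A)%E /\ ((2 * (r / 3))%:E < w rho0 B)%E).
  by apply: (@liftable_cube (r / 3)); split=> //; rewrite [LHS]hr; congr _%:E; field.
have branch xi a b : reversed_data iota xi a b -> (0 < w rho0 a)%E -> (0 < w rho0 b)%E ->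
    liftable v x0 iota rho0 eta.
  move=> [b0 gi gx gg gf] pa pb.
  exact: (liftable_branches v3 eta_iota b0 gi gx gg pa pb irr0 root2 gf).
have small : ((w rho0 A <= (r / 3)%:E) || (w rho0 B <= (2 * (r / 3))%:E))%E.
  by rewrite !leNgt -negb_and; apply/negP => /andP[h1 h2]; apply: hn.
have [A0|A0] := eqVneq A 0.
  have B0 : B != 0.
    by apply/eqP => B0; move: small; rewrite A0 B0 val0.
  have [b hb] := val_fin (w rho0) B0.
  have hb' : b < 2 * (r / 3).
    move: small; rewrite A0 val0 hb lee_fin /= => hle; rewrite lt_neqAle hle andbT; apply/eqP => e.
    by apply: (@C_exp Bp 2 B0 isT _ _ hb hr); lra.
  apply: branch (reversed2 irr pz gen B0) _ _; first by rewrite A0 !mul0r val0 lt0y.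
  by rewrite (val_div_fin (valX_fin 2 hr) (valX_fin 3 hb)) lte_fin; lra.
have [a ha] := val_fin (w rho0) A0.
have first_case : a < r / 3 -> (forall b, w rho0 B = b%:E -> 2 * a < b) -> liftable v x0 iota rho0 eta.
  move=> h1 h2; apply: branch (reversed1 irr pz gen A0) _ _; last first.
    by rewrite (val_div_fin hr (valX_fin 3 ha)) lte_fin; lra.
  have [->|/(val_fin (w rho0))[b hb]] := eqVneq B 0; first by rewrite mul0r val0 lt0y.
  by rewrite (val_div_fin hb (valX_fin 2 ha)) lte_fin; have := h2 b hb; lra.
have strictA : a <= r / 3 -> a < r / 3.
  move=> hle; rewrite lt_neqAle hle andbT; apply/eqP => e.
  by apply: (@C_exp Ap 1 A0 isT _ _ ha hr); lra.
have [B0|B0] := eqVneq B 0.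
  apply: first_case => [|b]; last by rewrite B0 val0.
  by apply: strictA; move: small; rewrite B0 val0 orbF ha lee_fin.
have [b hb] := val_fin (w rho0) B0.
move: small; rewrite ha hb !lee_fin => small.
have [h|h] := ltP (2 * a) b.
  apply: first_case => [|b']; last by rewrite hb => -[<-].
  by case/orP: small => hs; [apply: strictA | lra].
have hb' : b < 2 * (r / 3).
  rewrite lt_neqAle; apply/andP; split; last by case/orP: small => hs; lra.
  by apply/eqP => e; apply: (@C_exp Bp 2 B0 isT _ _ hb hr); lra.
apply: branch (reversed2 irr pz gen B0) _ _.
  by rewrite (val_div_fin (valM_fin ha hr) (valX_fin 2 hb)) lte_fin; lra.
by rewrite (val_div_fin (valX_fin 2 hr) (valX_fin 3 hb)) lte_fin; lra.
Qed.

End Irrational.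

(** * Limits of extended real functions *)

Section EreaLimits.
Variables (R : realType).
Implicit Types (D : set R) (f : R -> \bar R) (x : R) (l : \bar R).

(** Convergence [f s -> l] as [s -> x] in [D], for functions with values in the
    extended reals, by one-sided real thresholds: this form is stable under
    minima and maxima. *)
Definition ecvg D f x l :=
  (forall M : R, (M%:E < l)%E -> exists2 e, 0 < e & forall s, D s -> `|s - x| < e -> (M%:E < f s)%E) /\
  (forall M : R, (l < M%:E)%E -> exists2 e, 0 < e & forall s, D s -> `|s - x| < e -> (f s < M%:E)%E).

Lemma ecvgP D f x l : ecvg D f x l <-> f @ within D (nbhs x) --> l.
Proof.
have nearP P : (\forall s \near within D (nbhs x), P s) <->
    exists2 e : R, 0 < e & forall s, D s -> `|s - x| < e -> P s.
  split=> [/nbhs_ballP[e /= e0 he]|[e e0 he]].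
    by exists e => // s Ds hs; apply: (he s) => //; rewrite /ball /= distrC.
  by apply/nbhs_ballP; exists e => //= s; rewrite /ball /= distrC => hs Ds; apply: he.
split=> [[h1 h2]|h].
  case: l h1 h2 => [l||] h1 h2.
  - apply/fine_cvgP; split.
      have [e1 e10 he1] := h1 (l - 1) ltac:(by rewrite lte_fin; lra).
      have [e2 e20 he2] := h2 (l + 1) ltac:(by rewrite lte_fin; lra).
      apply/nearP; exists (Num.min e1 e2); first by rewrite lt_min e10 e20.
      move=> s Ds; rewrite lt_min => /andP[/(he1 s Ds) a1 /(he2 s Ds) a2].
      by rewrite fin_numE -ltey -ltNye (lt_trans (ltNyr _) a1) (lt_trans a2 (ltry _)).
    apply/cvgrPdist_lt => k k0; apply/nearP.
    have [e1 e10 he1] := h1 (l - k) ltac:(by rewrite lte_fin; lra).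
    have [e2 e20 he2] := h2 (l + k) ltac:(by rewrite lte_fin; lra).
    exists (Num.min e1 e2); first by rewrite lt_min e10 e20.
    move=> s Ds; rewrite lt_min => /andP[/(he1 s Ds) + /(he2 s Ds)] /=.
    case: (f s) => [q||] //; rewrite !lte_fin /= => a1 a2.
    by rewrite ltr_norml; apply/andP; split; lra.
  - apply/cvgeyPgt => M; apply/nearP; exact: (h1 M (ltry _)).
  - apply/cvgeNyPlt => M; apply/nearP; exact: (h2 M (ltNyr _)).
split=> M hM; apply/nearP.
  by apply: (h [set y | (M%:E < y)%E]); apply: open_nbhs_nbhs; split => //; exact: open_ereal_gt_ereal.
by apply: (h [set y | (y < M%:E)%E]); apply: open_nbhs_nbhs; split => //; exact: open_ereal_lt_ereal.
Qed.

Lemma ecvg_ext D f g x l : (forall s, D s -> f s = g s) -> ecvg D f x l -> ecvg D g x l.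
Proof.
move=> fg [h1 h2]; split=> M hM.
  by have [e e0 he] := h1 M hM; exists e => // s Ds; rewrite -fg //; apply: he.
by have [e e0 he] := h2 M hM; exists e => // s Ds; rewrite -fg //; apply: he.
Qed.

Lemma ecvg_cst D x l : ecvg D (fun=> l) x l.
Proof. by split=> M hM; exists 1. Qed.

Lemma ecvg_min D f g x l m : ecvg D f x l -> ecvg D g x m ->
  ecvg D (fun s => Order.min (f s) (g s)) x (Order.min l m).
Proof.
move=> [h1 h2] [k1 k2]; split=> M.
  rewrite lt_min => /andP[/h1[e e0 he] /k1[d d0 hd]].
  exists (Num.min e d); first by rewrite lt_min e0 d0.
  by move=> s Ds; rewrite !lt_min => /andP[a b]; rewrite he ?hd.
rewrite gt_min => /orP[/h2|/k2] [e e0 he]; exists e => // s Ds hs; rewrite gt_min he ?orbT //.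
Qed.

Lemma ecvg_max D f g x l m : ecvg D f x l -> ecvg D g x m ->
  ecvg D (fun s => Order.max (f s) (g s)) x (Order.max l m).
Proof.
move=> [h1 h2] [k1 k2]; split=> M.
  by rewrite lt_max => /orP[/h1|/k1] [e e0 he]; exists e => // s Ds hs; rewrite lt_max he ?orbT.
rewrite gt_max => /andP[/h2[e e0 he] /k2[d d0 hd]].
exists (Num.min e d); first by rewrite lt_min e0 d0.
by move=> s Ds; rewrite lt_min => /andP[a b]; rewrite gt_max he ?hd.
Qed.

Lemma ecvg_lip D f x : D x -> lipschitz_val D f -> ecvg D f x (f x).
Proof.
move=> Dx [K K0 hK]; have [q [_ [hq _ _]]] := hK x x Dx Dx; rewrite hq.
pose k := K + 1; have k0 : 0 < k by rewrite /k; lra.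
have bound e s : 0 < e -> D s -> `|s - x| < e / k -> exists r, f s = r%:E /\ `|r - q| < e.
  move=> e0 Ds hs; have [r [r' [h1 h2 h3]]] := hK s x Ds Dx.
  exists r; split=> //; move: h2; rewrite hq => -[->]; apply: le_lt_trans h3 _.
  apply: (@le_lt_trans _ _ (k * `|s - x|)); last by rewrite mulrC -ltr_pdivlMr.
  by rewrite ler_wpM2r // /k; lra.
split=> M; rewrite lte_fin => hM.
  exists ((q - M) / k); first by rewrite divr_gt0 // subr_gt0.
  move=> s Ds hs; have [|r [-> hr]] := bound (q - M) s _ Ds hs; first by rewrite subr_gt0.
  by rewrite lte_fin; have := ler_norm (q - r); rewrite distrC; lra.
exists ((M - q) / k); first by rewrite divr_gt0 // subr_gt0.
move=> s Ds hs; have [|r [-> hr]] := bound (M - q) s _ Ds hs; first by rewrite subr_gt0.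
by rewrite lte_fin; have := ler_norm (r - q); lra.
Qed.

Lemma ecvg_unique D f g x l m : ecvg D f x l -> ecvg D g x m ->
  (forall e, 0 < e -> exists s, [/\ D s, `|s - x| < e & f s = g s]) -> l = m.
Proof.
move=> hf hg dense.
wlog lm : f g l m hf hg dense / (l <= m)%E.
  move=> wl; case/orP: (le_total l m) => h; first exact: (wl f g).
  apply/esym/(wl g f) => // e e0; have [s [h1 h2 h3]] := dense e e0; by exists s.
apply/eqP; rewrite eq_le lm leNgt /=; apply/negP => lm'.
have [M /andP[M1 M2]] : exists M : R, (l < M%:E < m)%E.
  case: l m lm' {lm hf hg} => [l||] [m||] //; rewrite ?ltxx // => h.
  - by exists ((l + m) / 2); rewrite !lte_fin in h *; lra.
  - by exists (l + 1); rewrite ltry lte_fin; lra.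
  - by exists (m - 1); rewrite ltNyr lte_fin; lra.
  - by exists 0; rewrite ltNyr ltry.
have [e e0 he] := hf.2 M M1; have [d d0 hd] := hg.1 M M2.
have [|s [Ds]] := dense (Num.min e d); first by rewrite lt_min e0 d0.
rewrite lt_min => /andP[a b] fg.
by have := hd s Ds b; rewrite -fg => /(lt_trans (he s Ds a)); rewrite ltxx.
Qed.

Lemma ecvg_comp D D' (h : R -> R) f x l : (forall s, D s -> D' (h s)) ->
  (exists2 K, 0 < K & forall s, D s -> `|h s - h x| <= K * `|s - x|) ->
  ecvg D' f (h x) l -> ecvg D (f \o h) x l.
Proof.
move=> DD [K K0 hK] [h1 h2].
have tr e s : D s -> `|s - x| < e / K -> `|h s - h x| < e.
  by move=> Ds hs; apply: le_lt_trans (hK s Ds) _; rewrite mulrC -ltr_pdivlMr.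
split=> M hM.
  have [e e0 he] := h1 M hM; exists (e / K); first by rewrite divr_gt0.
  by move=> s Ds hs; apply: he (tr _ _ Ds hs); apply: DD.
have [e e0 he] := h2 M hM; exists (e / K); first by rewrite divr_gt0.
by move=> s Ds hs; apply: he (tr _ _ Ds hs); apply: DD.
Qed.

Lemma within01P f : {within `[0, 1], continuous f} <->
  forall x, 0 <= x <= 1 -> ecvg [set s | 0 <= s <= 1] f x (f x).
Proof.
have -> : `[0, 1]%classic = [set s : R | 0 <= s <= 1].
  by apply/seteqP; split=> s /=; rewrite in_itv.
rewrite subspace_continuousP; split=> h x hx; apply/ecvgP; exact: h.
Qed.

End EreaLimits.

(** * The different over the interior of the path *)

Section Formula.
Variables (R : realType) (CK : fieldType) (v : valuation R CK) (x0 : CK).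
Variables (A B C : ratfun CK) (v3 : \bar R).
Hypothesis C0 : C != 0.

Definition formula_at rho := different_formula v3 A B C (gauss v x0 rho).

Let term_cvg (F : ratfun CK) (k l : R) x : 0 < k -> ecvg setT
  (fun rho => (k%:E * gauss v x0 rho F - l%:E * gauss v x0 rho C)%E) x
  (k%:E * gauss v x0 x F - l%:E * gauss v x0 x C)%E.
Proof.
move=> k0; have [KC KC0 hC] := gauss_lip v x0 C0.
have finC rho := val_fin (gauss v x0 rho) C0.
have [->|F0] := eqVneq F 0.
  have E rho : (k%:E * gauss v x0 rho 0%R - l%:E * gauss v x0 rho C)%E = (k%:E * +oo)%E.
    have [r ->] := finC rho; rewrite val0.
    by rewrite gt0_muley ?lte_fin.
  by rewrite E; apply: ecvg_ext (ecvg_cst _ _ _) => rho _; rewrite E.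
have [KF KF0 hF] := gauss_lip v x0 F0.
apply: ecvg_lip => //; exists (`|k| * KF + `|l| * KC).
  by rewrite addr_ge0 // mulr_ge0.
move=> s s' _ _; have [r hr] := finC s; have [r' hr'] := finC s'.
have [q hq] := val_fin (gauss v x0 s) F0; have [q' hq'] := val_fin (gauss v x0 s') F0.
exists (k * q - l * r), (k * q' - l * r'); rewrite hr hr' hq hq'; split=> //.
have -> : k * q - l * r - (k * q' - l * r') = k * (q - q') - l * (r - r') by ring.
apply: le_trans (ler_normB _ _) _; rewrite !normrM mulrDl -!mulrA lerD //.
  by apply: ler_wpM2l => //; apply: hF hq hq'.
by apply: ler_wpM2l => //; apply: hC hr hr'.
Qed.

Lemma formula_cvg x : ecvg setT formula_at x (formula_at x).
Proof.
apply: ecvg_max; first exact: ecvg_cst.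
apply: ecvg_min; first exact: ecvg_cst.
apply: ecvg_min; first by apply: term_cvg; lra.
have k0 : (0 : R) < 3 / 2 by lra.
have := term_cvg B 1 x k0; rewrite mul1e; apply: ecvg_ext => s _.
by rewrite mul1e.
Qed.

End Formula.

Lemma cubic_horner (F E : fieldType) (iota : {rmorphism F -> E}) (z : E) (A B C : F) :
  (map_poly iota ('X^3 + A%:P * 'X^2 + B%:P * 'X + C%:P)).[z] =
  z ^+ 3 + iota A * z ^+ 2 + iota B * z + iota C.
Proof.
rewrite !(rmorphD, rmorphM, rmorphXn) /= !map_polyX !map_polyC.
by rewrite !(hornerD, hornerM, horner_exp, hornerX, hornerC) /=; ring.
Qed.

Section Setting.
Variables (R : realType) (K : fieldType) (vK : valuation R K).
Variables (kappa : fieldType) (resK : {rmorphism valring vK -> kappa}).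
Hypothesis K_discrete : nontrivial_discrete vK.
Hypothesis kappa_residue : is_residue_field resK.
Hypothesis kappa_char : 3%N \in [pchar kappa].
Variables (Kbar : closedFieldType) (vbar : valuation R Kbar).
Variable (i : {rmorphism K -> Kbar}).
Hypothesis Kbar_algebraic : forall a : Kbar, algebraicOver i a.
Hypothesis vbar_ext : forall a : K, vbar (i a) = vK a.
Variables (CK : fieldType) (v : valuation R CK) (j : {rmorphism Kbar -> CK}).
Hypothesis CK_completion : is_completion vbar v j.

Lemma v_base a : v (j (i a)) = vK a.
Proof. by have [h _ _] := CK_completion; rewrite h vbar_ext. Qed.

Lemma v_three : v 3 = vK 3.
Proof. by rewrite -(rmorph_nat (j \o i) 3) /= v_base. Qed.

Lemma v_three_gt0 : (0 < v 3%R)%E.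
Proof.
rewrite v_three; have : resK 3 = 0 by rewrite rmorph_nat; have /andP[_ /eqP] := kappa_char.
by move/kappa_residue.2; rewrite rmorph_nat.
Qed.

Lemma v_nontrivial : exists (c : CK) (r : R), v c = r%:E /\ 0 < r.
Proof. by have [r r0 [[x hx] _]] := K_discrete; exists (j (i x)), r; rewrite v_base. Qed.

Lemma v_dense (r r' : R) : r < r' -> exists (c : CK) (q : R), v c = q%:E /\ r < q < r'.
Proof.
have [c [r0 [hc r00]]] := v_nontrivial.
exact: (value_group_dense CK_completion hc (lt0r_neq0 r00)).
Qed.

Section Curve.
Variables (E : fieldType) (iota : {rmorphism ratfun CK -> E}).
Variables (x0 : CK) (z : E) (a2 a1 a0 b3 b2 b1 b0 c4 c2 c1 : CK) (A B C : ratfun CK).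
Hypothesis A_def : let t := xfun CK - ratC CK x0 in let k := ratC CK in
   A = k a2 * t ^+ 2 + k a1 * t + k a0.
Hypothesis B_def : let t := xfun CK - ratC CK x0 in let k := ratC CK in
   B = k b3 * t ^+ 3 + k b2 * t ^+ 2 + k b1 * t + k b0.
Hypothesis C_def : let t := xfun CK - ratC CK x0 in let k := ratC CK in
   C = k c4 * t ^+ 4 + k c2 * t ^+ 2 + k c1 * t.
Hypothesis minpoly_z : is_minimal_polynomial iota z
  ('X^3 + A%:P * 'X^2 + B%:P * 'X + C%:P).
Hypothesis gen : forall x, exists q : {poly ratfun CK}, x = (map_poly iota q).[z].

Let Ap : {poly CK} := a2%:P * 'X^2 + a1%:P * 'X + a0%:P.
Let Bp : {poly CK} := b3%:P * 'X^3 + b2%:P * 'X^2 + b1%:P * 'X + b0%:P.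
Let Cp : {poly CK} := c4%:P * 'X^4 + c2%:P * 'X^2 + c1%:P * 'X.

Let AE : A = polyT x0 Ap.
Proof. by rewrite A_def /Ap !polyTD !(polyTXn, polyTM) !polyTX !polyTC. Qed.

Let BE : B = polyT x0 Bp.
Proof. by rewrite B_def /Bp !polyTD !(polyTXn, polyTM) !polyTX !polyTC. Qed.

Let CE : C = polyT x0 Cp.
Proof. by rewrite C_def normal_C. Qed.

Let irr : irreducible_poly ('X^3 + A%:P * 'X^2 + B%:P * 'X + C%:P).
Proof. by have [] := minpoly_z. Qed.

Lemma minpoly_root : z ^+ 3 + iota A * z ^+ 2 + iota B * z + iota C = 0.
Proof.
by have [_ _ /rootP h] := minpoly_z; rewrite -cubic_horner.
Qed.

Lemma C_neq0 : C != 0. Proof. exact: cubic_const_neq0 irr. Qed.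

Lemma E_algebraic (x : E) : algebraicOver iota x.
Proof.
have [q ->] := gen x; apply/integral_algebraic; apply: integral_horner.
  by apply/integral_poly => k; rewrite coef_map; apply: integral_id.
apply/integral_algebraic; have [/monic_neq0 h _ hz] := minpoly_z.
by exists ('X^3 + A%:P * 'X^2 + B%:P * 'X + C%:P).
Qed.

Variables (A2 A1 A0 : {poly K}) (y : E) (delta : (E -> \bar R) -> \bar R).
Hypothesis delta_different : is_different_function resK v (j \o i) iota y
  (quartic_form A2 A1 A0) delta.

Let Y := Yan v (j \o i) iota y (quartic_form A2 A1 A0).
Let fm := formula_at v x0 A B C (vK 3).

Lemma Yan_gauss (eta : valuation R E) rho :
  (forall f, eta (iota f) = gauss v x0 rho f) -> Y eta.
Proof. by move=> h; left; exists eta; split=> // a; rewrite /Y_cst /= h gauss_C. Qed.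

Lemma delta_typeII (eta : valuation R E) rho (d : CK) : v d = rho%:E ->
  (forall f, eta (iota f) = gauss v x0 rho f) -> delta eta = fm rho.
Proof.
move=> hd he; have [_ h _] := delta_different.
have tII : is_type_II resK (Y_cst iota \o (j \o i)) eta.
  exact: (typeII_gauss kappa_residue Kbar_algebraic vbar_ext CK_completion hd he E_algebraic).
have [H1 [w1 [i1 [H2 [w2 [i2 [g [compl1 compl2 gi gv ->]]]]]]]] := h eta (Yan_gauss he) tII.
rewrite /fm /formula_at -v_three.
have irr' := irr; have pz := minpoly_root; rewrite CE in irr' pz *.
exact: (different_at_gauss v_three_gt0 irr' pz gen he compl1 compl2 gi gv
  (@value_group_div _ _ _ _ _ _ CK_completion) hd).
Qed.

(** Value groups are divisible, so no multiple of [rho] is a value either. *)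
Lemma delta_irrational_step (eta : valuation R E) rho :
  (forall f, eta (iota f) = gauss v x0 rho f) ->
  (~ exists d, v d = rho%:E) -> liftable v x0 iota rho eta.
Proof.
move=> he hn; have irr' := irr; have pz := minpoly_root.
rewrite CE AE BE in irr' pz.
apply: (liftable_irrational v_three_gt0 irr' pz gen he) => [n c n0 hc|c c0].
  have [d [r [h1 h2]]] := value_group_div CK_completion n0 (val_fin_neq0 hc).
  apply: hn; exists d; rewrite h1; congr _%:E; move: h2; rewrite hc => -[].
  move=> /(mulfI (_ : n%:R != 0)) ->; rewrite ?pnatr_eq0 -?lt0n //.
exact: (value_group_root CK_completion).
Qed.

Lemma interval_intro (X : set (E -> \bar R)) (gam : R -> E -> \bar R) (T : E) :
  (forall s, 0 <= s <= 1 -> X (gam s)) ->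
  (forall s s', 0 <= s <= 1 -> 0 <= s' <= 1 -> gam s T = gam s' T -> s = s') ->
  (forall f x, 0 <= x <= 1 -> ecvg [set s | 0 <= s <= 1] (fun s => gam s f) x (gam x f)) ->
  is_interval_in X gam.
Proof.
move=> hX hinj hc; split.
- by move=> s; rewrite in_itv; apply: hX.
- move=> s s'; rewrite !inE /= !in_itv /= => hs hs' e.
  by apply: hinj => //; rewrite e.
by move=> f; apply/within01P => x hx; apply: hc.
Qed.

(** There are radii arbitrarily close to [rho] which are values of constants. *)
Theorem delta_interior (eta : valuation R E) rho :
  (forall f, eta (iota f) = gauss v x0 rho f) -> delta eta = fm rho.
Proof.
move=> he; have [[d hd]|hn] := pselect (exists d, v d = rho%:E).
  exact: delta_typeII hd he.
have [e [W [e0 W0 Wi Wl]]] := delta_irrational_step he hn.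
pose h s : R := rho + s * e; pose gam s : E -> \bar R := W (h s).
have hseg s : 0 <= s <= 1 -> segment rho e (h s).
  move=> /andP[s0 s1]; apply/andP; rewrite /h lerDl lerD2l; split.
    by rewrite mulr_ge0 // ltW.
  by rewrite -[leRHS]mul1r ler_wpM2r // ltW.
have hlip x : exists2 k, 0 < k & forall s, 0 <= s <= 1 -> `|h s - h x| <= k * `|s - x|.
  exists e => // s _; rewrite /h.
  have -> : rho + s * e - (rho + x * e) = e * (s - x) by ring.
  by rewrite normrM (ger0_norm (ltW e0)).
have int_gam : is_interval_in Y gam.
  apply: (@interval_intro _ _ (iota (tpar x0))).
  - by move=> s /hseg hs; apply: Yan_gauss => f; apply: Wi hs.
  - move=> s s' /hseg hs /hseg hs'; rewrite /gam !Wi // !gauss_t => -[] /addrI.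
    by apply: mulIf; rewrite gt_eqF.
  move=> f x hx; have [->|f0] := eqVneq f 0.
    by rewrite /gam val0; apply: ecvg_ext (ecvg_cst _ _ _) => s _; rewrite val0.
  apply: (ecvg_comp (D' := segment rho e) (h := h) (f := fun s => W s f)); rewrite //=.
  by apply: ecvg_lip; [apply: hseg | apply: Wl].
have [_ _ /(_ gam int_gam) /within01P hc] := delta_different.
have h00 : 0 <= (0 : R) <= 1 by rewrite lexx ler01.
have E0 : gam 0 = eta by apply/funext => f; rewrite /gam /h mul0r addr0 W0.
have h0 : h 0 = rho by rewrite /h mul0r addr0.
have lim1 := hc 0 h00; rewrite E0 in lim1.
have lim2 : ecvg [set s | 0 <= s <= 1] (fm \o h) 0 (fm rho).
  by apply: (ecvg_comp (D' := setT)) => //; rewrite h0; apply: formula_cvg C_neq0 _.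
apply: (ecvg_unique lim1 lim2) => k k0.
pose m := Num.min k 1; have m0 : 0 < m by rewrite lt_min k0 ltr01.
have mk : m <= k by rewrite ge_min lexx.
have m1 : m <= 1 by rewrite ge_min lexx orbT.
have [|c [q [hq /andP[q1 q2]]]] := @v_dense rho (rho + m * e); first by rewrite ltrDl mulr_gt0.
pose s := (q - rho) / e.
have hs : h s = q by rewrite /h /s divfK ?gt_eqF // addrC subrK.
have s0 : 0 < s by rewrite divr_gt0 // subr_gt0.
have sm : s < m by rewrite ltr_pdivrMr //; lra.
have s01 : 0 <= s <= 1 by apply/andP; split; lra.
exists s; split=> //; first by rewrite subr0 gtr0_norm //; lra.
rewrite /= hs; apply: (delta_typeII (d := c)) => // f.
by rewrite -hs; apply: Wi; apply: hseg.
Qed.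

End Curve.
End Setting.

(** * Closed points as limits of valuations *)

(** Regular functions at a closed point, compared with a family [W s] of
    valuations which tends to that point when [s] tends to infinity. *)
Section ClosedPoint.
Variables (R : realType) (C E : fieldType) (v : valuation R C) (c : {rmorphism C -> E}).
Variables (m : nat) (e : 'I_m -> E) (P : 'I_m -> C) (k : 'I_m).
Hypothesis ek : e k != 0.
Hypothesis Pk : P k != 0.
Variables (W : R -> valuation R E) (s1 : R).
Hypothesis W_cst : forall s a, s1 <= s -> W s (c a) = v a.

(** [f - a] is as small as the local coordinate up to a constant, so that [f] has the
    value [a] at the limit point. *)
Definition grows (f : E) (a : C) := exists K : R, forall s, K <= s -> vge (W s) (s - K) (f - c a).

Let eps l := e l / e k.
Let p l := P l / P k.

Hypothesis coord_grows : forall l, grows (eps l) (p l).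

Lemma growsW f a : grows f a -> exists K, [/\ 0 <= K, s1 <= K &
  forall s L, K <= L -> L <= s -> vge (W s) (s - L) (f - c a)].
Proof.
move=> [K hK]; exists (Num.max K (Num.max s1 0)); split.
- by rewrite !le_max lexx !orbT.
- by rewrite !le_max lexx !orbT.
move=> s L; rewrite ge_max => /andP[h _] h'; apply: vgeW (hK s (le_trans h h')).
by rewrite lerD2l lerN2.
Qed.

Lemma grows_cst a : grows (c a) a.
Proof. by exists 0 => s _; rewrite subrr vge0. Qed.

Lemma growsD f g a b : grows f a -> grows g b -> grows (f + g) (a + b).
Proof.
move=> /growsW[K [K0 _ hK]] /growsW[L [L0 _ hL]]; exists (K + L) => s hs.
rewrite rmorphD (_ : f + g - (c a + c b) = (f - c a) + (g - c b)); last by ring.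
by apply: vgeD; [apply: hK | apply: hL] => //; lra.
Qed.

Lemma vge_cst_ex a : exists2 N : R, 0 <= N & forall s, s1 <= s -> vge (W s) (- N) (c a).
Proof.
have [->|/(val_fin v)[r hr]] := eqVneq a 0.
  by exists 0 => // s _; rewrite rmorph0 vge0.
exists `|r| => // s hs; rewrite /vge W_cst // hr lee_fin.
by have := ler_norm (- r); rewrite normrN; lra.
Qed.

Lemma growsM f g a b : grows f a -> grows g b -> grows (f * g) (a * b).
Proof.
move=> /growsW[K [K0 sK hK]] /growsW[L [L0 sL hL]].
have [N N0 hN] := vge_cst_ex a; have [N' N0' hN'] := vge_cst_ex b.
exists (K + L + N + N') => s hs; have ss : s1 <= s by lra.
have h1 := hK s K (lexx _) ltac:(lra); have h2 := hL s L (lexx _) ltac:(lra).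
rewrite rmorphM (_ : f * g - c a * c b =
  (f - c a) * (g - c b) + (c a * (g - c b) + c b * (f - c a))); last by ring.
apply: vgeD; first by apply: vgeM' h1 h2 _; lra.
apply: vgeD; first by apply: vgeM' (hN s ss) h2 _; lra.
by apply: vgeM' (hN' s ss) h1 _; lra.
Qed.

Lemma grows_neq0 f a : grows f a -> a != 0 -> f != 0.
Proof.
move=> /growsW[K [K0 sK hK]] a0; apply/eqP => f0; subst f.
have [r hr] := val_fin v a0.
have hs : s1 <= K + `|r| + 1 by have := normr_ge0 r; lra.
have := hK (K + `|r| + 1) K (lexx _) ltac:(have := normr_ge0 r; lra).
rewrite sub0r vgeN /vge W_cst // hr lee_fin; have := ler_norm r; lra.
Qed.

Lemma grows_val f a : grows f a -> a != 0 -> exists L : R, forall s, L <= s -> W s f = v a.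
Proof.
move=> /growsW[K [K0 sK hK]] a0; have [r hr] := val_fin v a0.
exists (K + `|r| + 1) => s hs; rewrite hr.
have ss : s1 <= s by have := normr_ge0 r; lra.
have h := hK s K (lexx _) ltac:(have := normr_ge0 r; lra).
apply: (valB_fin (M := s - K)) h; first by rewrite W_cst.
by have := ler_norm r; lra.
Qed.

Lemma growsV f a : grows f a -> a != 0 -> grows f^-1 a^-1.
Proof.
move=> gf a0; have f0 := grows_neq0 gf a0.
have [L hL] := grows_val gf a0; have [K [K0 sK hK]] := growsW gf.
have [r hr] := val_fin v a0.
have ca0 : c a != 0 by rewrite fmorph_eq0.
exists (Num.max L K + 2 * `|r|) => s hs.
have r0 := normr_ge0 r.
have l1 : L <= s by apply: le_trans hs; rewrite ler_wpDr ?le_max ?lexx // mulr_ge0.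
have l2 : K <= s by apply: le_trans hs; rewrite ler_wpDr ?le_max ?lexx ?orbT // mulr_ge0.
have h := hK s K (lexx _) l2.
have ss : s1 <= s by lra.
have hf : W s f = r%:E by rewrite hL.
have hc : W s (c a) = r%:E by rewrite W_cst.
rewrite fmorphV (_ : f^-1 - (c a)^-1 = - (f - c a) / (f * c a)); last by field; do ?[apply/andP; split]; by [].
rewrite (vgeMr _ _ (valM_fin hf hc)) vgeN; apply: vgeW h.
have : K <= Num.max L K by rewrite le_max lexx orbT.
by have := ler_norm r; lra.
Qed.

Lemma grows_poly (G : mpoly m C) : grows (mmap c eps G) (meval p G).
Proof.
rewrite /meval /mmap.
elim/big_rec2: _ => [|n x y _ IH]; first by rewrite -(rmorph0 c); apply: grows_cst.
apply: growsD => //; apply: growsM; first exact: grows_cst.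
rewrite /mmap1; elim/big_rec2: _ => [|l x' y' _ IH']; first by rewrite -(rmorph1 c); apply: grows_cst.
apply: growsM => //; elim: (n l) => [|q IHq]; first by rewrite !expr0 -(rmorph1 c); apply: grows_cst.
by rewrite !exprS; apply: growsM.
Qed.

Lemma homog_scale (F : fieldType) (h : {rmorphism C -> F}) (a : 'I_m -> F) (G : mpoly m C) n :
  a k != 0 -> G \is ishomog1 n mdeg -> mmap h a G = a k ^+ n * mmap h (fun l => a l / a k) G.
Proof.
move=> ak /dhomogP hG; rewrite /mmap big_distrr /=; apply: eq_big_seq => q hq.
rewrite mulrCA; congr (_ * _); rewrite -(hG q hq : mdeg q = n) mdegE /mmap1 expr_sum -big_split /=.
by apply: eq_bigr => l _; rewrite -exprMn mulrC divfK.
Qed.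

Local Notation V := (value_at c e P).

Lemma value_atE f a : V f a <-> exists (n : nat) (g h : mpoly m C),
  [/\ g \is ishomog1 n mdeg, h \is ishomog1 n mdeg, meval p h != 0,
      f = mmap c eps g / mmap c eps h & a = meval p g / meval p h].
Proof.
have ekn n : e k ^+ n != 0 by rewrite expf_neq0.
have Pkn n : P k ^+ n != 0 by rewrite expf_neq0.
have sc n (G : mpoly m C) : G \is ishomog1 n mdeg ->
    mmap c e G = e k ^+ n * mmap c eps G /\ meval P G = P k ^+ n * meval p G.
  move=> hG; split; first exact: homog_scale.
  exact: (@homog_scale _ idfun).
split=> -[n [g [h [hg hh h0 -> ->]]]]; exists n, g, h; split=> //.
- by move: h0; rewrite (sc n h hh).2 mulf_eq0 negb_or => /andP[].
- by rewrite (sc n h hh).1 (sc n g hg).1 invfM mulrACA mulfV ?mul1r.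
- by rewrite (sc n h hh).2 (sc n g hg).2 invfM mulrACA mulfV ?mul1r.
- by rewrite (sc n h hh).2 mulf_neq0.
- by rewrite (sc n h hh).1 (sc n g hg).1 invfM mulrACA mulfV ?mul1r.
- by rewrite (sc n h hh).2 (sc n g hg).2 invfM mulrACA mulfV ?mul1r.
Qed.

Lemma value_grows f a : V f a -> grows f a.
Proof.
move=> /value_atE[n [g [h [_ _ h0 -> ->]]]].
by apply: growsM (grows_poly g) _; apply: growsV (grows_poly h) h0.
Qed.

Lemma grows_unique f a b : grows f a -> grows f b -> a = b.
Proof.
move=> fa fb; apply/eqP; rewrite -subr_eq0; apply/negPn/negP => ab.
have gc : grows 0 (b - a).
  have := growsD fb (growsM (grows_cst (-1)) fa); rewrite rmorphN rmorph1 !mulN1r subrr.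
  by [].
by have := grows_neq0 gc; rewrite -opprB oppr_eq0 ab eqxx => /(_ isT).
Qed.

Lemma closed_val_regular f a : V f a -> closed_point_val v c e P f = v a.
Proof.
move=> fa; rewrite /closed_point_val asboolT; last by exists a.
congr (v _); case: xgetP => [b _ fb|/(_ a)//].
exact: grows_unique (value_grows fb) (value_grows fa).
Qed.

Lemma V_cst a : V (c a) a.
Proof.
exists 0%N, (mpolyC m a), 1; split; rewrite ?mevalC ?meval1 ?oner_neq0 ?dhomog1 //.
- by rewrite -[mpolyC m a]mulr1 -mpolyC1 -mpolyCM mulr1 -alg_mpolyC; apply: dhomogZ; rewrite dhomog1.
- by rewrite (rmorph1 (mmap c e)) mmapC divr1.
by rewrite divr1.
Qed.

Let homX (l : 'I_m) : mpolyX C (mnm1 l) \is ishomog1 1 mdeg.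
Proof. by rewrite dhomogX; apply/eqP; exact: mdeg1. Qed.

Lemma V_coord l : V (eps l) (p l).
Proof.
exists 1%N, (mpolyX C (mnm1 l)), (mpolyX C (mnm1 k)); split; rewrite ?homX //.
- by rewrite mevalXU.
- by rewrite !mmapX !mmap1U.
by rewrite !mevalXU.
Qed.

Let nz (h : mpoly m C) : meval p h != 0 -> mmap c eps h != 0.
Proof. by move=> h0; apply: grows_neq0 (grows_poly h) h0. Qed.

Lemma V_add f g a b : V f a -> V g b -> V (f + g) (a + b).
Proof.
move=> /value_atE[n [g1 [h1 [hg1 hh1 h10 -> ->]]]] /value_atE[n' [g2 [h2 [hg2 hh2 h20 -> ->]]]].
apply/value_atE; exists (n + n')%N, (g1 * h2 + g2 * h1), (h1 * h2); split.
- by apply: dhomogD; [|rewrite addnC]; apply: dhomogM.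
- exact: dhomogM.
- by rewrite mevalM mulf_neq0.
- by rewrite mmapD !(rmorphM (mmap c eps)) /= addf_div ?nz.
by rewrite mevalD !mevalM addf_div.
Qed.

Lemma V_mul f g a b : V f a -> V g b -> V (f * g) (a * b).
Proof.
move=> /value_atE[n [g1 [h1 [hg1 hh1 h10 -> ->]]]] /value_atE[n' [g2 [h2 [hg2 hh2 h20 -> ->]]]].
apply/value_atE; exists (n + n')%N, (g1 * g2), (h1 * h2); split; try exact: dhomogM.
- by rewrite mevalM mulf_neq0.
- by rewrite !(rmorphM (mmap c eps)) /= mulf_div.
by rewrite !mevalM mulf_div.
Qed.

Lemma V_inv f a : V f a -> a != 0 -> V f^-1 a^-1.
Proof.
move=> [n [g [h [hg hh h0 -> ->]]]] a0; exists n, h, g; split; rewrite ?invf_div //.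
by apply: contraNneq a0 => ->; rewrite mul0r.
Qed.

Lemma V_exp f a n : V f a -> V (f ^+ n) (a ^+ n).
Proof.
move=> fa; elim: n => [|n IH]; first by rewrite !expr0 -(rmorph1 c); apply: V_cst.
by rewrite !exprS; apply: V_mul.
Qed.

Variable (pi : E).
Hypothesis pi_val : forall s, s1 <= s -> W s pi = s%:E.

Hypothesis pi_regular : V pi 0.

(** [f - f(P)] is divisible by [pi] in the local ring; all regular functions inherit
    this from the coordinates. *)
Definition unif (f : E) (a : C) := V f a /\ exists g b, V g b /\ f - c a = pi * g.

Hypothesis coord_unif : forall l, unif (eps l) (p l).

Lemma unif_cst a : unif (c a) a.
Proof.
split; first exact: V_cst.
by exists 0, 0; rewrite subrr mulr0; split=> //; rewrite -(rmorph0 c); apply: V_cst.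
Qed.

Lemma unifD f g a b : unif f a -> unif g b -> unif (f + g) (a + b).
Proof.
move=> [Vf [f' [a' [Vf' ef]]]] [Vg [g' [b' [Vg' eg]]]]; split; first exact: V_add.
exists (f' + g'), (a' + b'); split; first exact: V_add.
by rewrite mulrDr -ef -eg rmorphD; ring.
Qed.

Lemma unifM f g a b : unif f a -> unif g b -> unif (f * g) (a * b).
Proof.
move=> [Vf [f' [a' [Vf' ef]]]] [Vg [g' [b' [Vg' eg]]]]; split; first exact: V_mul.
exists (f * g' + f' * c b), (a * b' + a' * b); split.
  by apply: V_add; apply: V_mul => //; apply: V_cst.
rewrite mulrDr mulrCA -eg mulrA -ef rmorphM; ring.
Qed.

Lemma unifV f a : unif f a -> a != 0 -> unif f^-1 a^-1.
Proof.
move=> [Vf [f' [a' [Vf' ef]]]] a0; split; first exact: V_inv.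
have f0 := grows_neq0 (value_grows Vf) a0.
have ca0 : c a != 0 by rewrite fmorph_eq0.
exists (- f' * (f^-1 * (c a)^-1)), (- a' * (a^-1 * a^-1)); split.
  apply: V_mul; last by apply: V_mul; [apply: V_inv | rewrite -fmorphV; apply: V_cst].
  by have := V_mul (V_cst (-1)) Vf'; rewrite rmorphN rmorph1 !mulN1r.
transitivity (- (pi * f') * (f^-1 * (c a)^-1)); last by ring.
by rewrite -ef fmorphV; field; do ?[apply/andP; split]; by [].
Qed.

Lemma unif_poly (G : mpoly m C) : unif (mmap c eps G) (meval p G).
Proof.
rewrite /meval /mmap.
elim/big_rec2: _ => [|n x y _ IH]; first by rewrite -(rmorph0 c); apply: unif_cst.
apply: unifD => //; apply: unifM; first exact: unif_cst.
rewrite /mmap1; elim/big_rec2: _ => [|l x' y' _ IH']; first by rewrite -(rmorph1 c); apply: unif_cst.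
apply: unifM => //; elim: (n l) => [|q IHq]; first by rewrite !expr0 -(rmorph1 c); apply: unif_cst.
by rewrite !exprS; apply: unifM.
Qed.

Lemma value_unif f a : V f a -> unif f a.
Proof.
move=> /value_atE[n [g [h [_ _ h0 -> ->]]]].
by apply: unifM (unif_poly g) _; apply: unifV (unif_poly h) h0.
Qed.

Hypothesis bounded_above : forall f, f != 0 ->
  exists K L : R, forall s r, L <= s -> W s f = r%:E -> r <= K * s + L.
Hypothesis frac : forall f, exists x a y b, [/\ V x a, V y b, y != 0 & f = x / y].

Lemma pi_neq0 : pi != 0.
Proof. exact: val_fin_neq0 (pi_val (lexx s1)). Qed.

(** Repeated division by [pi] stops because the values of [f] grow at most linearly. *)
Lemma regular_unit f a : V f a -> f != 0 ->
  exists (n : nat) g b, [/\ f = pi ^+ n * g, V g b & b != 0].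
Proof.
move=> Vf f0; apply: contrapT => hn.
have step n : exists2 g, f = pi ^+ n * g & V g 0.
  elim: n => [|n [g eg Vg]].
    exists f; first by rewrite expr0 mul1r.
    have [a0|a0] := eqVneq a 0; first by rewrite -a0.
    by exfalso; apply: hn; exists 0%N, f, a; rewrite expr0 mul1r.
  have [_ [g' [b' [Vg' eg']]]] := value_unif Vg.
  rewrite rmorph0 subr0 in eg'.
  exists g'; first by rewrite eg eg' exprSr mulrA.
  have [b0|b0] := eqVneq b' 0; first by rewrite -b0.
  by exfalso; apply: hn; exists n.+1, g', b'; rewrite exprSr -mulrA -eg'.
have [K [L hKL]] := bounded_above f0.
have [n hn'] : exists n : nat, K < n.+1%:R * 1 by apply: archi_ex.
rewrite mulr1 in hn'.
have [g eg /value_grows/growsW[N [N0 sN hN]]] := step n.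
have k0 : 0 < n.+1%:R - K by lra.
pose s := Num.max (Num.max L N) ((N + L + 1) / (n.+1%:R - K)).
have s1' : L <= s by rewrite !le_max lexx.
have s2' : N <= s by rewrite !le_max lexx orbT.
have s3' : (N + L + 1) / (n.+1%:R - K) <= s by rewrite !le_max lexx orbT.
have ss : s1 <= s by lra.
have := hN s N (lexx _) s2'; rewrite rmorph0 subr0 => hg.
have hf : vge (W s) (n%:R * s + (s - N)) f.
  by rewrite eg; apply: vgeM => //; apply: vgeX; rewrite (vge_fin _ (pi_val ss)).
have [r hr] := val_fin (W s) f0.
have := hKL s r s1' hr; rewrite (vge_fin _ hr) in hf.
move: s3'; rewrite ler_pdivrMr // => h1 h2.
have h3 : n.+1%:R = n%:R + 1 :> R by rewrite -natr1.
rewrite h3 mulrBr in h1; lra.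
Qed.

(** Discreteness of the local ring: a function which is not regular has a
    regular inverse, vanishing at the point. *)
Lemma regular_or_pole f : (exists a, V f a) \/ V f^-1 0.
Proof.
have [x [a [y [b [Vx Vy y0 ->]]]]] := frac f.
have [->|x0] := eqVneq x 0.
  by left; exists 0; rewrite mul0r -(rmorph0 c); apply: V_cst.
have [n [g [a' [-> Vg a0]]]] := regular_unit Vx x0.
have [l [h [b' [-> Vh b0]]]] := regular_unit Vy y0.
have g0 := grows_neq0 (value_grows Vg) a0.
have h0 := grows_neq0 (value_grows Vh) b0.
have pX i : pi ^+ i != 0 by rewrite expf_neq0 // pi_neq0.
have [ln|nl] := leqP l n.
  left; exists (0 ^+ (n - l) * (a' / b')).
  have -> : pi ^+ n * g / (pi ^+ l * h) = pi ^+ (n - l) * (g / h).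
    rewrite -[in pi ^+ n](subnK ln) exprD; field; by rewrite h0 pX.
  by apply: V_mul; [exact: V_exp pi_regular | apply: V_mul => //; apply: V_inv].
right; have -> : (pi ^+ n * g / (pi ^+ l * h))^-1 = pi ^+ (l - n) * (h / g).
  rewrite -[in pi ^+ l](subnK (ltnW nl)) exprD; field; by rewrite g0 h0 !pX.
rewrite -[0](mul0r (b' / a')); apply: V_mul; last by apply: V_mul => //; apply: V_inv.
by have := V_exp (l - n) pi_regular; rewrite expr0n subn_eq0 leqNgt nl.
Qed.

Theorem closed_point_limit f :
  (forall M : R, (M%:E < closed_point_val v c e P f)%E ->
     exists L : R, forall s, L <= s -> (M%:E < W s f)%E) /\
  (forall M : R, (closed_point_val v c e P f < M%:E)%E ->
     exists L : R, forall s, L <= s -> (W s f < M%:E)%E).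
Proof.
have big g : V g 0 -> forall M : R, exists L : R, forall s, L <= s -> (M%:E < W s g)%E.
  move=> /value_grows/growsW[K [K0 sK hK]] M; exists (K + `|M| + 1) => s hs.
  have M0 := ler_norm M; have M1 := normr_ge0 M; have := hK s K (lexx _) ltac:(lra).
  by rewrite rmorph0 subr0; apply: vge_gt; lra.
have [[a Vf]|nV] := pselect (exists a, V f a).
  rewrite (closed_val_regular Vf).
  have [a0|a0] := eqVneq a 0.
    by rewrite a0 in Vf *; rewrite val0; split=> M // _; apply: big.
  by have [L hL] := grows_val (value_grows Vf) a0; split=> M hM; exists L => s hs; rewrite hL.
have Vi : V f^-1 0 by case: (regular_or_pole f).
have -> : closed_point_val v c e P f = -oo%E by rewrite /closed_point_val asboolF.
split=> M // _; have [L hL] := big _ Vi (- M); exists L => s /hL.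
have [f0|f0] := eqVneq f 0.
  by exfalso; apply: nV; exists 0; rewrite f0 -(rmorph0 c); apply: V_cst.
have [r hr] := val_fin (W s) f0.
by rewrite (valV_fin hr) hr !lte_fin; lra.
Qed.

End ClosedPoint.

(** * The analytic projective line *)

Section ProjectiveLine.
Variables (R : realType) (C : fieldType) (v : valuation R C).
Notation x := (xfun C).
Notation k := (ratC C).
Notation e := (@P1_coord C).

Lemma closed_point_scale (E : fieldType) (c : {rmorphism C -> E}) m (e' : 'I_m -> E)
    (P P' : 'I_m -> C) (l : 'I_m) : e' l != 0 -> P l != 0 -> P' l != 0 ->
  (forall n, P n / P l = P' n / P' l) ->
  closed_point_val v c e' P = closed_point_val v c e' P'.
Proof.
move=> el Pl Pl' PP.
have E1 f a : value_at c e' P f a <-> value_at c e' P' f a.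
  rewrite (value_atE c el Pl) (value_atE c el Pl').
  have -> : (fun n => P n / P l) = (fun n => P' n / P' l) by apply/funext.
  by [].
apply/funext => f; rewrite /closed_point_val.
have -> : (exists a, value_at c e' P f a) = (exists a, value_at c e' P' f a).
  by apply/propext; split=> -[a h]; exists a; apply/E1.
by congr (if _ then v (xget 0 _) else _); apply/seteqP; split=> a /E1.
Qed.

Let e1 : e (inord 1) = 1. Proof. by rewrite /P1_coord inordK. Qed.
Let e0 : e (inord 0) = x. Proof. by rewrite /P1_coord inordK. Qed.

Lemma ord2P (P : 'I_2 -> Prop) : P (inord 0) -> P (inord 1) -> forall n, P n.
Proof.
move=> h0 h1 [[|[|n]] hn] //.
  by have -> : Ordinal hn = inord 0 by apply: val_inj; rewrite /= inordK.
by have -> : Ordinal hn = inord 1 by apply: val_inj; rewrite /= inordK.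
Qed.

Lemma P1_val_point (a : C) f b :
  value_at k e (P1_point a) f b -> P1_val v (P1_point a) f = v b.
Proof.
apply: (@closed_val_regular _ _ _ v k 2 e (P1_point a) (inord 1) _ _
  (fun s => gauss v a s) 0).
- by rewrite e1 oner_neq0.
- by rewrite /P1_point inordK // oner_neq0.
- by move=> s a' _; apply: gauss_C.
apply: ord2P; rewrite e1 /P1_point !inordK //= !divr1; exists 0 => s _.
  by rewrite e0 subr0; apply: vge_self; apply: gauss_t.
by rewrite rmorph1 subrr vge0.
Qed.

Lemma P1_val_finite (a b : C) : P1_val v (P1_point a) (x - k b) = v (a - b).
Proof.
apply: P1_val_point; exists 1%N.
exists (mpolyX C (mnm1 (inord 0 : 'I_2)) - b *: mpolyX C (mnm1 (inord 1 : 'I_2))).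
exists (mpolyX C (mnm1 (inord 1 : 'I_2))).
have hX (l : 'I_2) : mpolyX C (mnm1 l) \is ishomog1 1 mdeg.
  by rewrite dhomogX; apply/eqP; exact: mdeg1.
split=> //.
- by apply: rpredB => //; apply: rpredZ.
- by rewrite mevalXU /P1_point inordK //= oner_neq0.
- by rewrite mmapB mmapZ !mmapX !mmap1U e0 e1 mulr1 divr1.
by rewrite mevalB mevalZ !mevalXU /P1_point !inordK //= mulr1 divr1.
Qed.

Let infty_grows l : grows k (fun s => gauss v 0 (- s)) (e l / e (inord 0))
  (P1_infty C l / P1_infty C (inord 0)).
Proof.
have x0 : x != 0 by have := tpar_neq0 (0 : C); rewrite /tpar rmorph0 subr0.
have gx s : gauss v 0 (- s) x = (- s)%:E.
  by have := gauss_t v 0 (- s); rewrite /tpar rmorph0 subr0.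
move: l; apply: ord2P; rewrite /P1_infty !inordK //= !divr1 e0 ?e1; exists 0 => s _.
  by rewrite mulfV // rmorph1 subrr vge0.
rewrite rmorph0 !subr0 div1r; apply: vge_self; rewrite (valV_fin (gx s)).
by rewrite opprK.
Qed.

Let infty_value f b : value_at k e (P1_infty C) f b ->
  grows k (fun s => gauss v 0 (- s)) f b.
Proof.
have x0 : x != 0 by have := tpar_neq0 (0 : C); rewrite /tpar rmorph0 subr0.
apply: (@value_grows _ _ _ v k 2 e (P1_infty C) (inord 0) _ _
  (fun s => gauss v 0 (- s)) 0 _ infty_grows).
- by rewrite e0.
- by rewrite /P1_infty inordK // oner_neq0.
- by move=> s a' _; apply: gauss_C.
Qed.

Lemma P1_val_infinite (b : C) : P1_val v (P1_infty C) (x - k b) = -oo%E.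
Proof.
rewrite /P1_val /closed_point_val asboolF // => -[a /infty_value].
have hC s a' : 0 <= s -> gauss v 0 (- s) (k a') = v a' by move=> _; apply: gauss_C.
move=> /(growsW 0)[K [K0 _ hK]].
have [r hr] : exists r : R, vge v r (b + a).
  have [->|/(val_fin v)[r hr]] := eqVneq (b + a) 0; first by exists 0; rewrite vge0.
  by exists r; apply: vge_self hr.
pose s := Num.max K (1 - r).
have s1 : K <= s by rewrite le_max lexx.
have s2 : 1 - r <= s by rewrite le_max lexx orbT.
have := hK (s + 1) K (lexx _) ltac:(lra).
have -> : x - k b - k a = x - k (b + a) by rewrite rmorphD opprD addrA.
have hx : gauss v 0 (- (s + 1)) x = (- (s + 1))%:E.
  by have := gauss_t v 0 (- (s + 1)); rewrite /tpar rmorph0 subr0.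
have hxb : gauss v 0 (- (s + 1)) (x - k (b + a)) = (- (s + 1))%:E.
  apply: (valD_fin hx (M := r)); first lra.
  by rewrite vgeN /vge gauss_C.
rewrite (vge_fin _ hxb); lra.
Qed.

Lemma P1_val_infinite_inv (b : C) : P1_val v (P1_infty C) (x - k b)^-1 = +oo%E.
Proof.
have xb0 : x - k b != 0 := tpar_neq0 b.
have x0 : x != 0 by have := tpar_neq0 (0 : C); rewrite /tpar rmorph0 subr0.
rewrite -(val0 v); apply: (@closed_val_regular _ _ _ v k 2 e (P1_infty C) (inord 0) _ _
  (fun s => gauss v 0 (- s)) 0 _ infty_grows).
- by rewrite e0.
- by rewrite /P1_infty inordK // oner_neq0.
- by move=> s a' _; apply: gauss_C.
exists 1%N, (mpolyX C (mnm1 (inord 1 : 'I_2))).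
exists (mpolyX C (mnm1 (inord 0 : 'I_2)) - b *: mpolyX C (mnm1 (inord 1 : 'I_2))).
have hX (l : 'I_2) : mpolyX C (mnm1 l) \is ishomog1 1 mdeg.
  by rewrite dhomogX; apply/eqP; exact: mdeg1.
have evP : meval (P1_infty C)
    (mpolyX C (mnm1 (inord 0 : 'I_2)) - b *: mpolyX C (mnm1 (inord 1 : 'I_2))) = 1.
  by rewrite mevalB mevalZ !mevalXU /P1_infty !inordK //= mulr0 subr0.
split=> //.
- by apply: rpredB => //; apply: rpredZ.
- by rewrite evP oner_neq0.
- by rewrite mmapB mmapZ !mmapX !mmap1U e0 e1 mulr1 div1r.
by rewrite evP mevalXU /P1_infty inordK // divr1.
Qed.

Lemma P1an_cases xi : P1an v xi -> [\/ exists w : valuation R (ratfun C), xi = w /\ forall a, w (k a) = v a,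
  exists a, xi = P1_val v (P1_point a) | xi = P1_val v (P1_infty C)].
Proof.
have x0 : x != 0 by have := tpar_neq0 (0 : C); rewrite /tpar rmorph0 subr0.
move=> [h|[P [[l hl] ->]]]; first by constructor 1.
have [p1|p1] := eqVneq (P (inord 1)) 0.
  have p0 : P (inord 0) != 0.
    by move: l hl; apply: ord2P => //; rewrite p1 eqxx.
  constructor 3; apply: (@closed_point_scale _ _ _ _ _ _ (inord 0)); rewrite ?e0 //.
    by rewrite /P1_infty inordK // oner_neq0.
  by apply: ord2P; rewrite /P1_infty !inordK //= ?p1 ?mul0r ?mulfV ?oner_neq0 // divr1.
constructor 2; exists (P (inord 0) / P (inord 1)).
apply: (@closed_point_scale _ _ _ _ _ _ (inord 1)); rewrite ?e1 ?oner_neq0 //.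
  by rewrite /P1_point inordK // oner_neq0.
by apply: ord2P; rewrite /P1_point !inordK //= ?divr1 // mulfV.
Qed.

(** In the open disc around [a] the distance to a point outside is constant. *)
Lemma P1an_disc xi (a b : C) (r : R) : P1an v xi -> (r%:E < xi (x - k a)%R)%E ->
  (v (b - a)%R <= r%:E)%E -> xi (x - k b) = v (b - a).
Proof.
have near F (w : valuation R F) (p q : F) : (r%:E < w p)%E -> (w q <= r%:E)%E -> w (p - q) = w q.
  move=> hp hq; rewrite -(valN w q); apply: val_eq_near; rewrite opprK subrK valN.
  exact: le_lt_trans hp.
move=> /P1an_cases[[w [-> wc]]|[p ->]|->] h1 h2.
- rewrite (_ : x - k b = (x - k a) - k (b - a)); last by rewrite rmorphB opprB addrA subrK.
  by rewrite near ?wc.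
- rewrite P1_val_finite in h1; rewrite P1_val_finite (_ : p - b = (p - a) - (b - a)); last by ring.
  exact: near.
by rewrite P1_val_infinite in h1.
Qed.

End ProjectiveLine.

(** * The path from [x0] to infinity *)

(** The supremum of the times before [s0] at which [f] is at most [r]. *)
Lemma last_crossing (R : realType) (f : R -> \bar R) (s0 r : R) : 0 <= s0 <= 1 ->
  (forall x, 0 <= x <= 1 -> ecvg [set s | 0 <= s <= 1] f x (f x)) ->
  (f 0%R <= r%:E)%E -> (r%:E < f s0)%E ->
  exists s1, [/\ 0 <= s1, s1 < s0, f s1 = r%:E & forall s, s1 < s -> s <= s0 -> (r%:E < f s)%E].
Proof.
move=> /andP[s00 s01] fc f0 fs0.
pose S := [set s | 0 <= s <= s0 /\ (f s <= r%:E)%E].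
have S0 : S 0 by split; rewrite ?lexx.
have Sub : ubound S s0 by move=> s [/andP[]].
have Ssup : has_sup S by split; [exists 0 | exists s0].
pose s1 := sup S.
have s10 : 0 <= s1 by apply: ub_le_sup => //; exists s0.
have s1s : s1 <= s0 by apply: sup_le_ub => //; exists 0.
have s1D : 0 <= s1 <= 1 by rewrite s10 (le_trans s1s).
have after s : s1 < s -> s <= s0 -> (r%:E < f s)%E.
  move=> h1 h2; rewrite ltNge; apply/negP => h.
  have : s <= s1 by apply: ub_le_sup; [exists s0 | split=> //; rewrite h2 (le_trans s10) // ltW].
  by rewrite leNgt h1.
have le1 : (f s1 <= r%:E)%E.
  rewrite leNgt; apply/negP => h; have [d d0 hd] := (fc s1 s1D).1 r h.
  have [s [[/andP[a1 a2] b] c]] := sup_adherent d0 Ssup.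
  have : s <= s1 by apply: ub_le_sup; [exists s0 | split=> //; rewrite a1].
  move=> ss1; have := hd s; rewrite /= a1 (le_trans a2) //= => /(_ isT).
  rewrite distrC ger0_norm ?subr_ge0 // => hh.
  have : (r%:E < f s)%E by apply: hh; rewrite ltrBlDr -ltrBlDl.
  by rewrite ltNge b.
have lt1 : s1 < s0.
  rewrite lt_neqAle s1s andbT; apply/eqP => e; move: fs0; rewrite -e ltNge le1 //.
exists s1; split=> //; apply/eqP; rewrite eq_le le1 leNgt /=; apply/negP => h.
have [d d0 hd] := (fc s1 s1D).2 r h.
pose s := Num.min s0 (s1 + d / 2).
have ss : s1 < s by rewrite lt_min lt1 ltrDl divr_gt0.
have ss0 : s <= s0 by rewrite ge_min lexx.
have ssd : s <= s1 + d / 2 by rewrite ge_min lexx orbT.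
have h1 : (f s < r%:E)%E.
  apply: hd; first by rewrite /= (le_trans s10 (ltW ss)) (le_trans ss0).
  by rewrite gtr0_norm ?subr_gt0 //; lra.
by have := lt_trans h1 (after s ss ss0); rewrite ltxx.
Qed.

Lemma addrC_sub (V : zmodType) (p q : V) : p + q - p = q.
Proof. by rewrite addrC addKr. Qed.

Section Path.
Variables (R : realType) (Kbar : closedFieldType) (C : fieldType) (vbar : valuation R Kbar).
Variables (v : valuation R C) (j : {rmorphism Kbar -> C}).
Hypothesis compl : is_completion vbar v j.
Variables (x0 : C) (gamma : R -> ratfun C -> \bar R).
Hypothesis gamma_interval : is_interval_in (P1an v) gamma.
Hypothesis gamma0 : gamma 0 = P1_val v (P1_point x0).
Hypothesis gamma1 : gamma 1 = P1_val v (@P1_infty C).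
Notation x := (xfun C).
Notation k := (ratC C).

Lemma path_continuous f t : 0 <= t <= 1 ->
  ecvg [set s | 0 <= s <= 1] (fun s => gamma s f) t (gamma t f).
Proof. by move=> ht; have [_ _ /(_ f) /within01P] := gamma_interval; apply. Qed.

Lemma path_point s : 0 <= s <= 1 -> P1an v (gamma s).
Proof. by move=> hs; have [h _ _] := gamma_interval; apply: h; rewrite in_itv. Qed.

Lemma path_inj s t : 0 <= s <= 1 -> 0 <= t <= 1 -> gamma s = gamma t -> s = t.
Proof.
by move=> hs ht; have [_ h _] := gamma_interval; apply: h; rewrite inE /= in_itv.
Qed.

(** The values of all linear polynomials at [gamma s1] are limits of values at
    points inside the disc, where they are known by [P1an_disc]. *)
Lemma boundary_point (a : C) (r s1 s0 : R) : 0 <= s1 <= 1 -> 0 <= s0 <= 1 -> s1 != s0 ->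
  gamma s1 (x - k a) = r%:E ->
  (forall s, `|s - s1| <= `|s0 - s1| -> 0 < (s - s1) * (s0 - s1) -> (r%:E < gamma s (x - k a)%R)%E) ->
  gamma s1 = gauss v a r.
Proof.
move=> hs1 hs0 s10 h1 h2.
(* Inside the disc the value of [x - b] is constant, hence also at [s1]. *)
have far b : (v (b - a)%R <= r%:E)%E -> gamma s1 (x - k b) = v (b - a).
  move=> hb; apply: (ecvg_unique (D := [set s | 0 <= s <= 1]) (path_continuous (x - k b) hs1)
    (ecvg_cst _ s1 (v (b - a)))) => e e0.
  have d0 : 0 < `|s0 - s1| by rewrite normr_gt0 subr_eq0 eq_sym.
  pose l := Num.min 1 (e / (2 * `|s0 - s1|)).
  have l0 : 0 < l by rewrite lt_min ltr01 divr_gt0 // mulr_gt0.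
  have l1 : l <= 1 by rewrite ge_min lexx.
  have l2 : l * `|s0 - s1| <= e / 2.
    apply: (@le_trans _ _ (e / (2 * `|s0 - s1|) * `|s0 - s1|)).
      by rewrite ler_wpM2r // ge_min lexx orbT.
    by rewrite invfM mulrA divfK ?gt_eqF.
  pose s := s1 + l * (s0 - s1).
  have es : s - s1 = l * (s0 - s1) by rewrite /s addrC addKr.
  have sD : 0 <= s <= 1.
    have -> : s = (1 - l) * s1 + l * s0 by rewrite /s; ring.
    have l1' : 0 <= 1 - l by rewrite subr_ge0.
    move: hs1 hs0 => /andP[a1 a2] /andP[b1 b2]; apply/andP; split.
      by rewrite addr_ge0 // mulr_ge0 // ltW.
    have e1 : (1 - l) * s1 <= (1 - l) * 1 by rewrite ler_wpM2l.
    have e2 : l * s0 <= l * 1 by rewrite ler_wpM2l // ltW.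
    lra.
  exists s; split=> //.
    by rewrite es normrM gtr0_norm //; lra.
  apply: (P1an_disc (path_point sD) _ hb); apply: h2.
    by rewrite es normrM gtr0_norm // ler_piMl.
  by rewrite es -mulrA mulr_gt0 // -expr2 exprn_even_gt0 //= subr_eq0 eq_sym.
case/P1an_cases: (path_point hs1) => [[w [ew wc]]|[p ep]|ei].
- have wa : w (x - k a) = r%:E by rewrite -ew.
  rewrite ew; apply/funext => f; apply: (gauss_detect compl wc) => b.
  rewrite /tpar -addrA -opprD -rmorphD -ew.
  have [hb|hb] := leP (v b) r%:E.
    by rewrite far addrC addKr.
  rewrite ew rmorphD opprD addrA.
  apply/eqP; rewrite -wa; apply/eqP; apply: val_eq_near.
  by rewrite addrC_sub valN wc wa.
- have := far p; rewrite ep P1_val_finite subrr val0 => far'.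
  have va : v (p - a) = r%:E by rewrite -h1 ep P1_val_finite.
  by have := far' ltac:(by rewrite va); rewrite va.
by move: h1; rewrite ei P1_val_infinite.
Qed.

(** Otherwise the path enters and leaves an open disc which contains neither of its
    ends, both times through the boundary point of the disc; it is injective. *)
Lemma path_bound s a : 0 <= s <= 1 -> (gamma s (x - k a)%R <= v (x0 - a)%R)%E.
Proof.
move=> hs; rewrite leNgt; apply/negP => h.
have [r hr] : exists2 r : R, (v (x0 - a)%R <= r%:E)%E & (r%:E < gamma s (x - k a)%R)%E.
  case E : (v (x0 - a)) h => [q||] h.
  - by exists q.
  - by move: h; rewrite ltNge leey.
  - by have := @val_neqNy _ _ v (x0 - a); rewrite E.
move=> hr'.
have f0 : (gamma 0 (x - k a)%R <= r%:E)%E by rewrite gamma0 P1_val_finite.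
have f1 : (gamma (1 - 0) (x - k a)%R <= r%:E)%E by rewrite subr0 gamma1 P1_val_infinite leNye.
have [s1 [s10 s1s e1 after1]] := last_crossing hs (fun t ht => path_continuous (x - k a) ht) f0 hr'.
have hs' : 0 <= 1 - s <= 1 by move: hs => /andP[? ?]; apply/andP; split; lra.
have rev (t : R) : 0 <= t <= 1 -> 0 <= 1 - t <= 1 by move=> /andP[? ?]; apply/andP; split; lra.
have c' (t : R) : 0 <= t <= 1 -> ecvg [set s | 0 <= s <= 1] (fun s => gamma (1 - s) (x - k a)) t
    (gamma (1 - t) (x - k a)).
  move=> ht; apply: (ecvg_comp (D' := [set s | 0 <= s <= 1]) (h := fun s => 1 - s)
    (f := fun s => gamma s (x - k a))); [exact: rev | | exact: path_continuous (rev _ ht)].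
  exists 1 => // s' _; rewrite mul1r (_ : 1 - s' - (1 - t) = - (s' - t)) ?normrN //; ring.
have hr'' : (r%:E < gamma (1 - (1 - s)) (x - k a)%R)%E by rewrite subKr.
have [t1 [t10 t1s e2 after2]] := last_crossing hs' c' f1 hr''.
have s01 : s <= 1 by move: hs => /andP[].
have d1 : 0 <= s1 <= 1 by rewrite s10 (le_trans (ltW s1s)).
have d2 : 0 <= 1 - t1 <= 1 by apply: rev; rewrite t10 (le_trans (ltW t1s)) //; move: hs' => /andP[].
have E1 : gamma s1 = gauss v a r.
  apply: (boundary_point d1 hs _ e1); first by rewrite lt_eqF.
  move=> q hq; rewrite pmulr_lgt0 ?subr_gt0 // => hq'; apply: after1 => //.
  move: hq; rewrite !gtr0_norm ?subr_gt0 //; lra.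
have E2 : gamma (1 - t1) = gauss v a r.
  apply: (boundary_point d2 hs _ e2); first by apply/eqP => h'; lra.
  move=> q hq hq'; have q1 : q < 1 - t1.
    rewrite -subr_lt0; move: hq'; rewrite nmulr_lgt0 //; lra.
  have := after2 (1 - q); rewrite subKr; apply; first lra.
  move: hq; rewrite !ltr0_norm ?subr_lt0 //; lra.
have := path_inj d1 d2 (etrans E1 (esym E2)); lra.
Qed.

(** By [path_bound] the valuation has the values of a Gauss valuation with centre
    [x0] on linear polynomials. *)
Lemma path_gauss s : 0 < s < 1 -> exists rho : R, gamma s = gauss v x0 rho.
Proof.
move=> /andP[s0 s1]; have hs : 0 <= s <= 1 by rewrite !ltW.
have d0 : 0 <= (0 : R) <= 1 by rewrite lexx ler01.
have d1 : 0 <= (1 : R) <= 1 by rewrite lexx ler01.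
case/P1an_cases: (path_point hs) => [[w [ew wc]]|[p ep]|ei].
- have [rho hrho] := val_fin w (tpar_neq0 x0).
  exists rho; rewrite ew; apply/funext; apply: (gauss_detect compl wc) => a.
  have hb : (w (tpar x0 - k a)%R <= v a)%E.
    have := path_bound (x0 + a) hs; rewrite ew rmorphD opprD addrA => h.
    by apply: le_trans h _; rewrite opprD addrA subrr sub0r valN.
  have [h|h] := ltP rho%:E (v a).
    by rewrite -hrho; apply: val_eq_near; rewrite addrC_sub valN wc hrho.
  apply/eqP; rewrite eq_le hb /=; apply: le_trans (Defs.valD w _ _).
  by rewrite valN wc hrho le_min h lexx.
- have hp : v (x0 - p) = +oo%E.
    by apply/eqP; rewrite -leye_eq; have := path_bound p hs; rewrite ep P1_val_finite subrr val0.
  have {hp} hp : x0 = p by apply/eqP; rewrite -subr_eq0; apply/eqP; apply/(val_eqy v).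
  have := path_inj hs d0 (etrans ep (etrans (f_equal _ (esym (f_equal _ hp))) (esym gamma0))).
  by move=> e; rewrite e ltxx in s0.
by have e := path_inj hs d1 (etrans ei (esym gamma1)); rewrite e ltxx in s1.
Qed.

Lemma path_to_zero (M : R) : exists2 e, 0 < e & forall s rho, 0 < s -> s < e -> s < 1 ->
  gamma s = gauss v x0 rho -> M < rho.
Proof.
have d0 : 0 <= (0 : R) <= 1 by rewrite lexx ler01.
have [|e e0 he] := (path_continuous (tpar x0) d0).1 M.
  by rewrite gamma0 P1_val_finite subrr val0 ltry.
exists e => // s rho s0 se s1 es.
have := he s; rewrite /= es gauss_t lte_fin; apply; first by rewrite !ltW.
by rewrite subr0 gtr0_norm.
Qed.

Lemma path_to_one (M : R) : exists2 e, 0 < e & forall s rho, 0 < s -> 1 - e < s -> s < 1 ->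
  gamma s = gauss v x0 rho -> rho < M.
Proof.
have d1 : 0 <= (1 : R) <= 1 by rewrite lexx ler01.
have [|e e0 he] := (path_continuous (tpar x0)^-1 d1).1 (- M).
  by rewrite gamma1 P1_val_infinite_inv ltry.
exists e => // s rho s0 se s1 es.
have := he s; rewrite /= es (valV_fin (gauss_t v x0 rho)) lte_fin ltrN2; apply; first by rewrite !ltW.
by rewrite distrC ger0_norm ?subr_ge0 ?ltW //; lra.
Qed.

End Path.

(** * Continuity at an endpoint *)

Section Endpoint.
Variables (R : realType) (CK E : fieldType) (v : valuation R CK) (x0 : CK).
Variables (iota : {rmorphism ratfun CK -> E}) (X : set (E -> \bar R)).
Variables (delta : (E -> \bar R) -> \bar R) (fm : R -> \bar R).
Hypothesis delta_gauss : forall (eta : valuation R E) rho,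
  (forall f, eta (iota f) = gauss v x0 rho f) -> delta eta = fm rho.
Hypothesis X_gauss : forall (eta : valuation R E) rho,
  (forall f, eta (iota f) = gauss v x0 rho f) -> X eta.
Hypothesis delta_continuous : forall gamma, is_interval_in X gamma ->
  {within `[0, 1], continuous (fun s => delta (gamma s))}.
Variables (xi : E -> \bar R) (W : R -> valuation R E) (s1 : R) (rho : R -> R) (pi : E).
Hypothesis X_xi : X xi.
Hypothesis W_iota : forall s f, s1 <= s -> W s (iota f) = gauss v x0 (rho s) f.
Hypothesis W_lip : forall n f, f != 0 -> lipschitz_val (segment s1 n) (fun s => W s f).
Hypothesis W_pi : forall s, s1 <= s -> W s pi = s%:E.
Hypothesis xi_pi : xi pi = +oo%E.
Hypothesis W_lim : forall f,
  (forall M : R, (M%:E < xi f)%E -> exists L : R, forall s, L <= s -> (M%:E < W s f)%E) /\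
  (forall M : R, (xi f < M%:E)%E -> exists L : R, forall s, L <= s -> (W s f < M%:E)%E).

(** The half-line of parameters at least [s1], compactified to [[0, 1]] with
    the closed point [xi] at 0. *)
Let h s : R := s1 + s^-1 - 1.
Let gam s : E -> \bar R := if s == 0 then xi else W (h s).
Let D := [set s : R | 0 <= s <= 1].

Let h_ge s : 0 < s -> s <= 1 -> s1 <= h s.
Proof. by move=> s0 s_1; rewrite /h -addrA lerDl subr_ge0 invf_ge1. Qed.

Let gam0 : gam 0 = xi. Proof. by rewrite /gam eqxx. Qed.

Let gamE s : 0 < s -> gam s = W (h s).
Proof. by move=> s0; rewrite /gam gt_eqF. Qed.

Let h_large L : exists2 e, 0 < e & forall s, 0 < s -> s < e -> L <= h s.
Proof.
exists (`|L - s1| + 2)^-1; first by rewrite invr_gt0; have := normr_ge0 (L - s1); lra.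
move=> s s0 hs; have d0 : 0 < `|L - s1| + 2 by have := normr_ge0 (L - s1); lra.
have : `|L - s1| + 2 <= s^-1 by rewrite -[leLHS]invrK lef_pV2 ?posrE ?invr_gt0 // ltW.
by rewrite /h; have := ler_norm (L - s1); lra.
Qed.

Lemma endpoint_interval : is_interval_in X gam.
Proof.
apply: (@interval_intro _ _ X gam pi).
- move=> s /andP[s0 s_1]; have [->|n0] := eqVneq s 0; first by rewrite gam0.
  have sp : 0 < s by rewrite lt_neqAle eq_sym n0.
  by rewrite gamE //; apply: X_gauss => f; apply: W_iota; apply: h_ge.
- move=> s s' /andP[s0 s_1] /andP[s0' s_1'].
  have [->|n0] := eqVneq s 0; have [->|n0'] := eqVneq s' 0 => //.
  + have sp : 0 < s' by rewrite lt_neqAle eq_sym n0'.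
    by rewrite gam0 gamE // xi_pi W_pi ?h_ge.
  + have sp : 0 < s by rewrite lt_neqAle eq_sym n0.
    by rewrite gam0 gamE // xi_pi W_pi ?h_ge.
  have sp : 0 < s by rewrite lt_neqAle eq_sym n0.
  have sp' : 0 < s' by rewrite lt_neqAle eq_sym n0'.
  rewrite !gamE // !W_pi ?h_ge // => -[]; rewrite /h => e.
  by apply: invr_inj; lra.
move=> f x hx; have [f0|f0] := eqVneq f 0.
  subst f; have z s : D s -> (+oo = gam s 0)%E.
    move=> hs; have [->|n0] := eqVneq s 0; last by rewrite /gam (negPf n0) val0.
    rewrite gam0; case Exi : (xi 0) => [r||] //; exfalso.
      have [|L hL] := (W_lim 0).2 (r + 1); first by rewrite Exi lte_fin ltrDl.
      by have := hL L (lexx _); rewrite val0 ltNge leey.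
    have [|L hL] := (W_lim 0).2 0; first by rewrite Exi ltNyr.
    by have := hL L (lexx _); rewrite val0 ltNge leey.
  by rewrite -z //; apply: ecvg_ext z (ecvg_cst _ _ _).
have [x_0|x_n0] := eqVneq x 0.
  subst x; rewrite gam0; split=> M hM.
    have [L hL] := (W_lim f).1 M hM; have [e e0 he] := h_large L.
    exists e => // s /andP[s0 s_1]; rewrite subr0 ger0_norm // => se.
    have [->|n0] := eqVneq s 0; first by rewrite gam0.
    by rewrite /gam (negPf n0); apply: hL; apply: he; rewrite // lt_neqAle eq_sym n0.
  have [L hL] := (W_lim f).2 M hM; have [e e0 he] := h_large L.
  exists e => // s /andP[s0 s_1]; rewrite subr0 ger0_norm // => se.
  have [->|n0] := eqVneq s 0; first by rewrite gam0.
  by rewrite /gam (negPf n0); apply: hL; apply: he; rewrite // lt_neqAle eq_sym n0.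
have xp : 0 < x by rewrite lt_neqAle eq_sym x_n0; case/andP: hx.
pose D' := [set s : R | x / 2 <= s <= 1].
have x2 : 0 < x / 2 by rewrite divr_gt0.
have D'x : D' x by rewrite /D' /=; case/andP: hx => _ ->; rewrite andbT; lra.
have loc : ecvg D' (fun s => gam s f) x (gam x f).
  apply: (@ecvg_ext _ D' (fun s => W (h s) f)).
    by move=> s /andP[hs _]; rewrite gamE //; apply: lt_le_trans hs.
  rewrite gamE //; apply: (ecvg_comp (D' := segment s1 (x / 2)^-1) (h := h) (f := fun s => W s f)).
  - move=> s /andP[hs hs']; have sp : 0 < s by apply: lt_le_trans hs.
    apply/andP; split; first exact: h_ge.
    have : s^-1 <= (x / 2)^-1 by rewrite lef_pV2 ?posrE.
    by rewrite /h; lra.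
  - exists (2 / (x * x)); first by rewrite divr_gt0 // mulr_gt0.
    move=> s /andP[hs hs']; have sp : 0 < s by apply: lt_le_trans hs.
    have -> : h s - h x = (x - s) / (s * x) by rewrite /h; field; rewrite !gt_eqF.
    rewrite normrM distrC mulrC [`|(s * x)^-1|]gtr0_norm ?invr_gt0 ?mulr_gt0 //.
    rewrite ler_wpM2r // -[leRHS]invrK lef_pV2 ?posrE ?invr_gt0 ?divr_gt0 ?mulr_gt0 //.
    by rewrite invf_div mulrAC ler_pM2r.
  apply: ecvg_lip; last exact: W_lip.
  apply/andP; split; first by apply: h_ge => //; case/andP: hx.
  have : x^-1 <= (x / 2)^-1 by rewrite lef_pV2 ?posrE //; lra.
  by rewrite /h; lra.
have near0 s : D s -> `|s - x| < x / 2 -> D' s.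
  move=> /andP[_ a1]; rewrite distrC => a2; rewrite /D' /= a1 andbT.
  by have := ler_norm (x - s); lra.
split=> M hM.
  have [e e0 he] := loc.1 M hM; exists (Num.min e (x / 2)); first by rewrite lt_min e0 x2.
  by move=> s Ds; rewrite lt_min => /andP[a b]; apply: he => //; apply: near0.
have [e e0 he] := loc.2 M hM; exists (Num.min e (x / 2)); first by rewrite lt_min e0 x2.
by move=> s Ds; rewrite lt_min => /andP[a b]; apply: he => //; apply: near0.
Qed.

Lemma endpoint_limit :
  (forall M : R, (M%:E < delta xi)%E -> exists L : R, forall s, L <= s -> (M%:E < fm (rho s))%E) /\
  (forall M : R, (delta xi < M%:E)%E -> exists L : R, forall s, L <= s -> (fm (rho s) < M%:E)%E).
Proof.
have p0 : 0 <= (0 : R) <= 1 by rewrite lexx ler01.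
have /within01P /(_ 0 p0) [c1 c2] := delta_continuous endpoint_interval.
rewrite gam0 in c1 c2.
have key (Q : \bar R -> Prop) e : 0 < e ->
    (forall s, D s -> `|s - 0| < e -> Q (delta (gam s))) ->
    exists L : R, forall s, L <= s -> Q (fm (rho s)).
  move=> e0 he; exists (s1 + e^-1 + 1) => s hs.
  have ie : 0 < e^-1 by rewrite invr_gt0.
  have d1 : 1 <= s - s1 + 1 by lra.
  have d0 : 0 < s - s1 + 1 by lra.
  have := he (s - s1 + 1)^-1; rewrite gamE ?invr_gt0 // /h invrK.
  have -> : s1 + (s - s1 + 1) - 1 = s by ring.
  rewrite (@delta_gauss _ (rho s)); last by move=> f; apply: W_iota; lra.
  apply; first by apply/andP; split; [rewrite invr_ge0 ltW | rewrite invf_le1].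
  rewrite subr0 gtr0_norm ?invr_gt0 // -[ltRHS]invrK ltf_pV2 ?posrE //; lra.
split=> M hM.
  by have [e e0 he] := c1 M hM; apply: (key (fun q => (M%:E < q)%E) e).
by have [e e0 he] := c2 M hM; apply: (key (fun q => (q < M%:E)%E) e).
Qed.

End Endpoint.

(** * Newton iteration *)

(** Newton's iteration with constant slope for a polynomial with small constant
    term and linear coefficient close to [b]. *)
Section Newton.
Variables (R : realType) (M : fieldType) (w : valuation R M).
Variables (P : {poly M}) (b : M) (beta N s : R).
Hypothesis N0 : 0 <= N.
Hypothesis b_val : w b = beta%:E.
Hypothesis P_bound : forall k, vge w (- N) P`_k.
Hypothesis P1_near : vge w (s - N) (P`_1 - b).
Hypothesis P0_small : vge w (s - N) P`_0.
Hypothesis s_large : 2 * N + 2 * `|beta| + 1 <= s.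

Fixpoint newton n := if n is n'.+1 then newton n' - P.[newton n'] / b else 0.

Let tau := s - N - beta.

Let tau0 : 0 <= tau.
Proof. rewrite /tau; have := ler_norm beta; have := normr_ge0 beta; have := N0; have := s_large; lra. Qed.

Let b0 : b != 0. Proof. exact: val_fin_neq0 b_val. Qed.

Let pow_diff D x y k : vge w D (x - y) -> vge w tau x -> vge w tau y ->
  vge w (D + tau) (x ^+ k.+2 - y ^+ k.+2).
Proof.
have t0 := tau0.
move=> hD hx hy; elim: k => [|k IH].
  have -> : x ^+ 2 - y ^+ 2 = (x - y) * (x + y) by ring.
  by apply: vgeM => //; apply: vgeD.
have -> : x ^+ k.+3 - y ^+ k.+3 = x * (x ^+ k.+2 - y ^+ k.+2) + (x - y) * y ^+ k.+2.
  by rewrite !(exprS _ k.+2); ring.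
apply: vgeD; first by apply: vgeM0 => //; apply: vgeW hx.
apply: vgeM => //; rewrite exprS; apply: vgeM0r => //; apply: vgeX0; exact: vgeW hy.
Qed.

Let contraction D x y : vge w D (x - y) -> vge w tau x -> vge w tau y ->
  vge w (D + beta + 1) ((P.[x] - b * x) - (P.[y] - b * y)).
Proof.
move=> hD hx hy; have sl := s_large; have nb := ler_norm beta; have n0 := N0.
have nb' := ler_norm (- beta); rewrite normrN in nb'.
have -> : (P.[x] - b * x) - (P.[y] - b * y) =
    \sum_(k < (size P).+2) (if k == 1%N :> nat then (P`_1 - b) * (x - y) else P`_k * (x ^+ k - y ^+ k)).
  have sz : (size P <= (size P).+2)%N by rewrite -addn2 leq_addr.
  rewrite !(horner_coef_wide _ sz).
  rewrite (_ : _ - _ - _ = \sum_(k < (size P).+2) P`_k * x ^+ k - \sum_(k < (size P).+2) P`_k * y ^+ k - b * (x - y)); last by ring.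
  rewrite -sumrB !big_ord_recl /= !expr0 !expr1 !subrr mulr0 !add0r.
  rewrite addrAC; congr (_ + _); first by ring.
  by apply: eq_bigr => k _; rewrite mulrBr.
apply: vge_sum => -[k hk] _ /=; case: k hk => [|[|k]] hk /=.
- by rewrite !expr0 subrr mulr0 vge0.
- by apply: vgeM' P1_near hD _; lra.
apply: vgeM' (P_bound _) (pow_diff k hD hx hy) _; rewrite /tau; lra.
Qed.

(** The map [x - P(x) / b] is a contraction near 0; every step gains 1. *)
Lemma newton_step D : tau <= D -> vge w (D + beta) P`_0 -> forall n,
  [/\ vge w tau (newton n), vge w tau (newton n.+1) &
      vge w (D + n%:R) (newton n.+1 - newton n)].
Proof.
move=> tD hD; have t0 := tau0; elim=> [|n [h1 h2 h3]].
  have e1 : newton 1 = - P`_0 / b by rewrite /= horner_coef0 sub0r mulNr.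
  have h : vge w D (newton 1) by rewrite e1 (vgeMr _ _ b_val) vgeN.
  split; first exact: vge0.
    exact: vgeW h.
  by rewrite addr0 subr0.
have E : newton n.+2 - newton n.+1 =
    - ((P.[newton n.+1] - b * newton n.+1) - (P.[newton n] - b * newton n)) / b.
  have e : newton n.+1 - newton n = - (P.[newton n] / b) by rewrite /= addrC addKr.
  have -> : newton n.+2 - newton n.+1 = - (P.[newton n.+1] / b) by rewrite /= addrC addKr.
  have -> : - ((P.[newton n.+1] - b * newton n.+1) - (P.[newton n] - b * newton n)) / b =
    - (P.[newton n.+1] / b) + (P.[newton n] / b) + (newton n.+1 - newton n) by field.
  by rewrite e addrK.
have h : vge w (D + n.+1%:R) (newton n.+2 - newton n.+1).
  rewrite E (vgeMr _ _ b_val) vgeN; apply: vgeW (contraction h3 h2 h1).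
  by rewrite -natr1; lra.
split=> //; apply: vge_near h2; apply: vgeW h.
by have : 0 <= n.+1%:R :> R by []; lra.
Qed.

Let base : vge w (tau + beta) P`_0.
Proof. by rewrite /tau subrK. Qed.

Lemma newton_small n : vge w tau (newton n).
Proof. by have [] := newton_step (lexx _) base n. Qed.

Lemma newton_root n : vge w (tau + beta + n%:R) P.[newton n].
Proof.
have [_ _] := newton_step (lexx _) base n.
have -> : newton n.+1 - newton n = - (P.[newton n] / b) by rewrite /= addrC addKr.
by rewrite vgeN (vgeMr _ _ b_val) addrAC.
Qed.

Lemma newton_cauchy n m : (n <= m)%N -> vge w (tau + n%:R) (newton m - newton n).
Proof.
move=> nm; rewrite -(subnK nm); elim: (m - n)%N => [|q IH]; first by rewrite subrr vge0.
rewrite addSn; apply: vge_trans IH; have [_ _ h] := newton_step (lexx _) base (q + n).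
by apply: vgeW h; rewrite lerD2l ler_nat leq_addl.
Qed.

(** The first step gives the leading term of the root. *)
Lemma newton_lead D n : tau <= D -> vge w (D + beta) P`_0 ->
  vge w (D + 1) (newton n.+1 - (- P`_0 / b)).
Proof.
move=> tD hD; have -> : - P`_0 / b = newton 1 by rewrite /= horner_coef0 sub0r mulNr.
elim: n => [|n IH]; first by rewrite subrr vge0.
apply: vge_trans IH; have [_ _ h] := newton_step tD hD n.+1.
by apply: vgeW h; rewrite lerD2l ler1n.
Qed.

End Newton.

(** * Plane quartics *)

Section QuarticValues.
Variables (S : comNzRingType) (c2 c1 c0 : nat -> S).

Definition quartic (x y z : S) : S :=
  z * y ^+ 3 + (c2 0 * z ^+ 2 + c2 1 * (x * z) + c2 2 * x ^+ 2) * y ^+ 2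
  + (c1 0 * z ^+ 3 + c1 1 * (x * z ^+ 2) + c1 2 * (x ^+ 2 * z) + c1 3 * x ^+ 3) * y
  + (c0 0 * z ^+ 4 + c0 1 * (x * z ^+ 3) + c0 2 * (x ^+ 2 * z ^+ 2) + c0 3 * (x ^+ 3 * z)
     + c0 4 * x ^+ 4).

Definition quartic_x (x y z : S) : S :=
  (c2 1 * z + 2 * c2 2 * x) * y ^+ 2
  + (c1 1 * z ^+ 2 + 2 * c1 2 * (x * z) + 3 * c1 3 * x ^+ 2) * y
  + (c0 1 * z ^+ 3 + 2 * c0 2 * (x * z ^+ 2) + 3 * c0 3 * (x ^+ 2 * z) + 4 * c0 4 * x ^+ 3).

Definition quartic_y (x y z : S) : S :=
  3 * z * y ^+ 2 + 2 * (c2 0 * z ^+ 2 + c2 1 * (x * z) + c2 2 * x ^+ 2) * y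
  + (c1 0 * z ^+ 3 + c1 1 * (x * z ^+ 2) + c1 2 * (x ^+ 2 * z) + c1 3 * x ^+ 3).

Definition quartic_z (x y z : S) : S :=
  y ^+ 3 + (2 * c2 0 * z + c2 1 * x) * y ^+ 2
  + (3 * c1 0 * z ^+ 2 + 2 * c1 1 * (x * z) + c1 2 * x ^+ 2) * y
  + (4 * c0 0 * z ^+ 3 + 3 * c0 1 * (x * z ^+ 2) + 2 * c0 2 * (x ^+ 2 * z) + c0 3 * x ^+ 3).

(** At a point of the curve with [k]-th coordinate 1 this expresses the [k]-th
    partial derivative by the others; so one of the others is not 0 if the point is
    smooth. *)
Lemma quartic_euler x y z :
  x * quartic_x x y z + y * quartic_y x y z + z * quartic_z x y z = 4 * quartic x y z.
Proof. by rewrite /quartic /quartic_x /quartic_y /quartic_z; ring. Qed.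

Lemma quartic_scale a x y z : quartic (a * x) (a * y) (a * z) = a ^+ 4 * quartic x y z.
Proof. by rewrite /quartic; ring. Qed.

Lemma quartic_x_scale a x y z : quartic_x (a * x) (a * y) (a * z) = a ^+ 3 * quartic_x x y z.
Proof. by rewrite /quartic_x; ring. Qed.

Lemma quartic_y_scale a x y z : quartic_y (a * x) (a * y) (a * z) = a ^+ 3 * quartic_y x y z.
Proof. by rewrite /quartic_y; ring. Qed.

Lemma quartic_z_scale a x y z : quartic_z (a * x) (a * y) (a * z) = a ^+ 3 * quartic_z x y z.
Proof. by rewrite /quartic_z; ring. Qed.

End QuarticValues.

Lemma quartic_morph (S T : comNzRingType) (f : {rmorphism S -> T}) c2 c1 c0 x y z :
  f (quartic c2 c1 c0 x y z) = quartic (f \o c2) (f \o c1) (f \o c0) (f x) (f y) (f z).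
Proof. by rewrite /quartic /=; ring. Qed.

(** The chain rule. *)
Lemma quartic_derivation (S : comNzRingType) (c2 c1 c0 : nat -> S) (D : S -> S) :
  {morph D : x y / x + y} -> (forall x y, D (x * y) = D x * y + x * D y) ->
  (forall k, D (c2 k) = 0) -> (forall k, D (c1 k) = 0) -> (forall k, D (c0 k) = 0) ->
  forall x y z, D (quartic c2 c1 c0 x y z) =
    quartic_x c2 c1 c0 x y z * D x + quartic_y c2 c1 x y z * D y
    + quartic_z c2 c1 c0 x y z * D z.
Proof.
move=> DD DM h2 h1 h0 x y z.
rewrite /quartic /quartic_x /quartic_y /quartic_z !exprS !expr0 !mulr1 !(DD, DM, h2, h1, h0); ring.
Qed.

Section QuarticForm.
Variables (K : fieldType) (A2 A1 A0 : {poly K}).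

Lemma quartic_sum (S : comNzRingType) (c2 c1 c0 : nat -> S) x y z :
  z * y ^+ 3 + \sum_(i < 3) c2 i * (x ^+ i * z ^+ (2 - i)) * y ^+ 2
  + \sum_(i < 4) c1 i * (x ^+ i * z ^+ (3 - i)) * y
  + \sum_(i < 5) c0 i * (x ^+ i * z ^+ (4 - i)) = quartic c2 c1 c0 x y z.
Proof. by rewrite !big_ord_recl !big_ord0 /= /bump /= /quartic; ring. Qed.

Lemma quartic_form_mmap (S : comNzRingType) (f : {rmorphism K -> S}) (e : 'I_3 -> S) :
  mmap f e (quartic_form A2 A1 A0) =
  quartic (fun k => f A2`_k) (fun k => f A1`_k) (fun k => f A0`_k)
    (e (inord 0)) (e (inord 1)) (e (inord 2)).
Proof.
pose k A n : mpoly 3 K := mpolyC 3 A`_n.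
have -> : quartic_form A2 A1 A0 = quartic (k A2) (k A1) (k A0) (mpolyX K (mnm1 (inord 0)))
    (mpolyX K (mnm1 (inord 1))) (mpolyX K (mnm1 (inord 2))).
  rewrite /quartic_form -quartic_sum; congr (_ + _ + _ + _);
    by apply: eq_bigr => n _; rewrite -mul_mpolyC.
have kE A : mmap f e \o k A = fun n => f A`_n by apply/funext => n /=; rewrite mmapC.
by rewrite (quartic_morph (mmap f e)) !kE /= !mmapX !mmap1U.
Qed.

End QuarticForm.

Section PartialMorph.
Variables (S T : comNzRingType) (g : {rmorphism S -> T}) (c2 c1 c0 : nat -> S) (x y z : S).

Lemma quartic_x_morph : g (quartic_x c2 c1 c0 x y z) =
  quartic_x (g \o c2) (g \o c1) (g \o c0) (g x) (g y) (g z).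
Proof. by rewrite /quartic_x /=; ring. Qed.

Lemma quartic_y_morph : g (quartic_y c2 c1 x y z) = quartic_y (g \o c2) (g \o c1) (g x) (g y) (g z).
Proof. by rewrite /quartic_y /=; ring. Qed.

Lemma quartic_z_morph : g (quartic_z c2 c1 c0 x y z) =
  quartic_z (g \o c2) (g \o c1) (g \o c0) (g x) (g y) (g z).
Proof. by rewrite /quartic_z /=; ring. Qed.

End PartialMorph.

Section Eval.
Variables (K : fieldType) (A2 A1 A0 : {poly K}).
Variables (L : fieldType) (h : {rmorphism K -> L}) (P : 'I_3 -> L).
Let k2 k : L := h A2`_k.
Let k1 k : L := h A1`_k.
Let k0 k : L := h A0`_k.

Definition partial (S : comNzRingType) (c2 c1 c0 : nat -> S) (k : 'I_3) (x y z : S) : S :=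
  if k == inord 0 then quartic_x c2 c1 c0 x y z
  else if k == inord 1 then quartic_y c2 c1 x y z else quartic_z c2 c1 c0 x y z.

Let X m : mpoly 3 L := mpolyX L (mnm1 m).

Let mapE : map_mpoly h (quartic_form A2 A1 A0) =
  quartic (fun k => mpolyC 3 (k2 k)) (fun k => mpolyC 3 (k1 k)) (fun k => mpolyC 3 (k0 k))
    (X (inord 0)) (X (inord 1)) (X (inord 2)).
Proof. by rewrite /map_mpoly quartic_form_mmap. Qed.

Let evC (f : nat -> L) : meval P \o (fun k => mpolyC 3 (f k)) = f.
Proof. by apply/funext => k /=; rewrite mevalC. Qed.

Lemma quartic_form_meval : meval P (map_mpoly h (quartic_form A2 A1 A0)) =
  quartic k2 k1 k0 (P (inord 0)) (P (inord 1)) (P (inord 2)).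
Proof. by rewrite mapE (quartic_morph (meval P)) !evC /= /X !mevalXU. Qed.

Lemma ord3_neq : [/\ inord 0 == inord 1 :> 'I_3 = false, inord 0 == inord 2 :> 'I_3 = false &
  inord 1 == inord 2 :> 'I_3 = false].
Proof. by split; rewrite -val_eqE /= !inordK. Qed.

Lemma ord3P (Q : 'I_3 -> Prop) : Q (inord 0) -> Q (inord 1) -> Q (inord 2) -> forall n, Q n.
Proof.
move=> h0 h1 h2 [[|[|[|n]]] hn] //.
- by have -> : Ordinal hn = inord 0 by apply: val_inj; rewrite /= inordK.
- by have -> : Ordinal hn = inord 1 by apply: val_inj; rewrite /= inordK.
- by have -> : Ordinal hn = inord 2 by apply: val_inj; rewrite /= inordK.
Qed.

Lemma ord3_cases (m : 'I_3) : [\/ m = inord 0, m = inord 1 | m = inord 2].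
Proof. by move: m; apply: ord3P; [constructor 1 | constructor 2 | constructor 3]. Qed.

Lemma quartic_form_mderiv k : meval P (mderiv k (map_mpoly h (quartic_form A2 A1 A0))) =
  partial k2 k1 k0 k (P (inord 0)) (P (inord 1)) (P (inord 2)).
Proof.
have dX m : mderiv k (X m) = (k == m)%:R.
  rewrite mderivX mnm1E eq_sym; case: eqP => [->|_]; last by rewrite scale0r.
  by rewrite scale1r (_ : mnm_sub _ _ = @mnm0 3) ?mpolyX0 //; apply/mnmP => q; rewrite mnmBE subnn mnm0E.
rewrite mapE (quartic_derivation (D := mderiv k)) ?dX.
- rewrite !rmorphD !rmorphM !rmorph_nat /partial.
  have [n01 n02 n12] := ord3_neq.
  rewrite (quartic_x_morph (meval P)) (quartic_y_morph (meval P)) (quartic_z_morph (meval P)) !evC /= /X !mevalXU.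
  case: (ord3_cases k) => ->.
  - by rewrite eqxx n01 n02 mulr1 !mulr0 !addr0.
  - by rewrite eqxx n12 (eq_sym (inord 1) (inord 0)) n01 mulr1 !mulr0 addr0 add0r.
  - by rewrite eqxx (eq_sym (inord 2) (inord 0)) n02 (eq_sym (inord 2) (inord 1)) n12 mulr1 !mulr0 !add0r.
- exact: mderivD.
- exact: mderivM.
- by move=> m; rewrite mderivC.
- by move=> m; rewrite mderivC.
- by move=> m; rewrite mderivC.
Qed.

End Eval.

(** * Affine charts *)

(** The inner variable is sent to [pi] and the outer one to [T]. *)
Definition eval2 (C S : comNzRingType) (f : {rmorphism C -> S}) (pi T : S) :
  {rmorphism {poly {poly C}} -> S} :=
  horner_eval T \o map_poly (horner_eval pi \o map_poly f).

Section Eval2.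
Variables (C S : comNzRingType) (f : {rmorphism C -> S}) (pi T : S).

Lemma eval2_C a : eval2 f pi T a%:P%:P = f a.
Proof. by rewrite /eval2 /= {1}/horner_eval map_polyC hornerC /= /horner_eval map_polyC hornerC. Qed.

Lemma eval2_pi : eval2 f pi T 'X%:P = pi.
Proof. by rewrite /eval2 /= {1}/horner_eval map_polyC hornerC /= /horner_eval map_polyX hornerX. Qed.

Lemma eval2_T : eval2 f pi T 'X = T.
Proof. by rewrite /eval2 /= {1}/horner_eval map_polyX hornerX. Qed.

End Eval2.

Lemma eval2_origin (C : comNzRingType) (G : {poly {poly C}}) : eval2 idfun 0 0 G = (G`_0)`_0.
Proof.
rewrite /eval2 /= {1}/horner_eval horner_coef0 coef_map /= /horner_eval horner_coef0.
by rewrite map_poly_id.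
Qed.

Lemma coef_bound (R : realType) (C : fieldType) (v : valuation R C) (G : {poly {poly C}}) :
  exists2 N : R, 0 <= N & forall a b, vge v (- N) (G`_a)`_b.
Proof.
have one (p : {poly C}) : exists2 N : R, 0 <= N & forall b, vge v (- N) p`_b.
  elim/poly_ind: p => [|p c [N N0 hN]]; first by exists 0 => // b; rewrite coef0 vge0.
  have [r hr] : exists r : R, vge v r c.
    have [->|/(val_fin v)[r hr]] := eqVneq c 0; first by exists 0; rewrite vge0.
    by exists r; apply: vge_self hr.
  exists (N + `|r|); first by rewrite addr_ge0.
  have h1 := ler_norm (- r); rewrite normrN in h1.
  move=> [|b]; rewrite coefD coefMX coefC /=.
    by rewrite add0r; apply: vgeW hr; lra.
  by rewrite addr0; apply: vgeW (hN b); have := normr_ge0 r; lra.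
elim/poly_ind: G => [|G c [N N0 hN]].
  by exists 0 => // a b; rewrite !coef0 vge0.
have [N' N0' hN'] := one c; exists (N + N'); first by rewrite addr_ge0.
move=> [|a] b; rewrite coefD coefMX coefC /=.
  by rewrite add0r; apply: vgeW (hN' b); lra.
by rewrite addr0; apply: vgeW (hN a b); lra.
Qed.

Section Chart.
Variables (C : fieldType) (c2 c1 c0 : nat -> C) (p : 'I_3 -> C) (l i : 'I_3).

(** The point [p] moved by [pi] in direction [l] and by [T] in direction [i]. *)
Definition chart_pt (S : comNzRingType) (f : C -> S) (pi T : S) (m : 'I_3) : S :=
  f (p m) + (m == l)%:R * pi + (m == i)%:R * T.

Definition on_quartic (S : comNzRingType) (f : C -> S) (e : 'I_3 -> S) : S :=
  quartic (f \o c2) (f \o c1) (f \o c0) (e (inord 0)) (e (inord 1)) (e (inord 2)).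

(** The equation of the curve in the affine coordinates centred at [p]. *)
Definition chart_eq : {poly {poly C}} :=
  on_quartic (polyC \o polyC) (chart_pt (polyC \o polyC) 'X%:P 'X).

Lemma eval_chart (S : comNzRingType) (f : {rmorphism C -> S}) (pi T : S) :
  eval2 f pi T chart_eq = on_quartic f (chart_pt f pi T).
Proof.
rewrite /chart_eq /on_quartic (quartic_morph (eval2 f pi T)).
have E (c : nat -> C) : eval2 f pi T \o ((polyC \o polyC) \o c) = f \o c.
  by apply/funext => n; exact: eval2_C.
have e m : eval2 f pi T (chart_pt (polyC \o polyC) 'X%:P 'X m) = chart_pt f pi T m.
  rewrite /chart_pt !rmorphD !rmorphM !rmorph_nat.
  by rewrite eval2_pi eval2_T -[eval2 _ _ _ _]/(eval2 f pi T (p m)%:P%:P) eval2_C.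
by rewrite !E !e.
Qed.

Let beta := partial c2 c1 c0 i (p (inord 0)) (p (inord 1)) (p (inord 2)).

Lemma chart_eq00 : quartic c2 c1 c0 (p (inord 0)) (p (inord 1)) (p (inord 2)) = 0 ->
  (chart_eq`_0)`_0 = 0.
Proof.
move=> h; rewrite -eval2_origin eval_chart -[RHS]h /on_quartic /chart_pt.
by rewrite !mulr0 !addr0.
Qed.

(** The coefficient of [T] is a value of the derivation [d/dT]. *)
Lemma chart_eq10 : (chart_eq`_1)`_0 = beta.
Proof.
have -> : chart_eq`_1 = chart_eq^`()`_0 by rewrite coef_deriv.
rewrite -eval2_origin /chart_eq /on_quartic.
have D0 (c : nat -> C) n : deriv (((polyC \o polyC) \o c) n) = 0 by rewrite /= derivC.
rewrite (quartic_derivation (D := @deriv _)) //; last 2 first.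
- exact: derivD.
- exact: derivM.
have De m : (chart_pt (polyC \o polyC) 'X%:P 'X m)^`() = (m == i)%:R.
  by rewrite /chart_pt !mulr_natl !derivD !derivMn derivX /= !derivC mul0rn addr0 add0r.
rewrite !De.
set g := eval2 idfun 0 0.
have E (c : nat -> C) : g \o ((polyC \o polyC) \o c) = c.
  by apply/funext => n; exact: eval2_C.
have e m : g (chart_pt (polyC \o polyC) 'X%:P 'X m) = p m.
  rewrite /chart_pt !rmorphD !rmorphM !rmorph_nat /g eval2_pi eval2_T !mulr0 !addr0.
  by rewrite -[eval2 _ _ _ _]/(eval2 idfun 0 0 (p m)%:P%:P) eval2_C.
rewrite !(rmorphD g) !(rmorphM g) !(rmorph_nat g).
rewrite (quartic_x_morph g) (quartic_y_morph g) (quartic_z_morph g) !E !e /beta /partial.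
have [n01 n02 n12] := ord3_neq.
case: (ord3_cases i) => ->.
- by rewrite eqxx !(eq_sym _ (inord 0)) n01 n02 mulr1 !mulr0 !addr0.
- by rewrite eqxx n01 (eq_sym (inord 1) (inord 0)) n01 (eq_sym (inord 2) (inord 1)) n12 mulr1 !mulr0 addr0 add0r.
by rewrite eqxx n02 n12 (eq_sym (inord 2) (inord 0)) n02 (eq_sym (inord 2) (inord 1)) n12 mulr1 !mulr0 !add0r.
Qed.

End Chart.

Lemma map_tofrac_inj (C : fieldType) : injective (map_poly (@tofrac {poly C})).
Proof.
apply: map_inj_poly; last exact: rmorph0.
by move=> a b /eqP; rewrite tofrac_eq => /eqP.
Qed.

Lemma clear_bezout (C : fieldType) (G P : {poly {poly C}}) (UF WF : {poly ratfun C}) :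
  UF * map_poly (@tofrac {poly C}) G + WF * map_poly (@tofrac {poly C}) P = 1 ->
  exists2 h, h != 0 & exists U W, U * G + W * P = h%:P.
Proof.
pose tf : {rmorphism {poly C} -> ratfun C} := @tofrac {poly C}.
move=> hUW.
have [d [U [d0 hU]]] := clear_denom UF; have [d' [W [d0' hW]]] := clear_denom WF.
exists (d * d'); first by rewrite mulf_neq0.
exists (d'%:P * U), (d%:P * W); apply: map_tofrac_inj.
rewrite (rmorphD (map_poly tf)) !(rmorphM (map_poly tf)) /= !map_polyC /=.
have -> : map_poly tf U = (tf d)%:P * UF by [].
have -> : map_poly tf W = (tf d')%:P * WF by [].
rewrite -[tf (d * d')]/(tofrac (d * d')) (rmorphM tf) polyCM.
have bez : forall (S : comNzRingType) (a b u v g q : S), u * g + v * q = 1 ->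
    b * (a * u) * g + a * (b * v) * q = a * b.
  by move=> S a b u v g q h; rewrite -[RHS]mulr1 -h; ring.
exact: bez hUW.
Qed.

Section ClearDenominators.
Variables (C E : fieldType) (iota : {rmorphism ratfun C -> E}) (y : E) (P : {poly {poly C}}).
Let tf : {rmorphism {poly C} -> ratfun C} := @tofrac {poly C}.
Hypothesis P_irr : irreducible_poly (map_poly tf P).
Hypothesis Py : (map_poly iota (map_poly tf P)).[y] = 0.
Hypothesis gen : forall x, exists q : {poly ratfun C}, x = (map_poly iota q).[y].

Definition io : {rmorphism {poly C} -> E} := iota \o tf.

Lemma io_inj a : io a = 0 -> a = 0.
Proof. by move/eqP; rewrite /io /= fmorph_eq0 tofrac_eq0 => /eqP. Qed.

Lemma io_map G : map_poly io G = map_poly iota (map_poly tf G).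
Proof. by rewrite map_poly_comp. Qed.

Lemma io_div G : (map_poly io G).[y] = 0 -> exists2 h, h != 0 & exists W, h%:P * G = W * P.
Proof.
rewrite io_map => /(irr_div P_irr Py)[WF hW]; have [d [W [d0 hd]]] := clear_denom WF.
exists d => //; exists W; apply: map_tofrac_inj; rewrite !(rmorphM (map_poly tf)) /= map_polyC.
by rewrite hW mulrA; congr (_ * _).
Qed.

Lemma io_bezout G : (map_poly io G).[y] != 0 ->
  exists2 h, h != 0 & exists U W, U * G + W * P = h%:P.
Proof. by rewrite io_map => /(irr_bezout P_irr Py)[UF [WF]]; apply: clear_bezout. Qed.

Lemma io_frac x : exists G a, a != 0 /\ x = (map_poly io G).[y] / io a.
Proof.
have [q ->] := gen x; have [d [Q [d0 hQ]]] := clear_denom q; exists Q, d; split=> //.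
have d0' : io d != 0 by rewrite /io /= fmorph_eq0 tofrac_eq0.
rewrite io_map -hQ (rmorphM (map_poly iota)) /= map_polyC hornerM hornerC.
have d1' : iota (tofrac d) != 0 by [].
by rewrite /= mulrAC mulfV // mul1r.
Qed.

End ClearDenominators.

(** * The branch through a smooth point *)

(** The branch of the quartic through a smooth point: approximate roots, in the
    field [M] of functions of the local coordinate, of the chart equation. *)
Section ChartBranch.
Variables (R : realType) (C : fieldType) (v : valuation R C).
Variables (c2 c1 c0 : nat -> C) (p : 'I_3 -> C) (l i : 'I_3).
Hypothesis p_quartic : quartic c2 c1 c0 (p (inord 0)) (p (inord 1)) (p (inord 2)) = 0.
Hypothesis p_smooth : partial c2 c1 c0 i (p (inord 0)) (p (inord 1)) (p (inord 2)) != 0.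
Variables (M : fieldType) (V : R -> valuation R M) (emb : {rmorphism {poly C} -> M}).
Hypothesis hV : forall s a, V s (emb a) = gval v s a.

Let cM : {rmorphism C -> M} := emb \o polyC.
Let pi := emb 'X.
Let Phi := chart_eq c2 c1 c0 p l i.
Let PM := map_poly emb Phi.
Let beta := partial c2 c1 c0 i (p (inord 0)) (p (inord 1)) (p (inord 2)).

Lemma emb_horner a : emb a = (map_poly cM a).[pi].
Proof. by rewrite map_poly_comp horner_map /= -[(map_poly polyC a).['X]]/(a \Po 'X) comp_polyXr. Qed.

Lemma branch_eval T : PM.[T] = on_quartic c2 c1 c0 cM (chart_pt p l i cM pi T).
Proof.
rewrite -eval_chart /eval2 /= {1}/horner_eval; congr (_.[_]).
by apply: eq_map_poly => a; rewrite emb_horner.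
Qed.

Let PM0 : PM`_0 = on_quartic c2 c1 c0 cM (chart_pt p l i cM pi 0).
Proof. by rewrite -branch_eval horner_coef0. Qed.

Let emb_pge s m a : pge v s m a -> vge (V s) m (emb a).
Proof. by move=> h; rewrite /vge hV; apply/gval_geP. Qed.

(** The sequence [x n] is the Newton iteration for the equation in [T]; its linear
    coefficient is close to [beta], which is not 0 by smoothness. *)
Theorem chart_branch : exists (S t : R) (bv : R) (x : nat -> M),
  [/\ 0 <= S, (forall s, S <= s -> 1 <= s - t), v beta = bv%:E &
  forall s, S <= s -> [/\ forall n, vge (V s) (s - t) (x n),
    forall n, vge (V s) (s - t + n%:R) (on_quartic c2 c1 c0 cM (chart_pt p l i cM pi (x n))),
    forall n m, (n <= m)%N -> vge (V s) (s - t + n%:R) (x m - x n) &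
    forall n r, V s (on_quartic c2 c1 c0 cM (chart_pt p l i cM pi 0)) = r%:E ->
      vge (V s) (r - bv + 1) (x n - (- on_quartic c2 c1 c0 cM (chart_pt p l i cM pi 0) / cM beta))]].
Proof.
have [bv hb] := val_fin v p_smooth; have [N N0 hN] := coef_bound v Phi.
pose S := 2 * N + 2 * `|bv| + 1.
have nb := ler_norm bv; have nb' := ler_norm (- bv); rewrite normrN in nb'.
exists S, (N + `|bv|), bv, (fun n => newton PM (cM beta) n.+1); split=> //.
- by rewrite /S; have := normr_ge0 bv; lra.
- by rewrite /S => s hs; lra.
move=> s hs.
have s0 : 0 <= s by move: hs; rewrite /S; have := normr_ge0 bv; lra.
have b_val : V s (cM beta) = bv%:E.
  rewrite /cM /= hV -hb; apply/ereal_eq_thr => m; rewrite gval_geP; split.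
    by move=> /(_ 0%N); rewrite coefC mul0r subr0.
  by move=> h [|q]; rewrite coefC /= ?vge0 // mul0r subr0.
have P_bound k : vge (V s) (- N) PM`_k.
  rewrite coef_map; apply: emb_pge => q; apply: vgeW (hN k q).
  by rewrite lerBlDr lerDl mulr_ge0.
have small (a : {poly C}) : (forall q, vge v (- N) a`_q) -> a`_0 = 0 -> vge (V s) (s - N) (emb a).
  move=> ha a0; apply: emb_pge => -[|q]; first by rewrite a0 vge0.
  apply: vgeW (ha q.+1); rewrite -natr1; have : 0 <= q%:R * s by rewrite mulr_ge0.
  lra.
have P1 : vge (V s) (s - N) (PM`_1 - cM beta).
  rewrite coef_map /cM /= -rmorphB; apply: small; last first.
    by rewrite coefB coefC /= chart_eq10 subrr.
  move=> q; rewrite coefB coefC; case: q => [|q] /=; last by rewrite subr0; apply: hN.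
  by rewrite chart_eq10 subrr vge0.
have P0 : vge (V s) (s - N) PM`_0.
  by rewrite coef_map; apply: small; [exact: hN | exact: chart_eq00].
split.
- by move=> n; apply: vgeW (newton_small N0 b_val P_bound P1 P0 hs n.+1); lra.
- move=> n; rewrite -branch_eval.
  by apply: vgeW (newton_root N0 b_val P_bound P1 P0 hs n.+1); rewrite -natr1; lra.
- move=> n m nm; apply: vgeW (newton_cauchy N0 b_val P_bound P1 P0 hs (_ : (n.+1 <= m.+1)%N)) => //.
  by rewrite -natr1; lra.
move=> n r; rewrite -PM0 => hr.
have P0' : s - N <= r by move: P0; rewrite (vge_fin _ hr).
have P0r : vge (V s) (r - bv + bv) PM`_0 by rewrite subrK; apply: vge_self hr.
by apply: (newton_lead N0 b_val P_bound P1 hs n _ P0r); lra.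
Qed.

End ChartBranch.

Section LimitValue.
Variables (R : realType) (M E : fieldType) (A : idomainType).
Variables (V : R -> valuation R M) (J : nat -> set R).
Variables (io : {rmorphism A -> E}) (th : E) (p : {poly A}).
Variables (al : nat -> {rmorphism A -> M}) (u : nat -> M).
Hypothesis io_inj : forall a, io a = 0 -> a = 0.
Hypothesis al_good : forall k a, good V (J k) (fun n => al n a).
Hypothesis al_away : forall k a, a != 0 -> away V (J k) (fun n => al n a).
Hypothesis u_good : forall k, good V (J k) u.
Hypothesis p_null : forall k, null V (J k) (fun n => (map_poly (al n) p).[u n]).
Hypothesis div : forall G : {poly A}, (map_poly io G).[th] = 0 ->
  exists2 h, h != 0 & exists W, h%:P * G = W * p.
Hypothesis frac : forall x, exists G a, a != 0 /\ x = (map_poly io G).[th] / io a.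
Variable W : R -> valuation R E.
Hypothesis hW : forall k G, (map_poly io G).[th] != 0 -> exists N : nat, forall n s,
    (N <= n)%N -> J k s -> W s (map_poly io G).[th] = V s (evn al u n G).

Lemma limit_vge k s G B : J k s -> (forall n, vge (V s) B (evn al u n G)) ->
  vge (W s) B (map_poly io G).[th].
Proof.
move=> Js h; have [->|g0] := eqVneq (map_poly io G).[th] 0; first exact: vge0.
by have [N hN] := hW k g0; rewrite /vge (hN N s (leqnn _) Js); apply: h.
Qed.

Lemma limit_value k s G r : J k s -> (forall n, V s (evn al u n G) = r%:E) ->
  W s (map_poly io G).[th] = r%:E.
Proof.
move=> Js h; have [g0|g0] := eqVneq (map_poly io G).[th] 0; last first.
  by have [N hN] := hW k g0; rewrite (hN N s (leqnn _) Js).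
have [N hN] := evn_null al_good al_away u_good p_null div k g0 (r + 1).
exfalso; have := hN N s (leqnn _) Js; rewrite (vge_fin _ (h N)) => hr.
by move: hr; rewrite gerDl leNgt ltr01.
Qed.

Lemma limit_lipschitz k x : (forall m, m != 0 -> lipschitz_val setT (fun s => V s m)) ->
  (exists s, J k s) -> x != 0 -> lipschitz_val (J k) (fun s => W s x).
Proof.
move=> Vlip [s0 Js0]; have [G [a [a0 ->]]] := frac x; rewrite mulf_eq0 invr_eq0 negb_or => /andP[g0 ioa0].
have [N hN] := hW k g0.
have ea : (map_poly io a%:P).[th] = io a by rewrite map_polyC hornerC.
have ga : (map_poly io a%:P).[th] != 0 by rewrite ea.
have [N' hN'] := hW k ga; rewrite ea in hN'.
set n := maxn N N'; have hn := hN n _ (leq_maxl _ _); have hn' := hN' n _ (leq_maxr _ _).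
have nz H x' : x' != 0 -> W s0 x' = V s0 (evn al u n H) -> evn al u n H != 0.
  by move=> /(val_fin (W s0))[r ->] /esym/val_fin_neq0.
have n1 := nz _ _ g0 (hn s0 Js0); have n2 := nz _ _ ioa0 (hn' s0 Js0).
have q0 : evn al u n G / evn al u n a%:P != 0 by rewrite mulf_neq0 ?invr_eq0.
have [K K0 hK] := Vlip _ q0.
have VW s : J k s -> V s (evn al u n G / evn al u n a%:P) = W s ((map_poly io G).[th] / io a).
  move=> Js; have [r hr] := val_fin (V s) n1; have [r' hr'] := val_fin (V s) n2.
  by rewrite (val_div_fin hr hr') (@val_div_fin _ _ _ _ _ r r') // ?hn ?hn'.
by exists K => // s s' Js Js'; rewrite -!VW //; apply: hK.
Qed.

End LimitValue.

Lemma gvalC (R : realType) (C : fieldType) (v : valuation R C) s a : gval v s a%:P = v a.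
Proof.
apply/ereal_eq_thr => m; rewrite gval_geP; split.
  by move=> /(_ 0%N); rewrite coefC mul0r subr0.
by move=> h [|q]; rewrite coefC /= ?vge0 // mul0r subr0.
Qed.

Lemma gvalX (R : realType) (C : fieldType) (v : valuation R C) s : gval v s 'X = s%:E.
Proof. by rewrite -(gaussE v 0) polyTX gauss_t. Qed.

(** * Valuations along the branch *)

Section Family.
Variables (R : realType) (Kbar : closedFieldType) (CK : fieldType) (vbar : valuation R Kbar).
Variables (v : valuation R CK) (j : {rmorphism Kbar -> CK}).
Hypothesis compl : is_completion vbar v j.
Variables (E : fieldType) (iota : {rmorphism ratfun CK -> E}) (y : E) (c2 c1 c0 : nat -> CK).
Let cE := Y_cst iota.
Let e := Y_coord iota y.
Let tf : {rmorphism {poly CK} -> ratfun CK} := @tofrac {poly CK}.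

(** The affine equation of the curve, as a polynomial in the second coordinate. *)
Definition affine_poly : {poly {poly CK}} :=
  quartic ((polyC \o polyC) \o c2) ((polyC \o polyC) \o c1) ((polyC \o polyC) \o c0) 'X%:P 'X 1.
Let P := affine_poly.

Hypothesis P_irr : irreducible_poly (map_poly tf P).
Hypothesis Py : (map_poly iota (map_poly tf P)).[y] = 0.
Hypothesis gen : forall x, exists q : {poly ratfun CK}, x = (map_poly iota q).[y].

Lemma eval2_affine (S : comNzRingType) (f : {rmorphism CK -> S}) X Y :
  eval2 f X Y P = quartic (f \o c2) (f \o c1) (f \o c0) X Y 1.
Proof.
rewrite /P /affine_poly (quartic_morph (eval2 f X Y)) eval2_pi eval2_T rmorph1.
have q (c : nat -> CK) : eval2 f X Y \o ((polyC \o polyC) \o c) = f \o c.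
  by apply/funext => n; exact: eval2_C.
by rewrite !q.
Qed.

Lemma eval2_io G : (map_poly (io iota) G).[y] = eval2 cE (iota (xfun CK)) y G.
Proof.
rewrite /eval2 /= {1}/horner_eval; congr (_.[_]); apply: eq_map_poly => a.
exact: (emb_horner (io iota) a).
Qed.

Variables (p : 'I_3 -> CK) (l i k : 'I_3).
Hypothesis li : l != i.
Hypothesis lk : l != k.
Hypothesis ik : i != k.
Hypothesis pk : p k = 1.
Variables (M : fieldType) (V : R -> valuation R M) (emb : {rmorphism {poly CK} -> M}).
Hypothesis hV : forall s a, V s (emb a) = gval v s a.
Hypothesis Vlip : forall m, m != 0 -> lipschitz_val setT (fun s => V s m).

Let cM : {rmorphism CK -> M} := emb \o polyC.
Let pi := emb 'X.

Variables (S t : R) (x : nat -> M).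
Hypothesis small : forall s n, S <= s -> vge (V s) (s - t) (x n).
Let eh n m := chart_pt p l i cM pi (x n) m.
Hypothesis x_root : forall s n, S <= s -> vge (V s) (s - t + n%:R) (on_quartic c2 c1 c0 cM (eh n)).
Hypothesis x_cauchy : forall s n m, S <= s -> (n <= m)%N -> vge (V s) (s - t + n%:R) (x m - x n).

Variables (x0 : CK) (rho : R -> R) (m2 : M).
Hypothesis m2_neq0 : m2 != 0.
Hypothesis den : forall s n, S <= s -> V s (eh n (inord 2)) = V s m2.
Let X n := eh n (inord 0) / eh n (inord 2).
Let Y n := eh n (inord 1) / eh n (inord 2).
Hypothesis centred : forall s n b, S <= s ->
  V s (X n - cM x0 - cM b) = Order.min (rho s)%:E (v b).

Let J (n : nat) := segment S n%:R.
Let al n : {rmorphism {poly CK} -> M} := horner_eval (X n) \o map_poly cM.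

Let S_in n : J n S.
Proof. by rewrite /J /segment /= lexx lerDl ler0n. Qed.

Let VC s a : V s (cM a) = v a.
Proof. by rewrite /cM /= hV gvalC. Qed.

Let Vpi s : V s pi = s%:E.
Proof. by rewrite hV gvalX. Qed.

Lemma family_horner s n a : S <= s -> V s (al n a) = gauss v x0 (rho s) (tofrac a).
Proof.
move=> hs; rewrite (tofracT x0) gaussE -(gval_detect (f := cM) (T := X n - cM x0) compl (w := V s)).
- rewrite map_comp_poly rmorphD /= map_polyX map_polyC /= horner_comp hornerD hornerX hornerC subrK.
  by [].
- by move=> b; apply: VC.
by move=> b; apply: centred.
Qed.

Let bd m n : exists K : R, forall s, J n s -> vge (V s) K m.
Proof.
have [->|m0] := eqVneq m 0; first by exists 0 => s _; rewrite vge0.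
have [K K0 hK] := Vlip m0; have [r [_ [hr _ _]]] := hK S S I I.
exists (r - K * n%:R) => s /andP[s1 s2].
have [r1 [r2 [h h' h'']]] := hK s S I I; rewrite (vge_fin _ h).
move: h'; rewrite hr => -[er]; subst r2.
have := ler_norm (r - r1); rewrite distrC => h5.
have h6 : K * `|s - S| <= K * n%:R by rewrite ler_wpM2l // ger0_norm ?subr_ge0 //; lra.
lra.
Qed.

Let x_good n : good V (J n) x.
Proof.
split.
  by exists (S - t) => q s /andP[s1 _]; apply: vgeW (small q s1); lra.
move=> B; have [N hN] := archi_ex ltr01 (B - S + t); exists N.+1 => q q' s.
wlog qq : q q' / (q' <= q)%N => [hw|] h1 h2 /andP[s1 s2].
  have [qq|/ltnW qq] := leqP q' q; first by apply: hw => //; apply/andP.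
  by rewrite vgeBC; apply: hw => //; apply/andP.
apply: vgeW (x_cauchy s1 qq).
have : N.+1%:R <= q'%:R :> R by rewrite ler_nat.
lra.
Qed.

Let eh_good n m : good V (J n) (fun q => eh q m).
Proof.
rewrite /eh /chart_pt; apply: goodD; first exact: good_cst (bd _ _).
by apply: goodM; [exact: good_cst (bd _ _) | exact: x_good].
Qed.

Let den_fin s n : S <= s -> exists2 r, V s m2 = r%:E & V s (eh n (inord 2)) = r%:E.
Proof. by move=> hs; have [r hr] := val_fin (V s) m2_neq0; exists r => //; rewrite den. Qed.

Let den_neq0 n : eh n (inord 2) != 0.
Proof. by have [r _ /val_fin_neq0] := den_fin n (lexx S). Qed.

Let inv_good n : good V (J n) (fun q => (eh q (inord 2))^-1).
Proof.
apply: goodV => //; have [K hK] := bd m2^-1 n; exists K => q s Js.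
have [r hr hr'] := den_fin q (andP Js).1.
by have := hK s Js; rewrite /vge (valV_fin hr) (valV_fin hr').
Qed.

Let X_good n : good V (J n) X.
Proof. exact: goodM (eh_good _ _) (inv_good _). Qed.

Let Y_good n : good V (J n) Y.
Proof. exact: goodM (eh_good _ _) (inv_good _). Qed.

Let al_good n a : good V (J n) (fun q => al q a).
Proof.
elim/poly_ind: a => [|a b IH].
  by apply: good_ext (good_cst (bd 0 n)) => q; rewrite rmorph0.
apply: good_ext (goodD (goodM IH (X_good n)) (good_cst (bd (cM b) n))) => q.
by rewrite /al rmorphD rmorphM /= /horner_eval map_polyX map_polyC hornerX hornerC.
Qed.

Let al_neq0 n a : a != 0 -> al n a != 0.
Proof.
move=> a0; have fa : (tofrac a : ratfun CK) != 0 by rewrite tofrac_eq0.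
have [r hr] := val_fin (gauss v x0 (rho S)) fa.
by apply: (@val_fin_neq0 _ _ (V S) _ r); rewrite family_horner.
Qed.

Let al_away n a : a != 0 -> away V (J n) (fun q => al q a).
Proof.
move=> a0; have [K hK] := bd (al 0 a)^-1 n; exists 0%N, (1 - K) => q s _ Js h.
have hs := (andP Js).1; have h' : vge (V s) (1 - K) (al 0 a).
  by move: h; rewrite /vge !family_horner.
have := vgeM h' (hK s Js); rewrite mulfV ?al_neq0 // /vge Defs.val1 lee_fin; lra.
Qed.

Let al_eval n G : evn al Y n G = eval2 cM (X n) (Y n) G.
Proof. by []. Qed.

Let p_null n : null V (J n) (fun q => (map_poly (al q) P).[Y q]).
Proof.
have [K hK] := bd (m2^-1 ^+ 4) n; move=> B.
have [N hN] := archi_ex ltr01 (B - S + t - K); exists N.+1 => q s h1 Js.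
have hs := (andP Js).1.
have -> : (map_poly (al q) P).[Y q] = (eh q (inord 2))^-1 ^+ 4 * on_quartic c2 c1 c0 cM (eh q).
  rewrite -/(evn al Y q P) al_eval eval2_affine /on_quartic -quartic_scale.
  by congr quartic; rewrite mulrC // mulfV.
have hi : vge (V s) K ((eh q (inord 2))^-1 ^+ 4).
  have [r hr hr'] := den_fin q hs.
  by have := hK s Js; rewrite /vge (valX_fin 4 (valV_fin hr)) (valX_fin 4 (valV_fin hr')).
apply: vgeM' hi (x_root q hs) _.
have : N.+1%:R <= q%:R :> R by rewrite ler_nat.
lra.
Qed.

Let io_e (m : 'I_3) : exists G : {poly {poly CK}}, (forall (S' : comNzRingType) (f : {rmorphism CK -> S'}) (A B : S'),
  eval2 f A B G = if m == inord 0 then A else if m == inord 1 then B else 1).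
Proof.
have [n01 n02 n12] := ord3_neq.
case: (ord3_cases m) => ->.
- by exists 'X%:P => S' f A B; rewrite eqxx eval2_pi.
- by exists 'X => S' f A B; rewrite (eq_sym (inord 1)) n01 eqxx eval2_T.
by exists 1 => S' f A B; rewrite !(eq_sym (inord 2)) n02 n12 rmorph1.
Qed.

Let e_if (m : 'I_3) : e m = if m == inord 0 then iota (xfun CK) else if m == inord 1 then y else 1.
Proof.
have [n01 n02 n12] := ord3_neq; rewrite /e /Y_coord.
case: (ord3_cases m) => ->; rewrite inordK //=.
- by rewrite eqxx.
- by rewrite (eq_sym (inord 1)) n01 eqxx.
by rewrite !(eq_sym (inord 2)) n02 n12.
Qed.

Let eh_if n m : eh n m / eh n (inord 2) =
  if m == inord 0 then X n else if m == inord 1 then Y n else 1.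
Proof.
have [n01 n02 n12] := ord3_neq.
case: (ord3_cases m) => ->; rewrite ?eqxx //.
- by rewrite (eq_sym (inord 1)) n01.
by rewrite !(eq_sym (inord 2)) n02 n12 mulfV.
Qed.

Let ek n : eh n k = 1.
Proof.
by rewrite /eh /chart_pt pk rmorph1 (eq_sym k l) (negPf lk) (eq_sym k i) (negPf ik) !mul0r !addr0.
Qed.

(** The functions of [x] and [y] are evaluated at the points [eh n] of the branch
    and [limit_valuation] is applied, for [J] exhausting the half-line. *)
Theorem closed_point_family : exists W : R -> valuation R E,
  [/\ forall s f, S <= s -> W s (iota f) = gauss v x0 (rho s) f,
      forall (n : R) f, f != 0 -> lipschitz_val (segment S n) (fun s => W s f),
      forall s, S <= s -> W s (e l / e k - cE (p l)) = s%:E &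
      forall s, S <= s -> vge (W s) (s - t) (e i / e k - cE (p i))]
  /\ (e k != 0 /\ forall f, f != 0 -> lipschitz_val [set s | S <= s] (fun s => W s (iota f))).
Proof.
have al_g := al_good; have al_a := al_away; have u_g := Y_good; have p_n := p_null.
have dv G : (map_poly (io iota) G).[y] = 0 -> exists2 h, h != 0 & exists W, h%:P * G = W * P.
  exact: io_div.
have bz G : (map_poly (io iota) G).[y] != 0 ->
    exists2 h, h != 0 & exists U W, U * G + W * P = h%:P by exact: io_bezout.
have fr z : exists G a, a != 0 /\ z = (map_poly (io iota) G).[y] / io iota a by exact: io_frac.
have [W hW] := limit_valuation (@io_inj _ _ iota) (S_in 0) al_g al_a u_g p_n dv bz fr.
have seg s : S <= s -> exists n, J n s.
  move=> hs; have [n hn] := archi_ex ltr01 (s - S); exists n.+1; rewrite /J /segment /=.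
  by rewrite hs /=; lra.
have val s G r : S <= s -> (forall n, V s (eval2 cM (X n) (Y n) G) = r%:E) ->
    W s (eval2 cE (iota (xfun CK)) y G) = r%:E.
  move=> /seg[n Js] h; rewrite -eval2_io.
  apply: (limit_value al_g al_a u_g p_n dv hW Js) => n'; exact: h.
have ge s G B : S <= s -> (forall n, vge (V s) B (eval2 cM (X n) (Y n) G)) ->
    vge (W s) B (eval2 cE (iota (xfun CK)) y G).
  move=> /seg[n Js] h; rewrite -eval2_io; exact: (limit_vge hW Js).
have Wpoly s a : S <= s -> W s (iota (tofrac a)) = gauss v x0 (rho s) (tofrac a).
  move=> hs; have [->|a0] := eqVneq a 0; first by rewrite !rmorph0 !val0.
  have fa : (tofrac a : ratfun CK) != 0 by rewrite tofrac_eq0.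
  have [r hr] := val_fin (gauss v x0 (rho s)) fa; rewrite hr.
  have := val s a%:P r hs; rewrite -eval2_io map_polyC hornerC; apply=> n.
  by rewrite -al_eval /evn map_polyC hornerC family_horner.
have Wiota s f : S <= s -> W s (iota f) = gauss v x0 (rho s) f.
  move=> hs; have [a [d [d0 ->]]] := polyTP x0 f; rewrite !polyTE.
  set a' := tofrac _; set d' := tofrac _.
  have d'0 : d' != 0 by rewrite /d' -polyTE polyT_eq0.
  have [->|a'0] := eqVneq a' 0; first by rewrite mul0r rmorph0 !val0.
  have [r hr] := val_fin (gauss v x0 (rho s)) a'0.
  have [r' hr'] := val_fin (gauss v x0 (rho s)) d'0.
  rewrite (val_div_fin hr hr') fmorph_div (@val_div_fin _ _ _ _ _ r r') // Wpoly //.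
have lin m : exists G, (forall n, eval2 cM (X n) (Y n) G = (eh n m - cM (p m)) / eh n (inord 2)) /\
    eval2 cE (iota (xfun CK)) y G = e m - cE (p m) * e k.
  have [G hG] := io_e m; have [H hH] := io_e k; exists (G - (p m)%:P%:P * H); split.
    move=> n; rewrite rmorphB rmorphM eval2_C hG hH -!eh_if ek; ring.
  by rewrite rmorphB rmorphM eval2_C hG hH -!e_if.
have Wek s r : S <= s -> V s m2 = r%:E -> W s (e k) = (- r)%:E.
  move=> hs hr; have [G hG] := io_e k.
  have -> : e k = eval2 cE (iota (xfun CK)) y G by rewrite hG e_if.
  apply: val => // n; rewrite hG -eh_if ek div1r; apply: valV_fin; by rewrite den.
have ek0 : e k != 0.
  by have [r hr] := val_fin (V S) m2_neq0; apply: val_fin_neq0 (Wek S r (lexx _) hr).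
have quo m : e m / e k - cE (p m) = (e m - cE (p m) * e k) / e k by field.
exists W; split; last first.
  split=> // f f0; have [a [d [d0 ef]]] := polyTP x0 f.
  have a0 : a != 0.
    apply: contraNneq f0 => a0; rewrite ef a0.
    have -> : polyT x0 (0 : {poly CK}) = 0 by apply/eqP; rewrite polyT_eq0.
    by rewrite mul0r.
  pose a' := a \Po ('X - x0%:P); pose d' := d \Po ('X - x0%:P).
  have ta : polyT x0 a = tofrac a' by rewrite polyTE.
  have td : polyT x0 d = tofrac d' by rewrite polyTE.
  have a'0 : a' != 0 by rewrite -(tofrac_eq0 a') -ta polyT_eq0.
  have d'0 : d' != 0 by rewrite -(tofrac_eq0 d') -td polyT_eq0.
  have q0 : al 0 a' / al 0 d' != 0 by rewrite mulf_neq0 ?invr_eq0 ?al_neq0.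
  have [K K0 hK] := Vlip q0.
  have Es s : S <= s -> V s (al 0 a' / al 0 d') = W s (iota f).
    move=> hs; have [r hr] := val_fin (V s) (al_neq0 0 a'0).
    have [r' hr'] := val_fin (V s) (al_neq0 0 d'0).
    rewrite (val_div_fin hr hr') Wiota // ef ta td (@val_div_fin _ _ _ _ _ r r') //.
      by rewrite -(family_horner 0) // hr.
    by rewrite -(family_horner 0) // hr'.
  by exists K => // s s' hs hs'; rewrite -!Es //; apply: hK.
split=> //.
- move=> n f f0; have [N hN] := archi_ex ltr01 n.
  have ex : exists s, J N.+1 s by exists S.
  have [K K0 hK] := limit_lipschitz fr hW Vlip ex f0.
  have sub s : segment S n s -> J N.+1 s.
    by move=> /andP[h1 h2]; rewrite /J /segment /= h1 /=; lra.
  by exists K => // s s' /sub hs /sub hs'; apply: hK.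
- move=> s hs; have [G [h1 h2]] := lin l; have [r hr] := val_fin (V s) m2_neq0.
  rewrite quo -h2 (_ : s%:E = ((s - r) - (- r))%:E); last by rewrite opprK subrK.
  apply: val_div_fin (Wek s r hs hr); apply: val => // n; rewrite h1.
  have -> : eh n l - cM (p l) = pi by rewrite /eh /chart_pt eqxx (negPf li) mul1r mul0r addr0 addrAC subrr add0r.
  by apply: val_div_fin (Vpi s) _; rewrite den.
move=> s hs; have [G [h1 h2]] := lin i; have [r hr] := val_fin (V s) m2_neq0.
rewrite quo -h2 (vgeMr _ _ (Wek s r hs hr)); apply: ge => // n; rewrite h1.
have hr' : V s (eh n (inord 2)) = r%:E by rewrite den.
rewrite (vgeMr _ _ hr') subrK.
have -> : eh n i - cM (p i) = x n.
  by rewrite /eh /chart_pt eqxx (eq_sym i l) (negPf li) mul1r mul0r addr0 addrAC subrr add0r.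
exact: small.
Qed.

End Family.

Lemma monic_cubic_bound (R : realType) (F : fieldType) (w : valuation R F) (a b c y : F) (B : R) :
  B <= 0 -> vge w B a -> vge w B b -> vge w B c -> y ^+ 3 + a * y ^+ 2 + b * y + c = 0 ->
  vge w B y.
Proof.
move=> B0 ha hb hc h; have [->|/(val_fin w)[r hr]] := eqVneq y 0; first exact: vge0.
rewrite (vge_fin _ hr) leNgt; apply/negP => rB.
have e : y ^+ 3 = - (a * y ^+ 2 + b * y + c).
  by apply/eqP; rewrite -addr_eq0; apply/eqP; rewrite -h; ring.
have h3 := valX_fin 3 hr; have h2 := valX_fin 2 hr; rewrite e in h3.
have : vge w (B + 2%:R * r) (- (a * y ^+ 2 + b * y + c)).
  rewrite vgeN; apply: vgeD; [apply: vgeD|].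
  - by apply: vgeM ha (vge_self h2).
  - by apply: vgeW (vgeM hb (vge_self hr)); lra.
  by apply: vgeW hc; lra.
by rewrite (vge_fin _ h3); lra.
Qed.

(** * The limit of the family *)

Section Local.
Variables (R : realType) (C E : fieldType) (v : valuation R C) (iota : {rmorphism ratfun C -> E}).
Variables (y : E) (c2 c1 c0 : nat -> C).
Let cE := Y_cst iota.
Let e := Y_coord iota y.
Hypothesis E_curve : on_quartic c2 c1 c0 cE e = 0.
Hypothesis gen : forall x, exists q : {poly ratfun C}, x = (map_poly iota q).[y].
Variables (p : 'I_3 -> C) (l i k : 'I_3).
Hypothesis li : l != i.
Hypothesis lk : l != k.
Hypothesis ik : i != k.
Hypothesis pk : p k = 1.
Hypothesis p_quartic : quartic c2 c1 c0 (p (inord 0)) (p (inord 1)) (p (inord 2)) = 0.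
Hypothesis p_smooth : partial c2 c1 c0 i (p (inord 0)) (p (inord 1)) (p (inord 2)) != 0.
Variables (W : R -> valuation R E) (S t : R) (x0 : C) (rho : R -> R).
Let pi := e l / e k - cE (p l).
Let T := e i / e k - cE (p i).
Hypothesis W_iota : forall s f, S <= s -> W s (iota f) = gauss v x0 (rho s) f.
Hypothesis W_pi : forall s, S <= s -> W s pi = s%:E.
Hypothesis W_T : forall s, S <= s -> vge (W s) (s - t) T.
Hypothesis ek : e k != 0.
Hypothesis W_lip : forall f, f != 0 -> lipschitz_val [set s | S <= s] (fun s => W s (iota f)).

Let W_cst s a : S <= s -> W s (cE a) = v a.
Proof. by move=> hs; rewrite /cE /Y_cst /= W_iota // gauss_C. Qed.

Let pk0 : p k != 0. Proof. by rewrite pk oner_eq0. Qed.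

Let third m : m != l -> m != i -> m = k.
Proof.
move: li lk ik; have [n01 n02 n12] := ord3_neq.
case: (ord3_cases l) => ->; case: (ord3_cases i) => ->; case: (ord3_cases k) => ->;
  case: (ord3_cases m) => -> //; by rewrite ?eqxx.
Qed.

Let coord_grows m : grows cE W (e m / e k) (p m / p k).
Proof.
rewrite pk divr1; have [->|ml] := eqVneq m l.
  by exists (Num.max S 0) => s; rewrite ge_max => /andP[hs s0]; rewrite (vge_fin _ (W_pi hs)) lerBlDr lerDl le_max lexx orbT.
have [->|mi] := eqVneq m i.
  exists (Num.max S t) => s; rewrite ge_max => /andP[hs _].
  by apply: vgeW (W_T hs); rewrite lerD2l lerN2 le_max lexx orbT.
exists 0 => s _; have -> : m = k by exact: third.
by rewrite pk rmorph1 divff // subrr vge0.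
Qed.

Local Notation V := (value_at cE e p).

Let Vc a : V (cE a) a. Proof. exact: V_cst. Qed.
Let Vm m : V (e m / e k) (p m).
Proof. by have := V_coord cE e pk0 m; rewrite pk divr1. Qed.
Let VD f g a b : V f a -> V g b -> V (f + g) (a + b).
Proof. exact: (V_add ek pk0 W_cst coord_grows). Qed.
Let VM f g a b : V f a -> V g b -> V (f * g) (a * b).
Proof. exact: (V_mul ek pk0). Qed.
Let VI f a : V f a -> a != 0 -> V f^-1 a^-1.
Proof. exact: V_inv. Qed.

Let VB m : V (e m / e k - cE (p m)) 0.
Proof. by have := VD (Vm m) (Vc (- p m)); rewrite rmorphN subrr. Qed.

Let Veval G : V (eval2 cE pi T G) (G`_0)`_0.
Proof.
have one (a : {poly C}) : V (map_poly cE a).[pi] a`_0.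
  elim/poly_ind: a => [|a b IH]; first by rewrite rmorph0 horner0 coef0 -(rmorph0 cE); apply: Vc.
  rewrite rmorphD rmorphM /= map_polyX map_polyC hornerD hornerM hornerX hornerC.
  rewrite coefD coefMX coefC /=; apply: VD (Vc b).
  by have := VM IH (VB l); rewrite mulr0.
elim/poly_ind: G => [|G a IH].
  by rewrite rmorph0 !coef0 -(rmorph0 cE); apply: Vc.
have -> : eval2 cE pi T (G * 'X + a%:P) = eval2 cE pi T G * T + (map_poly cE a).[pi].
  rewrite rmorphD rmorphM eval2_T; congr (_ + _).
  by rewrite /eval2 /= {1}/horner_eval map_polyC hornerC.
rewrite coefD coefMX coefC /= coefD coef0; apply: VD (one a).
by have := VM IH (VB i); rewrite mulr0.
Qed.

Let T_root : eval2 cE pi T (chart_eq c2 c1 c0 p l i) = 0.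
Proof.
rewrite eval_chart; have h m : chart_pt p l i cE pi T m = (e k)^-1 * e m.
  rewrite /chart_pt; have [->|ml] := eqVneq m l.
    by rewrite (negPf li) mul1r mul0r addr0 /pi; ring.
  have [->|mi] := eqVneq m i; first by rewrite mul1r mul0r addr0 /T; ring.
  by rewrite !mul0r !addr0 (third ml mi) pk rmorph1 mulVf.
by rewrite /on_quartic !h quartic_scale -/(on_quartic c2 c1 c0 cE e) E_curve mulr0.
Qed.

Let pi_unif : unif cE e p pi (e l / e k) (p l).
Proof.
split; first exact: Vm.
by exists 1, 1; rewrite mulr1 -(rmorph1 cE); split=> //; apply: Vc.
Qed.

(** The chart equation reads [G T + a pi = 0] with [G] a unit at the point. *)
Let T_unif : unif cE e p pi (e i / e k) (p i).
Proof.
split; first exact: Vm.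
have h00 := chart_eq00 l i p_quartic; have h10 := chart_eq10 c2 c1 c0 p l i.
move: T_root h00 h10; set G := chart_eq _ _ _ _ _ _.
elim/poly_ind: G => [|G a _]; first by move=> _ _; rewrite !coef0 => /esym/eqP; rewrite (negPf p_smooth).
have -> : eval2 cE pi T (G * 'X + a%:P) = eval2 cE pi T G * T + (map_poly cE a).[pi].
  rewrite rmorphD rmorphM eval2_T; congr (_ + _).
  by rewrite /eval2 /= {1}/horner_eval map_polyC hornerC.
rewrite !coefD !coefMX !coefC /= add0r addr0.
elim/poly_ind: a => [|a b _].
  rewrite coef0 rmorph0 horner0 addr0 => /eqP; rewrite mulf_eq0 => /orP[/eqP G0|/eqP T0] _ b1.
    have := Veval G; rewrite (G0 : eval2 cE pi T G = 0) b1 => Vz; have Vz' := Vc 0; rewrite rmorph0 in Vz'.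
    have := grows_unique W_cst (value_grows ek pk0 W_cst coord_grows Vz) (value_grows ek pk0 W_cst coord_grows Vz').
    by move/eqP; rewrite (negPf p_smooth).
  by exists (cE 0), 0; split; [exact: Vc | rewrite rmorph0 mulr0].
rewrite coefD coefMX coefC /= add0r => h0 b0 b1.
have {}h0 : eval2 cE pi T G * T + (map_poly cE (a * 'X + b%:P)).[pi] = 0 := h0.
have h : eval2 cE pi T G * T + (map_poly cE a).[pi] * pi = 0.
  by rewrite -[RHS]h0 b0 polyC0 addr0 (rmorphM (map_poly cE)) /= map_polyX hornerM hornerX.
clear h0.
have VG := Veval G; rewrite b1 in VG.
have G0 : eval2 cE pi T G != 0 by apply: (grows_neq0 W_cst (value_grows ek pk0 W_cst coord_grows VG)).
have Va := Veval a%:P.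
have ea : eval2 cE pi T a%:P = (map_poly cE a).[pi] by rewrite /eval2 /= {1}/horner_eval map_polyC hornerC.
rewrite ea in Va.
have VG' := VI VG p_smooth.
have Vq := VM (Vc (-1)) (VM Va VG'); set q := _ * _ in Vq; set qv := _ * _ in Vq.
exists q, qv; split=> //; rewrite -/T.
apply: (mulfI G0); rewrite /q rmorphN rmorph1 -[LHS](addrK ((map_poly cE a).[pi] * pi)) h.
move: G0; set g := eval2 _ _ _ _; set aa := _.[_] => G0.
by field.
Qed.

Let coord_unif m : unif cE e p pi (e m / e k) (p m / p k).
Proof.
rewrite pk divr1; have [->|ml] := eqVneq m l; first exact: pi_unif.
have [->|mi] := eqVneq m i; first exact: T_unif.
split; first exact: Vm.
exists (cE 0), 0; split; first exact: Vc.
by rewrite (third ml mi) divff // pk rmorph1 rmorph0 mulr0 subrr.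
Qed.

(** Values decrease at most linearly along the family.  Applied to inverses this
    is the bound required in [closed_point_limit]. *)
Let lower g := exists2 K : R, 0 <= K & forall s, K <= s -> S <= s -> vge (W s) (- (K * s)) g.

Let lowerW g K K' : 0 <= K -> K <= K' -> (forall s, K <= s -> S <= s -> vge (W s) (- (K * s)) g) ->
  forall s, K' <= s -> S <= s -> vge (W s) (- (K' * s)) g.
Proof.
move=> K0 KK h s hs Ss; have s0 : 0 <= s by lra.
by apply: vgeW (h s _ Ss); rewrite ?lerN2 ?ler_wpM2r //; lra.
Qed.

Let lowerD g g' : lower g -> lower g' -> lower (g + g').
Proof.
move=> [K K0 hK] [K' K0' hK']; exists (K + K'); first by rewrite addr_ge0.
move=> s hs Ss; apply: vgeD; first by apply: (lowerW K0 _ hK) => //; lra.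
by apply: (lowerW K0' _ hK') => //; lra.
Qed.

Let lowerM g g' : lower g -> lower g' -> lower (g * g').
Proof.
move=> [K K0 hK] [K' K0' hK']; exists (K + K'); first by rewrite addr_ge0.
move=> s hs Ss; have h1 : vge (W s) (- (K * s)) g by apply: hK => //; lra.
have h2 : vge (W s) (- (K' * s)) g' by apply: hK' => //; lra.
by apply: vgeM' h1 h2 _; rewrite mulrDl opprD.
Qed.

Let lower_iota f : lower (iota f).
Proof.
have [->|f0] := eqVneq f 0; first by exists 0 => // s _ _; rewrite rmorph0 vge0.
have [K0 K00 hK] := W_lip f0; have [r0 [_ [h0 _ _]]] := hK S S (lexx S) (lexx S).
have nS := normr_ge0 S; have nr := normr_ge0 r0.
pose K1 : R := `|r0| + K0 + K0 * `|S| + 1.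
have K1ge : 1 <= K1 by rewrite /K1; have := mulr_ge0 K00 nS; lra.
exists K1 => [|s hs Ss]; first by lra.
have [r [r' [hr hr' h]]] := hK s S Ss (lexx S).
have [er] : r'%:E = r0%:E by rewrite -hr' -h0.
subst r'; rewrite (vge_fin _ hr).
have sS : 0 <= s - S by rewrite subr_ge0.
rewrite (ger0_norm sS) in h; have := ler_norm (r0 - r); rewrite distrC => h1.
have s1 : 1 <= s by lra.
have h2 : `|r0| * 1 <= `|r0| * s by rewrite ler_wpM2l.
have h3 : (K0 * `|S|) * 1 <= (K0 * `|S|) * s by rewrite ler_wpM2l // mulr_ge0.
have h4 : K0 * - S <= K0 * `|S| by rewrite ler_wpM2l // -normrN ler_norm.
have h5 := ler_norm (- r0); rewrite normrN in h5.
have : K1 * s = `|r0| * s + K0 * s + K0 * `|S| * s + s by rewrite /K1; ring.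
have : K0 * (s - S) = K0 * s + K0 * - S by ring.
lra.
Qed.

Let e0 : e (inord 0) = iota (xfun C). Proof. by rewrite /e /Y_coord inordK. Qed.
Let e1 : e (inord 1) = y. Proof. by rewrite /e /Y_coord inordK. Qed.
Let e2 : e (inord 2) = 1. Proof. by rewrite /e /Y_coord inordK. Qed.

Let y_cubic : exists a b c : ratfun C, y ^+ 3 + iota a * y ^+ 2 + iota b * y + iota c = 0.
Proof.
pose kk := ratC C; pose X := xfun C.
pose qa (F : comNzRingType) (c : nat -> F) (x : F) := c 0 + c 1 * x + c 2 * x ^+ 2.
pose qb (F : comNzRingType) (c : nat -> F) (x : F) := c 0 + c 1 * x + c 2 * x ^+ 2 + c 3 * x ^+ 3.
pose qc (F : comNzRingType) (c : nat -> F) (x : F) :=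
  c 0 + c 1 * x + c 2 * x ^+ 2 + c 3 * x ^+ 3 + c 4 * x ^+ 4.
have alg (F : comNzRingType) (d2 d1 d0 : nat -> F) (x z : F) :
    quartic d2 d1 d0 x z 1 = z ^+ 3 + qa F d2 x * z ^+ 2 + qb F d1 x * z + qc F d0 x.
  by rewrite /quartic /qa /qb /qc; ring.
have ma (F F' : comNzRingType) (f : {rmorphism F -> F'}) c x :
    f (qa F c x) = qa F' (f \o c) (f x) by rewrite /qa /=; ring.
have mb (F F' : comNzRingType) (f : {rmorphism F -> F'}) c x :
    f (qb F c x) = qb F' (f \o c) (f x) by rewrite /qb /=; ring.
have mc (F F' : comNzRingType) (f : {rmorphism F -> F'}) c x :
    f (qc F c x) = qc F' (f \o c) (f x) by rewrite /qc /=; ring.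
exists (qa _ (kk \o c2) X), (qb _ (kk \o c1) X), (qc _ (kk \o c0) X).
rewrite ma mb mc -[RHS]E_curve /on_quartic e0 e1 e2 alg; congr (_ + _ + _ + _); congr (_ * _).
Qed.

Let lower_y : lower y.
Proof.
have [a [b [c h]]] := y_cubic.
have [K1 K10 h1] := lower_iota a; have [K2 K20 h2] := lower_iota b.
have [K3 K30 h3] := lower_iota c; exists (K1 + K2 + K3); first by lra.
move=> s hs Ss; apply: (monic_cubic_bound _ _ _ _ h).
- by rewrite oppr_le0 mulr_ge0 //; lra.
- by apply: (lowerW K10 _ h1) => //; lra.
- by apply: (lowerW K20 _ h2) => //; lra.
by apply: (lowerW K30 _ h3) => //; lra.
Qed.

Let lower_all f : lower f.
Proof.
have [q ->] := gen f; elim/poly_ind: q => [|q a IH].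
  by rewrite rmorph0 horner0 -(rmorph0 iota); apply: lower_iota.
rewrite rmorphD rmorphM /= map_polyX map_polyC hornerD hornerM hornerX hornerC.
by apply: lowerD (lower_iota a); apply: lowerM.
Qed.

Let bounded_above f : f != 0 -> exists K L : R, forall s r, L <= s -> W s f = r%:E -> r <= K * s + L.
Proof.
move=> f0; have [K K0 hK] := lower_all f^-1; exists K, (Num.max K S) => s r.
rewrite ge_max => /andP[hs Ss] hr; have := hK s hs Ss; rewrite (vge_fin _ (valV_fin hr)) lerN2.
by move=> h; apply: le_trans h _; rewrite lerDl le_max K0.
Qed.

Let isfrac f := exists x a z b, [/\ V x a, V z b, z != 0 & f = x / z].

Let frac_reg f a : V f a -> isfrac f.
Proof. by move=> h; exists f, a, (cE 1), 1; rewrite rmorph1 oner_eq0 divr1; split=> //; have := Vc 1; rewrite rmorph1. Qed.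

Let fracD f g : isfrac f -> isfrac g -> isfrac (f + g).
Proof.
move=> [x [a [z [b [h1 h2 z0 ->]]]]] [x' [a' [z' [b' [h1' h2' z0' ->]]]]].
exists (x * z' + x' * z), (a * b' + a' * b), (z * z'), (b * b'); split.
- by apply: VD; apply: VM.
- exact: VM.
- by rewrite mulf_neq0.
exact: addf_div.
Qed.

Let fracM f g : isfrac f -> isfrac g -> isfrac (f * g).
Proof.
move=> [x [a [z [b [h1 h2 z0 ->]]]]] [x' [a' [z' [b' [h1' h2' z0' ->]]]]].
exists (x * x'), (a * a'), (z * z'), (b * b'); split; rewrite ?mulf_neq0 //.
- exact: VM.
- exact: VM.
exact: mulf_div.
Qed.

Let fracV f : isfrac f -> isfrac f^-1.
Proof.
move=> [x [a [z [b [h1 h2 z0 ->]]]]]; have [->|x0'] := eqVneq x 0.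
  by rewrite mul0r invr0 -(rmorph0 cE); apply: frac_reg (Vc 0).
by exists z, b, x, a; rewrite invf_div.
Qed.

Let frac_all f : isfrac f.
Proof.
have quo m : e m = (e m / e k) / (e (inord 2) / e k).
  by rewrite e2 div1r invrK divfK.
have fe m : isfrac (e m).
  by rewrite quo; apply: fracM; [|apply: fracV]; apply: frac_reg (Vm _).
have fpoly (a : {poly C}) : isfrac (iota (tofrac a)).
  elim/poly_ind: a => [|a b IH]; first by rewrite !rmorph0 -(rmorph0 cE); apply: frac_reg (Vc 0).
  rewrite (rmorphD (@tofrac {poly C})) (rmorphM (@tofrac {poly C})) rmorphD rmorphM.
  by apply: fracD (frac_reg (Vc b)); apply: fracM IH _; rewrite -[X in isfrac X]e0.
have [q ->] := gen f; elim/poly_ind: q => [|q a IH].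
  by rewrite rmorph0 horner0 -(rmorph0 cE); apply: frac_reg (Vc 0).
rewrite rmorphD rmorphM /= map_polyX map_polyC hornerD hornerM hornerX hornerC.
apply: fracD; first by apply: fracM IH _; rewrite -e1.
have [n [d [d0 ->]]] := polyTP x0 a; rewrite !polyTE.
have hq b d' : isfrac (iota b) -> isfrac (iota d') -> isfrac (iota (b / d')).
  by move=> hb hd'; rewrite fmorph_div; apply: fracM hb _; apply: fracV.
by apply: hq; apply: fpoly.
Qed.

Let xi := closed_point_val v cE e p.

Theorem local_limit : xi pi = +oo%E /\ forall f,
  (forall M : R, (M%:E < xi f)%E -> exists L : R, forall s, L <= s -> (M%:E < W s f)%E) /\
  (forall M : R, (xi f < M%:E)%E -> exists L : R, forall s, L <= s -> (W s f < M%:E)%E).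
Proof.
split; first by rewrite /xi (closed_val_regular ek pk0 W_cst coord_grows (VB l)) val0.
exact: (closed_point_limit ek pk0 W_cst coord_grows W_pi (VB l) coord_unif bounded_above frac_all).
Qed.

End Local.

(** * Charts over finite points and over infinity *)

Section Monomials.
Variables (R : realType) (C : fieldType) (v : valuation R C).
Let V (s : R) : valuation R (ratfun C) := gauss v 0 s.
Let emb : {rmorphism {poly C} -> ratfun C} := @tofrac {poly C}.
Let cM : {rmorphism C -> ratfun C} := emb \o polyC.
Let pi := emb 'X.

Lemma gauss0E s a : V s (emb a) = gval v s a.
Proof.
have -> : emb a = polyT 0 a by rewrite polyTE polyC0 subr0 comp_polyXr.
exact: gaussE.
Qed.

Lemma gauss0_cst s a : V s (cM a) = v a.
Proof. by rewrite /cM /= gauss0E gvalC. Qed.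

Lemma gauss0_pi s : V s pi = s%:E.
Proof. by rewrite gauss0E gvalX. Qed.

Lemma gauss0_mono s c r k : v c = r%:E -> V s (cM c * pi ^+ k) = (r + k%:R * s)%:E.
Proof.
by move=> hr; apply: valM_fin (valX_fin k (gauss0_pi s)); rewrite gauss0_cst.
Qed.

Let binom s c b k : (0 < k)%N -> V s (cM c * pi ^+ k - cM b) =
  Order.min (v c + (k%:R * s)%:E)%E (v b).
Proof.
move=> k0; have -> : cM c * pi ^+ k - cM b = emb (c%:P * 'X^k - b%:P).
  by rewrite rmorphB rmorphM rmorphXn.
rewrite gauss0E; apply/ereal_eq_thr => m.
have hk : vge v (m - k%:R * s) c <-> (m%:E <= v c + (k%:R * s)%:E)%E.
  have [->|/(val_fin v)[r hr]] := eqVneq c 0; first by rewrite /vge val0 addye // !leey.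
  by rewrite (vge_fin _ hr) hr -EFinD lee_fin lerBlDr.
rewrite gval_geP le_min; split.
  move=> h; apply/andP; split.
    apply/hk; have := h k; rewrite coefB coefCM coefXn eqxx mulr1 coefC.
    by rewrite (gtn_eqF k0) subr0.
  have := h 0%N; rewrite coefB coefCM coefXn coefC /= (ltn_eqF k0) mulr0 sub0r vgeN mul0r subr0.
  by [].
move=> /andP[/hk h1 h2] q; rewrite coefB coefCM coefXn coefC.
have [->|qk] := eqVneq q k.
  by rewrite (gtn_eqF k0) subr0 mulr1.
rewrite mulr0 sub0r vgeN; case: q qk => [|q] qk /=; last exact: vge0.
by rewrite mul0r subr0.
Qed.

Lemma mono_pos s c r b k : (0 < k)%N -> v c = r%:E ->
  V s (cM c * pi ^+ k - cM b) = Order.min (r + k%:R * s)%:E (v b).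
Proof. by move=> k0 hr; rewrite binom // hr. Qed.

(** There is no cancellation between a non-constant monomial and a constant. *)
Lemma mono_neg s c r b k : (0 < k)%N -> v c = r%:E ->
  V s (cM c / pi ^+ k - cM b) = Order.min (r - k%:R * s)%:E (v b).
Proof.
move=> k0 hr; have hp := valX_fin k (gauss0_pi s); have p0 := val_fin_neq0 hp.
have [->|/(val_fin v)[q hq]] := eqVneq b 0.
  by rewrite rmorph0 subr0 val0 (val_div_fin (etrans (gauss0_cst s c) hr) hp) min_l ?leey.
have -> : cM c / pi ^+ k - cM b = - (cM b * pi ^+ k - cM c) / pi ^+ k.
  by rewrite opprB mulrBl mulfK.
rewrite Defs.valM valN binom // hr hq (valV_fin hp) -EFinD.
rewrite -!EFin_min -EFinD; congr _%:E; rewrite !minElt.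
by case: (ltP (q + k%:R * s) r) => h1; case: (ltP (r - k%:R * s) q) => h2; lra.
Qed.

(** The error [T - mu] is smaller than all the values compared. *)
Lemma near_translate s (T mu : ratfun C) r : V s mu = r%:E ->
  (forall b, V s (mu - cM b) = Order.min r%:E (v b)) -> vge (V s) (r + 1) (T - mu) ->
  forall b, V s (T - cM b) = Order.min r%:E (v b).
Proof.
move=> hmu h hT b; rewrite -h.
have [q hq qr] : exists2 q, V s (mu - cM b) = q%:E & q <= r.
  rewrite h; have [->|/(val_fin v)[q hq]] := eqVneq b 0; first by rewrite val0 min_l ?leey //; exists r.
  by rewrite hq -EFin_min; exists (Order.min r q); rewrite ?ge_min ?lexx.
rewrite hq; apply: (valB_fin hq (M := r + 1)); first by lra.
by have -> : T - cM b - (mu - cM b) = T - mu by ring.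
Qed.

(** The values of the other terms grow faster with [s]. *)
Lemma lowest_term (a : {poly C}) : a != 0 -> exists (k : nat) (r S : R),
  [/\ v a`_k = r%:E, (a`_0 = 0 -> (0 < k)%N) , forall q, (q < k)%N -> a`_q = 0 &
   forall s, S <= s -> vge (V s) (r + k%:R * s + 1) (emb a - cM a`_k * pi ^+ k)].
Proof.
move=> a0; have ex : exists k, a`_k != 0.
  by exists (size a).-1; rewrite -/(lead_coef a) lead_coef_eq0.
pose k := ex_minn ex; have [hk kmin] : a`_k != 0 /\ forall q, a`_q != 0 -> (k <= q)%N.
  by rewrite /k; case: ex_minnP.
have low q : (q < k)%N -> a`_q = 0.
  by move=> qk; apply/eqP; apply: contraTT qk => /kmin; rewrite -leqNgt.
have [r hr] := val_fin v hk; have [N N0 hN] := coef_bound v a%:P.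
have {}hN b : vge v (- N) a`_b by have := hN 0%N b; rewrite coefC.
exists k, r, (Num.max 0 (r + 1 + N)); split=> // [a00|s].
  by rewrite lt0n; apply/eqP => k0; move: hk; rewrite k0 a00 eqxx.
rewrite ge_max => /andP[s0 hs].
have -> : emb a - cM a`_k * pi ^+ k = emb (a - (a`_k)%:P * 'X^k).
  by rewrite rmorphB rmorphM rmorphXn.
rewrite /vge gauss0E; apply/gval_geP => q; rewrite coefB coefCM coefXn.
have [->|qk] := eqVneq q k; first by rewrite mulr1 subrr vge0.
rewrite mulr0 subr0; have [qk'|kq] := ltnP q k; first by rewrite low // vge0.
apply: vgeW (hN q); have : (k.+1 <= q)%N by rewrite ltn_neqAle eq_sym qk kq.
rewrite -(ler_nat R) -natr1 => h.
have := ler_wpM2r s0 h; rewrite mulrDl mul1r; lra.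
Qed.

End Monomials.

Definition increasing_affine (R : realType) (rho : R -> R) :=
  exists r k : R, 0 < k /\ forall s, rho s = r + k * s.
Definition decreasing_affine (R : realType) (rho : R -> R) :=
  exists r k : R, 0 < k /\ forall s, rho s = r - k * s.

Section Reached.
Variables (R : realType) (Kbar : closedFieldType) (CK : fieldType) (vbar : valuation R Kbar).
Variables (v : valuation R CK) (j : {rmorphism Kbar -> CK}).
Hypothesis compl : is_completion vbar v j.
Variables (E : fieldType) (iota : {rmorphism ratfun CK -> E}) (y : E) (c2 c1 c0 : nat -> CK).
Let cE := Y_cst iota.
Let e := Y_coord iota y.
Variable x0 : CK.

(** The point [xi] is the limit of valuations over the Gauss valuations with
    centre [x0] and radii [rho s], as [s] grows. *)
Definition reached (xi : E -> \bar R) (rho : R -> R) :=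
  exists (W : R -> valuation R E) (s1 : R) (pi : E),
  [/\ forall s f, s1 <= s -> W s (iota f) = gauss v x0 (rho s) f,
      forall (n : R) f, f != 0 -> lipschitz_val (segment s1 n) (fun s => W s f),
      forall s, s1 <= s -> W s pi = s%:E,
      xi pi = +oo%E &
      forall f,
      (forall M : R, (M%:E < xi f)%E -> exists L : R, forall s, L <= s -> (M%:E < W s f)%E) /\
      (forall M : R, (xi f < M%:E)%E -> exists L : R, forall s, L <= s -> (W s f < M%:E)%E)].

Hypothesis P_irr : irreducible_poly (map_poly (@tofrac {poly CK}) (affine_poly c2 c1 c0)).
Hypothesis E_curve : on_quartic c2 c1 c0 cE e = 0.
Hypothesis gen : forall x, exists q : {poly ratfun CK}, x = (map_poly iota q).[y].

Let Py : (map_poly iota (map_poly (@tofrac {poly CK}) (affine_poly c2 c1 c0))).[y] = 0.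
Proof.
have -> : map_poly iota (map_poly (@tofrac {poly CK}) (affine_poly c2 c1 c0)) =
    map_poly (io iota) (affine_poly c2 c1 c0) by rewrite io_map.
rewrite eval2_io eval2_affine -[RHS]E_curve /on_quartic /e /Y_coord !inordK //.
Qed.

Let M := ratfun CK.
Let V (s : R) : valuation R M := gauss v 0 s.
Let emb : {rmorphism {poly CK} -> M} := @tofrac {poly CK}.
Let cM : {rmorphism CK -> M} := emb \o polyC.
Let pi := emb 'X.

Section Chart.
Variables (p : 'I_3 -> CK) (l i k : 'I_3).
Hypothesis li : l != i.
Hypothesis lk : l != k.
Hypothesis ik : i != k.
Hypothesis pk : p k = 1.
Hypothesis p_quartic : quartic c2 c1 c0 (p (inord 0)) (p (inord 1)) (p (inord 2)) = 0.
Let beta := partial c2 c1 c0 i (p (inord 0)) (p (inord 1)) (p (inord 2)).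
Hypothesis p_smooth : beta != 0.
Variable Q : (R -> R) -> Prop.
Let q0 := on_quartic c2 c1 c0 cM (chart_pt p l i cM pi 0).
Let eh x m : M := chart_pt p l i cM pi x m.

(** It remains to know the denominator and the value of [x - x0 - b] along the
    branch; both are read off from the leading term of [x n]. *)
Theorem chart_reached :
  (forall (S bv : R) (x : nat -> M), v beta = bv%:E ->
     (forall s n r, S <= s -> V s q0 = r%:E -> vge (V s) (r - bv + 1) (x n - (- q0 / cM beta))) ->
     exists (rho : R -> R) (S1 : R) (m2 : M), [/\ Q rho, m2 != 0,
       forall s n, S1 <= s -> V s (eh (x n) (inord 2)) = V s m2 &
       forall s n b, S1 <= s ->
         V s (eh (x n) (inord 0) / eh (x n) (inord 2) - cM x0 - cM b) = Order.min (rho s)%:E (v b)]) ->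
  exists2 rho, reached (closed_point_val v cE e p) rho & Q rho.
Proof.
move=> chart; have hV s a : V s (emb a) = gval v s a by exact: gauss0E.
have [S [t [bv [x [S0 ht hbv hx]]]]] := chart_branch l p_quartic p_smooth hV.
have [|rho [S1 [m2 [Qrho m20 den cen]]]] := chart S bv x hbv.
  by move=> s n r hs hr; have [_ _ _ h] := hx s hs; apply: h.
pose S2 := Num.max S S1.
have s2 s : S2 <= s -> S <= s /\ S1 <= s by rewrite ge_max => /andP[].
have Vlip m : m != 0 -> lipschitz_val setT (fun s => V s m) by move=> m0; apply: lipschitz_gauss.
have [W [[h1 h2 h3 h4] [h5 h6]]] := closed_point_family compl P_irr Py gen li lk ik pk hV Vlip
  (S := S2) (t := t) (x := x)
  (fun s n hs => let: And4 h _ _ _ := hx s (s2 s hs).1 in h n)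
  (fun s n hs => let: And4 _ h _ _ := hx s (s2 s hs).1 in h n)
  (fun s n m hs nm => let: And4 _ _ h _ := hx s (s2 s hs).1 in h n m nm)
  m20 (fun s n hs => den s n (s2 s hs).2) (fun s n b hs => cen s n b (s2 s hs).2).
have [h7 h8] := local_limit E_curve gen li lk ik pk p_quartic p_smooth h1 h3 h4 h5 h6.
by exists rho => //; exists W, S2, (e l / e k - cE (p l)).
Qed.

End Chart.
End Reached.

Section Charts.
Variables (R : realType) (Kbar : closedFieldType) (CK : fieldType) (vbar : valuation R Kbar).
Variables (v : valuation R CK) (j : {rmorphism Kbar -> CK}).
Hypothesis compl : is_completion vbar v j.
Variables (E : fieldType) (iota : {rmorphism ratfun CK -> E}) (y : E) (c2 c1 c0 : nat -> CK).
Let cE := Y_cst iota.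
Let e := Y_coord iota y.
Variable x0 : CK.
Hypothesis P_irr : irreducible_poly (map_poly (@tofrac {poly CK}) (affine_poly c2 c1 c0)).
Hypothesis E_curve : on_quartic c2 c1 c0 cE e = 0.
Hypothesis gen : forall x, exists q : {poly ratfun CK}, x = (map_poly iota q).[y].

Let M := ratfun CK.
Let V (s : R) : valuation R M := gauss v 0 s.
Let emb : {rmorphism {poly CK} -> M} := @tofrac {poly CK}.
Let cM : {rmorphism CK -> M} := emb \o polyC.
Let pi := emb 'X.

Let mono s c r k : v c = r%:E -> V s (cM c * pi ^+ k) = (r + k%:R * s)%:E.
Proof. exact: gauss0_mono. Qed.

Let VC s a : V s (cM a) = v a. Proof. exact: gauss0_cst. Qed.

(** [x n] is close to the first Newton step [- phi / beta]. *)
Lemma branch_leading (phi : {poly CK}) (beta : CK) (S bv : R) (x : nat -> M) :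
  phi != 0 -> phi`_0 = 0 -> v beta = bv%:E ->
  (forall s n r, S <= s -> V s (emb phi) = r%:E -> vge (V s) (r - bv + 1) (x n - (- emb phi / cM beta))) ->
  exists (k : nat) (c : CK) (r S1 : R), [/\ (0 < k)%N, phi`_k != 0, v c = r%:E, 0 <= S1 &
    forall s n, S1 <= s -> vge (V s) (r + k%:R * s + 1) (x n - cM c * pi ^+ k) /\
      V s (x n) = (r + k%:R * s)%:E].
Proof.
move=> phi0 phi00 hb lead; have [k [r [S0 [hr k0 _ hS]]]] := lowest_term v phi0.
have pk := val_fin_neq0 hr; have b0 := val_fin_neq0 hb.
have hc : v (- phi`_k / beta) = (r - bv)%:E by apply: val_div_fin hb; rewrite valN.
exists k, (- phi`_k / beta), (r - bv), (Num.max 0 (Num.max S S0)); split=> //.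
- exact: k0.
- by rewrite le_max lexx.
move=> s n; rewrite !ge_max => /and3P[s0 Ss S0s].
have hm := mono s k hr; have h1 := hS s S0s.
have hphi : V s (emb phi) = (r + k%:R * s)%:E.
  by apply: (valB_fin hm (M := r + k%:R * s + 1)); rewrite // ltrDl ltr01.
have h2 := lead s n _ Ss hphi.
have h3 : vge (V s) (r - bv + k%:R * s + 1) (x n - cM (- phi`_k / beta) * pi ^+ k).
  have hbM : V s (cM beta) = bv%:E by rewrite VC.
  have h4 : vge (V s) (r - bv + k%:R * s + 1) (- emb phi / cM beta - cM (- phi`_k / beta) * pi ^+ k).
    have -> : - emb phi / cM beta - cM (- phi`_k / beta) * pi ^+ k =
        - (emb phi - cM phi`_k * pi ^+ k) / cM beta.
      have alg (F : fieldType) (a b d q : F) : - a / b - - d / b * q = - (a - d * q) / b by ring.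
      by rewrite fmorph_div rmorphN; apply: alg.
    by rewrite (vgeMr _ _ hbM) vgeN; apply: vgeW h1; lra.
  by apply: vge_trans h4; apply: vgeW h2; lra.
split=> //; apply: (valB_fin (mono s k hc) _ h3); lra.
Qed.

Let o0 : 'I_3 := inord 0.
Let o1 : 'I_3 := inord 1.
Let o2 : 'I_3 := inord 2.
Let o01 : o0 == o1 = false. Proof. by have [] := ord3_neq. Qed.
Let o02 : o0 == o2 = false. Proof. by have [] := ord3_neq. Qed.
Let o12 : o1 == o2 = false. Proof. by have [] := ord3_neq. Qed.
Let o10 : o1 == o0 = false. Proof. by rewrite eq_sym o01. Qed.
Let o20 : o2 == o0 = false. Proof. by rewrite eq_sym o02. Qed.
Let o21 : o2 == o1 = false. Proof. by rewrite eq_sym o12. Qed.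
Let oE := (o01, o02, o12, o10, o20, o21, eqxx, mul0r, mul1r, mulr0, addr0, add0r).

Variable p : 'I_3 -> CK.
Let q m := partial c2 c1 c0 m (p o0) (p o1) (p o2).
Hypothesis p_quartic : quartic c2 c1 c0 (p o0) (p o1) (p o2) = 0.
Let xi := closed_point_val v cE e p.
Local Notation reach := (reached v iota x0 xi).

Let emb_quartic (x' y' z' : {poly CK}) :
  quartic (cM \o c2) (cM \o c1) (cM \o c0) (emb x') (emb y') (emb z') =
  emb (quartic (polyC \o c2) (polyC \o c1) (polyC \o c0) x' y' z').
Proof. by rewrite (quartic_morph emb). Qed.

Let pinfty (r : R) k : (0 < k)%N -> increasing_affine (fun s => r + k%:R * s).
Proof. by move=> k0; exists r, k%:R; rewrite ltr0n. Qed.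

Let ninfty (r : R) k : (0 < k)%N -> decreasing_affine (fun s => r - k%:R * s).
Proof. by move=> k0; exists r, k%:R; rewrite ltr0n. Qed.

(** The function [x - x0] is itself a local coordinate. *)
Lemma reached_finite_y : p o2 = 1 -> p o0 = x0 -> q o1 != 0 ->
  exists2 rho, reach rho & increasing_affine rho.
Proof.
move=> p2 p0 qn.
apply: (chart_reached compl P_irr E_curve gen (l := o0) (i := o1) (k := o2)); rewrite ?oE //.
move=> S bv x hbv _; exists (fun s => 0 + 1%:R * s), S, 1; split; rewrite ?oner_eq0 //.
- exact: pinfty.
- by move=> s n _; rewrite /chart_pt !oE p2 (rmorph1 cM).
move=> s n b _; rewrite /chart_pt !oE p2 p0 (rmorph1 cM) divr1.
have h := mono_pos s b (ltn0Sn 0) (Defs.val1 v).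
rewrite (rmorph1 cM) mul1r expr1 add0r mul1r in h.
rewrite -h; congr (V s _).
have alg (F : zmodType) (f g h' : F) : f + g - f - h' = g - h' by rewrite [f + g]addrC addrK.
exact: alg.
Qed.

(** [y - y(P)] is a local coordinate, and [x - x0] has a leading term of positive
    degree in it; the equation is not constant along the line since it is monic in [y]. *)
Lemma reached_finite_x : p o2 = 1 -> p o0 = x0 -> q o0 != 0 ->
  exists2 rho, reach rho & increasing_affine rho.
Proof.
move=> p2 p0 qn.
pose phi := quartic (polyC \o c2) (polyC \o c1) (polyC \o c0) x0%:P ((p o1)%:P + 'X) 1.
have phi0 : phi != 0.
  pose g : {rmorphism {poly CK} -> {poly CK}} := comp_poly ('X - (p o1)%:P).
  have gC a : g a%:P = a%:P by rewrite /g /= comp_polyC.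
  have : g phi != 0.
    have -> : g phi = quartic (polyC \o c2) (polyC \o c1) (polyC \o c0) x0%:P 'X 1.
      rewrite /phi (quartic_morph g) rmorph1 rmorphD /= !gC.
      have gc (c : nat -> CK) : g \o (polyC \o c) = polyC \o c by apply/funext => n /=; rewrite gC.
      by rewrite !gc /= comp_polyX addrC subrK.
    pose A := c2 0 + c2 1 * x0 + c2 2 * x0 ^+ 2.
    pose B := c1 0 + c1 1 * x0 + c1 2 * x0 ^+ 2 + c1 3 * x0 ^+ 3.
    pose D := c0 0 + c0 1 * x0 + c0 2 * x0 ^+ 2 + c0 3 * x0 ^+ 3 + c0 4 * x0 ^+ 4.
    have -> : quartic (polyC \o c2) (polyC \o c1) (polyC \o c0) x0%:P 'X 1 =
        'X^3 + A%:P * 'X^2 + B%:P * 'X + D%:P.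
      by rewrite /quartic /A /B /D /= !(polyCD, polyCM, polyC_exp); ring.
    exact: monic_neq0 (cubic_monic A B D).
  by apply: contraNneq => ->; rewrite rmorph0.
have phi00 : phi`_0 = 0.
  rewrite -horner_coef0 -[LHS]/(horner_eval 0 phi) /phi (quartic_morph (horner_eval 0)).
  have gc (c : nat -> CK) : horner_eval 0 \o (polyC \o c) = c.
    by apply/funext => n /=; rewrite /horner_eval hornerC.
  rewrite !gc rmorph1 rmorphD /= /horner_eval !hornerC hornerX addr0.
  by have := p_quartic; rewrite p0 p2.
have q0E : on_quartic c2 c1 c0 cM (chart_pt p o1 o0 cM pi 0) = emb phi.
  rewrite /on_quartic /chart_pt -/o0 -/o1 -/o2 !oE p0 p2 /phi -emb_quartic.
  by rewrite rmorph1 rmorphD.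
apply: (chart_reached compl P_irr E_curve gen (l := o1) (i := o0) (k := o2)); rewrite ?oE //.
move=> S bv x hbv lead; rewrite -/emb -/cM -/pi q0E in lead.
have [k [c [r [S1 [k0 _ hc S10 h]]]]] := branch_leading phi0 phi00 hbv lead.
exists (fun s => r + k%:R * s), S1, 1; split; rewrite ?oner_eq0 //.
- exact: pinfty.
- by move=> s n _; rewrite /chart_pt !oE p2 (rmorph1 cM).
move=> s n b hs; rewrite /chart_pt !oE p2 p0 (rmorph1 cM) divr1 [_ + x n]addrC addrK.
apply: near_translate (mono s k hc) _ (h s n hs).1 _ => b'.
exact: mono_pos.
Qed.

Let val_cst_ge : exists N : R, forall s, vge (V s) (- N) (cM x0).
Proof.
have [->|/(val_fin v)[r hr]] := eqVneq x0 0; first by exists 0 => s; rewrite rmorph0 vge0.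
by exists (- r) => s; rewrite opprK; apply: vge_self; rewrite VC.
Qed.

(** [1 / x] is a local coordinate. *)
Lemma reached_infinite_y : p o0 = 1 -> p o2 = 0 -> q o1 != 0 ->
  exists2 rho, reach rho & decreasing_affine rho.
Proof.
move=> p0 p2 qn; have [N hN] := val_cst_ge.
apply: (chart_reached compl P_irr E_curve gen (l := o2) (i := o1) (k := o0)); rewrite ?oE //.
move=> S bv x hbv _; exists (fun s => 0 - 1%:R * s), (N + 1), pi; split.
- exact: ninfty.
- exact: val_fin_neq0 (gauss0_pi v 0).
- by move=> s n _; rewrite /chart_pt !oE p2 (rmorph0 cM) add0r.
move=> s n b hs; rewrite /chart_pt !oE p2 p0 (rmorph1 cM) (rmorph0 cM) add0r.
have hmu := val_div_fin (etrans (VC s 1) (Defs.val1 v)) (valX_fin 1 (gauss0_pi v s)).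
have hm b' := mono_neg s b' (ltn0Sn 0) (Defs.val1 v).
rewrite (rmorph1 cM) div1r expr1 sub0r mul1r in hmu.
have hm' b' : V s (pi^-1 - cM b') = Order.min (- s)%:E (v b').
  by have := hm b'; rewrite (rmorph1 cM) div1r expr1 sub0r mul1r.
rewrite div1r; apply: (near_translate hmu hm').
have -> : pi^-1 - cM x0 - pi^-1 = - cM x0 by rewrite addrAC subrr add0r.
by rewrite vgeN; apply: vgeW (hN s); lra.
Qed.

(** With [d t^l] in the numerator and a branch of order [k > l] in the
    denominator the quotient tends to infinity and dominates all constants. *)
Lemma invert_leading (x : M) (d c : CK) s r rd k l N : v c = r%:E -> v d = rd%:E -> (l < k)%N ->
  0 <= s -> rd - r + N + 1 <= s -> vge (V s) (- N) (cM x0) ->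
  vge (V s) (r + k%:R * s + 1) (x - cM c * pi ^+ k) -> V s x = (r + k%:R * s)%:E ->
  forall b, V s (cM d * pi ^+ l / x - cM x0 - cM b) = Order.min (rd - r - (k - l)%:R * s)%:E (v b).
Proof.
move=> hc hd lk s0 hs hN h hx.
have hm := mono s k hc; have hl := mono s l hd.
have lkR : (k - l)%:R = k%:R - l%:R :> R by rewrite natrB // ltnW.
have hdc : v (d / c) = (rd - r)%:E by apply: val_div_fin.
have hmu := val_div_fin (etrans (VC s (d / c)) hdc) (valX_fin (k - l) (gauss0_pi v s)).
apply: (near_translate hmu).
  by move=> b; apply: mono_neg; rewrite ?subn_gt0.
have k1 : 1 * s <= (k - l)%:R * s by rewrite ler_wpM2r // ler1n subn_gt0.
have -> : cM d * pi ^+ l / x - cM x0 - cM (d / c) / pi ^+ (k - l) =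
    - (cM d * pi ^+ l * (x - cM c * pi ^+ k) / (x * (cM c * pi ^+ k))) - cM x0.
  have cn0 : cM c != 0 by rewrite fmorph_eq0 (val_fin_neq0 hc).
  have pi0 : pi != 0 by apply: val_fin_neq0 (gauss0_pi v s).
  have x0' := val_fin_neq0 hx.
  have alg (F : fieldType) (D C' w z P Q S' : F) : C' != 0 -> z != 0 -> P != 0 -> S' != 0 -> S' * Q = P ->
      D * Q / z - w - (D / C') / S' = - (D * Q * (z - C' * P) / (z * (C' * P))) - w.
    move=> C0 z0 P0 S0 eP; have Q0 : Q != 0 by apply: contraNneq P0 => Q0; rewrite -eP Q0 mulr0.
    by rewrite -eP; field; rewrite C0 z0 S0 Q0.
  have P0 : pi ^+ k != 0 := expf_neq0 k pi0.
  have S0 : pi ^+ (k - l) != 0 := expf_neq0 (k - l) pi0.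
  have eP : pi ^+ (k - l) * pi ^+ l = pi ^+ k by rewrite -exprD subnK // ltnW.
  rewrite (fmorph_div cM).
  exact: (alg M (cM d) (cM c) (cM x0) x (pi ^+ k) (pi ^+ l) (pi ^+ (k - l)) cn0 x0' P0 S0 eP).
apply: vgeB; last by apply: vgeW hN; lra.
rewrite vgeN (vgeMr _ _ (valM_fin hx hm)).
by apply: vgeM' (vge_self hl) h _; rewrite lkR; lra.
Qed.

Hypothesis top : ~ (c2 2 = 0 /\ c1 3 = 0 /\ c0 4 = 0).

(** [y / x], less its value, is a local coordinate and [1 / x] has a leading term in it. *)
Lemma reached_infinite_z : p o0 = 1 -> p o2 = 0 -> q o2 != 0 ->
  exists2 rho, reach rho & decreasing_affine rho.
Proof.
move=> p0 p2 qn; have [N hN] := val_cst_ge.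
pose phi := quartic (polyC \o c2) (polyC \o c1) (polyC \o c0) 1 ((p o1)%:P + 'X) 0.
have phi0 : phi != 0.
  pose g : {rmorphism {poly CK} -> {poly CK}} := comp_poly ('X - (p o1)%:P).
  have gC a : g a%:P = a%:P by rewrite /g /= comp_polyC.
  have : g phi != 0.
    have -> : g phi = quartic (polyC \o c2) (polyC \o c1) (polyC \o c0) 1 'X 0.
      rewrite /phi (quartic_morph g) rmorph1 rmorph0 rmorphD /= !gC.
      have gc (c : nat -> CK) : g \o (polyC \o c) = polyC \o c by apply/funext => n /=; rewrite gC.
      by rewrite !gc /= comp_polyX addrC subrK.
    have -> : quartic (polyC \o c2) (polyC \o c1) (polyC \o c0) 1 'X 0 =
        (c2 2)%:P * 'X^2 + (c1 3)%:P * 'X + (c0 4)%:P.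
      by rewrite /quartic /=; ring.
    apply/eqP => h; apply: top.
    have hk n := congr1 (fun a : {poly CK} => a`_n) h.
    split; [move: (hk 2%N) | split; [move: (hk 1%N) | move: (hk 0%N)]];
      by rewrite !coefD !coefCM coefXn coefX coefC coef0 /= ?(mulr0, mulr1, addr0, add0r).
  by apply: contraNneq => ->; rewrite rmorph0.
have phi00 : phi`_0 = 0.
  rewrite -horner_coef0 -[LHS]/(horner_eval 0 phi) /phi (quartic_morph (horner_eval 0)).
  have gc (c : nat -> CK) : horner_eval 0 \o (polyC \o c) = c.
    by apply/funext => n /=; rewrite /horner_eval hornerC.
  rewrite !gc rmorph1 rmorph0 rmorphD /= /horner_eval !hornerC hornerX addr0.
  by have := p_quartic; rewrite p0 p2.
have q0E : on_quartic c2 c1 c0 cM (chart_pt p o1 o2 cM pi 0) = emb phi.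
  have e1 : cM 1 = emb 1 by rewrite (rmorph1 cM) (rmorph1 emb).
  have e0 : cM 0 = emb 0 by rewrite (rmorph0 cM) (rmorph0 emb).
  rewrite /on_quartic /chart_pt -/o0 -/o1 -/o2 !oE p0 p2 /phi -emb_quartic e1 e0.
  by rewrite (rmorphD emb).
apply: (chart_reached compl P_irr E_curve gen (l := o1) (i := o2) (k := o0)); rewrite ?oE //.
move=> S bv x hbv lead; rewrite -/emb -/cM -/pi q0E in lead.
have [k [c [r [S1 [k0 _ hc S10 h]]]]] := branch_leading phi0 phi00 hbv lead.
exists (fun s => 0 - r - (k - 0)%:R * s), (Num.max S1 (0 - r + N + 1)), (cM c * pi ^+ k); split.
- by rewrite subn0; apply: ninfty.
- exact: val_fin_neq0 (mono 0 k hc).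
- move=> s n; rewrite ge_max => /andP[hs _].
  by rewrite /chart_pt !oE p2 (rmorph0 cM) add0r (h s n hs).2 (mono s k hc).
move=> s n b; rewrite ge_max => /andP[hs hs'].
have [h1 h2] := h s n hs.
have main := invert_leading hc (Defs.val1 v) k0 (le_trans S10 hs) hs' (hN s) h1 h2 b.
have eM : cM 1 * pi ^+ 0 = 1 by rewrite (rmorph1 cM) expr0 mulr1.
have E0 : chart_pt p o1 o2 cM pi (x n) o0 = 1 by rewrite /chart_pt !oE p0 (rmorph1 cM).
have E2 : chart_pt p o1 o2 cM pi (x n) o2 = x n by rewrite /chart_pt !oE p2 (rmorph0 cM) add0r.
rewrite eM in main; rewrite -main -/o0 -/o2 -/emb -/cM -/pi E0 E2.
by [].
Qed.

(** At the point (0 : 1 : 0) the partial derivative by the third coordinate is 1.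
    In terms of the coordinate [x / y] the function [1 / y] has order at least 2,
    so [x] has a pole. *)
Lemma reached_infinite_pole : p o0 = 0 -> p o1 = 1 -> p o2 = 0 ->
  exists2 rho, reach rho & decreasing_affine rho.
Proof.
move=> p0 p1 p2; have [N hN] := val_cst_ge.
pose phi : {poly CK} := (c2 2)%:P * 'X^2 + (c1 3)%:P * 'X^3 + (c0 4)%:P * 'X^4.
have hk n : phi`_n = c2 2 * (n == 2%N)%:R + c1 3 * (n == 3%N)%:R + c0 4 * (n == 4%N)%:R.
  by rewrite /phi !coefD !coefCM !coefXn.
have phi0 : phi != 0.
  apply/eqP => h; apply: top; move: (hk 2%N) (hk 3%N) (hk 4%N).
  by rewrite h !coef0 /= !(mulr0, mulr1, addr0, add0r) => <- <- <-.
have phi00 : phi`_0 = 0 by rewrite hk /= !mulr0 !addr0.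
have qn : q o2 != 0.
  suff -> : q o2 = 1 by rewrite oner_eq0.
  by rewrite /q /partial -/o0 -/o1 -/o2 o20 o21 p0 p1 p2 /quartic_z; ring.
have q0E : on_quartic c2 c1 c0 cM (chart_pt p o0 o2 cM pi 0) = emb phi.
  have phiE : phi = quartic (polyC \o c2) (polyC \o c1) (polyC \o c0) 'X 1 0.
    by rewrite /phi /quartic /=; ring.
  have e1 : cM 1 = emb 1 by rewrite (rmorph1 cM) (rmorph1 emb).
  have e0 : cM 0 = emb 0 by rewrite (rmorph0 cM) (rmorph0 emb).
  rewrite phiE -emb_quartic /on_quartic /chart_pt -/o0 -/o1 -/o2 !oE p0 p1 p2 e1 e0.
  by rewrite (rmorph0 emb) add0r.
apply: (chart_reached compl P_irr E_curve gen (l := o0) (i := o2) (k := o1)); rewrite ?oE //.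
move=> S bv x hbv lead; rewrite -/emb -/cM -/pi q0E in lead.
have [k [c [r [S1 [k0 ck hc S10 h]]]]] := branch_leading phi0 phi00 hbv lead.
have k1 : (1 < k)%N.
  case: k k0 ck {h} => [|[|k]] //.
  by rewrite hk /= !mulr0 !addr0 eqxx.
exists (fun s => 0 - r - (k - 1)%:R * s), (Num.max S1 (0 - r + N + 1)), (cM c * pi ^+ k); split.
- by apply: ninfty; rewrite subn_gt0.
- exact: val_fin_neq0 (mono 0 k hc).
- move=> s n; rewrite ge_max => /andP[hs _].
  by rewrite /chart_pt !oE p2 (rmorph0 cM) add0r (h s n hs).2 (mono s k hc).
move=> s n b; rewrite ge_max => /andP[hs hs'].
have [h1 h2] := h s n hs.
have main := invert_leading hc (Defs.val1 v) k1 (le_trans S10 hs) hs' (hN s) h1 h2 b.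
have eM : cM 1 * pi ^+ 1 = pi by rewrite (rmorph1 cM) expr1 mul1r.
have E0 : chart_pt p o0 o2 cM pi (x n) o0 = pi by rewrite /chart_pt !oE p0 (rmorph0 cM) add0r.
have E2 : chart_pt p o0 o2 cM pi (x n) o2 = x n by rewrite /chart_pt !oE p2 (rmorph0 cM) add0r.
rewrite eM in main; rewrite -main -/o0 -/o2 -/emb -/cM -/pi E0 E2.
by [].
Qed.

End Charts.

Section ClosedPoints.
Variables (R : realType) (Kbar : closedFieldType) (CK : fieldType) (vbar : valuation R Kbar).
Variables (v : valuation R CK) (j : {rmorphism Kbar -> CK}).
Hypothesis compl : is_completion vbar v j.
Variables (E : fieldType) (iota : {rmorphism ratfun CK -> E}) (y : E) (c2 c1 c0 : nat -> CK).
Let cE := Y_cst iota.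
Let e := Y_coord iota y.
Variable x0 : CK.
Hypothesis P_irr : irreducible_poly (map_poly (@tofrac {poly CK}) (affine_poly c2 c1 c0)).
Hypothesis E_curve : on_quartic c2 c1 c0 cE e = 0.
Hypothesis gen : forall x, exists q : {poly ratfun CK}, x = (map_poly iota q).[y].
Hypothesis y_neq0 : y != 0.
Hypothesis top : ~ (c2 2 = 0 /\ c1 3 = 0 /\ c0 4 = 0).

Let o0 : 'I_3 := inord 0.
Let o1 : 'I_3 := inord 1.
Let o2 : 'I_3 := inord 2.

Lemma partialE (S : comNzRingType) (d2 d1 d0 : nat -> S) x' y' z' :
  [/\ partial d2 d1 d0 o0 x' y' z' = quartic_x d2 d1 d0 x' y' z',
      partial d2 d1 d0 o1 x' y' z' = quartic_y d2 d1 x' y' z' &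
      partial d2 d1 d0 o2 x' y' z' = quartic_z d2 d1 d0 x' y' z'].
Proof.
have [n01 n02 n12] := ord3_neq.
by rewrite /partial eqxx !(eq_sym _ o0) n01 n02 eqxx (eq_sym o2) n12.
Qed.

Lemma partial_scale a k x' y' z' :
  partial c2 c1 c0 k (a * x') (a * y') (a * z') = a ^+ 3 * partial c2 c1 c0 k x' y' z'.
Proof.
rewrite /partial; case: ifP => _; first exact: quartic_x_scale.
by case: ifP => _; [exact: quartic_y_scale | exact: quartic_z_scale].
Qed.

Variable P : 'I_3 -> CK.
Hypothesis P_quartic : quartic c2 c1 c0 (P o0) (P o1) (P o2) = 0.
Hypothesis P_smooth : exists k, partial c2 c1 c0 k (P o0) (P o1) (P o2) != 0.
Let xi := closed_point_val v cE e P.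

Let CPS l p' : e l != 0 -> P l != 0 -> p' l != 0 -> (forall n, P n / P l = p' n / p' l) ->
  xi = closed_point_val v cE e p'.
Proof. exact: closed_point_scale. Qed.

Let e2 : e o2 != 0. Proof. by rewrite /e /Y_coord inordK // oner_eq0. Qed.

Let p k m := (P k)^-1 * P m.

Let p_quartic k : quartic c2 c1 c0 (p k o0) (p k o1) (p k o2) = 0.
Proof. by rewrite quartic_scale P_quartic mulr0. Qed.

Let p_smooth k : P k != 0 -> exists m, partial c2 c1 c0 m (p k o0) (p k o1) (p k o2) != 0.
Proof.
move=> Pk; have [m hm] := P_smooth; exists m.
by rewrite partial_scale mulf_neq0 // expf_neq0 // invr_eq0.
Qed.

Let euler k :
  p k o0 * partial c2 c1 c0 o0 (p k o0) (p k o1) (p k o2) +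
  p k o1 * partial c2 c1 c0 o1 (p k o0) (p k o1) (p k o2) +
  p k o2 * partial c2 c1 c0 o2 (p k o0) (p k o1) (p k o2) = 0.
Proof.
have [-> -> ->] := partialE c2 c1 c0 (p k o0) (p k o1) (p k o2).
by rewrite quartic_euler p_quartic mulr0.
Qed.

Lemma reached_finite : P o2 != 0 -> P o0 / P o2 = x0 ->
  exists2 rho, reached v iota x0 xi rho & increasing_affine rho.
Proof.
move=> P2 P02; have p2 : p o2 o2 = 1 by rewrite /p mulVf.
have p0 : p o2 o0 = x0 by rewrite /p mulrC.
have -> : xi = closed_point_val v cE e (p o2).
  apply: (@CPS o2) => //; first by rewrite p2 oner_eq0.
  by move=> n; rewrite p2 divr1 /p mulrC.
have [q1|q1] := eqVneq (partial c2 c1 c0 o1 (p o2 o0) (p o2 o1) (p o2 o2)) 0; last first.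
  exact: (reached_finite_y compl P_irr E_curve gen (p_quartic o2)).
have [q0|q0] := eqVneq (partial c2 c1 c0 o0 (p o2 o0) (p o2 o1) (p o2 o2)) 0; last first.
  exact: (reached_finite_x compl P_irr E_curve gen (p_quartic o2)).
have := euler o2; rewrite q0 q1 !mulr0 !add0r {1}p2 mul1r => q2.
have [m] := p_smooth P2.
by case: (ord3_cases m) => ->; rewrite ?q0 ?q1 ?q2 eqxx.
Qed.

Lemma reached_infinite : (exists k, P k != 0) -> P o2 = 0 ->
  exists2 rho, reached v iota x0 xi rho & decreasing_affine rho.
Proof.
move=> [k Pk] P2; have [P0|P0] := eqVneq (P o0) 0.
  have P1 : P o1 != 0.
    by move: Pk; case: (ord3_cases k) => -> //; rewrite -/o0 -/o2 ?P0 ?P2 eqxx.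
  have p1 : p o1 o1 = 1 by rewrite /p mulVf.
  have y0 : e o1 != 0 by rewrite /e /Y_coord inordK.
  have -> : xi = closed_point_val v cE e (p o1).
    apply: (@CPS o1) => //; first by rewrite p1 oner_eq0.
    by move=> n; rewrite p1 divr1 /p mulrC.
  apply: (reached_infinite_pole compl x0 P_irr E_curve gen (p_quartic o1) top).
  - by rewrite /p P0 mulr0.
  - exact: p1.
  - by rewrite /p P2 mulr0.
have p0 : p o0 o0 = 1 by rewrite /p mulVf.
have p2 : p o0 o2 = 0 by rewrite /p P2 mulr0.
have x_neq0 : e o0 != 0.
  rewrite /e /Y_coord inordK //= fmorph_eq0 /xfun tofrac_eq0 polyX_eq0 //.
have -> : xi = closed_point_val v cE e (p o0).
  apply: (@CPS o0) => //; first by rewrite p0 oner_eq0.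
  by move=> n; rewrite p0 divr1 /p mulrC.
have [q1|q1] := eqVneq (partial c2 c1 c0 o1 (p o0 o0) (p o0 o1) (p o0 o2)) 0; last first.
  exact: (reached_infinite_y compl x0 P_irr E_curve gen (p_quartic o0)).
have [q2|q2] := eqVneq (partial c2 c1 c0 o2 (p o0 o0) (p o0 o1) (p o0 o2)) 0; last first.
  exact: (reached_infinite_z compl x0 P_irr E_curve gen (p_quartic o0) top).
have := euler o0; rewrite q2 q1 !mulr0 !addr0 {1}p0 mul1r => q0.
have [m] := p_smooth P0.
by case: (ord3_cases m) => ->; rewrite ?q0 ?q1 ?q2 eqxx.
Qed.

End ClosedPoints.

(** * Smoothness over the completion *)

Section AlgebraicPoints.
Variables (Kbar : closedFieldType) (CK : fieldType) (j : {rmorphism Kbar -> CK}).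

(** The polynomial splits over [Kbar]. *)
Lemma algebraic_root (q : {poly Kbar}) (a : CK) : q != 0 -> (map_poly j q).[a] = 0 ->
  exists a', a = j a'.
Proof.
move=> q0; have [r hr] := closed_field_poly_normal q; rewrite hr map_polyZ hornerZ.
move/eqP; rewrite mulf_eq0 fmorph_eq0 lead_coef_eq0 (negPf q0) /= rmorph_prod.
rewrite (eq_bigr (fun z => 'X - (j z)%:P)); last by move=> z _; rewrite /= map_polyXsubC.
rewrite -(big_map j predT (fun z => 'X - z%:P)) -/(root _ _) root_prod_XsubC.
by move=> /mapP[a' _ ->]; exists a'.
Qed.

End AlgebraicPoints.

Section Curve.
Variables (K : fieldType) (A2 A1 A0 : {poly K}).
Hypothesis A2_deg : (size A2 <= 3)%N.
Hypothesis A1_deg : (size A1 <= 4)%N.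
Hypothesis A0_deg : (size A0 <= 5)%N.

Section Base.
Variables (L : fieldType) (h : {rmorphism K -> L}).
Definition coefA2 k : L := h A2`_k.
Definition coefA1 k : L := h A1`_k.
Definition coefA0 k : L := h A0`_k.

Lemma small_horner (A : {poly K}) n (x : L) : (size A <= n)%N ->
  (map_poly h A).[x] = \sum_(k < n) h A`_k * x ^+ k.
Proof.
move=> sA; rewrite (@horner_coef_wide _ n) ?(leq_trans (size_poly _ _)) //.
by apply: eq_bigr => k _; rewrite coef_map.
Qed.

Lemma quartic_affine x y : quartic coefA2 coefA1 coefA0 x y 1 =
  y ^+ 3 + (map_poly h A2).[x] * y ^+ 2 + (map_poly h A1).[x] * y + (map_poly h A0).[x].
Proof.
rewrite (small_horner _ A2_deg) (small_horner _ A1_deg) (small_horner _ A0_deg).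
rewrite !big_ord_recr !big_ord0 /= /quartic /coefA2 /coefA1 /coefA0; ring.
Qed.

Lemma quartic_y_affine x y : quartic_y coefA2 coefA1 x y 1 =
  3 * y ^+ 2 + 2 * (map_poly h A2).[x] * y + (map_poly h A1).[x].
Proof.
rewrite (small_horner _ A2_deg) (small_horner _ A1_deg).
rewrite !big_ord_recr !big_ord0 /= /quartic_y /coefA2 /coefA1; ring.
Qed.

Lemma eval2_poly x y a : eval2 h x y a%:P = (map_poly h a).[x].
Proof. by rewrite /eval2 /= {1}/horner_eval map_polyC hornerC. Qed.

Lemma affine_point x y : eval2 h x y (affine_eq A2 A1 A0) = quartic coefA2 coefA1 coefA0 x y 1.
Proof.
rewrite quartic_affine /affine_eq !(rmorphD (eval2 h x y)) !(rmorphM (eval2 h x y)).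
rewrite !eval2_T !eval2_poly; ring.
Qed.

Lemma affine_point_y x y : eval2 h x y (affine_eq A2 A1 A0)^`() = quartic_y coefA2 coefA1 x y 1.
Proof.
have -> : (affine_eq A2 A1 A0)^`() = 3 * 'X^2 + 2 * A2%:P * 'X + A1%:P.
  rewrite /affine_eq !derivD !derivM !derivC !derivX; ring.
rewrite quartic_y_affine !(rmorphD (eval2 h x y)) !(rmorphM (eval2 h x y)).
rewrite !(rmorph_nat (eval2 h x y)) !eval2_T !eval2_poly; ring.
Qed.

End Base.

Lemma partial_morph (L L' : fieldType) (h : {rmorphism K -> L}) (j : {rmorphism L -> L'}) k x y z :
  j (partial (coefA2 h) (coefA1 h) (coefA0 h) k x y z) =
  partial (coefA2 (j \o h)) (coefA1 (j \o h)) (coefA0 (j \o h)) k (j x) (j y) (j z).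
Proof.
rewrite /partial; case: ifP => _; first exact: quartic_x_morph.
by case: ifP => _; [exact: quartic_y_morph | exact: quartic_z_morph].
Qed.

Variables (Kbar : closedFieldType) (i : {rmorphism K -> Kbar}).
Variables (CK : fieldType) (j : {rmorphism Kbar -> CK}).
Hypothesis Y_irreducible : geometrically_irreducible i (quartic_form A2 A1 A0).
Hypothesis Y_smooth : smooth_curve i (quartic_form A2 A1 A0).
Hypothesis phi_separable :
  separable_poly (map_poly (@tofrac {poly K}) (affine_eq A2 A1 A0)).
Let h : {rmorphism K -> CK} := j \o i.

Let o0 : 'I_3 := inord 0.
Let o1 : 'I_3 := inord 1.
Let o2 : 'I_3 := inord 2.

Let cofactor (S : comNzRingType) (d2 d1 d0 : nat -> S) (x y z : S) := y ^+ 3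
  + (d2 0 * z + d2 1 * x) * y ^+ 2
  + (d1 0 * z ^+ 2 + d1 1 * (x * z) + d1 2 * x ^+ 2) * y
  + (d0 0 * z ^+ 3 + d0 1 * (x * z ^+ 2) + d0 2 * (x ^+ 2 * z) + d0 3 * x ^+ 3).

Let cofactorE (S : comNzRingType) (d2 d1 d0 : nat -> S) (x y z : S) :
  d2 2 = 0 -> d1 3 = 0 -> d0 4 = 0 -> quartic d2 d1 d0 x y z = z * cofactor d2 d1 d0 x y z.
Proof. by move=> h2 h1 h0; rewrite /quartic h2 h1 h0 /cofactor; ring. Qed.

Let cofactor_morph (S T : comNzRingType) (f : {rmorphism S -> T}) (d2 d1 d0 : nat -> S) (x y z : S) :
  f x = 0 -> f y = 0 -> f z = 0 -> f (cofactor d2 d1 d0 x y z) = 0.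
Proof.
have -> : f (cofactor d2 d1 d0 x y z) = cofactor (f \o d2) (f \o d1) (f \o d0) (f x) (f y) (f z).
  by rewrite /cofactor /=; ring.
by move=> -> -> ->; rewrite /cofactor; ring.
Qed.

(** Otherwise the quartic form is divisible by [z]. *)
Lemma leading_neq0 : ~ (A2`_2 = 0 /\ A1`_3 = 0 /\ A0`_4 = 0).
Proof.
move=> [h2 [h1 h0]]; case: Y_irreducible => _ _ irr.
pose X m : mpoly 3 Kbar := mpolyX Kbar (mnm1 m).
pose d2 k := mpolyC 3 (i A2`_k); pose d1 k := mpolyC 3 (i A1`_k); pose d0 k := mpolyC 3 (i A0`_k).
have QE : map_mpoly i (quartic_form A2 A1 A0) = quartic d2 d1 d0 (X o0) (X o1) (X o2).
  by rewrite /map_mpoly quartic_form_mmap.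
have d20 : d2 2%N = 0 by rewrite /d2 h2 rmorph0 mpolyC0.
have d10 : d1 3%N = 0 by rewrite /d1 h1 rmorph0 mpolyC0.
have d00 : d0 4%N = 0 by rewrite /d0 h0 rmorph0 mpolyC0.
have nonunit (u : mpoly 3 Kbar) : meval (fun=> 0) u = 0 -> u \isn't a GRing.unit.
  move=> u0; apply/negP => /mulrV /(congr1 (meval (fun=> (0 : Kbar)))).
  by rewrite mevalM u0 mul0r meval1 => /eqP; rewrite eq_sym oner_eq0.
have [] := irr (X o2) (cofactor d2 d1 d0 (X o0) (X o1) (X o2)).
- by rewrite QE; apply: cofactorE.
- by apply/negP/nonunit; rewrite /X mevalXU.
by apply/negP/nonunit; apply: (cofactor_morph (f := meval (fun=> 0))); rewrite /= /X mevalXU.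
Qed.

Lemma smooth_base (P : 'I_3 -> Kbar) : (exists k, P k != 0) ->
  quartic (coefA2 i) (coefA1 i) (coefA0 i) (P o0) (P o1) (P o2) = 0 ->
  exists k, partial (coefA2 i) (coefA1 i) (coefA0 i) k (P o0) (P o1) (P o2) != 0.
Proof.
move=> hP hQ; have [|k hk] := Y_smooth hP; first by rewrite quartic_form_meval.
by exists k; move: hk; rewrite quartic_form_mderiv.
Qed.

Let smooth_algebraic (x y z : Kbar) : z != 0 \/ x != 0 ->
  quartic (coefA2 h) (coefA1 h) (coefA0 h) (j x) (j y) (j z) = 0 ->
  exists k, partial (coefA2 h) (coefA1 h) (coefA0 h) k (j x) (j y) (j z) != 0.
Proof.
move=> hxz hQ; pose P : 'I_3 -> Kbar := fun m => [:: x; y; z]`_m.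
have P0 : P o0 = x by rewrite /P inordK.
have P1 : P o1 = y by rewrite /P inordK.
have P2 : P o2 = z by rewrite /P inordK.
have [||k hk] := @smooth_base P.
- by case: hxz => hn; [exists o2; rewrite P2 | exists o0; rewrite P0].
- rewrite P0 P1 P2; apply: (fmorph_inj j); rewrite rmorph0 -[RHS]hQ.
  exact: (quartic_morph j).
exists k; rewrite -[partial _ _ _ _ _ _ _](partial_morph i j) fmorph_eq0.
by rewrite P0 P1 P2 in hk.
Qed.

(** A singular point would be algebraic over the base field: if it is affine, its
    first coordinate is a zero of a non-zero polynomial, by separability. *)
Lemma smooth_completion (P : 'I_3 -> CK) : (exists k, P k != 0) ->
  quartic (coefA2 h) (coefA1 h) (coefA0 h) (P o0) (P o1) (P o2) = 0 ->
  exists k, partial (coefA2 h) (coefA1 h) (coefA0 h) k (P o0) (P o1) (P o2) != 0.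
Proof.
move=> [k0 hk0] hQ; apply: contrapT => sing.
have {}sing k : partial (coefA2 h) (coefA1 h) (coefA0 h) k (P o0) (P o1) (P o2) = 0.
  by apply/eqP; apply: contrapT => /negP hk; apply: sing; exists k.
have norm k : P k != 0 -> let p m := (P k)^-1 * P m in
    quartic (coefA2 h) (coefA1 h) (coefA0 h) (p o0) (p o1) (p o2) = 0 /\
    forall m, partial (coefA2 h) (coefA1 h) (coefA0 h) m (p o0) (p o1) (p o2) = 0.
  move=> Pk p; split; first by rewrite quartic_scale hQ mulr0.
  by move=> m; rewrite partial_scale sing mulr0.
have alg x y z : z != 0 \/ x != 0 ->
    quartic (coefA2 h) (coefA1 h) (coefA0 h) (j x) (j y) (j z) = 0 ->
    (forall m, partial (coefA2 h) (coefA1 h) (coefA0 h) m (j x) (j y) (j z) = 0) -> False.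
  by move=> xz hq hm; have [m] := smooth_algebraic xz hq; rewrite hm eqxx.
have [P2|P2] := eqVneq (P o2) 0; last first.
  pose a := (P o2)^-1 * P o0; pose b := (P o2)^-1 * P o1.
  have [hq hm] := norm o2 P2; rewrite /= mulVf // -/a -/b in hq hm.
  have /Bezout_eq1_coprimepP[[u w] /= buw] : coprimep (map_poly (@tofrac {poly K}) (affine_eq A2 A1 A0))
      (map_poly (@tofrac {poly K}) (affine_eq A2 A1 A0))^`() by have := phi_separable; rewrite unlock.
  rewrite deriv_map in buw; have [d d0 [U [W hUW]]] := clear_bezout buw.
  have := congr1 (eval2 h a b) hUW; rewrite rmorphD !rmorphM affine_point affine_point_y.
  have [_ hy _] := partialE (coefA2 h) (coefA1 h) (coefA0 h) a b 1; rewrite hq -hy hm !mulr0 addr0.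
  rewrite eval2_poly => /esym hd.
  have [a' ha'] : exists a', a = j a'.
    apply: (@algebraic_root _ _ j (map_poly i d)); first by rewrite map_poly_eq0.
    by rewrite -map_poly_comp.
  have hcub := hq; rewrite (quartic_affine h) ha' in hcub.
  have hmap A : (map_poly h A).[j a'] = j (map_poly i A).[a'].
    by rewrite -horner_map -map_poly_comp.
  rewrite !hmap -cubic_horner in hcub.
  have [b' hb'] := algebraic_root (monic_neq0 (cubic_monic _ _ _)) hcub.
  apply: (alg a' b' 1); rewrite ?oner_eq0 ?rmorph1 -?ha' -?hb' //; by left.
(* At infinity: (0 : 1 : 0) is smooth, the other points satisfy a non-zero equation. *)
have [P0|P0] := eqVneq (P o0) 0.
  have P1 : P o1 != 0.
    by move: hk0; case: (ord3_cases k0) => -> //; rewrite -/o0 -/o2 ?P0 ?P2 eqxx.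
  have [_ /(_ o2)] := norm o1 P1; rewrite P0 P2 mulr0 mulVf //.
  have [_ _ ->] := partialE (coefA2 h) (coefA1 h) (coefA0 h) 0 1 0.
  have -> : quartic_z (coefA2 h) (coefA1 h) (coefA0 h) 0 1 0 = 1 by rewrite /quartic_z; ring.
  by move/eqP; rewrite oner_eq0.
have [] := norm o0 P0; rewrite P2 mulr0 mulVf //; set r := _ * _ => hq hm.
pose q : {poly Kbar} := (i A2`_2)%:P * 'X^2 + (i A1`_3)%:P * 'X + (i A0`_4)%:P.
have q0 : q != 0.
  apply/eqP => hq0; apply: leading_neq0.
  have hk n := congr1 (fun a : {poly Kbar} => a`_n) hq0.
  split; [move: (hk 2%N) | split; [move: (hk 1%N) | move: (hk 0%N)]];
    rewrite !coefD !coefCM coefXn coefX coefC coef0 /= ?(mulr0, mulr1, addr0, add0r) => /eqP;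
    by rewrite fmorph_eq0 => /eqP.
have [r' hr'] : exists r', r = j r'.
  apply: (algebraic_root q0); rewrite -[RHS]hq /q !(rmorphD, rmorphM, rmorphXn) /=.
  rewrite map_polyX !map_polyC !(hornerD, hornerM, hornerXn, hornerX, hornerC) /quartic /coefA2 /coefA1 /coefA0 /=.
  ring.
apply: (alg 1 r' 0); rewrite ?oner_eq0 ?rmorph1 ?rmorph0 -?hr' //; by right.
Qed.

End Curve.

(** * The affine equation *)

Section AffineEquation.
Variables (K : fieldType) (A2 A1 A0 : {poly K}).
Hypothesis A2_deg : (size A2 <= 3)%N.
Hypothesis A1_deg : (size A1 <= 4)%N.
Hypothesis A0_deg : (size A0 <= 5)%N.
Variables (C : fieldType) (h : {rmorphism K -> C}).
Let c2 := coefA2 A2 h.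
Let c1 := coefA1 A1 h.
Let c0 := coefA0 A0 h.

Lemma map_small (A : {poly K}) n : (size A <= n)%N ->
  map_poly h A = \sum_(k < n) (h A`_k)%:P * 'X^k.
Proof.
move=> sA; apply/polyP => k; rewrite coef_map coef_sum.
have [kn|nk] := ltnP k n.
  rewrite (bigD1 (Ordinal kn)) //= coefCM coefXn eqxx mulr1 big1 ?addr0 //.
  move=> l /negPf lk; rewrite coefCM coefXn; case: eqP => [kl|_]; last by rewrite mulr0.
  by move: lk; rewrite -val_eqE /= kl eqxx.
have -> : A`_k = 0 by apply: nth_default; apply: leq_trans sA nk.
transitivity (0 : C); first exact: rmorph0.
apply/esym; apply: big1 => l _.
by rewrite coefCM coefXn gtn_eqF ?mulr0 // (leq_trans (ltn_ord l)).
Qed.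

Lemma affine_polyE : affine_poly c2 c1 c0 =
  'X^3 + (map_poly h A2)%:P * 'X^2 + (map_poly h A1)%:P * 'X + (map_poly h A0)%:P.
Proof.
rewrite (map_small A2_deg) (map_small A1_deg) (map_small A0_deg).
rewrite !big_ord_recr !big_ord0 /= /affine_poly /quartic /= /c2 /c1 /c0 /coefA2 /coefA1 /coefA0.
rewrite !(polyCD, polyCM, polyC_exp) expr0 !expr1; ring.
Qed.

Lemma tofrac_affine : map_poly (@tofrac {poly C}) (affine_poly c2 c1 c0) =
  'X^3 + (tofrac (map_poly h A2))%:P * 'X^2 + (tofrac (map_poly h A1))%:P * 'X
  + (tofrac (map_poly h A0))%:P.
Proof.
by rewrite affine_polyE !(rmorphD, rmorphM, rmorphXn) /= map_polyX !map_polyC.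
Qed.

Lemma function_field_eq : map_poly (fun a : {poly K} => tofrac (map_poly h a) : ratfun C)
  (affine_eq A2 A1 A0) = map_poly (@tofrac {poly C}) (affine_poly c2 c1 c0).
Proof.
pose g : {rmorphism {poly K} -> ratfun C} := @tofrac {poly C} \o map_poly h.
rewrite tofrac_affine -[LHS]/(map_poly g (affine_eq A2 A1 A0)) /affine_eq.
by rewrite !(rmorphD, rmorphM, rmorphXn) /= map_polyX !map_polyC.
Qed.

End AffineEquation.

(** The second cubic, translated by [s], vanishes at [y - s], so it is a constant
    multiple of the first one, which is irreducible. *)
Section Translate.
Variables (F E : fieldType) (iota : {rmorphism F -> E}) (y : E) (s : F).
Variables (a b c A B C : F).
Hypothesis irr : irreducible_poly ('X^3 + A%:P * 'X^2 + B%:P * 'X + C%:P).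
Hypothesis pz : (map_poly iota ('X^3 + A%:P * 'X^2 + B%:P * 'X + C%:P)).[y - iota s] = 0.
Hypothesis py : (map_poly iota ('X^3 + a%:P * 'X^2 + b%:P * 'X + c%:P)).[y] = 0.

Lemma translate_horner (q : {poly F}) :
  (map_poly iota (q \Po ('X + s%:P))).[y - iota s] = (map_poly iota q).[y].
Proof.
rewrite map_comp_poly horner_comp rmorphD /= map_polyX map_polyC.
by rewrite hornerD hornerX hornerC subrK.
Qed.

Lemma translate_irreducible : irreducible_poly ('X^3 + a%:P * 'X^2 + b%:P * 'X + c%:P).
Proof.
apply: cubic_irreducible; first by rewrite size_cubic.
move=> r; apply/negP => /rootP hr; have py' := py; rewrite -translate_horner in py'.
have [W hW] := irr_div irr pz py'.
have := congr1 (fun q : {poly F} => q.[r - s]) hW.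
rewrite horner_comp [('X + _).[_]]hornerD hornerX hornerC subrK hr hornerM => /esym/eqP.
have := congr1 (fun q : {poly F} => size q) hW.
have W0 : W != 0.
  apply/eqP => W0; move: hW; rewrite W0 mul0r => /eqP.
  by rewrite -size_poly_eq0 size_comp_poly2 ?size_XaddC // size_cubic.
have p0 := monic_neq0 (cubic_monic A B C).
rewrite size_comp_poly2 ?size_XaddC // size_mul // !size_cubic addnC /= => sW.
have /eqP/size_poly1P[d d0 ->] : size W = 1%N by move: sW => [].
rewrite hornerC mulf_eq0 (negPf d0) /= => /eqP hroot.
have := cubic_noroot irr (r - s).
by move/eqP; apply; rewrite -[RHS]hroot !(hornerD, hornerM, hornerXn, hornerX, hornerC).
Qed.

Lemma translate_gen : (forall x, exists q : {poly F}, x = (map_poly iota q).[y]) ->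
  forall x, exists q : {poly F}, x = (map_poly iota q).[y - iota s].
Proof. by move=> gen x; have [q ->] := gen x; exists (q \Po ('X + s%:P)); rewrite translate_horner. Qed.

End Translate.

(** * The limits along the path *)

Section Limits.
Variables (R : realType) (Kbar : closedFieldType) (C : fieldType) (vbar : valuation R Kbar).
Variables (v : valuation R C) (j : {rmorphism Kbar -> C}).
Hypothesis compl : is_completion vbar v j.
Variables (x0 : C) (gamma : R -> ratfun C -> \bar R).
Hypothesis gamma_interval : is_interval_in (P1an v) gamma.
Hypothesis gamma0 : gamma 0 = P1_val v (P1_point x0).
Hypothesis gamma1 : gamma 1 = P1_val v (@P1_infty C).
Variables (A B D : ratfun C) (v3 : \bar R) (rho : R -> R) (l : \bar R).
Let fm := formula_at v x0 A B D v3.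
Hypothesis below : forall M : R, (M%:E < l)%E -> exists L : R, forall s, L <= s -> (M%:E < fm (rho s))%E.
Hypothesis above : forall M : R, (l < M%:E)%E -> exists L : R, forall s, L <= s -> (fm (rho s) < M%:E)%E.

(** By [path_to_zero] the radius tends to infinity along the path, as [rho] does. *)
Lemma limit_zero : increasing_affine rho ->
  different_formula v3 A B D (gamma s) @[s --> 0^'+] --> l.
Proof.
move=> [r [k [k0 hrho]]].
have near (Q : \bar R -> Prop) : (exists L : R, forall s, L <= s -> Q (fm (rho s))) ->
    exists2 e : R, 0 < e & forall s, 0 < s -> `|s - 0| < e -> Q (different_formula v3 A B D (gamma s)).
  move=> [L hL]; have [e e0 he] := path_to_zero gamma_interval gamma0 (r + k * L).
  exists (Num.min e 1); first by rewrite lt_min e0 ltr01.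
  move=> s s0; rewrite subr0 gtr0_norm // lt_min => /andP[se s1].
  have [|q hq] := path_gauss compl gamma_interval gamma0 gamma1 (s := s); first by rewrite s0.
  have := he s q s0 se s1 hq; rewrite hq => lq.
  have := hL ((q - r) / k); rewrite hrho ler_pdivlMr // mulrCA divff ?gt_eqF // mulr1.
  by rewrite [r + _]addrC subrK; apply; lra.
apply: (ecvgP [set s : R | 0 < s] (fun s => different_formula v3 A B D (gamma s)) 0 l).1.
by split=> M hM; [apply: (near (fun x => (M%:E < x)%E)) (below hM) | apply: (near (fun x => (x < M%:E)%E)) (above hM)].
Qed.

Lemma limit_one : decreasing_affine rho ->
  different_formula v3 A B D (gamma s) @[s --> 1^'-] --> l.
Proof.
move=> [r [k [k0 hrho]]].
have near (Q : \bar R -> Prop) : (exists L : R, forall s, L <= s -> Q (fm (rho s))) ->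
    exists2 e : R, 0 < e & forall s, s < 1 -> `|s - 1| < e -> Q (different_formula v3 A B D (gamma s)).
  move=> [L hL]; have [e e0 he] := path_to_one x0 gamma_interval gamma1 (r - k * L).
  exists (Num.min e 1); first by rewrite lt_min e0 ltr01.
  move=> s s1; rewrite distrC gtr0_norm ?subr_gt0 // lt_min => /andP[se s0].
  have s0' : 0 < s by lra.
  have [|q hq] := path_gauss compl gamma_interval gamma0 gamma1 (s := s); first by rewrite s0'.
  have se' : 1 - e < s by lra.
  have := he s q s0' se' s1 hq; rewrite hq => lq.
  have := hL ((r - q) / k); rewrite hrho ler_pdivlMr // mulrCA divff ?gt_eqF // mulr1.
  by rewrite subKr; apply; lra.
apply: (ecvgP [set s : R | s < 1] (fun s => different_formula v3 A B D (gamma s)) 1 l).1.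
by split=> M hM; [apply: (near (fun x => (M%:E < x)%E)) (below hM) | apply: (near (fun x => (x < M%:E)%E)) (above hM)].
Qed.

End Limits.

(** The values on a family of valuations tending to a closed point determine
    the image of the point on the line. *)
Section Image.
Variables (R : realType) (C E : fieldType) (v : valuation R C) (iota : {rmorphism ratfun C -> E}).
Variables (xi : E -> \bar R) (a : C) (rho : R -> R).
Hypothesis hr : reached v iota a xi rho.

Lemma reached_gt f (M : R) : (M%:E < xi (iota f))%E ->
  exists L : R, forall s, L <= s -> (M%:E < gauss v a (rho s) f)%E.
Proof.
move=> hM; have [W [s1 [pi [hW _ _ _ lim]]]] := hr.
have [L hL] := (lim (iota f)).1 M hM; exists (Num.max L s1) => s.
by rewrite ge_max => /andP[h1 h2]; rewrite -hW //; apply: hL.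
Qed.

Lemma reached_lt f (M : R) : (xi (iota f) < M%:E)%E ->
  exists L : R, forall s, L <= s -> (gauss v a (rho s) f < M%:E)%E.
Proof.
move=> hM; have [W [s1 [pi [hW _ _ _ lim]]]] := hr.
have [L hL] := (lim (iota f)).2 M hM; exists (Num.max L s1) => s.
by rewrite ge_max => /andP[h1 h2]; rewrite -hW //; apply: hL.
Qed.

(** Such a point lies over [a]. *)
Lemma reached_center : increasing_affine rho -> xi (iota (tpar a)) = +oo%E.
Proof.
move=> [r [k [k0 hrho]]]; apply/eqP; rewrite eq_le leey leNgt /=; apply/negP => h.
have [M hM] : exists M : R, (xi (iota (tpar a)) < M%:E)%E.
  case: (xi _) h => [q||] // _; first by exists (q + 1); rewrite lte_fin; lra.
  by exists 0; rewrite ltNyr.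
have [L hL] := reached_lt hM; pose s := Num.max L ((M - r) / k).
have := hL s; rewrite le_max lexx => /(_ isT); rewrite gauss_t lte_fin hrho.
have : (M - r) / k <= s by rewrite le_max lexx orbT.
by rewrite ler_pdivrMr // mulrC; lra.
Qed.

Lemma reached_off_center b : increasing_affine rho -> a != b ->
  exists q : R, xi (iota (tpar b)) = q%:E.
Proof.
move=> [r [k [k0 hrho]]] ab; have ab0 : a - b != 0 by rewrite subr_eq0.
have [q hq] := val_fin v ab0.
pose S := (q - r) / k + 1.
have val s : S <= s -> gauss v a (rho s) (tpar b) = q%:E.
  move=> hs; have -> : tpar b = ratC C (a - b) + tpar a by rewrite /tpar rmorphB; ring.
  have lq : q < rho s.
    have : (q - r) / k < s by rewrite /S in hs; lra.
    by rewrite hrho ltr_pdivrMr // mulrC; lra.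
  apply: (valD_fin _ lq (vge_self (gauss_t _ _ _))).
  by rewrite gauss_C.
exists q; apply/eqP; rewrite eq_le; apply/andP; split; rewrite leNgt; apply/negP => h.
  have [L hL] := reached_gt h; have := hL (Num.max L S); rewrite le_max lexx => /(_ isT).
  by rewrite val ?le_max ?lexx ?orbT // ltxx.
have [L hL] := reached_lt h; have := hL (Num.max L S); rewrite le_max lexx => /(_ isT).
by rewrite val ?le_max ?lexx ?orbT // ltxx.
Qed.

(** Such a point lies over infinity. *)
Lemma reached_infinity : decreasing_affine rho -> xi (iota (tpar a)) = -oo%E.
Proof.
move=> [r [k [k0 hrho]]]; apply/eqP; rewrite eq_le leNye andbT leNgt; apply/negP => h.
have [M hM] : exists M : R, (M%:E < xi (iota (tpar a)))%E.
  case: (xi _) h => [q||] // _; first by exists (q - 1); rewrite lte_fin; lra.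
  by exists 0; rewrite ltry.
have [L hL] := reached_gt hM; pose s := Num.max L ((r - M) / k).
have := hL s; rewrite le_max lexx => /(_ isT); rewrite gauss_t lte_fin hrho.
have : (r - M) / k <= s by rewrite le_max lexx orbT.
by rewrite ler_pdivrMr // mulrC; lra.
Qed.

End Image.

Theorem mainTheorem3 (R : realType)
  (* the base field *)
  (K : fieldType) (vK : valuation R K)
  (kappa : fieldType) (resK : {rmorphism valring vK -> kappa})
  (K_complete : complete_valuation vK)
  (K_discrete : nontrivial_discrete vK)
  (kappa_residue : is_residue_field resK)
  (kappa_char : 3%N \in [pchar kappa])
  (kappa_perfect : perfect_field kappa)
  (* the completion CK of an algebraic closure of K *)
  (Kbar : closedFieldType) (vbar : valuation R Kbar)
  (i : {rmorphism K -> Kbar})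
  (Kbar_algebraic : forall a : Kbar, algebraicOver i a)
  (vbar_ext : forall a : K, vbar (i a) = vK a)
  (CK : fieldType) (v : valuation R CK) (j : {rmorphism Kbar -> CK})
  (CK_completion : is_completion vbar v j)
  (* the quartic and the covering given by x *)
  (A2 A1 A0 : {poly K})
  (A2_deg : (size A2 <= 3)%N) (A1_deg : (size A1 <= 4)%N)
  (A0_deg : (size A0 <= 5)%N)
  (Y_irreducible : geometrically_irreducible i (quartic_form A2 A1 A0))
  (Y_smooth : smooth_curve i (quartic_form A2 A1 A0))
  (phi_separable :
     separable_poly (map_poly (@tofrac {poly K}) (affine_eq A2 A1 A0)))
  (E : fieldType) (iota : {rmorphism ratfun CK -> E}) (y : E)
  (E_function_field : is_function_field (j \o i) iota y A2 A1 A0)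
  (* the different function *)
  (delta : (E -> \bar R) -> \bar R)
  (delta_different : is_different_function resK v (j \o i) iota y
                       (quartic_form A2 A1 A0) delta)
  (* the generator z *)
  (x0 y0 : CK) (p0 : 'I_3 -> CK)
  (p0_Y : Y_pts (j \o i) (quartic_form A2 A1 A0) p0)
  (p0_fiber : phi_an iota (Y_val v iota y p0) = P1_val v (P1_point x0))
  (y0_value : value_at (Y_cst iota) (Y_coord iota y) p0 y y0)
  (a2' a1' a0' b3' b2' b1' b0' c4' c3' c2' c1' : CK)
  (minpoly_y : let t := xfun CK - ratC CK x0 in let k := ratC CK in
     is_minimal_polynomial iota (y - Y_cst iota y0)
       ('X^3 + (k a2' * t ^+ 2 + k a1' * t + k a0')%:P * 'X^2
             + (k b3' * t ^+ 3 + k b2' * t ^+ 2 + k b1' * t + k b0')%:P * 'X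
             + (k c4' * t ^+ 4 + k c3' * t ^+ 3 + k c2' * t ^+ 2
                + k c1' * t)%:P))
  (u : CK) (u_root : u ^+ 3 + a1' * u ^+ 2 + b2' * u + c3' = 0)
  (z : E) (z_def : z = y - Y_cst iota y0 - iota (ratC CK u * (xfun CK - ratC CK x0)))
  (a2 a1 a0 b3 b2 b1 b0 c4 c2 c1 : CK) (A B C : ratfun CK)
  (A_def : let t := xfun CK - ratC CK x0 in let k := ratC CK in
     A = k a2 * t ^+ 2 + k a1 * t + k a0)
  (B_def : let t := xfun CK - ratC CK x0 in let k := ratC CK in
     B = k b3 * t ^+ 3 + k b2 * t ^+ 2 + k b1 * t + k b0)
  (C_def : let t := xfun CK - ratC CK x0 in let k := ratC CK in
     C = k c4 * t ^+ 4 + k c2 * t ^+ 2 + k c1 * t)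
  (minpoly_z : is_minimal_polynomial iota z
     ('X^3 + A%:P * 'X^2 + B%:P * 'X + C%:P))
  (* the path from x0 to infinity *)
  (gamma : R -> ratfun CK -> \bar R)
  (gamma_interval : is_interval_in (P1an v) gamma)
  (gamma0 : gamma 0 = P1_val v (P1_point x0))
  (gamma1 : gamma 1 = P1_val v (@P1_infty CK)) :
  (forall s : R, 0 < s < 1 ->
     forall eta, Yan v (j \o i) iota y (quartic_form A2 A1 A0) eta ->
       phi_an iota eta = gamma s ->
       delta eta = different_formula (vK 3) A B C (gamma s)) /\
  (forall eta, Yan v (j \o i) iota y (quartic_form A2 A1 A0) eta ->
     phi_an iota eta = gamma 0 ->
     different_formula (vK 3) A B C (gamma s) @[s --> 0^'+] --> delta eta) /\
  (forall eta, Yan v (j \o i) iota y (quartic_form A2 A1 A0) eta ->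
     phi_an iota eta = gamma 1 ->
     different_formula (vK 3) A B C (gamma s) @[s --> 1^'-] --> delta eta).
Proof.
have dbase := delta_interior K_discrete kappa_residue kappa_char Kbar_algebraic vbar_ext
  CK_completion A_def B_def C_def minpoly_z.
pose h : {rmorphism K -> CK} := j \o i.
pose d2 := coefA2 A2 h; pose d1 := coefA1 A1 h; pose d0 := coefA0 A0 h.
pose s0 : ratfun CK := ratC CK y0 + ratC CK u * (xfun CK - ratC CK x0).
have zE : z = y - iota s0.
  by rewrite z_def /s0 rmorphD /Y_cst /= opprD addrA.
have [y_root gen_y] := E_function_field.
rewrite (function_field_eq A2_deg A1_deg A0_deg) in y_root.
have Py := rootP y_root; have Pcub := tofrac_affine A2_deg A1_deg A0_deg h.
have [_ irr_z /rootP root_z] := minpoly_z.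
have Py' := Py; rewrite Pcub in Py'.
have root_z' := root_z; rewrite zE in root_z'.
have P_irr := translate_irreducible irr_z root_z' Py'.
have y_neq0 : y != 0.
  apply/eqP => yz; have := cubic_noroot P_irr 0.
  move: Py'; rewrite cubic_horner yz !expr0n !mulr0 !add0r => /eqP.
  by rewrite fmorph_eq0 => /eqP ->; rewrite eqxx.
rewrite -Pcub in P_irr.
have gen_z : forall x : E, exists q : {poly ratfun CK}, x = (map_poly iota q).[z].
  by rewrite zE; apply: translate_gen.
have {dbase} inner := dbase gen_z A2 A1 A0 y delta delta_different.
have E_curve : on_quartic d2 d1 d0 (Y_cst iota) (Y_coord iota y) = 0.
  rewrite -[RHS]Py -(io_map iota) eval2_io eval2_affine /on_quartic /Y_coord !inordK //.
have top : ~ (d2 2 = 0 /\ d1 3 = 0 /\ d0 4 = 0).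
  move=> [h2 [h1 h0]]; apply: (leading_neq0 Y_irreducible).
  by split; [|split]; apply: (fmorph_inj h); rewrite rmorph0.
have [_ _ delta_cont] := delta_different.
have closed P : Y_pts (j \o i) (quartic_form A2 A1 A0) P ->
    [/\ exists k, P k != 0,
        quartic d2 d1 d0 (P (inord 0)) (P (inord 1)) (P (inord 2)) = 0 &
        exists k, partial d2 d1 d0 k (P (inord 0)) (P (inord 1)) (P (inord 2)) != 0].
  move=> [Pn0]; rewrite quartic_form_meval => PQ; split=> //.
  exact: (smooth_completion A2_deg A1_deg A0_deg Y_irreducible Y_smooth phi_separable).
have finite P : Y_pts (j \o i) (quartic_form A2 A1 A0) P -> P (inord 2) != 0 ->
    exists2 rho, reached v iota (P (inord 0) / P (inord 2)) (Y_val v iota y P) rho & increasing_affine rho.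
  move=> /closed[_ PQ PS] P2.
  exact: (reached_finite CK_completion P_irr E_curve gen_y PQ PS P2).
have infinite P : Y_pts (j \o i) (quartic_form A2 A1 A0) P -> P (inord 2) = 0 ->
    exists2 rho, reached v iota x0 (Y_val v iota y P) rho & decreasing_affine rho.
  move=> /closed[Pn0 PQ PS] P2.
  exact: (reached_infinite CK_completion x0 P_irr E_curve gen_y y_neq0 top PQ PS Pn0 P2).
pose Y := Yan v (j \o i) iota y (quartic_form A2 A1 A0).
have Y_gauss (eta : valuation R E) rho : (forall f, eta (iota f) = gauss v x0 rho f) -> Y eta.
  exact: Yan_gauss.
pose fm := formula_at v x0 A B C (vK 3).
have ends eta rho : Y eta -> reached v iota x0 eta rho ->
  (forall M : R, (M%:E < delta eta)%E -> exists L : R, forall s, L <= s -> (M%:E < fm (rho s))%E) /\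
  (forall M : R, (delta eta < M%:E)%E -> exists L : R, forall s, L <= s -> (fm (rho s) < M%:E)%E).
  move=> Yeta [W [s1 [pi [h1 h2 h3 h4 h5]]]].
  exact: (endpoint_limit inner Y_gauss delta_cont Yeta h1 h2 h3 h4 h5).
split; [|split].
- move=> s hs eta Yeta he.
  have [rho hrho] := path_gauss CK_completion gamma_interval gamma0 gamma1 hs.
  have heta f : eta (iota f) = gauss v x0 rho f by rewrite -hrho -he.
  rewrite hrho; case: Yeta => [[w [ew _]]|[P [YP eP]]].
    by rewrite ew; apply: inner => f; rewrite -ew.
  exfalso; rewrite eP in heta; have [P2|P2] := eqVneq (P (inord 2)) 0.
    have [r hr hdec] := infinite P YP P2.
    by have := reached_infinity hr hdec; rewrite /Y_val heta gauss_t.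
  have [r hr hinc] := finite P YP P2; have := reached_center hr hinc; rewrite /Y_val heta.
  by have [q ->] := val_fin (gauss v x0 rho) (tpar_neq0 (P (inord 0) / P (inord 2))).
- move=> eta Yeta he.
  have hx0 : eta (iota (tpar x0)) = +oo%E.
    by rewrite -[LHS]/(phi_an iota eta (tpar x0)) he gamma0 P1_val_finite subrr val0.
  suff [rho hr hinc] : exists2 rho, reached v iota x0 eta rho & increasing_affine rho.
    have [below above] := ends eta rho Yeta hr.
    exact: (limit_zero CK_completion gamma_interval gamma0 gamma1 below above hinc).
  case: Yeta => [[w [ew _]]|[P [YP eP]]].
    by move: hx0; rewrite ew => /val_eqy/eqP; rewrite fmorph_eq0 (negPf (tpar_neq0 x0)).
  rewrite eP in hx0 *; have [P2|P2] := eqVneq (P (inord 2)) 0.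
    have [r hr hdec] := infinite P YP P2.
    by have := reached_infinity hr hdec; rewrite /Y_val hx0.
  have [r hr hinc] := finite P YP P2; have [ex|nx] := eqVneq (P (inord 0) / P (inord 2)) x0.
    by rewrite ex in hr; exists r.
  by have [q] := reached_off_center hr hinc nx; rewrite /Y_val hx0.
move=> eta Yeta he.
have hb b : eta (iota (tpar b)) = -oo%E.
  by rewrite -[LHS]/(phi_an iota eta (tpar b)) he gamma1 P1_val_infinite.
suff [rho hr hdec] : exists2 rho, reached v iota x0 eta rho & decreasing_affine rho.
  have [below above] := ends eta rho Yeta hr.
  exact: (limit_one CK_completion gamma_interval gamma0 gamma1 below above hdec).
case: Yeta => [[w [ew _]]|[P [YP eP]]].
  by have := hb x0; rewrite ew => /val_neqNy.
rewrite eP in hb *; have [P2|P2] := eqVneq (P (inord 2)) 0; first exact: infinite.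
have [r hr hinc] := finite P YP P2.
by have := reached_center hr hinc; rewrite /Y_val hb.
Qed.
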